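(* Let $\mathrm P$ be a polymatroid on $E$ of type $\mathbf a$ and rank $r$, and let $\ell\in A^1(X_{\Sigma_{\mathrm P}})$ correspond to a strictly convex piecewise linear function on $\Sigma_{\mathrm P}$. Then: (1) (Poincaré duality) there is an isomorphism $\deg_{\mathrm P}:A^r(X_{\Sigma_{\mathrm P}})\to\mathbb Z$ such that for $0\le k\le r/2$ the pairing $A^k(X_{\Sigma_{\mathrm P}})\times A^{r-k}(X_{\Sigma_{\mathrm P}})\to\mathbb Z$, $(x,y)\mapsto\deg_{\mathrm P}(xy)$, is unimodular; (2) (Hard Lefschetz) for every $0\le k\le r/2$, $x\mapsto \ell^{r-2k}x$ is an isomorphism $A^k(X_{\Sigma_{\mathrm P}})\otimes\mathbb Q\to A^{r-k}(X_{\Sigma_{\mathrm P}})\otimes\mathbb Q$; (3) (Hodge–Riemann) for every $0\le k\le r/2$, the bilinear form $(x,y)\mapsto(-1)^k\deg_{\mathrm P}(\ell^{r-2k}xy)$ on $A^k(X_{\Sigma_{\mathrm P}})\otimes\mathbb Q$ is positive definite on the kernel of multiplication by $\ell^{r-2k+1}$.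
   Context: $E=\{1,\dots,m\}$, $\mathbf a\in\mathbb Z^m_{\ge0}$, $n=\sum a_i$. Polymatroid of type $\mathbf a$: submodular monotone $\operatorname{rk}_{\mathrm P}:2^E\to\mathbb Z_{\ge0}$, $\operatorname{rk}_{\mathrm P}(\emptyset)=0$, $\operatorname{rk}_{\mathrm P}(\{i\})\le a_i$, rank $r=\operatorname{rk}_{\mathrm P}(E)$; flats are $F$ with $\operatorname{rk}(F\cup e)>\operatorname{rk}(F)$ for all $e\notin F$. $\widetilde E$ an $n$-element set, $\pi:\widetilde E\to E$ with $|\pi^{-1}(i)|=a_i$, $\mathbf e_U=\sum_{j\in U}\mathbf e_j\in\mathbb R^{\widetilde E}$. Compatible pairs $I\le\mathcal F$: $I\subseteq\widetilde E$, chain $F_1\subsetneq\dots\subsetneq F_k\subsetneq F_{k+1}=E$ ($k\ge0$) with $\pi^{-1}(A)\subseteq I\Rightarrow A\subseteq F_1$; cone $\sigma_{I\le\mathcal F}=\operatorname{cone}(-\mathbf e_{\widetilde E\setminus\pi^{-1}(F_1)},\dots,-\mathbf e_{\widetilde E\setminus\pi^{-1}(F_k)},\mathbf e_j:j\in I)$; these form the unimodular polystellahedral fan. The augmented Bergman fan $\Sigma_{\mathrm P}$ consists of the cones $\sigma_{S\le\mathcal F}$ with $F_1,\dots,F_k$ proper flats of $\mathrm P$, $\operatorname{rk}_{\mathrm P}(\pi(T))\ge|T|$ for all $T\subseteq S$, and $\operatorname{rk}_{\mathrm P}(F\cup\pi(T))>\operatorname{rk}_{\mathrm P}(F)+|T|$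 for all $F\in\mathcal F$ and nonempty $T\subseteq S\setminus\pi^{-1}(F)$; it is a pure $r$-dimensional unimodular fan. $X_{\Sigma_{\mathrm P}}$ is the (smooth, non-complete) toric variety of $\Sigma_{\mathrm P}$, and $A^\bullet(X_{\Sigma_{\mathrm P}})$ its Chow ring (the quotient of the polynomial ring on the rays of $\Sigma_{\mathrm P}$ by the Stanley–Reisner ideal and the linear relations $\sum_\rho\langle u_\rho,v\rangle x_\rho$, $v\in\mathbb Z^{\widetilde E}$). Elements of $A^1(X_{\Sigma_{\mathrm P}})$ correspond to piecewise linear functions on $\Sigma_{\mathrm P}$ modulo linear functions. *)

(* Defs.v *)
From HB Require Import structures.
From mathcomp Require Import all_boot all_order all_algebra.
From mathcomp Require Import mpoly.
Set Implicit Arguments. Unset Strict Implicit. Unset Printing Implicit Defensive.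
Import Order.TTheory GRing.Theory Num.Theory.
Local Open Scope ring_scope.

Definition is_polymatroid (m : nat) (a : 'I_m -> nat)
    (rk : {set 'I_m} -> nat) : Prop :=
  [/\ rk set0 = 0%N,
      (forall A B : {set 'I_m}, A \subset B -> (rk A <= rk B)%N),
      (forall A B : {set 'I_m}, (rk (A :|: B) + rk (A :&: B) <= rk A + rk B)%N)
    & (forall i, (rk [set i] <= a i)%N)].

Definition is_flat (m : nat) (rk : {set 'I_m} -> nat) (F : {set 'I_m}) : bool :=
  [forall e, (e \notin F) ==> (rk F < rk (e |: F))%N].

(* Rays / cones of the augmented Bergman fan Sigma_P in R^{E~}, E~ = 'I_n. *)
(* A ray generator is labelled either by a proper flat F (inl F, vector    *)
(* -e_{E~ \ pi^-1(F)}) or by an element j of E~ (inr j, vector e_j).       *)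
Definition Lab (m n : nat) := ({set 'I_m} + 'I_n)%type.

Definition ray_vec (m n : nat) (pi : 'I_n -> 'I_m) (L : Lab m n) : 'I_n -> int :=
  match L with
  | inl F => fun j => if pi j \in F then 0 else -1
  | inr j0 => fun j => (j == j0)%:R
  end.

Definition is_proper_flag (m : nat) (rk : {set 'I_m} -> nat)
    (C : {set {set 'I_m}}) : bool :=
  [forall F in C, is_flat rk F && (F != setT)] &&
  [forall F in C, forall G in C, (F \subset G) || (G \subset F)].

(* Compatibility I <= calF : pi^-1(A) \subset I implies A \subset F_1,     *)
(* where F_1 is the least member of the chain (F_1 = E when k = 0); since  *)
(* F_1 is the least member, "A \subset F_1" = "A \subset F for all F".     *)
Definition compatible (m n : nat) (pi : 'I_n -> 'I_m)
    (I : {set 'I_n}) (C : {set {set 'I_m}}) : bool :=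
  [forall A : {set 'I_m}, (pi @^-1: A \subset I) ==>
                          [forall F in C, A \subset F]].

Definition augBergman_cone (m n : nat) (rk : {set 'I_m} -> nat)
    (pi : 'I_n -> 'I_m) (S : {set 'I_n}) (C : {set {set 'I_m}}) : bool :=
  [&& is_proper_flag rk C, compatible pi S C,
      [forall T : {set 'I_n}, (T \subset S) ==> (#|T| <= rk (pi @: T))%N] &
      [forall F in C, forall T : {set 'I_n},
         ((T \subset S :\: pi @^-1: F) && (T != set0)) ==>
         (rk F + #|T| < rk (F :|: pi @: T))%N]].

Definition cone_labels (m n : nat) (S : {set 'I_n}) (C : {set {set 'I_m}})
    : {set Lab m n} :=
  [set inl F | F in C] :|: [set inr j | j in S].

Definition is_cone (m n : nat) (rk : {set 'I_m} -> nat) (pi : 'I_n -> 'I_m)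
    (L : {set Lab m n}) : bool :=
  [exists S : {set 'I_n}, exists C : {set {set 'I_m}},
     augBergman_cone rk pi S C && (L == cone_labels S C)].

Definition rays (m n : nat) (rk : {set 'I_m} -> nat) (pi : 'I_n -> 'I_m)
    : {set Lab m n} :=
  [set L | is_cone rk pi [set L]].

Definition nrays m n rk pi := #|@rays m n rk pi|.

Definition ray_of m n rk pi (i : 'I_(@nrays m n rk pi)) : Lab m n :=
  enum_val i.

Definition in_ideal (R : comNzRingType) (N : nat) (G : {mpoly R[N]} -> Prop)
    (p : {mpoly R[N]}) : Prop :=
  exists s : seq ({mpoly R[N]} * {mpoly R[N]}),
    (forall q, q \in s -> G q.2) /\ p = \sum_(q <- s) q.1 * q.2.

Definition chow_gen (R : comNzRingType) m n rk pi
    (g : {mpoly R[@nrays m n rk pi]}) : Prop :=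
  (exists T : {set 'I_(nrays rk pi)},
      ~~ is_cone rk pi [set ray_of i | i in T] /\ g = \prod_(i in T) 'X_i)
  \/
  (exists v : 'I_n -> int,
      g = \sum_(i < nrays rk pi)
            (\sum_(j < n) ray_vec pi (ray_of i) j * v j)%:~R *: 'X_i).

Definition chow_ideal (R : comNzRingType) m n rk pi (p : {mpoly R[@nrays m n rk pi]})
    : Prop := in_ideal (@chow_gen R m n rk pi) p.

(* Piecewise linear functions on the (unimodular) fan Sigma_P are given by *)
(* their (integer) values c on the ray generators; the value at           *)
(* v = sum_{rho in sigma} lam_rho u_rho is sum lam_rho c_rho.              *)
(* Strict convexity: for every cone sigma there is a linear function mu   *)
(* such that c - mu vanishes on sigma and is positive on the nonzero       *)
(* vectors of star(sigma) \ sigma.                                          *)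
Definition strictly_convex_PL m n (rk : {set 'I_m} -> nat) (pi : 'I_n -> 'I_m)
    (c : Lab m n -> int) : Prop :=
  forall sigma : {set Lab m n}, is_cone rk pi sigma ->
  exists mu : 'I_n -> rat,
    (forall L, L \in sigma ->
        (c L)%:~R = \sum_(j < n) mu j * (ray_vec pi L j)%:~R) /\
    (forall tau : {set Lab m n}, is_cone rk pi tau -> sigma \subset tau ->
     forall lam : Lab m n -> rat,
       (forall L, L \in tau -> 0 <= lam L) ->
       (exists2 L, L \in tau :\: sigma & 0 < lam L) ->
       0 < \sum_(L in tau) lam L *
             ((c L)%:~R - \sum_(j < n) mu j * (ray_vec pi L j)%:~R)).

Definition PL_class (R : comNzRingType) m n rk pi (c : Lab m n -> int)
    : {mpoly R[@nrays m n rk pi]} :=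
  \sum_(i < nrays rk pi) (c (ray_of i))%:~R *: 'X_i.

(* The pairing A^k1 x A^k2 -> Z, (x,y) |-> deg(xy), is unimodular: the      *)
(* induced map A^k1 -> Hom_Z(A^k2, Z) is an isomorphism (injective and      *)
(* surjective).  Elements of A^d are represented by degree-d homogeneous    *)
(* integer polynomials modulo the ideal I.                                  *)
Definition pairing_iso (N : nat) (I : {mpoly int[N]} -> Prop)
    (deg : {mpoly int[N]} -> int) (k1 k2 : nat) : Prop :=
  (forall x : {mpoly int[N]}, x \is k1.-homog ->
     (forall y : {mpoly int[N]}, y \is k2.-homog -> deg (x * y) = 0) -> I x) /\
  (forall phi : {mpoly int[N]} -> int,
     (forall y z : {mpoly int[N]}, y \is k2.-homog -> z \is k2.-homog ->
        phi (y + z) = phi y + phi z) ->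
     (forall y : {mpoly int[N]}, y \is k2.-homog -> I y -> phi y = 0) ->
     exists2 x : {mpoly int[N]}, x \is k1.-homog &
       forall y : {mpoly int[N]}, y \is k2.-homog -> phi y = deg (x * y)).

Definition unimodular_pairing (N : nat) (I : {mpoly int[N]} -> Prop)
    (deg : {mpoly int[N]} -> int) (k1 k2 : nat) : Prop :=
  pairing_iso I deg k1 k2 /\ pairing_iso I deg k2 k1.

(* Main.v *)
(* Attach to a cone the functional [p |-> deg (x_sigma p)], where [x_sigma] is the product of its rays.
   The degree and all these functionals are computed by one algebraic model: a tower of polynomial
   extensions which adds the flats of the cone's link from the largest to the smallest, each step
   being a product with a projective space or a blow-up whose centre is a smaller tower of the same
   kind.  For such towers the presentation by Feichtner-Yuzvinsky relations, Poincare duality over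
   the integers and, for a lexicographically small combination of the flats, the Hodge-Riemann
   relations are proved step by step; the Hodge-Riemann relations pass to a blow-up because the form
   degenerates, when the exceptional divisor has a small coefficient, to the orthogonal sum of the
   forms of the base and of the centre.  On the fan, hard Lefschetz for an ample class follows from
   the Hodge-Riemann relations of the links by positivity, and the signature is constant on the
   segment from the nef class of the tower to the given ample class.  Rational statements follow
   from the real ones since all degrees are compatible with base change. *)
Require Import Defs.
From HB Require Import structures.
From mathcomp Require Import all_boot all_order all_algebra.
From mathcomp Require Import mpoly ring lra zify.
From mathcomp Require Import boolp reals Rstruct.
Set Implicit Arguments.
Unset Strict Implicit.
Unset Printing Implicit Defensive.
Import Order.TTheory GRing.Theory Num.Theory.
Local Open Scope ring_scope.

(** * Graded algebras *)

(** No quotient ring is ever formed. A graded ring is studied modulo [null D], the annihilator of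
    its degree functional, so every form may be degenerate and finite generating lists replace
    bases. The price is that the annihilator must in the end be identified with the Chow ideal
    ([null_to_relsP], [nullI]); that identification gives the integral statements and the base
    changes. The towers are indexed by an abstract ordered set with a submodular rank on each
    component. This class contains the flats compatible with any cone ([goodC]) and is closed under
    passing to the centre of a blow-up ([good_z]), so a single induction serves base and centre. The
    analytic obstacle is that primitive subspaces move with the Lefschetz class and may jump in
    dimension. Finsler's lemma converts positivity on a moving subspace into positivity of a
    penalised form on a fixed space. Every deformation is polynomial in one parameter, so
    coefficient bounds take the place of compactness. In the blow-up the parameter is a square root
    of the coefficient of the exceptional divisor, since the natural rescaling has half-integral
    weights. *)

Fixpoint lspan (R S : comNzRingType) (sc : R -> S) (b : seq S) (x : S) : Prop :=
  if b is v :: b' then exists a, lspan sc b' (x - sc a * v) else x = 0.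

Section Lspan.
Variables (R S : comNzRingType) (sc : {rmorphism R -> S}).
Lemma lspan0 b : lspan sc b 0.
Proof. by elim: b => //= v b IH; exists 0; rewrite rmorph0 mul0r subr0. Qed.
Lemma lspanD b x y : lspan sc b x -> lspan sc b y -> lspan sc b (x + y).
Proof.
elim: b x y => [|v b IH] x y /=; first by move=> -> ->; rewrite addr0.
move=> [a ha] [c hc]; exists (a + c); rewrite rmorphD.
have -> : x + y - (sc a + sc c) * v = (x - sc a * v) + (y - sc c * v) by ring.
exact: IH.
Qed.
Lemma lspanZ b x c : lspan sc b x -> lspan sc b (sc c * x).
Proof.
elim: b x => [|v b IH] x /=; first by move->; rewrite mulr0.
move=> [a ha]; exists (c * a); rewrite rmorphM.
have -> : sc c * x - sc c * sc a * v = sc c * (x - sc a * v) by ring.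
exact: IH.
Qed.
Lemma lspanN b x : lspan sc b x -> lspan sc b (- x).
Proof. by move=> /(lspanZ (-1)); rewrite rmorphN1 mulN1r. Qed.
Lemma lspan_cons v b x : lspan sc b x -> lspan sc (v :: b) x.
Proof. by move=> h /=; exists 0; rewrite rmorph0 mul0r subr0. Qed.
Lemma lspan_mem b v : v \in b -> lspan sc b v.
Proof.
elim: b => //= w b IH; rewrite inE => /orP [/eqP ->|h].
  by exists 1; rewrite rmorph1 mul1r subrr; apply: lspan0.
by exists 0; rewrite rmorph0 mul0r subr0; apply: IH.
Qed.
End Lspan.

(** Homogeneity is a predicate and the pieces generate additively ([ga_ind]); degrees are told apart
    by functionals that vanish outside one degree. [ga_span] supplies the finite lists on which the
    linear algebra runs its inductions. *)
Record ga (R : comNzRingType) := Ga {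
  ga_car :> comNzRingType;
  ga_sc : {rmorphism R -> ga_car};
  ga_hom : nat -> ga_car -> Prop;
  ga_hom0 : forall k, ga_hom k 0;
  ga_homD : forall k x y, ga_hom k x -> ga_hom k y -> ga_hom k (x + y);
  ga_homM : forall j k x y, ga_hom j x -> ga_hom k y -> ga_hom (j + k) (x * y);
  ga_homsc : forall a, ga_hom 0 (ga_sc a);
  ga_ind : forall P : ga_car -> Prop,
    (forall x y, P x -> P y -> P (x + y)) ->
    (forall k x, ga_hom k x -> P x) -> forall x, P x;
  ga_span : forall k, exists b : seq ga_car,
    (forall x, x \in b -> ga_hom k x) /\
    (forall x, ga_hom k x -> lspan ga_sc b x) }.

Section GaBasics.
Variables (R : comNzRingType) (S : ga R).
Local Notation sc := (@ga_sc R S).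
Local Notation hom := (@ga_hom R S).
Implicit Types (b : seq S) (x y : S).

Lemma homZ k a x : hom k x -> hom k (sc a * x).
Proof. by move=> hx; have := ga_homM (ga_homsc S a) hx; rewrite add0n. Qed.
Lemma homN k x : hom k x -> hom k (- x).
Proof. by move=> hx; have := homZ (-1) hx; rewrite rmorphN1 mulN1r. Qed.
Lemma homB k x y : hom k x -> hom k y -> hom k (x - y).
Proof. by move=> hx hy; apply: ga_homD => //; apply: homN. Qed.
Lemma hom1 : hom 0 1.
Proof. by have := ga_homsc S 1; rewrite rmorph1. Qed.
Lemma homX k x n : hom k x -> hom (n * k) (x ^+ n).
Proof.
move=> hx; elim: n => [|n IH]; first by rewrite mul0n expr0; apply: hom1.
by rewrite mulSn exprS; apply: ga_homM.
Qed.
Lemma homX1 x n : hom 1 x -> hom n (x ^+ n).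
Proof. by move=> /(homX n); rewrite muln1. Qed.
Lemma hom_sum k (I : Type) (r : seq I) (P : pred I) (F : I -> S) :
  (forall i, P i -> hom k (F i)) -> hom k (\sum_(i <- r | P i) F i).
Proof.
move=> h; elim/big_rec: _ => [|i x Pi hx]; first exact: ga_hom0.
by apply: ga_homD => //; apply: h.
Qed.
Lemma homE k k' x : k = k' -> hom k x -> hom k' x. Proof. by move->. Qed.

Lemma lspan_ind b (P : S -> Prop) : P 0 -> (forall x y, P x -> P y -> P (x + y)) ->
  (forall a v, v \in b -> P (sc a * v)) -> forall x, lspan sc b x -> P x.
Proof.
move=> P0 PD; elim: b => [|v b IH] h x /=; first by move->.
move=> [a ha]; rewrite -(subrK (sc a * v) x); apply: PD; last first.
  by apply: h; rewrite inE eqxx.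
by apply: IH ha => c w hw; apply: h; rewrite inE hw orbT.
Qed.
(** Target and action are parameters so that the same lemmas serve functionals with values in [R]
    and in [{poly R}], the latter being one-parameter families of functionals. *)
Definition lin (W : zmodType) (act : R -> W -> W) (f : S -> W) :=
  (forall x y, f (x + y) = f x + f y) /\ (forall a x, f (sc a * x) = act a (f x)).

Section Lin.
Variables (W : zmodType) (act : R -> W -> W) (f : S -> W).
Hypothesis fL : lin act f.
Lemma linD x y : f (x + y) = f x + f y. Proof. exact: fL.1. Qed.
Lemma linZ a x : f (sc a * x) = act a (f x). Proof. exact: fL.2. Qed.
Lemma lin0 : f 0 = 0.
Proof. by apply: (addrI (f 0)); rewrite -linD !addr0. Qed.
Lemma linN x : f (- x) = - f x.
Proof. by apply: (addrI (f x)); rewrite -linD !subrr lin0. Qed.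
Lemma linB x y : f (x - y) = f x - f y. Proof. by rewrite linD linN. Qed.
Lemma lin_sum (I : Type) (r : seq I) (P : pred I) (F : I -> S) :
  f (\sum_(i <- r | P i) F i) = \sum_(i <- r | P i) f (F i).
Proof. by elim/big_rec2: _ => [|i x y _ <-]; [exact: lin0 | rewrite linD]. Qed.
Lemma linMn x n : f (x *+ n) = f x *+ n.
Proof. by elim: n => [|n IH]; rewrite ?mulr0n ?lin0 // !mulrS linD IH. Qed.
End Lin.
End GaBasics.

Notation linR := (lin *%R).
Notation linP := (lin (fun a p => a%:P * p)).

Definition symbil (R : comNzRingType) (S : ga R) (B : S -> S -> R) :=
  (forall x, linR (B x)) /\ (forall x y, B x y = B y x).

(** * Quadratic forms on finitely spanned spaces *)

Section Forms.
Variables (R : realFieldType) (S : ga R).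
Local Notation sc := (@ga_sc R S).
Implicit Types (b : seq S) (x y : S) (B Q q N : S -> S -> R).

Lemma symbilDl B : symbil B -> forall x y z, B (x + y) z = B x z + B y z.
Proof. by case=> hl hs x y z; rewrite hs (linD (hl z)) (hs z x) (hs z y). Qed.
Lemma symbilZl B : symbil B -> forall a x z, B (sc a * x) z = a * B x z.
Proof. by case=> hl hs a x z; rewrite hs (linZ (hl z)) hs. Qed.
Lemma symbilDr B : symbil B -> forall x y z, B z (x + y) = B z x + B z y.
Proof. by case=> hl hs x y z; rewrite (linD (hl z)). Qed.
Lemma symbilZr B : symbil B -> forall a x z, B z (sc a * x) = a * B z x.
Proof. by case=> hl hs a x z; rewrite (linZ (hl z)). Qed.
Lemma symbil_sq B a x y : symbil B ->
  B (sc a * x + y) (sc a * x + y) = a ^+ 2 * B x x + 2 * a * B x y + B y y.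
Proof.
move=> hB; rewrite !(symbilDl hB) !(symbilDr hB) !(symbilZl hB) !(symbilZr hB).
by rewrite (hB.2 y x); ring.
Qed.

(** For isotropic [x] the form is affine in [s] along [s x + y], and a nonnegative affine function
    is constant. *)
Lemma psd_kernel Q b : symbil Q -> (forall x, lspan sc b x -> 0 <= Q x x) ->
  forall x y, lspan sc b x -> lspan sc b y -> Q x x = 0 -> Q x y = 0.
Proof.
move=> hQ psd x y hx hy q0.
have h s : 0 <= 2 * s * Q x y + Q y y.
  have := psd (sc s * x + y) (lspanD (lspanZ s hx) hy).
  by rewrite symbil_sq // q0 mulr0 add0r.
apply/eqP/negPn/negP => nz.
(* At this [s] the affine function takes the value -1. *)
have := h (- (Q y y + 1) / (2 * Q x y)).
have -> : 2 * (- (Q y y + 1) / (2 * Q x y)) * Q x y = - (Q y y + 1) by field.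
by lra.
Qed.

(** Finite-dimensional substitute for compactness, by Gram-Schmidt on the generating list. An
    isotropic generator pairs to zero under both forms and drops out; otherwise the remaining
    generators are projected onto its [Q]-orthogonal complement. *)
Lemma psd_dominates b Q B : symbil Q -> symbil B ->
  (forall x, lspan sc b x -> 0 <= Q x x) ->
  (forall x y, lspan sc b x -> lspan sc b y -> Q x x = 0 -> B x y = 0) ->
  exists2 C : R, 0 <= C & forall x, lspan sc b x -> `|B x x| <= C * Q x x.
Proof.
elim: b Q B => [|v b IH] Q B hQ hB psd ker.
  exists 0 => // x /= ->.
  by rewrite (lin0 (hB.1 0)) mul0r normr0.
have hv : lspan sc (v :: b) v by apply: lspan_mem; rewrite inE eqxx.
have [q0|qn0] := eqVneq (Q v v) 0.
  have [C C0 hC] := IH Q B hQ hB (fun x h => psd x (lspan_cons v h))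
    (fun x y h h' => ker x y (lspan_cons v h) (lspan_cons v h')).
  exists C => // x /= [a hy]; set y := x - sc a * v in hy.
  have -> : x = sc a * v + y by rewrite /y; ring.
  rewrite !symbil_sq // q0 (psd_kernel hQ psd hv (lspan_cons v hy) q0).
  rewrite (ker v v) // (ker v y) // ?mulr0 ?add0r; last exact: lspan_cons.
  exact: hC.
have qv : 0 < Q v v by rewrite lt_def qn0 psd.
pose p x := x - sc (Q x v / Q v v) * v.
have pD x y : p (x + y) = p x + p y.
  by rewrite /p (symbilDl hQ) mulrDl rmorphD; ring.
have pZ a x : p (sc a * x) = sc a * p x.
  by rewrite /p (symbilZl hQ) -mulrA rmorphM; ring.
have hp x : lspan sc b x -> lspan sc (v :: b) (p x).
  move=> h; apply: lspanD; first exact: lspan_cons.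
  by apply: lspanN; apply: lspanZ.
have pE x : p x = x - sc (Q x v / Q v v) * v by [].
clearbody p.
have hQ' : symbil (fun x y => Q (p x) (p y)).
  split=> [x|x y]; last exact: hQ.2.
  by split=> *; rewrite ?pD ?pZ ?(symbilDr hQ) ?(symbilZr hQ).
have hB' : symbil (fun x y => B (p x) (p y)).
  split=> [x|x y]; last exact: hB.2.
  by split=> *; rewrite ?pD ?pZ ?(symbilDr hB) ?(symbilZr hB).
(* The cross term between [v] and [p y] is bounded through its square, so the induction hypothesis
   is also applied to this rank-one form. *)
have hW : symbil (fun x y => B (p x) v * B (p y) v).
  split=> [x|x y]; last exact: mulrC.
  by split=> *; rewrite ?pD ?pZ ?(symbilDl hB) ?(symbilZl hB); ring.
have psd' x : lspan sc b x -> 0 <= Q (p x) (p x) by move=> h; apply: psd; apply: hp.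
have [|C1 C10 h1] := IH _ _ hQ' hB' psd'.
  by move=> x y hx hy; apply: ker; apply: hp.
have [|C2 C20 h2] := IH _ _ hQ' hW psd'.
  by move=> x y hx hy q0; rewrite ker ?mul0r //; apply: hp.
have g0 : 0 <= (`|B v v| + 1) / Q v v.
  by apply: divr_ge0; [exact: addr_ge0 | exact: ltW].
exists ((`|B v v| + 1) / Q v v + C1 + C2).
  by do 2!apply: addr_ge0 => //.
move=> x /= [a hy]; set y := x - sc a * v in hy.
have [a' Ea] : exists a', a' = a + Q y v / Q v v by exists (a + Q y v / Q v v).
have -> : x = sc a' * v + p y by rewrite pE /y Ea rmorphD; ring.
rewrite !symbil_sq //.
have -> : Q v (p y) = 0.
  rewrite pE (linB (hQ.1 v)) (symbilZr hQ) (hQ.2 v y).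
  by rewrite divfK // subrr.
move: (h1 y hy) (h2 y hy); rewrite -expr2 normrX.
rewrite (hB.2 v (p y)); set w := B (p y) v; set Z := Q (p y) (p y).
rewrite real_normK ?num_real // => H1 H2.
rewrite mulr0 addr0.
have e1 : a' ^+ 2 * Q v v * ((`|B v v| + 1) / Q v v) = a' ^+ 2 * `|B v v| + a' ^+ 2.
  by field.
have a0 : 0 <= a' ^+ 2 by exact: sqr_ge0.
have n1 : `|a' ^+ 2 * B v v + 2 * a' * w + B (p y) (p y)|
   <= a' ^+ 2 * `|B v v| + (a' ^+ 2 + w ^+ 2) + `|B (p y) (p y)|.
  apply: le_trans (ler_normD _ _) _; rewrite lerD2r.
  apply: le_trans (ler_normD _ _) _; rewrite normrM (ger0_norm a0) lerD2l.
  rewrite ler_norml; have := sqr_ge0 (a' + w); have := sqr_ge0 (a' - w).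
  by move=> ? ?; apply/andP; split; nra.
apply: le_trans n1 _.
have z0 : 0 <= Z by exact: psd'.
have p1 : 0 <= a' ^+ 2 * Q v v * (C1 + C2).
  exact: mulr_ge0 (mulr_ge0 a0 (ltW qv)) (addr_ge0 C10 C20).
have p2 : 0 <= Z * ((`|B v v| + 1) / Q v v).
  exact: mulr_ge0.
set G := (_ / _) in e1 p2 *.
have -> : (G + C1 + C2) * (a' ^+ 2 * Q v v + Z) =
  a' ^+ 2 * Q v v * G + a' ^+ 2 * Q v v * (C1 + C2) + Z * G + C1 * Z + C2 * Z by ring.
rewrite e1; lra.
Qed.

(** A generator outside the kernel is used to project the remaining ones into it; their projections
    span the kernel. *)
Lemma kernel_span b (l : S -> R) : linR l -> exists b1,
  (forall x, lspan sc b1 x -> lspan sc b x /\ l x = 0) /\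
  (forall x, lspan sc b x -> l x = 0 -> lspan sc b1 x).
Proof.
move=> hl; elim: b => [|v b [b1 [IH1 IH2]]].
  by exists [::]; split=> x //= ->; rewrite (lin0 hl).
have [l0|ln0] := eqVneq (l v) 0.
  exists (v :: b1); split=> x /= [a hx].
    have [h1 h2] := IH1 _ hx; split; first by exists a.
    by move: h2; rewrite (linB hl) (linZ hl) l0 mulr0 subr0.
  move=> lx; exists a; apply: IH2 => //.
  by rewrite (linB hl) (linZ hl) l0 mulr0 subr0.
pose p x := x - sc (l x / l v) * v.
have pD x y : p (x + y) = p x + p y by rewrite /p (linD hl) mulrDl rmorphD; ring.
have pZ a x : p (sc a * x) = sc a * p x.
  by rewrite /p (linZ hl) -mulrA rmorphM; ring.
exists (map p b); split.
  apply: lspan_ind.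
  - by split; [exact: lspan0 | exact: lin0 hl].
  - move=> x y [h1 h2] [h3 h4]; split; first exact: lspanD.
    by rewrite (linD hl) h2 h4 addr0.
  move=> a w /mapP [u hu ->]; rewrite -pZ; split; last first.
    by rewrite /p (linB hl) (linZ hl (_ / _)) divfK // subrr.
  apply: lspanD; first by apply: lspanZ; apply: lspan_cons; apply: lspan_mem.
  by apply: lspanN; apply: lspanZ; apply: lspan_mem; rewrite inE eqxx.
move=> x /= [a hy] lx; set y := x - sc a * v in hy.
have -> : x = p y.
  have ly : l y = - a * l v by rewrite /y (linB hl) (linZ hl) lx; ring.
  by rewrite /p ly mulfK // /y rmorphN; ring.
elim/lspan_ind: _ / hy => [|u w hu hw|c w hw].
- by have -> : p 0 = 0; [rewrite /p (lin0 hl) mul0r rmorph0 mul0r subr0|exact: lspan0].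
- by rewrite pD; apply: lspanD.
by rewrite pZ; apply: lspanZ; apply: lspan_mem; apply: map_f.
Qed.

Lemma lin_vanish b (l : S -> R) : linR l -> all (fun v => l v == 0) b ->
  forall x, lspan sc b x -> l x = 0.
Proof.
move=> hl h; apply: lspan_ind; first exact: lin0 hl.
  by move=> x y h1 h2; rewrite (linD hl) h1 h2 addr0.
by move=> a v /(allP h) /eqP e; rewrite (linZ hl) e mulr0.
Qed.

(** Finsler's lemma: positivity on a hyperplane becomes positivity everywhere after adding a large
    multiple of the square of its equation. [N] enters only through its zeros, which mark the
    vectors where the form may degenerate. *)
Lemma finsler_step b q N (l : S -> R) : symbil q -> linR l ->
  (forall x y, lspan sc b x -> lspan sc b y -> N x x = 0 -> q x y = 0) ->
  (forall x, lspan sc b x -> l x = 0 -> N x x != 0 -> 0 < q x x) ->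
  exists2 M : R, 0 <= M &
    forall x, lspan sc b x -> N x x != 0 -> 0 < q x x + M * l x ^+ 2.
Proof.
move=> hq hl kq pos.
have [h|/allPn [v0 hv0 lv0]] := boolP (all (fun v => l v == 0) b).
  exists 0 => // x hx nx; rewrite mul0r addr0; apply: pos => //.
  exact: lin_vanish hx.
pose v := sc (l v0)^-1 * v0.
have hv : lspan sc b v by apply: lspanZ; apply: lspan_mem.
have lv : l v = 1 by rewrite /v (linZ hl) mulVf.
have [b1 [hb1 hb2]] := kernel_span b hl.
have hW : symbil (fun x y => q x v * q y v).
  split=> [x|x y]; last exact: mulrC.
  by split=> *; rewrite ?(symbilDl hq) ?(symbilZl hq); ring.
have psd x : lspan sc b1 x -> 0 <= q x x.
  move=> /hb1 [hx lx]; have [/kq ->|/pos h] := eqVneq (N x x) 0 => //.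
  by apply: ltW; apply: h.
have [|C C0 hC] := psd_dominates hq hW psd.
  move=> x y /hb1 [hx lx] /hb1 [hy ly] q0.
  have [/kq ->|/pos] := eqVneq (N x x) 0; rewrite ?mul0r //.
  by rewrite q0 ltxx => /(_ hx lx).
(* For [x = s v + y] the arithmetic-geometric inequality bounds the cross term by
   [2 (C + 1) s ^ 2 + q y y / 2]; the rest of the constant absorbs [s ^ 2 q v v] and leaves a
   surplus [s ^ 2]. *)
exists (2 * (C + 1) + `|q v v| + 1).
  by rewrite !addr_ge0 // mulr_ge0 // addr_ge0.
move=> x hx nx; set s := l x; pose y := x - sc s * v.
have hy : lspan sc b1 y.
  apply: hb2; last by rewrite /y (linB hl) (linZ hl) lv mulr1 subrr.
  by apply: lspanD => //; apply: lspanN; apply: lspanZ.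
have xe : x = sc s * v + y by rewrite /y; ring.
have -> : q x x = s ^+ 2 * q v v + 2 * s * q y v + q y y.
  by rewrite {1 2}xe symbil_sq // (hq.2 v y).
have := hC y hy; rewrite -expr2 normrX real_normK ?num_real //.
set t := q y v; set Y := q y y => hY.
have Y0 : 0 <= Y by exact: psd.
have g0 : - `|q v v| <= q v v by have := ler_norm (- q v v); rewrite normrN; lra.
have hs : 0 <= s ^+ 2 by exact: sqr_ge0.
have t2 : t ^+ 2 <= (C + 1) * Y by nra.
have key : - (2 * s * t) <= 2 * (C + 1) * s ^+ 2 + Y / 2.
  have C1 : 0 < C + 1 by lra.
  have h : 0 <= (2 * (C + 1) * s + t) ^+ 2 by exact: sqr_ge0.
  rewrite -(ler_pM2l C1); nra.
have lo : Y / 2 + s ^+ 2 <= s ^+ 2 * q v v + 2 * s * t + Y +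
    (2 * (C + 1) + `|q v v| + 1) * s ^+ 2.
  have : 0 <= s ^+ 2 * (q v v + `|q v v|) by rewrite mulr_ge0 //; lra.
  nra.
apply: lt_le_trans lo.
have [s0|s0] := eqVneq s 0; last first.
  have : 0 < s ^+ 2 by rewrite lt_def hs sqrf_eq0 s0.
  lra.
have yx : y = x by rewrite /y s0 rmorph0 mul0r subr0.
have : 0 < Y by rewrite /Y yx; apply: pos => //.
nra.
Qed.

(** The last constraint is imposed first, by passing to its kernel, and released last; the penalty
    for the other constraints is then part of the form. *)
Lemma finsler b q N (n : nat) (l : nat -> S -> R) : symbil q ->
  (forall i, linR (l i)) ->
  (forall x y, lspan sc b x -> lspan sc b y -> N x x = 0 -> q x y = 0) ->
  (forall i x, lspan sc b x -> N x x = 0 -> l i x = 0) ->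
  (forall x, lspan sc b x -> (forall i, (i < n)%N -> l i x = 0) ->
     N x x != 0 -> 0 < q x x) ->
  exists2 M : R, 0 <= M & forall x, lspan sc b x -> N x x != 0 ->
    0 < q x x + M * \sum_(i < n) l i x ^+ 2.
Proof.
move=> hq hl; elim: n b => [|n IH] b kq kl pos.
  by exists 0 => // x hx nx; rewrite mul0r addr0; apply: pos.
have [b1 [hb1 hb2]] := kernel_span b (hl n).
have [||x|M M0 hM] := IH b1.
- by move=> x y /hb1 [hx _] /hb1 [hy _]; apply: kq.
- by move=> i x /hb1 [hx _]; apply: kl.
- move=> /hb1 [hx ln] h; apply: pos => // i; rewrite ltnS leq_eqVlt.
  by case/orP => [/eqP ->|/h].
pose q1 x y := q x y + M * \sum_(i < n) l i x * l i y.
have hq1 : symbil q1.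
  split=> [x|x y]; last first.
    by rewrite /q1 hq.2; congr (_ + _ * _); apply: eq_bigr => i _; rewrite mulrC.
  split=> [y z|a y]; rewrite /q1.
    rewrite (symbilDr hq).
    under eq_bigr => i _ do rewrite (linD (hl i)) mulrDr.
    by rewrite big_split /=; ring.
  rewrite (symbilZr hq).
  under eq_bigr => i _ do rewrite (linZ (hl i)) mulrCA.
  by rewrite -mulr_sumr; ring.
have [||M' M'0 hM'] := @finsler_step b q1 N (l n) hq1 (hl n).
- move=> x y hx hy nx; rewrite /q1 kq // add0r big1 ?mulr0 // => i _.
  by rewrite kl // mul0r.
- by move=> x hx ln nx; apply: hM => //; apply: hb2.
exists (M + M'); first exact: addr_ge0.
move=> x hx nx; apply: lt_le_trans (hM' x hx nx) _.
rewrite /q1 -addrA lerD2l big_ord_recr /=.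
have -> : \sum_(i < n) l i x * l i x = \sum_(i < n) l i x ^+ 2.
  by apply: eq_bigr => i _; rewrite expr2.
have : 0 <= \sum_(i < n) l i x ^+ 2 by apply: sumr_ge0 => i _; apply: sqr_ge0.
have := sqr_ge0 (l n x).
nra.
Qed.

Lemma linP_size b (f : S -> {poly R}) : linP f ->
  exists K, forall x, lspan sc b x -> (size (f x) <= K)%N.
Proof.
move=> hf; elim: b => [|v b [K IH]].
  by exists 0%N => x /= ->; rewrite (lin0 hf) size_poly0.
exists (maxn (size (f v)) K) => x /= [a hx].
have -> : x = (x - sc a * v) + sc a * v by ring.
rewrite (linD hf) (linZ hf) mul_polyC.
apply: leq_trans (size_polyD _ _) _; rewrite geq_max; apply/andP; split.
  by apply: leq_trans (IH _ hx) _; apply: leq_maxr.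
by apply: leq_trans (size_scale_leq _ _) _; apply: leq_maxl.
Qed.

(** The loss is proportional to the constant coefficient itself, so the admissible size of [eta]
    does not depend on the vector from which [F] arises. *)
Lemma poly_eq_near (K : nat) (F : {poly R}) (C eta : R) : (size F <= K)%N -> 0 <= C ->
  (forall i, (i < K)%N -> `|F`_i| <= C * F`_0) -> `|eta| <= 1 -> 0 <= F`_0 ->
  F`_0 - `|eta| * (C * F`_0 *+ K) <= F.[eta].
Proof.
case: K => [|K] sF C0 hF e1 F0.
  move: sF; rewrite leqn0 size_poly_eq0 => /eqP ->.
  by rewrite coef0 horner0 mulr0n mulr0 subr0.
rewrite (horner_coef_wide _ sF) big_ord_recl expr0 mulr1 lerD2l.
rewrite lerNl -sumrN; apply: le_trans (ler_norm _) _.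
apply: le_trans (ler_norm_sum _ _ _) _.
have h : \sum_(i < K) `|- (F`_(bump 0 i) * eta ^+ bump 0 i)|
   <= \sum_(i < K) `|eta| * (C * F`_0).
  apply: ler_sum => i _; rewrite normrN normrM normrX /bump /= add1n exprS.
  rewrite mulrC -mulrA ler_wpM2l // -[X in _ <= X]mul1r ler_pM ?exprn_ge0 //.
    by rewrite exprn_ile1.
  by apply: hF; rewrite ltnS.
apply: le_trans h _; rewrite sumr_const card_ord -[leLHS]mulrnAr ler_wpM2l // mulrS lerDr.
exact: mulr_ge0.
Qed.

(** Form and constraints both move with the parameter, and the constraint space may jump in
    dimension. Finsler's lemma at 0 gives a penalised form that is positive without constraints; all
    its coefficients are dominated by the constant one, so it stays positive nearby, and on the
    moving constraint space the penalty vanishes. *)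
Lemma perturbation b (q : S -> S -> {poly R}) N (n : nat) (l : nat -> S -> {poly R}) :
  (forall x, linP (q x)) -> (forall x y, q x y = q y x) -> (forall i, linP (l i)) ->
  (forall x y, lspan sc b x -> lspan sc b y -> N x x = 0 -> q x y = 0) ->
  (forall i x, lspan sc b x -> N x x = 0 -> l i x = 0) ->
  (forall x, lspan sc b x -> (forall i, (i < n)%N -> (l i x).[0] = 0) ->
     N x x != 0 -> 0 < (q x x).[0]) ->
  exists2 d : R, 0 < d & forall eta, `|eta| < d -> forall x, lspan sc b x ->
    (forall i, (i < n)%N -> (l i x).[eta] = 0) -> N x x != 0 -> 0 < (q x x).[eta].
Proof.
move=> hq sq hl kq kl pos.
have hq0 : symbil (fun x y => (q x y).[0]).
  split=> [x|x y]; last by rewrite sq.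
  by split=> *; rewrite ?(linD (hq x)) ?(linZ (hq x)) ?hornerD // hornerCM.
have [||||M M0 hM] := @finsler b _ N n (fun i x => (l i x).[0]) hq0.
- by move=> i; split=> *; rewrite ?(linD (hl i)) ?(linZ (hl i)) ?hornerD // hornerCM.
- by move=> x y hx hy nx; rewrite kq // horner0.
- by move=> i x hx nx; rewrite kl // horner0.
- exact: pos.
pose F x y := q x y + M%:P * \sum_(i < n) l i x * l i y.
have FL x : linP (F x).
  split=> [y z|a y]; rewrite /F.
    rewrite (linD (hq x)).
    under eq_bigr => i _ do rewrite (linD (hl i)) mulrDr.
    by rewrite big_split /=; ring.
  rewrite (linZ (hq x)).
  under eq_bigr => i _ do rewrite (linZ (hl i)) mulrCA.
  by rewrite -mulr_sumr; ring.
have Fs x y : F x y = F y x.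
  by rewrite /F sq; congr (_ + _ * _); apply: eq_bigr => i _; rewrite mulrC.
have FE x e : (F x x).[e] = (q x x).[e] + M * \sum_(i < n) (l i x).[e] ^+ 2.
  rewrite /F hornerD hornerM hornerC horner_sum; congr (_ + _ * _).
  by apply: eq_bigr => i _; rewrite hornerM expr2.
have Fk x y : lspan sc b x -> lspan sc b y -> N x x = 0 -> F x y = 0.
  move=> hx hy nx; rewrite /F kq // add0r big1 ?mulr0 // => i _.
  by rewrite kl // mul0r.
have Fpos x : lspan sc b x -> N x x != 0 -> 0 < (F x x)`_0.
  by move=> hx nx; rewrite -horner_coef0 FE; apply: hM.
clearbody F.
have Fi i : symbil (fun x y => (F x y)`_i).
  split=> [x|x y]; last by rewrite Fs.
  by split=> *; rewrite ?(linD (FL x)) ?(linZ (FL x)) ?coefD // coefCM.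
have psd x : lspan sc b x -> 0 <= (F x x)`_0.
  by move=> hx; have [/Fk ->|/Fpos /ltW] := eqVneq (N x x) 0; rewrite ?coef0 //; apply.
have dom i : exists2 C : R, 0 <= C & forall x, lspan sc b x ->
    `|(F x x)`_i| <= C * (F x x)`_0.
  apply: (psd_dominates (Fi 0%N) (Fi i)) => // x y hx hy.
  have [e|h] := eqVneq (N x x) 0; first by rewrite (Fk x y) // coef0.
  by move=> e; move: (Fpos x hx h); rewrite e ltxx.
(* A common degree bound on the span leaves finitely many coefficients to dominate. *)
have [K hK] : exists K, forall x y, lspan sc b x -> lspan sc b y ->
    (size (F x y) <= K)%N.
  have h (c : seq S) : exists K, forall v, v \in c -> forall y, lspan sc b y ->
      (size (F v y) <= K)%N.
    elim: c => [|v c [K IH]]; first by exists 0%N => v; rewrite in_nil.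
    have [K' hK'] := linP_size b (FL v).
    exists (maxn K' K) => w; rewrite inE => /orP [/eqP ->|hw] y hy.
      by apply: leq_trans (hK' y hy) _; apply: leq_maxl.
    by apply: leq_trans (IH w hw y hy) _; apply: leq_maxr.
  have [K hK] := h b.
  exists K => x y hx hy; elim/lspan_ind: _ / hx => [|u w hu hw|a v hv].
  - by rewrite Fs (lin0 (FL y)) size_poly0.
  - rewrite Fs (linD (FL y)) !(Fs y); apply: leq_trans (size_polyD _ _) _.
    by rewrite geq_max hu hw.
  rewrite Fs (linZ (FL y)) (Fs y) mul_polyC.
  by apply: leq_trans (size_scale_leq _ _) _; apply: hK.
have [C C0 hC] : exists2 C : R, 0 <= C & forall i, (i < K)%N -> forall x, lspan sc b x ->
    `|(F x x)`_i| <= C * (F x x)`_0.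
  elim: (K) => [|k [C C0 IH]]; first by exists 0.
  have [C' C'0 hC'] := dom k.
  exists (C + C'); first exact: addr_ge0.
  move=> i; rewrite ltnS leq_eqVlt => hi x hx.
  have f0 := psd x hx.
  case/orP: hi => [/eqP ->|hi].
    by apply: le_trans (hC' x hx) _; rewrite ler_wpM2r // lerDr.
  by apply: le_trans (IH i hi x hx) _; rewrite ler_wpM2r // lerDl.
have D0 : 0 < 1 + C *+ K by rewrite ltr_wpDr // mulrn_wge0.
(* This forces [|eta| (C *+ K) < 1], so that [poly_eq_near] keeps a positive fraction of the
   constant coefficient; the summand 1 also yields [|eta| <= 1]. *)
exists (1 + C *+ K)^-1; first by rewrite invr_gt0.
move=> eta he x hx lx nx.
have e1 : `|eta| <= 1.
  apply: ltW; apply: lt_le_trans he _; rewrite invf_le1 // lerDl mulrn_wge0 //.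
have := poly_eq_near (hK x x hx hx) C0 (fun i hi => hC i hi x hx) e1 (psd x hx).
rewrite FE big1 => [|i _]; last by rewrite lx // expr0n.
rewrite mulr0 addr0; apply: lt_le_trans.
have f0 := Fpos x hx nx.
have : `|eta| * (1 + C *+ K) < 1 by rewrite -ltr_pdivlMr // div1r.
rewrite -mulrnAl mulrDr mulr1 => h.
have n0 := normr_ge0 eta.
rewrite subr_gt0 mulrA -subr_gt0 -{1}[(F x x)`_0]mul1r -mulrBl mulr_gt0 // subr_gt0.
lra.
Qed.

End Forms.

(** * Degree functionals and the Hodge-Riemann relations *)

Definition degfun (R : comNzRingType) (S : ga R) (d : nat) (D : S -> R) : Prop :=
  linR D /\ forall k x, ga_hom k x -> k != d -> D x = 0.

(** The annihilator of the functional. The ring modulo [null D] has a pairing without kernel and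
    stands for a cohomology ring throughout. *)
Definition null (R : comNzRingType) (S : ga R) (D : S -> R) (x : S) : Prop :=
  forall y, D (x * y) = 0.

Section Null.
Variables (R : comNzRingType) (S : ga R) (d : nat) (D : S -> R).
Hypothesis hD : degfun d D.
Local Notation sc := (@ga_sc R S).
Implicit Types x y : S.

Lemma nullD x y : null D x -> null D y -> null D (x + y).
Proof. by move=> hx hy z; rewrite mulrDl (linD hD.1) hx hy addr0. Qed.
Lemma nullM x y : null D x -> null D (y * x).
Proof. by move=> hx z; rewrite -mulrA mulrCA hx. Qed.
Lemma nullMr x y : null D x -> null D (x * y).
Proof. by move=> hx z; rewrite -mulrA hx. Qed.
Lemma null0 : null D 0.
Proof. by move=> z; rewrite mul0r (lin0 hD.1). Qed.
Lemma nullN x : null D x -> null D (- x).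
Proof. by move=> hx z; rewrite mulNr (linN hD.1) hx oppr0. Qed.
Lemma nullB x y : null D x -> null D y -> null D (x - y).
Proof. by move=> hx hy; apply: nullD => //; apply: nullN. Qed.
Lemma null_sum (I : Type) (r : seq I) (P : pred I) (F : I -> S) :
  (forall i, P i -> null D (F i)) -> null D (\sum_(i <- r | P i) F i).
Proof.
move=> h; elim/big_rec: _ => [|i x Pi hx]; first exact: null0.
by apply: nullD => //; apply: h.
Qed.
Lemma null_hom k x : ga_hom k x ->
  (forall j y, (j + k)%N = d -> ga_hom j y -> D (x * y) = 0) -> null D x.
Proof.
move=> hx h; apply: ga_ind => [y z hy hz|j y hy]; first by rewrite mulrDr (linD hD.1) hy hz addr0.
have [e|e] := eqVneq (j + k)%N d; first exact: h e hy.
by apply: hD.2 (ga_homM hx hy) _; rewrite addnC.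
Qed.
Lemma null_eq0 x : null D x -> D x = 0.
Proof. by move=> /(_ 1); rewrite mulr1. Qed.
Lemma null_congr x y : null D (x - y) -> D x = D y.
Proof. by move=> /null_eq0 /eqP; rewrite (linB hD.1) subr_eq0 => /eqP. Qed.
End Null.

(** Injectivity of the Lefschetz map modulo [null D], tested against degree [k]; over a field
    [HL_surj] adds surjectivity. *)
Definition HL (R : comNzRingType) (S : ga R) d (D : S -> R) (l : S) : Prop :=
  forall k, (2 * k <= d)%N -> forall x, ga_hom k x ->
  (forall y, ga_hom k y -> D (l ^+ (d - 2 * k) * x * y) = 0) -> null D x.

(** Primitivity is tested in the complementary degree [k - 1], named by [j.+1 = k] so that the
    condition is empty for [k = 0]. Definiteness is meant modulo [null D]. *)
Definition HR (R : numDomainType) (S : ga R) d (D : S -> R) (l : S) : Prop :=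
  forall k, (2 * k <= d)%N -> forall x, ga_hom k x ->
  (forall j y, j.+1 = k -> ga_hom j y -> D (l ^+ (d - 2 * k + 1) * x * y) = 0) ->
  0 <= (-1) ^+ k * D (l ^+ (d - 2 * k) * x * x) /\
  (D (l ^+ (d - 2 * k) * x * x) = 0 -> null D x).

(** A vector in the kernel of the Lefschetz form is primitive and isotropic, hence null. *)
Lemma HR_HL (R : numDomainType) (S : ga R) d (D : S -> R) (l : S) :
  ga_hom 1 l -> HR d D l -> HL d D l.
Proof.
move=> hl h k hk x hx ker.
have [|_ h2] := h k hk x hx; last by apply: h2; apply: ker.
move=> j y ej hy; rewrite addn1 exprS -mulrA.
have -> : l * l ^+ (d - 2 * k) * (x * y) = l ^+ (d - 2 * k) * x * (l * y) by ring.
by apply: ker; rewrite -ej; apply: (ga_homM hl hy).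
Qed.

Section Surj.
Variables (R : fieldType) (S : ga R) (d : nat) (D : S -> R) (l : S).
Hypotheses (hD : degfun d D) (hHL : HL d D l).
Local Notation sc := (@ga_sc R S).

(** On generators the claim is that the row of [phi] lies in the row space of the Gram matrix. A
    column of the cokernel is a combination orthogonal to everything, hence null by hard Lefschetz,
    hence killed by [phi]. *)
Lemma HL_surj k (phi : S -> R) : (2 * k <= d)%N -> linR phi ->
  (forall x, ga_hom k x -> null D x -> phi x = 0) ->
  exists2 u, ga_hom k u &
    forall w, ga_hom k w -> D (l ^+ (d - 2 * k) * u * w) = phi w.
Proof.
move=> hk hphi ker; have [b [hb sb]] := ga_span S k.
set e := (d - 2 * k)%N.
pose M := \matrix_(i < size b, j < size b) D (l ^+ e * b`_i * b`_j).
pose r := \row_(j < size b) phi b`_j.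
have hbi (i : 'I_(size b)) : ga_hom k b`_i by apply: hb; apply: mem_nth.
have comb (a : 'rV_(size b)) : ga_hom k (\sum_i sc (a 0 i) * b`_i).
  by apply: hom_sum => i _; apply: homZ.
have Dcomb (a : 'rV_(size b)) w :
    D (l ^+ e * (\sum_i sc (a 0 i) * b`_i) * w) = \sum_i a 0 i * D (l ^+ e * b`_i * w).
  rewrite mulr_sumr mulr_suml (lin_sum hD.1); apply: eq_bigr => i _.
  by rewrite -(linZ hD.1); congr D; ring.
have ext (f g : S -> R) : linR f -> linR g ->
    (forall i : 'I_(size b), f b`_i = g b`_i) -> forall w, ga_hom k w -> f w = g w.
  move=> hf hg h w /sb; elim/lspan_ind => [|x y hx hy|a v /(nthP 0) [i hi <-]].
  - by rewrite (lin0 hf) (lin0 hg).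
  - by rewrite (linD hf) (linD hg) hx hy.
  by rewrite (linZ hf) (linZ hg) (h (Ordinal hi)).
have lD x : linR (fun w => D (x * w)).
  by split=> *; rewrite ?mulrDr ?(linD hD.1) // mulrCA (linZ hD.1).
have lzero : linR (fun _ : S => 0 : R) by split=> *; rewrite ?addr0 ?mulr0.
have : (r <= M)%MS.
  rewrite submxE; apply/eqP/rowP => j; rewrite [RHS]mxE.
  pose a := (col j (cokermx M))^T.
  have hx := comb a; set x := \sum_i _ in hx.
  have nx : null D x.
    apply: hHL hk _ hx _; apply: ext => // i; rewrite Dcomb.
    have /matrixP /(_ i j) := mulmx_coker M; rewrite !mxE => h0; rewrite -[RHS]h0.
    apply: eq_bigr => i' _; rewrite !mxE mulrC; congr (D _ * _).
    by rewrite -!mulrA (mulrC b`_i).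
  have := ker x hx nx; rewrite (lin_sum hphi) => h0.
  rewrite mxE -[RHS]h0; apply: eq_bigr => i _.
  by rewrite (linZ hphi) !mxE mulrC.
case/submxP => a ra; exists (\sum_i sc (a 0 i) * b`_i); first exact: comb.
apply: ext => // i; rewrite Dcomb.
have /rowP /(_ i) := ra; rewrite !mxE => ->.
by apply: eq_bigr => j _; rewrite mxE.
Qed.

End Surj.

(** * Polynomial extensions *)

Section PolyGa.
Variables (R : comNzRingType) (S : ga R).

(** The coefficient of ['X^i] has degree [k - i]; naming that degree [j] avoids truncated
    subtraction. *)
Definition poly_hom k (f : {poly S}) : Prop :=
  forall i, (forall j, (j + i)%N = k -> ga_hom j f`_i) /\ ((k < i)%N -> f`_i = 0).

Definition poly_sc : {rmorphism R -> {poly S}} :=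
  GRing.RMorphism.clone _ _ (@polyC S \o ga_sc S) _.

Lemma poly_scE a : poly_sc a = (ga_sc S a)%:P. Proof. by []. Qed.

Lemma poly_hom0 k : poly_hom k 0.
Proof. by move=> i; split=> [j _|_]; rewrite coef0 //; apply: ga_hom0. Qed.
Lemma poly_homD k x y : poly_hom k x -> poly_hom k y -> poly_hom k (x + y).
Proof.
move=> hx hy i; split=> [j e|e]; rewrite coefD.
  by apply: ga_homD; [apply: (hx i).1 | apply: (hy i).1].
by rewrite (hx i).2 // (hy i).2 // addr0.
Qed.
Lemma poly_homM j k x y : poly_hom j x -> poly_hom k y -> poly_hom (j + k) (x * y).
Proof.
move=> hx hy i; split=> [a e|e]; rewrite coefM.
  apply: hom_sum => t _; have ht := ltn_ord t.
  have [c1|c1] := ltnP j t; first by rewrite (hx t).2 // mul0r; apply: ga_hom0.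
  have [c2|c2] := ltnP k (i - t); first by rewrite (hy _).2 // mulr0; apply: ga_hom0.
  have -> : a = ((j - t) + (k - (i - t)))%N by lia.
  by apply: ga_homM; [apply: (hx t).1 | apply: (hy _).1]; lia.
apply: big1 => t _; have ht := ltn_ord t.
have [c1|c1] := ltnP j t; first by rewrite (hx t).2 // mul0r.
by rewrite (hy _).2 ?mulr0 //; lia.
Qed.
Lemma poly_homC k x : ga_hom k x -> poly_hom k x%:P.
Proof.
move=> hx i; split=> [j e|e]; rewrite coefC; case: eqP => // i0.
- by apply: homE hx; lia.
- exact: ga_hom0.
- by lia.
Qed.
Lemma poly_homX : poly_hom 1 'X.
Proof.
move=> i; split=> [j e|e]; rewrite coefX; case: eqP => // i1.
- by apply: homE (hom1 S); lia.
- exact: ga_hom0.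
- by lia.
Qed.
Lemma poly_homXn n : poly_hom n 'X^n.
Proof.
elim: n => [|n IH]; first by rewrite expr0; apply/poly_homC/hom1.
by rewrite exprS; apply: (poly_homM poly_homX IH).
Qed.
Lemma poly_homsc a : poly_hom 0 (poly_sc a).
Proof. by apply: poly_homC; apply: ga_homsc. Qed.

Lemma poly_expand (f : {poly S}) n : (size f <= n)%N ->
  f = \sum_(i < n) (f`_i)%:P * 'X^i.
Proof.
move=> h; rewrite -{1}(coefK f) poly_def; under eq_bigr => i _ do rewrite -mul_polyC.
rewrite (big_ord_widen _ (fun i => (f`_i)%:P * 'X^i) h) big_mkcond; apply: eq_bigr => i _.
by case: ifP => // /negbT; rewrite -leqNgt => /leq_sizeP -> //; rewrite polyC0 mul0r.
Qed.

Lemma poly_hom_size k f : poly_hom k f -> (size f <= k.+1)%N.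
Proof. by move=> h; apply/leq_sizeP => i /(h i).2. Qed.

Lemma poly_ga_ind (P : {poly S} -> Prop) : (forall x y, P x -> P y -> P (x + y)) ->
  (forall k x, poly_hom k x -> P x) -> forall x, P x.
Proof.
move=> PD Ph f; rewrite (poly_expand (leqnn (size f))).
elim/big_rec: _ => [|i x _ hx]; first by apply: (Ph 0%N); apply: poly_hom0.
apply: (PD _ _ _ hx) => //; move: (f`_i); apply: ga_ind => [y z hy hz|k y hy].
  by rewrite polyCD mulrDl; apply: PD.
by apply: (Ph (k + i)%N); apply: poly_homM; [apply: poly_homC | apply: poly_homXn].
Qed.

Lemma poly_ga_span k : exists b : seq {poly S}, (forall x, x \in b -> poly_hom k x) /\
  (forall x, poly_hom k x -> lspan poly_sc b x).
Proof.
suff h m : exists b : seq {poly S}, (forall x, x \in b -> poly_hom k x) /\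
    (forall f, poly_hom k f -> lspan poly_sc b (\sum_(i < m) (f`_i)%:P * 'X^i)).
  have [b [h1 h2]] := h k.+1; exists b; split=> // f hf.
  by rewrite (poly_expand (poly_hom_size hf)); apply: h2.
have lsD (b : seq {poly S}) x y : lspan poly_sc b x -> lspan poly_sc b y ->
    lspan poly_sc b (x + y).
  elim: b x y => [|v b IH] x y /=; first by move=> -> ->; rewrite addr0.
  move=> [a ha] [c hc]; exists (a + c).
  have -> : x + y - poly_sc (a + c) * v = (x - poly_sc a * v) + (y - poly_sc c * v).
    by rewrite !poly_scE rmorphD polyCD; ring.
  exact: IH.
have ls0 (b : seq {poly S}) : lspan poly_sc b 0.
  by elim: b => //= v b IH; exists 0; rewrite rmorph0 mul0r subr0.
have lscat (b c : seq {poly S}) x : lspan poly_sc b x -> lspan poly_sc (b ++ c) x.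
  elim: b x => [|v b IH] x /=; first by move=> ->.
  by move=> [a /IH ha]; exists a.
have lscat' (b c : seq {poly S}) x : lspan poly_sc c x -> lspan poly_sc (b ++ c) x.
  by elim: b => //= v b IH /IH hx; exists 0; rewrite rmorph0 mul0r subr0.
elim: m => [|m [b [h1 h2]]].
  by exists [::]; split=> // f _; rewrite big_ord0.
have [hm|hm] := leqP m k; last first.
  exists b; split=> // f hf; rewrite big_ord_recr /= (hf m).2 // polyC0 mul0r addr0.
  exact: h2.
have [c [hc sc]] := ga_span S (k - m).
exists (b ++ [seq v%:P * 'X^m | v <- c]); split.
  move=> x; rewrite mem_cat => /orP [/h1 //|/mapP [v /hc hv ->]].
  have -> : k = ((k - m) + m)%N by lia.
  by apply: poly_homM; [apply: poly_homC | apply: poly_homXn].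
move=> f hf; rewrite big_ord_recr /=; apply: lsD; first by apply: lscat; apply: h2.
apply: lscat'.
have : ga_hom (k - m) f`_m by apply: (hf m).1; lia.
move=> /sc; move: (f`_m); elim: (c) => [|v c' IH] x /=.
  by move->; rewrite polyC0 mul0r.
move=> [a /IH ha]; exists a; move: ha; rewrite polyCB polyCM mulrBl.
by rewrite mulrA.
Qed.

Definition polyGA : ga R :=
  @Ga R {poly S} poly_sc poly_hom poly_hom0 poly_homD poly_homM poly_homsc
    poly_ga_ind poly_ga_span.

End PolyGa.

(** * Products with projective spaces *)

Lemma coefM0 (S : comNzRingType) (f g : {poly S}) : (f * g)`_0 = f`_0 * g`_0.
Proof. by rewrite coefM big_ord1. Qed.
Lemma coefM1 (S : comNzRingType) (f g : {poly S}) :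
  (f * g)`_1 = f`_0 * g`_1 + f`_1 * g`_0.
Proof. by rewrite coefM big_ord_recl big_ord1. Qed.

Section Proj.
Variables (R : comNzRingType) (S : ga R).

(** Integration along a projective space of dimension [m]; it makes ['X^(m.+1)] null. The factor
    [tau] adjusts signs, since [HR_projn] is also applied to a class with negative ['X]-part. *)
Definition Dcoef (tau : R) m (D : S -> R) (f : polyGA S) : R := tau * D (f : {poly S})`_m.

Lemma Dcoef_degfun tau m d D : degfun d D -> degfun (d + m) (Dcoef tau m D).
Proof.
move=> [hl hd]; split.
  split=> [x y|a x]; rewrite /Dcoef ?coefD ?(linD hl) ?mulrDr //=.
  by rewrite coefCM (linZ hl) mulrCA.
move=> k x hx kd; rewrite /Dcoef; have [c|c] := ltnP k m.
  by rewrite (hx m).2 // (lin0 hl) mulr0.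
by rewrite (hd (k - m)%N) ?mulr0 //; [apply: (hx m).1; lia | lia].
Qed.

Definition ellP (l : S) (s : R) : polyGA S := (l%:P + (ga_sc S s)%:P * 'X : {poly S}).

Lemma ellP_hom l s : ga_hom 1 l -> ga_hom 1 (ellP l s).
Proof.
move=> hl; apply: (@ga_homD _ (polyGA S)); first exact: poly_homC.
by apply: (homZ (S := polyGA S)); apply: poly_homX.
Qed.

Lemma ellP_coef0 l s n : ((ellP l s : {poly S}) ^+ n)`_0 = l ^+ n.
Proof.
elim: n => [|n IH]; first by rewrite !expr0 coefC.
by rewrite !exprS coefM0 IH /ellP coefD coefC coefCM coefX mulr0 addr0.
Qed.
Lemma ellP_coef1 l s n :
  ((ellP l s : {poly S}) ^+ n)`_1 = ga_sc S s * l ^+ n.-1 *+ n.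
Proof.
elim: n => [|n IH]; first by rewrite expr0 coefC mulr0n.
rewrite exprS coefM1 IH ellP_coef0 /ellP !coefD !coefC !coefCM !coefX.
rewrite mulr0 addr0 mulr1 add0r; case: n IH => [|n] IH /=.
  by rewrite mulr0n mulr0 add0r expr0 mulr1.
by rewrite mulrnAr mulrCA -exprS -mulrSr.
Qed.

End Proj.

Section Proj1.
Variables (R : realFieldType) (S : ga R) (d : nat) (D : S -> R) (l : S).
Hypotheses (hD : degfun d D) (hl : ga_hom 1 l) (hHR : HR d D l).

Lemma HR_proj0 tau s : 0 < tau -> HR d (Dcoef tau 0 D) (ellP l s).
Proof.
move=> t0 k hk x hx prim.
have hx0 : ga_hom k (x : {poly S})`_0 by apply: (hx 0%N).1; rewrite addn0.
have E n (y z : polyGA S) : Dcoef tau 0 D (ellP l s ^+ n * y * z) =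
    tau * D (l ^+ n * (y : {poly S})`_0 * (z : {poly S})`_0).
  by rewrite /Dcoef !coefM0 ellP_coef0.
have [|h1 h2] := hHR hk hx0.
  move=> j y ej hy; have := prim j y%:P ej (poly_homC hy).
  by rewrite E coefC /= => /eqP; rewrite mulf_eq0 gt_eqF //= => /eqP.
rewrite E; split; first by rewrite mulrCA mulr_ge0 // ltW.
move=> /eqP; rewrite mulf_eq0 gt_eqF //= => /eqP /h2 h y.
by rewrite /Dcoef coefM0 h mulr0.
Qed.

(** Write a class of positive degree as [u + v X]. Hard Lefschetz on the base gives [u = u0 + l u1]
    with [u0], [u1] primitive, and primitivity of the class forces [v = - s (n + 1) u1] modulo null.
    The form becomes [tau s (n A0 - (n + 2) A1)], where [A0] and [A1] are the forms of [u0] and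
    [u1]; these live in consecutive degrees and have opposite signs. *)
Lemma HR_proj1 tau s : 0 < tau * s -> HR d.+1 (Dcoef tau 1 D) (ellP l s).
Proof.
move=> ts k hk x hx prim.
set n := (d.+1 - 2 * k)%N.
pose u := (x : {poly S})`_0; pose v := (x : {poly S})`_1.
have hu : ga_hom k u by apply: (hx 0%N).1; rewrite addn0.
have t0 : tau != 0 by apply/negP => /eqP e; rewrite e mul0r ltxx in ts.
have E m (y z : polyGA S) : Dcoef tau 1 D (ellP l s ^+ m * y * z) =
    tau * (D (l ^+ m * (y : {poly S})`_0 * (z : {poly S})`_1) +
           D (l ^+ m * (y : {poly S})`_1 * (z : {poly S})`_0) +
           s * D (l ^+ m.-1 * (y : {poly S})`_0 * (z : {poly S})`_0) *+ m).
  rewrite /Dcoef !coefM1 !coefM0 ellP_coef0 ellP_coef1.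
  rewrite mulrDl !(linD hD.1) addrA; congr (_ * (_ + _ + _)).
  rewrite -(linZ hD.1) -(linMn hD.1); congr D.
  by rewrite -!mulrnAl !mulrA.
have En m y z : D (l ^+ m * (y + z) * (y + z)) =
    D (l ^+ m * y * y) + 2 * D (l ^+ m * y * z) + D (l ^+ m * z * z).
  rewrite mulr_natl -(linMn hD.1) -!(linD hD.1); congr D; ring.
have T (a : R) : tau * a = 0 -> a = 0.
  by move=> /eqP; rewrite mulf_eq0 (negbTE t0) => /eqP.
have xnull : null D u -> null D v -> null (Dcoef tau 1 D) x.
  by move=> nu nv y; rewrite /Dcoef coefM1 (linD hD.1) nu nv addr0 mulr0.
have lr (y : S) : linR (fun w : S => D (y * w)).
  by split=> *; rewrite ?mulrDr ?(linD hD.1) // mulrCA (linZ hD.1).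
case: k => [|k] in hk hx hu prim n xnull *.
  have v0 : v = 0 by apply: (hx 1%N).2.
  have [//||h1 h2] := hHR (k := 0%N) _ hu; first by [].
  have en : n = d.+1 by rewrite /n muln0 subn0.
  rewrite E -/u -/v v0 !mulr0 !mul0r !(lin0 hD.1) !add0r en /=.
  rewrite muln0 subn0 in h1 h2.
  rewrite expr0 !mul1r in h1 *; split.
    by rewrite -mulr_natl mulrCA mulr_ge0 ?ler0n // mulrA mulr_ge0 // ltW.
  move=> /eqP; rewrite -mulrnAr -mulr_natr !mulf_eq0 (negbTE t0) /=.
  rewrite pnatr_eq0 /= orbF => /orP [/eqP e|/eqP /h2 nu].
    by move: ts; rewrite e mulr0 ltxx.
  by apply: xnull => //; rewrite v0; apply: null0 hD.
have hv : ga_hom k v by apply: (hx 1%N).1; rewrite addn1.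
have hk' : (2 * k <= d)%N by lia.
have hn : (d - 2 * k)%N = n.+1 by rewrite /n; lia.
(* Primitivity tested against constants; [p0] below tests it against multiples of ['X]. *)
have p1 y : ga_hom k y -> D (l ^+ n.+1 * v * y) + s * D (l ^+ n * u * y) *+ n.+1 = 0.
  move=> hy; have := prim k y%:P erefl (poly_homC hy).
  rewrite E !coefC /= mulr0 (lin0 hD.1) add0r -/u -/v addn1.
  exact: T.
have p0 j y : j.+1 = k -> ga_hom j y -> D (l ^+ n.+1 * u * y) = 0.
  move=> ej hy; have hyX : ga_hom k (y%:P * 'X : polyGA S).
    by rewrite -ej -addn1; apply: poly_homM; [exact: poly_homC | exact: poly_homX].
  have := prim k _ erefl hyX; rewrite E !coefMX !coefC /= -/u addn1.
  by rewrite !mulr0 !(lin0 hD.1) mulr0 mul0rn !addr0; apply: T.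
have [u1 hu1 eu1] : exists2 u1, ga_hom k u1 &
    forall w, ga_hom k w -> D (l ^+ (d - 2 * k) * u1 * w) = D (l ^+ n * u * w).
  apply: (HL_surj hD (HR_HL hl hHR) hk'); first exact: lr.
  by move=> w _ nw; rewrite mulrC.
rewrite hn in eu1.
pose u0 := u - l * u1.
have hlu1 : ga_hom k.+1 (l * u1) by apply: (ga_homM hl hu1).
have hu0 : ga_hom k.+1 u0 by apply: homB.
have e0 w : ga_hom k w -> D (l ^+ n * u0 * w) = 0.
  move=> hw; have -> : l ^+ n * u0 * w = l ^+ n * u * w - l ^+ n.+1 * u1 * w.
    by rewrite /u0 exprS; ring.
  by rewrite (linB hD.1) eu1 // subrr.
have prim1 j y : j.+1 = k -> ga_hom j y -> D (l ^+ (d - 2 * k + 1) * u1 * y) = 0.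
  move=> ej hy; rewrite hn addn1.
  have -> : l ^+ n.+2 * u1 * y = l ^+ n.+1 * u1 * (l * y) by rewrite [in LHS]exprS; ring.
  rewrite eu1; last by rewrite -ej; apply: (ga_homM hl hy).
  rewrite -(p0 j y ej hy); congr D; rewrite exprS; ring.
have [a1 a1n] := hHR hk' hu1 prim1.
rewrite hn in a1 a1n.
have nv' : null D (v + u1 * ga_sc S (s *+ n.+1)).
  have hv' : ga_hom k (v + u1 * ga_sc S (s *+ n.+1)).
    by apply: ga_homD => //; rewrite mulrC; apply: homZ.
  apply: (HR_HL hl hHR) hk' _ hv' _ => y hy; rewrite hn -[RHS](p1 y hy).
  rewrite mulrDr mulrDl (linD hD.1); congr (_ + _).
  rewrite -(eu1 y hy) -mulrnAl -(linZ hD.1); congr D; ring.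
have Duv : D (l ^+ n * u * v) = - (s *+ n.+1) * D (l ^+ n.+1 * u1 * u1).
  rewrite -[v](addrK (u1 * ga_sc S (s *+ n.+1))) mulrBr (linB hD.1).
  rewrite (mulrC (l ^+ n * u)) nv' sub0r mulNr; congr (- _).
  by rewrite (eu1 _ hu1) -(linZ hD.1); congr D; ring.
set A1 := D (l ^+ n.+1 * u1 * u1) in a1 a1n Duv.
have eQ : exists A0, [/\ D (l ^+ n.-1 * u * u) *+ n = (A0 + A1) *+ n,
    0 <= (-1) ^+ k.+1 * A0 *+ n & (A0 *+ n = 0 -> null D u0)].
  (* For [n = 0] the degree of [u0] exceeds [d / 2] and there is no form for it; [e0] then already
     makes [u0] null. *)
  case en : n => [|n'].
    exists 0; split; rewrite ?mulr0n // => _.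
    apply: (null_hom hD hu0) => j y ej hy.
    rewrite -[RHS](e0 y); last by apply: homE hy; move: (en) ej; rewrite /n; lia.
    by rewrite en expr0 mul1r.
  have hk2 : (2 * k.+1 <= d)%N by rewrite /n in en; lia.
  have e2 : (d - 2 * k.+1)%N = n' by rewrite /n in en; lia.
  have [|b0 b0n] := hHR hk2 hu0.
    by move=> j y [ej] hy; rewrite e2 addn1 -en e0 // -ej.
  rewrite e2 in b0 b0n.
  exists (D (l ^+ n' * u0 * u0)); split.
  - have -> : u = u0 + l * u1 by rewrite /u0; ring.
    rewrite /= En; congr (_ *+ _); rewrite -[RHS]addr0 -addrA -[RHS]addrA.
    congr (_ + _); rewrite [LHS]addrC; congr (_ + _).
      by rewrite /A1 en; congr D; rewrite !exprS; ring.
    rewrite -[RHS](mulr0 2); congr (_ * _); rewrite -[RHS](e0 u1 hu1) en.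
    by congr D; rewrite exprS; ring.
  - by rewrite mulrn_wge0.
  by move=> /eqP; rewrite mulrn_eq0 /= => /eqP.
case: eQ => A0 [e1 A0p A0n].
have key : Dcoef tau 1 D (ellP l s ^+ n * x * x) =
    tau * s * (A0 *+ n - A1 *+ n.+2).
  rewrite E -/u -/v.
  have -> : l ^+ n * v * u = l ^+ n * u * v by ring.
  rewrite -mulrnAr e1 Duv -[RHS]mulrA; congr (_ * _).
  ring.
rewrite key.
have sgn : (-1) ^+ k.+1 * (tau * s * (A0 *+ n - A1 *+ n.+2)) =
   tau * s * ((-1) ^+ k.+1 * A0 *+ n + (-1) ^+ k * A1 *+ n.+2).
  by rewrite exprS -!mulrnAr; ring.
have A1p : 0 <= (-1) ^+ k * A1 *+ n.+2 by rewrite mulrn_wge0.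
split; first by rewrite sgn; apply: mulr_ge0; [exact: ltW | exact: addr_ge0].
move=> z; have := sgn; rewrite z mulr0 => /esym /eqP.
rewrite mulf_eq0 gt_eqF //= paddr_eq0 // => /andP [z0 z1].
have nu1 : null D u1.
  by apply: a1n; move: z1; rewrite mulrn_eq0 /= mulf_eq0 signr_eq0 => /eqP.
have nu0 : null D u0.
  by apply: A0n; move: z0; rewrite -mulrnAr mulf_eq0 signr_eq0 => /eqP.
apply: xnull.
  have -> : u = u0 + l * u1 by rewrite /u0; ring.
  by apply: (nullD hD) => //; apply: nullM.
have -> : v = v + u1 * ga_sc S (s *+ n.+1) - ga_sc S (s *+ n.+1) * u1 by ring.
by apply: (nullB hD) => //; apply: nullM.
Qed.

End Proj1.

Section ProjN.
Variables (R : realFieldType) (S : ga R).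

Definition polyCC : {rmorphism S -> {poly {poly S}}} :=
  GRing.RMorphism.clone _ _ (@polyC {poly S} \o @polyC S) _.
Lemma polyCC_comm : commr_rmorph polyCC ('X%:P + 'X). Proof. by move=> x; apply: mulrC. Qed.
(** Pull-back along multiplication of binary forms, a finite map from the product of an
    [m]-dimensional projective space with a line onto a projective space of dimension [m + 1]. Its
    degree [m + 1] is the factor in [D2E] below. *)
Definition diag : {rmorphism {poly S} -> {poly {poly S}}} :=
  GRing.RMorphism.clone _ _ (horner_morph polyCC_comm) _.

Lemma diagC a : diag a%:P = a%:P%:P.
Proof. exact: horner_morphC. Qed.
Lemma diagX : diag 'X = 'X%:P + 'X.
Proof. exact: horner_morphX. Qed.

Lemma diag_coef f : (diag f)`_0 = f /\ (diag f)`_1 = f^`().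
Proof.
elim/poly_ind: f => [|f c [h0 h1]]; first by rewrite rmorph0 !coef0 deriv0.
rewrite !rmorphD !rmorphM /= diagC diagX !coefD !coefC coefM0 coefM1 !coefD !coefC !coefX.
rewrite h0 h1 derivD derivM derivX derivC /= !(addr0, add0r, mulr1, mulr0).
by split=> //; rewrite addrC.
Qed.

Lemma diag_hom k f : poly_hom (S := S) k f -> poly_hom (S := polyGA S) k (diag f).
Proof.
move=> hf; rewrite (poly_expand (poly_hom_size hf)) rmorph_sum.
apply: (hom_sum (S := polyGA (polyGA S))) => i _.
rewrite rmorphM rmorphXn /= diagC diagX.
have e : ((k - i) + i)%N = k by have := ltn_ord i; lia.
apply: (homE (S := polyGA (polyGA S)) e).
apply: (ga_homM (g := polyGA (polyGA S))).
  do 2 apply: poly_homC; apply: (hf i).1; have := ltn_ord i; lia.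
apply: (homX1 (S := polyGA (polyGA S))); apply: (@ga_homD _ (polyGA (polyGA S))).
  by apply: poly_homC; apply: poly_homX.
exact: poly_homX.
Qed.

(** Induction on [m]: [HR_proj1] adds a line, and the relations are restricted to the image of
    [diag]. A primitive class stays primitive there because [D2] reads only coefficients of
    [l ^ (n + 1) x] and of its derivative, all null by [nf1]. *)
Lemma HR_projn d (D : S -> R) l m tau s : degfun d D -> ga_hom 1 l -> HR d D l ->
  0 < tau * s ^+ m -> HR (d + m) (Dcoef tau m D) (ellP l s).
Proof.
move=> hD hl hHR; elim: m tau => [|m IH] tau ts.
  by rewrite addn0; apply: HR_proj0 => //; rewrite expr0 mulr1 in ts.
have s0 : s != 0.
  by apply/eqP => e; move: ts; rewrite e expr0n /= mulr0 ltxx.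
have sm : 0 < s ^+ m * s ^+ m by rewrite -expr2 lt_def sqr_ge0 sqrf_eq0 expf_eq0 (negbTE s0) andbF.
have ss : 0 < s * s by rewrite -expr2 lt_def sqr_ge0 sqrf_eq0 s0.
have hD1 := Dcoef_degfun (s ^+ m) m hD.
have h2 := HR_proj1 hD1 (ellP_hom s hl) (IH _ sm) ss.
set D2 := Dcoef s 1 _ in h2.
have D2d (f : {poly S}) (G : {poly {poly S}}) :
    D2 (diag f * G) = s ^+ m.+1 * (D (f * G`_1)`_m + D (f^`() * G`_0)`_m).
  rewrite /D2 /Dcoef coefM1 (diag_coef f).1 (diag_coef f).2 coefD (linD hD.1).
  by rewrite exprS; ring.
have D2E f : D2 (diag f) = s ^+ m.+1 * (m.+1%:R * D f`_m.+1).
  rewrite /D2 /Dcoef (diag_coef f).2 coef_deriv (linMn hD.1) exprS -mulr_natl.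
  by ring.
have dl : diag (ellP l s) = ellP (ellP l s : polyGA S) s.
  rewrite /ellP rmorphD rmorphM /= !diagC diagX !polyCD !polyCM; ring.
move=> k hk x hx prim; set n := ((d + m.+1) - 2 * k)%N.
pose f1 : {poly S} := ellP l s ^+ (n + 1) * x.
have hf1 : poly_hom (n + 1 + k) f1.
  apply: (ga_homM (g := polyGA S)) => //.
  by apply: (homX1 (S := polyGA S)); apply: ellP_hom.
have t0 : tau != 0 by apply/eqP => e; move: ts; rewrite e mul0r ltxx.
have nf1 i : (i <= m.+1)%N -> null D f1`_i.
  move=> hi; have [c|c] := ltnP (n + 1 + k) i.
    by rewrite (hf1 i).2 //; apply: null0 hD.
  have hi' : ga_hom (n + 1 + k - i) f1`_i by apply: (hf1 i).1; lia.
  apply: (null_hom hD hi') => j y ej hy.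
  have ej' : ((j + (m.+1 - i)).+1 = k)%N by move: ej; rewrite /n; lia.
  have := prim (j + (m.+1 - i))%N (y%:P * 'X^(m.+1 - i)) ej'.
  rewrite /Dcoef -/f1 mulrA coefMXn coefMC ifN; last by rewrite -leqNgt; lia.
  have -> : (m.+1 - (m.+1 - i) = i)%N by lia.
  move=> h; have /eqP := h (poly_homM (poly_homC hy) (poly_homXn _ _)).
  by rewrite mulf_eq0 (negbTE t0) => /eqP.
have hk' : (2 * k <= (d + m).+1)%N by lia.
have en : ((d + m).+1 - 2 * k = n)%N by rewrite /n; lia.
have [|p1 p2] := h2 k hk' _ (diag_hom hx).
  move=> j y _ _; rewrite en -dl -rmorphXn -rmorphM /= D2d.
  rewrite !coefM !(lin_sum hD.1) !big1 ?addr0 ?mulr0 // => i _; have := ltn_ord i => hi.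
    by rewrite coef_deriv mulrnAl (linMn hD.1) nf1 ?mul0rn // ltnW.
  by rewrite nf1 //; lia.
rewrite en -dl -rmorphXn -!rmorphM /= D2E in p1 p2.
rewrite /Dcoef; set V := D _ in p1 p2 *.
have sg : 0 < s ^+ m.+1 * s ^+ m.+1.
  by rewrite -expr2 lt_def sqr_ge0 sqrf_eq0 expf_eq0 (negbTE s0) andbF.
split.
  have : 0 <= tau * s ^+ m.+1 * ((-1) ^+ k * (s ^+ m.+1 * (m.+1%:R * V))).
    by apply: mulr_ge0 => //; exact: ltW.
  have -> : tau * s ^+ m.+1 * ((-1) ^+ k * (s ^+ m.+1 * (m.+1%:R * V))) =
    (s ^+ m.+1 * s ^+ m.+1 * m.+1%:R) * ((-1) ^+ k * (tau * V)) by ring.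
  by rewrite pmulr_rge0 // mulr_gt0 // ltr0n.
move=> /eqP; rewrite mulf_eq0 (negbTE t0) /= => /eqP v0.
have nx : null D2 (diag x) by apply: p2; rewrite v0 !mulr0.
move=> y; have := nx (diag y); rewrite -rmorphM /= D2E => /eqP.
rewrite !mulf_eq0 pnatr_eq0 expf_eq0 (negbTE s0) andbF /= => /eqP ->.
by rewrite mulr0.
Qed.

End ProjN.

(** * Blow-ups *)

Section Blowup.
Variables (R : comNzRingType) (S : ga R).

(* The variable of [{poly S}] is the class [v] of the blow-up that restricts to the
   hyperplane class of the exceptional fibre; the exceptional divisor is [beta - v]. *)
Definition Dbl c (beta : S) (D : S -> R) (f : polyGA S) : R :=
  D (\sum_(q < c) beta ^+ q * (f : {poly S})`_q).

Lemma Dbl_degfun c beta d D : ga_hom 1 beta -> degfun d D -> degfun d (Dbl c beta D).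
Proof.
move=> hb [hl hd]; split.
  split=> [x y|a x]; rewrite /Dbl.
    by rewrite -(linD hl) -big_split; congr D; apply: eq_bigr => i _; rewrite coefD mulrDr.
  rewrite -(linZ hl) mulr_sumr; congr D; apply: eq_bigr => i _ /=.
  by rewrite coefCM mulrCA.
move=> k x hx kd; apply: hd kd; apply: hom_sum => i _.
have [c1|c1] := ltnP k i; first by rewrite (hx i).2 // mulr0; apply: ga_hom0.
have -> : k = (i + (k - i))%N by lia.
by apply: ga_homM; [apply: homX1 | apply: (hx i).1; lia].
Qed.

(** The sum telescopes. What remains is the integral over the centre, whose class is [beta ^ c.+1],
    of one coefficient of [h]. *)
Lemma Dbl_exc c beta (D : S -> R) (h : {poly S}) :
  Dbl c.+1 beta D ((beta%:P - 'X) * h : {poly S}) = D (beta ^+ c.+1 * h`_c).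
Proof.
rewrite /Dbl; congr D; elim: c => [|c IH].
  by rewrite big_ord1 expr0 mul1r mulrBl coefB coefCM coefXM subr0 expr1.
rewrite big_ord_recr /= IH mulrBl coefB coefCM coefXM /= mulrBr.
by rewrite [in RHS]exprSr; ring.
Qed.

Lemma Dbl_Xn c beta (D : S -> R) (h : {poly S}) : D 0 = 0 ->
  Dbl c beta D ('X^c * h : {poly S}) = 0.
Proof.
move=> D0; rewrite /Dbl big1 // => i _.
by rewrite coefXnM ltn_ord mulr0.
Qed.

Lemma coef_exc c (beta : S) p :
  ((beta%:P - 'X) ^+ p)`_c = (-1) ^+ c * beta ^+ (p - c) *+ 'C(p, c).
Proof.
elim: p c => [|p IH] [|c]; rewrite ?expr0 ?coefC ?bin0 ?bin0n ?mul1r //=.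
- by rewrite exprS coefM0 IH coefB coefC coefX subr0 bin0 !expr0 !mul1r !subn0 exprS.
rewrite exprS mulrBl coefB coefCM coefXM /= !IH binS mulrnDr.
have [h|h] := ltnP p c.+1.
  by rewrite bin_small // !mulr0n mulr0 !add0r subSS exprS mulN1r mulNr mulNrn.
have -> : (p.+1 - c.+1 = (p - c.+1).+1)%N by lia.
have -> : (p - c = (p - c.+1).+1)%N by lia.
by rewrite !exprS; ring.
Qed.

Lemma Dbl_exc_pow c beta (D : S -> R) p (a : S) : linR D ->
  Dbl c.+1 beta D ((beta%:P - 'X) ^+ p.+1 * a%:P : {poly S}) =
  (-1) ^+ c * 'C(p, c)%:R * D (beta ^+ p.+1 * a).
Proof.
move=> hl; rewrite exprS -mulrA Dbl_exc coefMC coef_exc.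
have [h|h] := ltnP p c.
  by rewrite bin_small // mulr0n mul0r !mulr0 mul0r (lin0 hl).
rewrite -(linZ hl) rmorphM rmorphXn rmorphN1 rmorph_nat; congr D.
have -> : beta ^+ p.+1 = beta ^+ c.+1 * beta ^+ (p - c) by rewrite -exprD; congr (_ ^+ _); lia.
by rewrite -mulr_natl; ring.
Qed.

Lemma Dbl_const c beta (D : S -> R) (a : S) : Dbl c.+1 beta D (a%:P : {poly S}) = D a.
Proof.
rewrite /Dbl big_ord_recl expr0 mul1r coefC /= big1 ?addr0 // => i _.
by rewrite coefC /= mulr0.
Qed.

(** In powers of the exceptional divisor the functional is the base term plus Segre-type terms on
    the centre; the latter start at the codimension [c.+1], since the binomial coefficients vanish
    before. *)
Lemma Dbl_comp c beta (D : S -> R) (g : {poly S}) K : linR D -> (size g <= K.+1)%N ->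
  Dbl c.+1 beta D (g \Po (beta%:P - 'X) : {poly S}) =
  D g`_0 + \sum_(p < K) (-1) ^+ c * 'C(p, c)%:R * D (beta ^+ p.+1 * g`_p.+1).
Proof.
move=> hl sg; have hb : linR (Dbl c.+1 beta D).
  split=> [x y|a x]; rewrite /Dbl.
    by rewrite -(linD hl) -big_split; congr D; apply: eq_bigr => i _; rewrite coefD mulrDr.
  rewrite -(linZ hl) mulr_sumr; congr D; apply: eq_bigr => i _ /=.
  by rewrite coefCM mulrCA.
rewrite {1}(poly_expand sg) linear_sum /= (lin_sum hb) big_ord_recl; congr (_ + _).
  by rewrite expr0 mulr1 comp_polyC Dbl_const.
apply: eq_bigr => i _; rewrite -Dbl_exc_pow //; congr Dbl.
rewrite comp_polyM comp_polyC rmorphXn /= comp_polyX mulrC; congr (_ * _).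
Qed.

End Blowup.

Lemma coef_comp_scale (S : comNzRingType) (c : S) (f : {poly S}) i :
  (f \Po (c%:P * 'X))`_i = c ^+ i * f`_i.
Proof.
elim/poly_ind: f i => [|f a IH] i; first by rewrite comp_poly0 !coef0 mulr0.
rewrite comp_polyD comp_polyM comp_polyC comp_polyX !coefD !coefC coefMX.
rewrite mulrA coefMX mulrDr; case: i => [|i] /=; first by rewrite expr0 !mul1r.
by rewrite coefMC IH exprSr mulr0 !addr0; ring.
Qed.

(** * Degeneration of the Hodge-Riemann form of a blow-up *)

Section BlowupHR.
Variables (R : rcfType) (S : ga R) (d c : nat) (D : S -> R) (beta l : S).
Hypotheses (hD : degfun d D) (hb : ga_hom 1 beta) (hl : ga_hom 1 l).
Hypothesis cd : (c.+1 <= d)%N.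
Let DZ (y : S) := D (beta ^+ c.+1 * y).
Hypotheses (HRD : HR d D l) (HRZ : HR (d - c.+1) DZ l).
Local Notation sc := (@ga_sc R S).
Let P := polyGA S.
Let e : {poly S} := beta%:P - 'X.
Let DB : P -> R := Dbl c.+1 beta D.
Let DBd : degfun d DB := Dbl_degfun c.+1 hb hD.

Let DZd : degfun (d - c.+1) DZ.
Proof.
split; first by split=> *; rewrite /DZ ?mulrDr ?(linD hD.1) // mulrCA (linZ hD.1).
move=> k x hx kd; apply: (hD.2 (c.+1 + k)%N); last by lia.
by apply: ga_homM => //; apply: homX1.
Qed.

Let M : {poly S} := l%:P - 'X.
Let MP : (M : P) = ellP l (-1).
Proof. by rewrite /M /ellP rmorphN1 polyCN mulN1r. Qed.
Let homMp n : poly_hom n (M ^+ n).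
Proof. by rewrite MP; apply: (homX1 (S := P)); apply: ellP_hom. Qed.

(** The coefficients 1 to [c] in the exceptional divisor, shifted down by one and seen as a class on
    the product of the centre with a projective space of dimension [c - 1]. *)
Let V (X : {poly S}) : {poly S} := \poly_(i < c) X`_i.+1.
Let VD X Y : V (X + Y) = V X + V Y.
Proof. by apply/polyP => i; rewrite coefD !coef_poly coefD; case: ifP => // _; rewrite addr0. Qed.
Let VZ a X : V (a%:P * X) = a%:P * V X.
Proof. by apply/polyP => i; rewrite coefCM !coef_poly coefCM; case: ifP => // _; rewrite mulr0. Qed.

(** The centre terms of [Dbl_comp] after substituting [eta ^ 2] times the variable, with the common
    factor [eta ^ (2 (c + 1))] taken out. *)
Let phi (f : {poly S}) : {poly R} := \sum_(i < d.+1)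
  ((-1) ^+ c * 'C(c + i, c)%:R * D (beta ^+ (c + i).+1 * f`_(c + i).+1))%:P * 'X^(2 * i).
Let phiD f g : phi (f + g) = phi f + phi g.
Proof.
rewrite /phi -big_split; apply: eq_bigr => i _.
by rewrite coefD mulrDr (linD hD.1) mulrDr polyCD mulrDl.
Qed.
Let phiZ a f : phi ((sc a)%:P * f) = a%:P * phi f.
Proof.
rewrite /phi mulr_sumr; apply: eq_bigr => i _.
by rewrite coefCM mulrCA (linZ hD.1) mulrCA polyCM -mulrA.
Qed.

(** The form of the blow-up in the coordinates [Xs], as a polynomial in [eta]. The cross terms carry
    a positive power of [eta], so at 0 the form is an orthogonal sum. *)
Let q n (X Y : {poly S}) : {poly R} :=
  (D (l ^+ n * X`_0 * Y`_0))%:P + 'X^(2 * c.+1) * phi (M ^+ n * (X`_0)%:P * (Y`_0)%:P)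
  + 'X^(c.+1) * (phi (M ^+ n * (X`_0)%:P * ('X * V Y)) + phi (M ^+ n * ('X * V X) * (Y`_0)%:P))
  + phi (M ^+ n * ('X * V X) * ('X * V Y)).

Let qs n X Y : q n X Y = q n Y X.
Proof.
rewrite /q (mulrAC (l ^+ n) X`_0) (mulrAC (M ^+ n) (X`_0)%:P (Y`_0)%:P).
rewrite (mulrAC (M ^+ n) ('X * V X) ('X * V Y)).
rewrite (mulrAC (M ^+ n) (X`_0)%:P ('X * V Y)) (mulrAC (M ^+ n) ('X * V X) (Y`_0)%:P).
ring.
Qed.

Let qlin n X : lin (S := P) (fun a p => a%:P * p) (q n X).
Proof.
split=> [Y Z|a Y]; rewrite /q /=.
  by rewrite !coefD !polyCD VD !mulrDr !phiD (linD hD.1) polyCD; ring.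
rewrite !coefCM !polyCM !VZ (mulrCA (l ^+ n * _)) (linZ hD.1) polyCM.
rewrite !(mulrCA _ (sc a)%:P) !phiZ; ring.
Qed.

Let Z (X : {poly S}) : Prop := null D X`_0 /\ forall p, (p < c)%N -> null DZ X`_p.+1.

Let ZV X i : Z X -> null DZ (V X)`_i.
Proof.
move=> [_ h]; rewrite coef_poly; case: ifP => [/h //|_]; exact: null0 DZd.
Qed.

Let phi0 (f : {poly S}) : (forall p, D (beta ^+ (c + p).+1 * f`_(c + p).+1) = 0) -> phi f = 0.
Proof. by move=> h; rewrite /phi big1 // => i _; rewrite h mulr0 polyC0 mul0r. Qed.

Let qker n X Y : Z X -> q n X Y = 0.
Proof.
move=> ZX; have [n0 nV] := ZX.
have e1 : phi (M ^+ n * (X`_0)%:P * (Y`_0)%:P) = 0.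
  apply: phi0 => p; rewrite !coefMC.
  rewrite -[RHS](n0 (beta ^+ (c + p).+1 * (M ^+ n)`_(c + p).+1 * Y`_0)).
  by congr D; ring.
have e2 : phi (M ^+ n * (X`_0)%:P * ('X * V Y)) = 0.
  apply: phi0 => p.
  rewrite (_ : M ^+ n * (X`_0)%:P * ('X * V Y) = (X`_0)%:P * (M ^+ n * ('X * V Y))); last by ring.
  by rewrite coefCM mulrCA n0.
have e3 (g : {poly S}) : phi ('X * V X * g) = 0.
  apply: phi0 => p; rewrite -mulrA coefXM /= coefM mulr_sumr (lin_sum hD.1) big1 // => i _.
  rewrite (_ : beta ^+ (c + p).+1 = beta ^+ c.+1 * beta ^+ p); last by rewrite -exprD addSn.
  have := ZV i ZX (beta ^+ p * g`_(c + p - i)); rewrite /DZ => <-.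
  by congr D; ring.
rewrite /q e1 e2.
rewrite (_ : l ^+ n * X`_0 * Y`_0 = X`_0 * (l ^+ n * Y`_0)); last by ring.
rewrite (_ : M ^+ n * ('X * V X) * (Y`_0)%:P = 'X * V X * (M ^+ n * (Y`_0)%:P)); last by ring.
rewrite (_ : M ^+ n * ('X * V X) * ('X * V Y) = 'X * V X * (M ^+ n * ('X * V Y))); last by ring.
by rewrite n0 !e3 polyC0 !(mulr0, addr0).
Qed.

(** The [i]-th power of the exceptional divisor is scaled by [eta ^ (2 i - (c + 1))]. With
    [t = eta ^ 2] this half-integral weight gives the centre part of the form order 0 and the cross
    terms order [c + 1]. *)
Let Xs (eta : R) (X : {poly S}) : {poly S} :=
  ((X`_0)%:P + (sc (eta ^- c.+1))%:P * ('X * V X)) \Po ((sc (eta ^+ 2))%:P * 'X).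
Let xx eta X : P := Xs eta X \Po e.

Let V_hom k X : poly_hom k.+1 X -> poly_hom k (V X).
Proof.
move=> hX i; rewrite coef_poly; split=> [j ej|ki].
  by case: ifP => _; [apply: (hX i.+1).1; lia | apply: ga_hom0].
by case: ifP => // _; apply: (hX i.+1).2.
Qed.

Let XV_hom k X : poly_hom k X -> poly_hom k ('X * V X).
Proof.
case: k => [|k] hX; last by apply: (poly_homM (poly_homX S)); apply: V_hom.
suff -> : V X = 0 by rewrite mulr0; apply: poly_hom0.
by apply/polyP => i; rewrite coef_poly coef0; case: ifP => // _; apply: (hX i.+1).2.
Qed.

Let scale_hom k (a : R) f : poly_hom k f -> poly_hom k (f \Po ((sc a)%:P * 'X)).
Proof.
move=> hf i; rewrite coef_comp_scale -rmorphXn; split=> [j ej|ki].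
  by apply: homZ; apply: (hf i).1.
by rewrite (hf i).2 // mulr0.
Qed.

Let e_hom : poly_hom 1 e.
Proof. by apply: (homB (S := P)); [apply: poly_homC | apply: poly_homX]. Qed.

Let comp_hom k f : poly_hom k f -> poly_hom k (f \Po e).
Proof.
move=> hf; rewrite {1}(poly_expand (poly_hom_size hf)) linear_sum /=.
apply: (hom_sum (S := P)) => i _.
rewrite comp_polyM comp_polyC rmorphXn /= comp_polyX.
have ei : ((k - i) + i)%N = k by have := ltn_ord i; lia.
apply: (homE (S := P) ei); apply: (ga_homM (g := P)).
  by apply: poly_homC; apply: (hf i).1.
by apply: (homX1 (S := P)); apply: e_hom.
Qed.

Let X0_hom k (X : {poly S}) : poly_hom k X -> poly_hom k ((X`_0)%:P).
Proof. by move=> h; apply: poly_homC; apply: (h 0%N).1; rewrite addn0. Qed.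

Let xx_hom k eta (X : {poly S}) : poly_hom k X -> poly_hom k (xx eta X).
Proof.
move=> hX; apply: comp_hom; apply: scale_hom; apply: (@ga_homD _ P).
  exact: X0_hom.
by apply: (homZ (S := P)); apply: XV_hom.
Qed.

Let L (t : R) : P := (l%:P - (sc t)%:P * e : {poly S}).

Let L_comp eta : L (eta ^+ 2) = (M \Po ((sc (eta ^+ 2))%:P * 'X)) \Po e.
Proof.
by rewrite /M !comp_polyB !comp_polyC comp_polyX comp_polyM comp_polyC comp_polyX.
Qed.

Let DB_comp f : poly_hom d f ->
  DB (f \Po e) = D f`_0 + \sum_(i < d.+1)
    (-1) ^+ c * 'C(c + i, c)%:R * D (beta ^+ (c + i).+1 * f`_(c + i).+1).
Proof.
move=> hf; have sf : (size f <= (c + d.+1).+1)%N.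
  by apply: leq_trans (poly_hom_size hf) _; lia.
rewrite /DB (Dbl_comp _ _ hD.1 sf) big_split_ord /= big1 ?add0r // => i _.
by rewrite bin_small ?mulr0 ?mul0r.
Qed.

Let qeval n kx ky eta X Y : eta != 0 -> poly_hom kx X -> poly_hom ky Y ->
  (n + kx + ky = d)%N -> DB (L (eta ^+ 2) ^+ n * xx eta X * xx eta Y) = (q n X Y).[eta].
Proof.
move=> eta0 hX hY ed; pose a := sc (eta ^- c.+1).
pose G : {poly S} := M ^+ n * ((X`_0)%:P + a%:P * ('X * V X)) * ((Y`_0)%:P + a%:P * ('X * V Y)).
have hG : poly_hom d G.
  rewrite -ed; apply: (ga_homM (g := P)); last first.
    by apply: (@ga_homD _ P); [apply: X0_hom | apply: (homZ (S := P)); apply: XV_hom].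
  apply: (ga_homM (g := P)); first exact: homMp.
  by apply: (@ga_homD _ P); [apply: X0_hom | apply: (homZ (S := P)); apply: XV_hom].
have -> : L (eta ^+ 2) ^+ n * xx eta X * xx eta Y =
    (G \Po ((sc (eta ^+ 2))%:P * 'X)) \Po e.
  by rewrite L_comp /xx /Xs /G !comp_polyM !rmorphXn.
rewrite DB_comp; last exact: scale_hom.
rewrite coef_comp_scale expr0 mul1r.
have G0 : G`_0 = l ^+ n * X`_0 * Y`_0.
  rewrite /G !coefM0 !coefD !coefC /= !coefM0 !coefX /= !(mul0r, mulr0, addr0).
  by rewrite MP ellP_coef0.
have GE i : G`_i = (M ^+ n * (X`_0)%:P * (Y`_0)%:P)`_i + a * ((M ^+ n * (X`_0)%:P * ('X * V Y))`_i
    + (M ^+ n * ('X * V X) * (Y`_0)%:P)`_i) + a * a * (M ^+ n * ('X * V X) * ('X * V Y))`_i.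
  have -> : G = M ^+ n * (X`_0)%:P * (Y`_0)%:P + a%:P * (M ^+ n * (X`_0)%:P * ('X * V Y)
      + M ^+ n * ('X * V X) * (Y`_0)%:P) + (a * a)%:P * (M ^+ n * ('X * V X) * ('X * V Y)).
    by rewrite polyCM /G; ring.
  by rewrite 2!coefD !coefCM coefD.
have phiE f : (phi f).[eta] = \sum_(i < d.+1) (-1) ^+ c * 'C(c + i, c)%:R *
    D (beta ^+ (c + i).+1 * f`_(c + i).+1) * eta ^+ (2 * i).
  by rewrite /phi horner_sum; apply: eq_bigr => i _; rewrite !hornerE.
rewrite G0 /q !(hornerD, hornerM, hornerC, hornerXn) -!addrA; congr (_ + _).
rewrite !phiE -big_split /= !mulr_sumr -!big_split /=; apply: eq_bigr => i _.
rewrite coef_comp_scale GE.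
set A1 := (M ^+ n * (X`_0)%:P * (Y`_0)%:P)`_ _.
set A2 := (M ^+ n * (X`_0)%:P * ('X * V Y))`_ _.
set A3 := (M ^+ n * ('X * V X) * (Y`_0)%:P)`_ _.
set A4 := (M ^+ n * ('X * V X) * ('X * V Y))`_ _.
set b := beta ^+ _; set k := _ * _%:R.
have -> : b * (sc (eta ^+ 2) ^+ (c + i).+1 * (A1 + a * (A2 + A3) + a * a * A4)) =
  sc ((eta ^+ 2) ^+ (c + i).+1) * (b * A1) +
  sc ((eta ^+ 2) ^+ (c + i).+1 * eta ^- c.+1) * (b * A2 + b * A3) +
  sc ((eta ^+ 2) ^+ (c + i).+1 * (eta ^- c.+1 * eta ^- c.+1)) * (b * A4).
  by rewrite !rmorphM !rmorphXn -/a; ring.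
rewrite !(linD hD.1) !(linZ hD.1) !(linD hD.1).
have -> : (eta ^+ 2) ^+ (c + i).+1 * (eta ^- c.+1 * eta ^- c.+1) = eta ^+ (2 * i).
  rewrite -exprM (_ : (2 * (c + i).+1 = 2 * i + c.+1 + c.+1)%N); last by lia.
  by rewrite !exprD; field; rewrite expf_neq0.
have -> : (eta ^+ 2) ^+ (c + i).+1 * eta ^- c.+1 = eta ^+ c.+1 * eta ^+ (2 * i).
  rewrite -exprM (_ : (2 * (c + i).+1 = 2 * i + c.+1 + c.+1)%N); last by lia.
  by rewrite !exprD; field; rewrite expf_neq0.
have -> : (eta ^+ 2) ^+ (c + i).+1 = eta ^+ (2 * c.+1) * eta ^+ (2 * i).
  by rewrite -exprM -exprD; congr (_ ^+ _); lia.
ring.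
Qed.

(** Exchanging the variable with the exceptional divisor is an involution, as each is [beta] minus
    the other. *)
Let ee (f : {poly S}) : (f \Po e) \Po e = f.
Proof.
rewrite -comp_polyA (_ : e \Po e = 'X) ?comp_polyXr //.
by rewrite {1}/e comp_polyB comp_polyC comp_polyX /e; ring.
Qed.

Let xx_null eta X : Z X -> null DB (xx eta X).
Proof.
move=> ZX y; have [n0 nV] := ZX.
pose g := Xs eta X * ((y : {poly S}) \Po e).
have -> : xx eta X * y = g \Po e by rewrite /g comp_polyM ee.
rewrite /DB (Dbl_comp c beta hD.1 (leqnSn (size g))).
have Xi i : (Xs eta X)`_i = sc (eta ^+ 2) ^+ i *
    ((if i == 0%N then X`_0 else 0) + sc (eta ^- c.+1) * (if i == 0%N then 0 else (V X)`_i.-1)).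
  by rewrite coef_comp_scale coefD coefC coefCM coefXM.
rewrite /g coefM0 Xi expr0 mul1r /= mulr0 addr0 n0 add0r big1 // => p _.
have [pc|pc] := ltnP p c; first by rewrite bin_small // mulr0 mul0r.
rewrite coefM mulr_sumr (lin_sum hD.1) big1 ?mulr0 // => i _.
rewrite Xi; case: eqP => i0.
  rewrite mulr0 addr0; set u := _ \Po e; set z := u`_ _.
  by rewrite -[RHS](n0 (beta ^+ p.+1 * sc (eta ^+ 2) ^+ i * z)); congr D; ring.
rewrite add0r; set u := _ \Po e; set z := u`_ _.
rewrite -[RHS](ZV i.-1 ZX (beta ^+ (p - c) * sc (eta ^+ 2) ^+ i * sc (eta ^- c.+1) * z)).
rewrite /DZ (_ : beta ^+ p.+1 = beta ^+ c.+1 * beta ^+ (p - c)); last first.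
  by rewrite -exprD; congr (_ ^+ _); lia.
by congr D; ring.
Qed.

Let q0E n X Y : (q n X Y).[0] = D (l ^+ n * X`_0 * Y`_0) +
  (if c == 0%N then 0 else (-1) ^+ c * DZ (M ^+ n * V X * V Y)`_c.-1).
Proof.
have phi_at0 f : (phi f).[0] = (-1) ^+ c * D (beta ^+ c.+1 * f`_c.+1).
  rewrite /phi horner_sum big_ord_recl hornerM hornerC hornerXn muln0 expr0 mulr1 /=.
  rewrite addn0 binn mulr1 big1 ?addr0 // => i _; rewrite hornerM hornerC hornerXn.
  by rewrite (_ : (2 * bump 0 i)%N = (2 * i).+2) ?expr0n ?mulr0 // /bump; lia.
rewrite /q !(hornerD, hornerM, hornerC, hornerXn) !expr0n muln_eq0 /= !mul0r !addr0 !phi_at0.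
congr (_ + _).
rewrite (_ : M ^+ n * ('X * V X) * ('X * V Y) = 'X * ('X * (M ^+ n * V X * V Y))); last by ring.
by rewrite !coefXM /=; case: eqP => // _; rewrite mulr0 (lin0 hD.1) mulr0.
Qed.

(** At [eta = 0] the second summand is the form of the centre times a projective space, in degree
    [k - 1]. That the sign is [(-1) ^ c] and not [(-1) ^ (c - 1)] compensates this shift of the
    degree. *)
Let blowup_pos k X : (2 * k <= d)%N -> poly_hom k X ->
  (forall j Y, j.+1 = k -> poly_hom j Y -> (q (d - 2 * k + 1) X Y).[0] = 0) ->
  ~ Z X -> 0 < (-1) ^+ k * (q (d - 2 * k) X X).[0].
Proof.
move=> hk hX prim nZ; set n := (d - 2 * k)%N in prim *.
have hX0 : ga_hom k X`_0 by apply: (hX 0%N).1; rewrite addn0.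
have [|A1 A2] := HRD hk hX0.
  move=> j y ej hy; have := prim j y%:P ej (poly_homC hy); rewrite q0E coefC /=.
  have -> : V y%:P = 0 by apply/polyP => i; rewrite coef_poly coef0 coefC; case: ifP.
  by rewrite mulr0 coef0 /DZ mulr0 (lin0 hD.1) mulr0 if_same addr0.
rewrite -/n in A1 A2.
have [B1 B2] : 0 <= (-1) ^+ k * (if c == 0%N then 0 else (-1) ^+ c * DZ (M ^+ n * V X * V X)`_c.-1)
    /\ ((if c == 0%N then 0 else (-1) ^+ c * DZ (M ^+ n * V X * V X)`_c.-1) = 0 ->
        forall p, (p < c)%N -> null DZ X`_p.+1).
  case: eqP => [c0|/eqP c0]; first by split; [rewrite mulr0 | move=> _ p; rewrite c0].
  case ek : k => [|k'].
    have V0 : V X = 0.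
      by apply/polyP => i; rewrite coef_poly coef0; case: ifP => // _; apply: (hX i.+1).2; rewrite ek.
    rewrite V0 mulr0 coef0 (lin0 DZd.1) !mulr0; split=> // _ p _.
    by rewrite (hX p.+1).2 ?ek //; apply: null0 DZd.
  have hV : poly_hom k' (V X) by apply: V_hom; rewrite -ek.
  have sgn : (0 : R) < (-1) ^+ c.-1 * (-1) ^+ c.-1 by rewrite -exprMn mulrNN mulr1 expr1n.
  have W := HR_projn DZd hl HRZ sgn.
  (* The product has dimension [d - 2], so degree [k - 1] on it and degree [k] on the blow-up use
     the same power [n] of the class. *)
  have dW : (d - c.+1 + c.-1 = d - 2)%N by move: c0 cd; case: (c) => //= *; lia.
  rewrite dW in W.
  have hk' : (2 * k' <= d - 2)%N by move: hk; rewrite ek; lia.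
  have nW : (d - 2 - 2 * k' = n)%N by rewrite /n ek; lia.
  have sc1 : (-1 : R) ^+ c = - (-1) ^+ c.-1.
    by rewrite -{1}(prednK (_ : (0 < c)%N)) ?exprS ?mulN1r // lt0n.
  have s0 : (-1 : R) ^+ c.-1 != 0 by rewrite signr_eq0.
  have [|b1 b2] := W k' hk' _ hV.
    move=> j Y ej hY; rewrite nW -MP.
    have := prim j.+1 ('X * Y) _ (poly_homM (poly_homX S) hY); rewrite ek ej => /(_ erefl).
    rewrite q0E coefXM /= mulr0 (lin0 hD.1) add0r (negbTE c0) sc1 mulNr => /eqP.
    rewrite oppr_eq0 => /eqP <-; rewrite /Dcoef; congr (_ * DZ _).
    rewrite !coefM; apply: eq_bigr => i _; congr (_ * _); rewrite coef_poly coefXM /=.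
    by rewrite ifT //; have := ltn_ord i; move: c0; rewrite -lt0n; lia.
  rewrite nW -MP /Dcoef in b1 b2; split.
    have E (a b v : R) : -1 * a * (- b * v) = a * (b * v) by ring.
    by rewrite sc1 exprS E.
  move=> /eqP; rewrite sc1 mulNr oppr_eq0 => /eqP /b2 nV p pc y.
  have := nV (y%:P * 'X^(c.-1 - p)); rewrite /Dcoef mulrA coefMXn coefMC.
  rewrite ifN; last by rewrite -leqNgt leq_subr.
  have -> : (c.-1 - (c.-1 - p) = p)%N by lia.
  by rewrite coef_poly pc => /eqP; rewrite mulf_eq0 (negbTE s0) => /eqP.
rewrite lt_def q0E mulrDr addr_ge0 // andbT; apply/negP; rewrite paddr_eq0 //.
rewrite !mulf_eq0 signr_eq0 /= => /andP [/eqP /A2 h1 /eqP /B2 h2].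
exact: nZ.
Qed.

Let blowup_k k : (2 * k <= d)%N -> exists2 del : R, 0 < del &
  forall t, 0 < t < del -> forall x : P, ga_hom k x ->
  (forall j y, j.+1 = k -> ga_hom j y -> DB (L t ^+ (d - 2 * k + 1) * x * y) = 0) ->
  0 <= (-1) ^+ k * DB (L t ^+ (d - 2 * k) * x * x) /\
  (DB (L t ^+ (d - 2 * k) * x * x) = 0 -> null DB x).
Proof.
move=> hk; set n := (d - 2 * k)%N.
have [b [hbm sb]] := ga_span P k.
have [bt [hbt sbt]] : exists bt : seq P, (forall y, y \in bt -> exists2 j, j.+1 = k & ga_hom j y) /\
    (forall j y, j.+1 = k -> ga_hom j y -> lspan (@ga_sc R P) bt y).
  case: (k) => [|k']; first by exists [::]; split.
  have [bt [h1 h2]] := ga_span P k'.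
  by exists bt; split=> [y /h1|j y [->]]; [exists k' | exact: h2].
(* Only the zeros of [N] matter in [perturbation], so an indicator of the degenerate vectors
   serves. *)
pose N (X _ : P) : R := if `[<Z X>] then 0 else 1.
have N0 X Y : N X Y = 0 -> Z X.
  by rewrite /N; case: asboolP => // _ /eqP; rewrite oner_eq0.
pose qq (X Y : P) := ((-1) ^+ k)%:P * q n X Y.
have qqL X : lin (S := P) (fun a p => a%:P * p) (qq X).
  by split=> [Y W|a Y]; rewrite /qq ?(linD (qlin n X)) ?(linZ (qlin n X)); ring.
have hom_b X : lspan (@ga_sc R P) b X -> poly_hom k X.
  elim/lspan_ind => [|u v hu hv|a v /hbm hv].
  - exact: poly_hom0.
  - exact: (@ga_homD _ P).
  - exact: (homZ (S := P)).
have [|||||X|del del0 hdel] := @perturbation R P b qq N (size bt) (fun i => q (n + 1) bt`_i).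
- exact: qqL.
- by move=> X Y; rewrite /qq qs.
- by move=> i; apply: qlin.
- by move=> X Y _ _ /N0 ZX; rewrite /qq qker ?mulr0.
- by move=> i X _ /N0 ZX; rewrite qs qker.
- move=> /hom_b hX prim nN; rewrite /qq hornerM hornerC; apply: blowup_pos => //; last first.
    by move=> ZX; move: nN; rewrite /N; case: asboolP => //; rewrite eqxx.
  move=> j Y ej hY; have := sbt j Y ej hY.
  elim/lspan_ind => [|u v hu hv|a v /(nthP 0) [i hi <-]].
  - by rewrite (lin0 (qlin _ X)) horner0.
  - by rewrite (linD (qlin _ X)) hornerD hu hv addr0.
  - by rewrite (linZ (qlin _ X)) hornerM qs prim // mulr0.
exists (del ^+ 2); first exact: exprn_gt0.
move=> t /andP [t0 td] x hx prim.
pose eta := Num.sqrt t.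
have e0 : 0 < eta by rewrite sqrtr_gt0.
have en0 : eta != 0 by rewrite gt_eqF.
have e2 : eta ^+ 2 = t by rewrite sqr_sqrtr // ltW.
have ed : `|eta| < del.
  by rewrite gtr0_norm // -(ltr_pXn2r (n := 2)) ?nnegrE ?e2 // ltW.
(* Multiples of ['X^(c.+1)] are null, so [x] may be truncated to degree [c], the range reached by
   the coordinates [Xs]. *)
pose x' : {poly S} := take_poly c.+1 x.
have nx : null DB ((x : {poly S}) - x' : P).
  have -> : (x : {poly S}) - x' = 'X^(c.+1) * drop_poly c.+1 x.
    by rewrite /x' -[X in X - _](poly_take_drop c.+1 (x : {poly S})) addrC addKr mulrC.
  move=> y; by rewrite -mulrA; apply: Dbl_Xn; rewrite (lin0 hD.1).
have hx' : poly_hom k x'.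
  move=> i; rewrite coef_take_poly; split=> [j ej|ki].
    by case: ifP => _; [apply: (hx i).1 | apply: ga_hom0].
  by case: ifP => // _; apply: (hx i).2.
pose X' := x' \Po e; have hX' : poly_hom k X' by apply: comp_hom.
have sX' : (size X' <= c.+1)%N.
  apply: leq_trans (size_comp_poly_leq _ _) _; rewrite ltnS.
  have s1 : (size x' <= c.+1)%N by apply: size_take_poly.
  have s2 : (size e <= 2)%N.
    rewrite /e addrC; apply: leq_trans (size_polyD _ _) _; rewrite size_polyN size_polyX.
    by rewrite geq_max leqnn /=; apply: leq_trans (size_polyC_leq1 _) _.
  have : ((size x').-1 * (size e).-1 <= c * 1)%N by apply: leq_mul; lia.
  by rewrite muln1.
(* Inverse of the scaling in [Xs]. *)
pose w i : R := if i == 0%N then 1 else eta ^+ c.+1 * eta ^- (2 * i).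
pose X : {poly S} := \poly_(i < c.+1) (sc (w i) * X'`_i).
have hX : poly_hom k X.
  move=> i; rewrite coef_poly; split=> [j ej|ki].
    by case: ifP => _; [apply: homZ; apply: (hX' i).1 | apply: ga_hom0].
  by case: ifP => // _; rewrite (hX' i).2 // mulr0.
have xE : xx eta X = x'.
  rewrite -[RHS]ee; congr (_ \Po e); apply/polyP => i.
  rewrite coef_comp_scale coefD coefC coefCM coefXM !coef_poly /= -/X'.
  case: i => [|i] /=; first by rewrite expr0 mulr0 addr0 /w eqxx rmorph1 !mul1r.
  rewrite add0r ltnS; case: ltnP => ic; last first.
    by rewrite !mulr0 nth_default //; apply: leq_trans sX' _.
  rewrite -rmorphXn /w /=.
  rewrite (mulrA (sc (eta ^- c.+1))) -rmorphM (mulrA (sc _)) -rmorphM.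
  rewrite (_ : (eta ^+ 2) ^+ i.+1 * (eta ^- c.+1 * (eta ^+ c.+1 * eta ^- (2 * i.+1))) = 1).
    by rewrite rmorph1 mul1r.
  by rewrite -exprM; field; rewrite !expf_neq0.
have xx1 (y : P) : DB ((x : P) * y) = DB ((x' : P) * y).
  by apply/eqP; rewrite -subr_eq0 -(linB DBd.1) -mulrBl nx.
have nkk : (n + k + k = d)%N by rewrite /n; lia.
have qE : DB (L t ^+ n * x * x) = (q n X X).[eta].
  rewrite -(qeval en0 hX hX nkk) xE e2.
  have r1 (a u v : P) : a * u * v = u * (a * v) by ring.
  have r2 (u a v : P) : u * (a * v) = v * (a * u) by ring.
  by rewrite r1 xx1 r2 xx1 -r1.
rewrite qE; have [ZX|nZ] := asboolP (Z X).
  rewrite qker // horner0 mulr0; split=> // _.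
  rewrite -[x](subrK (x' : P)); apply: (nullD DBd) => //.
  by rewrite -xE; apply: xx_null.
have := hdel eta ed X (sb X hX); rewrite /N; case: asboolP => // _.
rewrite /qq hornerM hornerC => h.
have pos : 0 < (-1) ^+ k * (q n X X).[eta].
  apply: h; last exact: oner_neq0.
  move=> i hi; have [j ej hj] := hbt _ (mem_nth 0 hi).
  have njk : (n + 1 + k + j = d)%N by rewrite /n; lia.
  rewrite qs -(qeval en0 hX hj njk) xE e2.
  have r1 (a u v : P) : a * u * v = u * (a * v) by ring.
  by rewrite r1 -xx1 -r1; apply: prim ej (xx_hom eta hj).
split; first exact: ltW.
by move=> z; move: pos; rewrite z mulr0 ltxx.
Qed.

(** [blowup_k] gives one bound per degree; finitely many degrees matter, so a minimum works. *)
Lemma HR_blowup : exists2 del : R, 0 < del &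
  forall t, 0 < t < del -> HR d (Dbl c.+1 beta D) (l%:P - (sc t)%:P * (beta%:P - 'X) : {poly S}).
Proof.
suff h m : exists2 del : R, 0 < del & forall t, 0 < t < del -> forall k, (k < m)%N ->
    (2 * k <= d)%N -> forall x : P, ga_hom k x ->
    (forall j y, j.+1 = k -> ga_hom j y -> DB (L t ^+ (d - 2 * k + 1) * x * y) = 0) ->
    0 <= (-1) ^+ k * DB (L t ^+ (d - 2 * k) * x * x) /\
    (DB (L t ^+ (d - 2 * k) * x * x) = 0 -> null DB x).
  have [del d0 hd] := h d.+1; exists del => // t ht k hk x.
  by apply: (hd t ht) => //; lia.
elim: m => [|m [del d0 hd]]; first by exists 1.
have [hm|hm] := leqP (2 * m) d; last first.
  exists del => // t ht k; rewrite ltnS leq_eqVlt => /orP [/eqP -> | km] hk.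
    by move: hm; rewrite ltnNge hk.
  exact: hd.
have [del' d0' hd'] := blowup_k hm.
exists (Num.min del del'); first by rewrite lt_min d0 d0'.
move=> t /andP [t0]; rewrite lt_min => /andP [t1 t2] k.
rewrite ltnS leq_eqVlt => /orP [/eqP -> | km] hk.
  by apply: hd'; rewrite t0 t2.
by apply: hd => //; rewrite t0 t1.
Qed.

End BlowupHR.

(** * Transfer of the relations along maps that are onto modulo null *)

Section Transfer.
Variables (R : numDomainType) (S T : ga R) (d : nat) (DS : S -> R) (DT : T -> R).
Variable phi : {rmorphism S -> T}.
Hypotheses (hT : degfun d DT) (hphi : forall k x, ga_hom k x -> ga_hom k (phi x)).
Hypothesis DE : forall x, DT (phi x) = DS x.
Hypothesis onto : forall k y, ga_hom k y -> exists2 x, ga_hom k x & null DT (y - phi x).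

Lemma null_transfer x y : null DT (y - phi x) -> null DS x -> null DT y.
Proof.
move=> ny nx; rewrite -(subrK (phi x) y); apply: (nullD hT) => //.
apply: ga_ind => [u v hu hv|k u hu]; first by rewrite mulrDr (linD hT.1) hu hv addr0.
have [v hv nv] := onto hu.
rewrite -(subrK (phi v) u) mulrDr (linD hT.1) mulrC nv add0r -rmorphM DE.
exact: nx.
Qed.

Lemma HR_transfer l : HR d DS l -> HR d DT (phi l).
Proof.
move=> h k hk y hy prim; have [x hx nx] := onto hy.
have E n z : DT (phi l ^+ n * y * z) = DT (phi (l ^+ n * x) * z).
  apply: (null_congr hT); rewrite rmorphM rmorphXn -mulrBl -mulrBr.
  by apply: nullMr; apply: nullM.
have [|h1 h2] := h k hk x hx.
  move=> j z ej hz; rewrite -DE rmorphM -E; apply: prim ej (hphi hz).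
have e : DT (phi l ^+ (d - 2 * k) * y * y) = DS (l ^+ (d - 2 * k) * x * x).
  by rewrite E rmorphM rmorphXn mulrAC E -rmorphM DE.
rewrite e; split=> // /h2; exact: null_transfer.
Qed.

End Transfer.

Lemma HR_congr (R : numDomainType) (S : ga R) d (D : S -> R) l l' : degfun d D ->
  null D (l - l') -> HR d D l -> HR d D l'.
Proof.
move=> hD nl h k hk x hx prim.
have E n y z : D (l ^+ n * y * z) = D (l' ^+ n * y * z).
  apply: (null_congr hD); rewrite -!mulrBl subrXX.
  by do 3 apply: nullMr.
have [|h1 h2] := h k hk x hx; first by move=> j y ej hy; rewrite E; apply: prim ej hy.
by rewrite E in h1 h2.
Qed.

(** * Deformation of the Lefschetz class *)

Lemma poly_near0 (R : realFieldType) (p : {poly R}) :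
  exists2 C : R, 0 <= C & forall eta, `|eta| <= 1 -> `|p.[eta] - p`_0| <= `|eta| * C.
Proof.
elim/poly_ind: p => [|p c [C C0 IH]].
  by exists 0 => // eta _; rewrite horner0 coef0 subrr normr0 mulr0.
exists (C + `|p`_0|); first exact: addr_ge0.
move=> eta h; rewrite hornerMXaddC coefD coefC coefMX /= add0r addrK normrM mulrC.
rewrite ler_wpM2l // -{1}(subrK p`_0 p.[eta]); apply: le_trans (ler_normD _ _) _.
rewrite lerD2r; apply: le_trans (IH eta h) _.
by rewrite -[X in _ <= X]mul1r ler_wpM2r.
Qed.

Lemma poly_ge0_left (R : realFieldType) (p : {poly R}) (t : R) : 0 < t ->
  (forall s, 0 <= s < t -> 0 <= p.[s]) -> 0 <= p.[t].
Proof.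
move=> t0 h; rewrite leNgt; apply/negP => neg.
pose p' := p \Po ('X + t%:P).
have pe eta : p'.[eta] = p.[eta + t] by rewrite horner_comp !hornerE.
have [C C0 hC] := poly_near0 p'.
have e0 : p'`_0 = p.[t] by rewrite -horner_coef0 pe add0r.
pose v := - p.[t]; have v0 : 0 < v by rewrite oppr_gt0.
pose s := Num.min (Num.min 1 t) (v / (C + 1) / 2).
have C1 : 0 < C + 1 by rewrite ltr_wpDl.
have s0 : 0 < s by rewrite !lt_min ltr01 t0 /= !divr_gt0.
have s1 : s <= 1 by rewrite /s !ge_min lexx.
have st : s <= t by rewrite /s !ge_min lexx orbT.
have sv : s * (C + 1) <= v / 2.
  rewrite -ler_pdivlMr // mulrAC.
  by rewrite /s ge_min lexx orbT.
have := hC (- s); rewrite normrN gtr0_norm // pe e0 => /(_ s1) /ler_normlP [_ h1].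
have : 0 <= p.[- s + t] by apply: h; apply/andP; split; lra.
have : s * C < s * (C + 1) by rewrite ltr_pM2l // ltrDl.
rewrite /v in v0 sv; move: (s * C) (s * (C + 1)) h1 sv => a b; lra.
Qed.

(** Connectedness of the unit interval by a supremum. Closedness is asked from the left only, the
    form in which [HR_closed] provides it. *)
Lemma real_connected (R : realType) (Q : R -> Prop) : Q 0 ->
  (forall t, 0 <= t <= 1 -> Q t ->
     exists2 e : R, 0 < e & forall s, 0 <= s <= 1 -> `|s - t| < e -> Q s) ->
  (forall t, 0 < t <= 1 -> (forall s, 0 <= s < t -> Q s) -> Q t) -> Q 1.
Proof.
move=> Q0 op cl.
pose E : classical_sets.set R := fun t => 0 <= t <= 1 /\ forall s, 0 <= s <= t -> Q s.
have E0 : E 0.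
  split; first by rewrite lexx ler01.
  by move=> s /andP [h1 h2]; have -> : s = 0 by apply/le_anti; rewrite h1 h2.
have Eb : classical_sets.ubound E 1 by move=> t [/andP [_ ]].
have hs : classical_sets.has_sup E by split; [exists 0 | exists 1].
have ubE t : E t -> t <= sup E by apply: sup_upper_bound.
set m := sup E in ubE.
have m0 : 0 <= m by apply: ubE.
have m1 : m <= 1 by apply: ge_sup => //; exists 0.
have Qlt s : 0 <= s < m -> Q s.
  move=> /andP [s0 sm]; have [|e [_ he] h] := sup_adherent (E := E) (eps := m - s) _ hs.
    by rewrite subr_gt0.
  by apply: he; rewrite s0 /= ltW //; move: h; rewrite -/m; lra.
have Qm : Q m.
  have [->//|mn0] := eqVneq m 0; apply: cl => //.
  by rewrite lt_def mn0 m0.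
have Em : E m.
  split; first by rewrite m0.
  move=> s /andP [s0]; rewrite le_eqVlt => /orP [/eqP -> //|sm].
  by apply: Qlt; rewrite s0.
have [<- //|mn1] := eqVneq m 1.
have [|e e0 he] := op m _ Qm; first by rewrite m0.
have lt1 : m < 1 by rewrite lt_def eq_sym mn1.
pose t := Num.min 1 (m + e / 2).
have mt : m < t by rewrite lt_min lt1 ltrDl divr_gt0.
suff /ubE : E t by rewrite leNgt mt.
split; first by rewrite (le_trans m0 (ltW mt)) /= /t ge_min lexx.
move=> s /andP [s0 st]; have [sm|ms] := leP s m; first by apply: Em.2; rewrite s0.
have t1 : t <= 1 by rewrite /t ge_min lexx.
have t2 : t <= m + e / 2 by rewrite /t ge_min lexx orbT.
apply: he; first by rewrite s0 (le_trans st).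
rewrite gtr0_norm ?subr_gt0 //; lra.
Qed.

Section Path.
Variables (R : realFieldType) (S : ga R) (d : nat) (D : S -> R).
Hypothesis hD : degfun d D.
Local Notation sc := (@ga_sc R S).

(** Turns a family of ring elements that is polynomial in a parameter into the polynomial of its
    integrals. *)
Definition polyD (G : {poly S}) : {poly R} := \sum_(i < size G) (D G`_i)%:P * 'X^i.

Lemma polyD_wide (G : {poly S}) n : (size G <= n)%N -> polyD G = \sum_(i < n) (D G`_i)%:P * 'X^i.
Proof.
move=> h; rewrite /polyD (big_ord_widen _ (fun i => (D G`_i)%:P * 'X^i) h) big_mkcond.
apply: eq_bigr => i _; case: ifP => // /negbT; rewrite -leqNgt => /leq_sizeP -> //.
by rewrite (lin0 hD.1) polyC0 mul0r.
Qed.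
Lemma polyDE G t : (polyD G).[t] = D (G.[sc t]).
Proof.
rewrite /polyD horner_sum horner_coef (lin_sum hD.1); apply: eq_bigr => i _.
by rewrite !hornerE -rmorphXn mulrC (mulrC G`_i) (linZ hD.1).
Qed.
Lemma polyD_D F G : polyD (F + G) = polyD F + polyD G.
Proof.
pose n := maxn (size F) (size G).
rewrite (polyD_wide (size_polyD F G)) (polyD_wide (leq_maxl _ _ : size F <= n)%N).
rewrite (polyD_wide (leq_maxr _ _ : size G <= n)%N) -big_split; apply: eq_bigr => i _.
by rewrite coefD (linD hD.1) polyCD mulrDl.
Qed.
Lemma polyD_Z a (G : {poly S}) : polyD ((sc a)%:P * G) = a%:P * polyD G.
Proof.
have h : (size ((sc a)%:P * G)%R <= size G)%N.
  by rewrite mul_polyC; apply: size_scale_leq.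
rewrite (polyD_wide h) /polyD mulr_sumr; apply: eq_bigr => i _.
by rewrite coefCM (linZ hD.1) polyCM mulrA.
Qed.

(** An instance of [perturbation] whose moving constraints are the pairings with generators of the
    previous degree; the degrees are treated one after the other. *)
Lemma HR_open A0 B0 : ga_hom 1 A0 -> ga_hom 1 B0 -> HR d D A0 ->
  exists2 e : R, 0 < e & forall eta, `|eta| < e -> HR d D (A0 + sc eta * B0).
Proof.
move=> hA hB h.
suff hm m : exists2 e : R, 0 < e & forall eta, `|eta| < e -> forall k, (k < m)%N ->
    (2 * k <= d)%N -> forall x, ga_hom k x ->
    (forall j y, j.+1 = k -> ga_hom j y -> D ((A0 + sc eta * B0) ^+ (d - 2 * k + 1) * x * y) = 0) ->
    0 <= (-1) ^+ k * D ((A0 + sc eta * B0) ^+ (d - 2 * k) * x * x) /\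
    (D ((A0 + sc eta * B0) ^+ (d - 2 * k) * x * x) = 0 -> null D x).
  have [e e0 he] := hm d.+1; exists e => // eta ee k hk x.
  by apply: (he eta ee) => //; lia.
elim: m => [|m [e e0 he]]; first by exists 1.
have [hk|hk] := leqP (2 * m) d; last first.
  exists e => // eta ee k; rewrite ltnS leq_eqVlt => /orP [/eqP ->|km] hk'.
    by move: hk; rewrite ltnNge hk'.
  exact: he.
pose L : {poly S} := A0%:P + B0%:P * 'X.
have LE eta : L.[sc eta] = A0 + sc eta * B0 by rewrite /L !hornerE mulrC.
pose q n (x y : S) := polyD (L ^+ n * x%:P * y%:P).
have qE n x y eta : (q n x y).[eta] = D ((A0 + sc eta * B0) ^+ n * x * y).
  by rewrite /q polyDE !hornerM horner_exp !hornerC LE.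
have ql n x : linP (q n x).
  split=> [y z|a y]; rewrite /q; first by rewrite polyCD mulrDr polyD_D.
  by rewrite polyCM mulrCA polyD_Z.
have qs n x y : q n x y = q n y x by rewrite /q mulrAC.
set n := (d - 2 * m)%N in he *.
have [b [hbm sb]] := ga_span S m.
have [bt [hbt sbt]] : exists bt : seq S, (forall y, y \in bt -> exists2 j, j.+1 = m & ga_hom j y) /\
    (forall j y, j.+1 = m -> ga_hom j y -> lspan sc bt y).
  case: (m) => [|k']; first by exists [::]; split.
  have [bt [h1 h2]] := ga_span S k'.
  by exists bt; split=> [y /h1|j y [->]]; [exists k' | exact: h2].
pose N (x _ : S) : R := if `[<null D x>] then 0 else 1.
have N0 x y : N x y = 0 -> null D x.
  by rewrite /N; case: asboolP => // _ /eqP; rewrite oner_eq0.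
have qn k x y : null D x -> q k x y = 0.
  move=> nx; rewrite /q /polyD big1 // => i _.
  rewrite !coefMC; set u := (L ^+ k)`_i; have -> : u * x * y = x * (u * y) by ring.
  by rewrite nx polyC0 mul0r.
pose qq x y := ((-1) ^+ m)%:P * q n x y.
have hom_b x : lspan sc b x -> ga_hom m x.
  elim/lspan_ind => [|u v hu hv|a v /hbm hv]; [exact: ga_hom0|exact: ga_homD|exact: homZ].
have [|||||x|del del0 hdel] := @perturbation R S b qq N (size bt) (fun i => q (n + 1) bt`_i).
- by move=> x; split=> [y z|a y]; rewrite /qq ?(linD (ql n x)) ?(linZ (ql n x)); ring.
- by move=> x y; rewrite /qq qs.
- by move=> i; apply: ql.
- by move=> x y _ _ /N0 nx; rewrite /qq qn ?mulr0.
- by move=> i x _ /N0 nx; rewrite qs qn.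
- move=> /hom_b hx prim nN; rewrite /qq hornerM hornerC qE rmorph0 mul0r addr0.
  have nx : ~ null D x.
    by move=> nx; move: nN; rewrite /N; case: asboolP => //; rewrite eqxx.
  have [|h1 h2] := h m hk x hx.
    move=> j y ej hy; have := sbt j y ej hy.
    have lr : linR (fun w => D (A0 ^+ (d - 2 * m + 1) * x * w)).
      by split=> *; rewrite ?mulrDr ?(linD hD.1) // mulrCA (linZ hD.1).
    elim/lspan_ind => [|u v hu hv|a v /(nthP 0) [i hi <-]].
    - by rewrite mulr0 (lin0 hD.1).
    - by rewrite mulrDr (linD hD.1) hu hv addr0.
    rewrite mulrCA (linZ hD.1) mulrAC; have := prim i hi.
    by rewrite qE rmorph0 mul0r addr0 => ->; rewrite mulr0.
  rewrite lt_def h1 andbT mulf_eq0 signr_eq0 /=.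
  by apply/eqP => /h2.
exists (Num.min e del); first by rewrite lt_min e0.
move=> eta; rewrite lt_min => /andP [ee ed] k.
rewrite ltnS leq_eqVlt => /orP [/eqP ->|km] hk'; last exact: he.
move=> x hx prim; have [nx|nx] := asboolP (null D x).
  by rewrite (mulrC _ x) nx mulr0.
have := hdel eta ed x (sb x hx); rewrite /N; case: asboolP => // _.
rewrite /qq hornerM hornerC qE => h'.
have pos : 0 < (-1) ^+ m * D ((A0 + sc eta * B0) ^+ n * x * x).
  apply: h'; last exact: oner_neq0.
  move=> i hi; have [j ej hj] := hbt _ (mem_nth 0 hi).
  by rewrite qs qE; apply: prim ej hj.
split; first exact: ltW.
by move=> z; move: pos; rewrite z mulr0 ltxx.
Qed.

Lemma horner_map_sc (p : {poly R}) t : (map_poly sc p).[sc t] = sc p.[t].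
Proof. exact: horner_map. Qed.

(* Closedness: a vector that is primitive at the limit point is the limit of primitive
   vectors [det M *: x - L W], where [M] is the Gram matrix of the Lefschetz form on a
   basis of the previous degree and [W] is obtained from the adjugate of [M]. *)
Lemma HR_closed A0 B0 t : 0 < t -> ga_hom 1 A0 -> ga_hom 1 B0 ->
  (forall s, 0 <= s < t -> HR d D (A0 + sc s * B0)) ->
  HL d D (A0 + sc t * B0) -> HR d D (A0 + sc t * B0).
Proof.
move=> t0 hA hB hs hHL; set l := A0 + sc t * B0 in hHL *.
have hl : ga_hom 1 l by apply: ga_homD => //; apply: homZ.
pose L : {poly S} := A0%:P + B0%:P * 'X.
have LE s : L.[sc s] = A0 + sc s * B0 by rewrite /L !hornerE mulrC.
(* Nonnegativity on primitive vectors is enough: an isotropic primitive vector is then orthogonal to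
   all primitive ones, and by hard Lefschetz at [t] every class is primitive plus [l w], so the
   vector is orthogonal to everything. *)
suff pos k : (2 * k <= d)%N -> forall x, ga_hom k x ->
    (forall j y, j.+1 = k -> ga_hom j y -> D (l ^+ (d - 2 * k + 1) * x * y) = 0) ->
    0 <= (-1) ^+ k * D (l ^+ (d - 2 * k) * x * x).
  move=> k hk x hx prim; split; first exact: pos.
  move=> Q0; set n := (d - 2 * k)%N in prim Q0 *.
  have orth z : ga_hom k z ->
      (forall j y, j.+1 = k -> ga_hom j y -> D (l ^+ (n + 1) * z * y) = 0) ->
      D (l ^+ n * x * z) = 0.
    move=> hz primz.
    have h s : 0 <= (-1) ^+ k * (2 * s * D (l ^+ n * x * z) + D (l ^+ n * z * z)).
      have := pos k hk (sc s * x + z) _ _.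
      have -> : D (l ^+ (d - 2 * k) * (sc s * x + z) * (sc s * x + z)) =
          2 * s * D (l ^+ n * x * z) + D (l ^+ n * z * z).
        rewrite -/n (_ : l ^+ n * (sc s * x + z) * (sc s * x + z) = sc (s ^+ 2) * (l ^+ n * x * x)
          + sc (2 * s) * (l ^+ n * x * z) + l ^+ n * z * z); last first.
          by rewrite rmorphXn rmorphM rmorph_nat; ring.
        by rewrite !(linD hD.1) !(linZ hD.1) Q0 mulr0 add0r.
      apply; first by apply: ga_homD => //; apply: homZ.
      move=> j y ej hy; rewrite -/n.
      rewrite (_ : l ^+ (n + 1) * (sc s * x + z) * y =
        sc s * (l ^+ (n + 1) * x * y) + l ^+ (n + 1) * z * y); last by ring.
      by rewrite (linD hD.1) (linZ hD.1) (prim j) // (primz j) // mulr0 addr0.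
    apply/eqP/negPn/negP => nz; set Y := D (l ^+ n * x * z) in h nz *.
    set Z := D (l ^+ n * z * z) in h.
    have s1 : (-1) ^+ k * (-1) ^+ k = 1 :> R by rewrite -exprMn mulrNN mulr1 expr1n.
    have := h (- (Z + (-1) ^+ k) / (2 * Y)).
    have -> : 2 * (- (Z + (-1) ^+ k) / (2 * Y)) * Y + Z = - (-1) ^+ k by field.
    by rewrite mulrN s1; lra.
  apply: (hHL k hk x hx) => y hy; rewrite -/n.
  case ek : k => [|k'].
    by apply: orth => // j z; rewrite ek.
  have hk' : (2 * k' <= d)%N by move: hk; rewrite ek; lia.
  have en : (d - 2 * k' = n.+2)%N by rewrite /n; move: hk; rewrite ek; lia.
  have [w hw ew] : exists2 w, ga_hom k' w & forall g, ga_hom k' g ->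
      D (l ^+ (d - 2 * k') * w * g) = D (l ^+ n.+1 * y * g).
    apply: (HL_surj hD hHL hk').
      by split=> *; rewrite ?mulrDr ?(linD hD.1) // mulrCA (linZ hD.1).
    by move=> g _ ng; rewrite mulrC.
  rewrite en in ew.
  have hlw : ga_hom k (l * w) by rewrite ek; apply: (ga_homM hl hw).
  rewrite -(subrK (l * w) y) mulrDr (linD hD.1) orth.
  - rewrite add0r mulrA (_ : l ^+ n * x * l * w = l ^+ (n + 1) * x * w); last first.
      by rewrite addn1 exprS; ring.
    exact: prim (esym ek) hw.
  - by apply: homB.
  move=> j g ej hg; rewrite (_ : l ^+ (n + 1) * (y - l * w) * g =
     l ^+ n.+1 * y * g - l ^+ n.+2 * w * g); last by rewrite addn1 [in RHS](exprS l n.+1); ring.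
  have hg' : ga_hom k' g by apply: homE hg; move: ej; rewrite ek; case.
  by rewrite (linB hD.1) ew // subrr.
move=> hk x hx prim; set n := (d - 2 * k)%N in prim *.
have tI s : 0 <= s < t -> HR d D (L.[sc s]) by move=> /hs; rewrite LE.
suff [X [a [a0 Xt hX primX]]] : exists X : {poly S}, exists a : R, [/\ a != 0,
    X.[sc t] = sc a * x, (forall s, ga_hom k X.[sc s]) &
    (forall s j y, j.+1 = k -> ga_hom j y -> D (L.[sc s] ^+ (n + 1) * X.[sc s] * y) = 0)].
  have := @poly_ge0_left R (((-1) ^+ k)%:P * polyD (L ^+ n * X * X)) t t0.
  have FE s : (((-1) ^+ k)%:P * polyD (L ^+ n * X * X)).[s] =
      (-1) ^+ k * D (L.[sc s] ^+ n * X.[sc s] * X.[sc s]).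
    by rewrite hornerM hornerC polyDE !hornerM horner_exp.
  rewrite FE Xt LE -/l => h.
  have : 0 <= (-1) ^+ k * D (l ^+ n * (sc a * x) * (sc a * x)).
    by apply: h => s ht; rewrite FE; apply: (tI s ht k hk _ (hX s) _).1; apply: primX.
  rewrite (_ : l ^+ n * (sc a * x) * (sc a * x) = sc (a ^+ 2) * (l ^+ n * x * x)); last first.
    by rewrite rmorphXn; ring.
  rewrite (linZ hD.1) mulrCA pmulr_rge0 //.
  by rewrite lt_def sqr_ge0 andbT sqrf_eq0.
have [ek|[k' ek]] : k = 0%N \/ exists k', k = k'.+1 by case: (k) => [|k']; [left|right; exists k'].
  exists x%:P, 1; split; [exact: oner_neq0 | by rewrite hornerC rmorph1 mul1r | |].
    by move=> s; rewrite hornerC.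
  by move=> s j y; rewrite ek.
have hk' : (2 * k' <= d)%N by lia.
have en : (d - 2 * k' = n.+2)%N by rewrite /n; lia.
have [b [hbm sb]] := ga_span S k'.
pose G := \matrix_(i < size b, j < size b) D (l ^+ n.+2 * b`_i * b`_j).
(* Generators independent for the Gram matrix at [t]; with a redundant list the determinant below
   could vanish identically. *)
pose f := maxrankfun G; pose r := \rank G.
pose b' (i : 'I_r) := b`_(f i).
have hb' i : ga_hom k' (b' i) by apply: hbm; apply: mem_nth.
have comb (I : finType) (a : I -> R) (v : I -> S) y :
    D (l ^+ n.+2 * (\sum_i sc (a i) * v i) * y) = \sum_i a i * D (l ^+ n.+2 * v i * y).
  rewrite mulr_sumr mulr_suml (lin_sum hD.1); apply: eq_bigr => i _.
  by rewrite -(linZ hD.1); congr D; ring.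
have lr z : linR (fun w => D (z * w)).
  by split=> *; rewrite ?mulrDr ?(linD hD.1) // mulrCA (linZ hD.1).
have ext z : (forall m : 'I_(size b), D (z * b`_m) = 0) -> forall y, ga_hom k' y -> D (z * y) = 0.
  move=> h y /sb; elim/lspan_ind => [|u v hu hv|a v /(nthP 0) [i hi <-]].
  - by rewrite mulr0 (lin0 hD.1).
  - by rewrite mulrDr (linD hD.1) hu hv addr0.
  by rewrite mulrCA (linZ hD.1) (h (Ordinal hi)) mulr0.
have red (m : 'I_(size b)) : exists c : 'I_r -> R, null D (b`_m - \sum_i sc (c i) * b' i).
  have /submxP [c ec] : (row m G <= rowsub f G)%MS by rewrite eq_maxrowsub row_sub.
  exists (fun i => c 0 i); apply: (hHL k' hk').
    apply: homB; first by apply: hbm; apply: mem_nth.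
    by apply: hom_sum => i _; apply: homZ.
  move=> y hy; rewrite en; apply: (ext (l ^+ n.+2 * _) _ y hy) => j.
  rewrite mulrBr mulrBl (linB hD.1) comb; apply/eqP; rewrite subr_eq0; apply/eqP.
  have /rowP /(_ j) := ec; rewrite !mxE => ->.
  by apply: eq_bigr => i _; rewrite !mxE.
have ext' z : (forall i, D (z * b' i) = 0) -> forall y, ga_hom k' y -> D (z * y) = 0.
  move=> h; apply: ext => m; have [c nc] := red m.
  rewrite -(subrK (\sum_i sc (c i) * b' i) b`_m) mulrDr (linD hD.1) mulrC nc add0r.
  rewrite mulr_sumr (lin_sum hD.1) big1 // => i _.
  by rewrite mulrCA (linZ hD.1) h mulr0.
pose M := \matrix_(i < r, j < r) polyD (L ^+ n.+2 * (b' i)%:P * (b' j)%:P).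
pose v := \row_(j < r) polyD (L ^+ n.+1 * x%:P * (b' j)%:P).
pose w := v *m \adj M.
pose W : {poly S} := \sum_i map_poly sc (w 0 i) * (b' i)%:P.
pose X : {poly S} := map_poly sc (\det M) * x%:P - L * W.
have WE s : W.[sc s] = \sum_i sc (w 0 i).[s] * b' i.
  by rewrite /W horner_sum; apply: eq_bigr => i _; rewrite hornerM hornerC horner_map_sc.
have XE s : X.[sc s] = sc (\det M).[s] * x - L.[sc s] * W.[sc s].
  by rewrite /X hornerD hornerN !hornerM hornerC horner_map_sc.
have Wh s : ga_hom k' W.[sc s].
  by rewrite WE; apply: hom_sum => i _; apply: homZ.
have Lh s : ga_hom 1 L.[sc s] by rewrite LE; apply: ga_homD => //; apply: homZ.
have ME s i j : (M i j).[s] = D (L.[sc s] ^+ n.+2 * b' i * b' j).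
  by rewrite mxE polyDE 2!hornerM horner_exp !hornerC.
have vE s j : (v 0 j).[s] = D (L.[sc s] ^+ n.+1 * x * b' j).
  by rewrite mxE polyDE 2!hornerM horner_exp !hornerC.
have wM j : \sum_i w 0 i * M i j = \det M * v 0 j.
  have e : w *m M = \det M *: v by rewrite /w -mulmxA mul_adj_mx mul_mx_scalar.
  transitivity ((w *m M) 0 j); first by rewrite [RHS]mxE.
  by rewrite e [LHS]mxE.
have prim' s j : D (L.[sc s] ^+ n.+1 * X.[sc s] * b' j) = 0.
  rewrite XE; have -> : L.[sc s] ^+ n.+1 * (sc (\det M).[s] * x - L.[sc s] * W.[sc s]) * b' j =
      sc (\det M).[s] * (L.[sc s] ^+ n.+1 * x * b' j) - L.[sc s] ^+ n.+2 * W.[sc s] * b' j.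
    by rewrite [in RHS](exprS _ n.+1); ring.
  rewrite (linB hD.1) (linZ hD.1) -vE -hornerM -wM WE mulr_sumr mulr_suml (lin_sum hD.1).
  rewrite horner_sum -sumrB big1 // => i _; rewrite hornerM ME -(linZ hD.1) -(linB hD.1).
  by rewrite -[RHS](lin0 hD.1); congr D; ring.
exists X, (\det M).[t]; split.
- have -> : (\det M).[t] = \det (map_mx (horner_eval t) M).
    by rewrite det_map_mx.
  rewrite -unitfE -[_ \is a _]/(_ \in unitmx) -row_free_unit -kermx_eq0.
  apply/eqP/row_matrixP => i0; rewrite row0.
  set a := row i0 _; have : a *m map_mx (horner_eval t) M = 0.
    by apply/sub_kermxP; rewrite row_sub.
  move=> aM; pose z := \sum_i sc (a 0 i) * b' i.
  have za j : D (l ^+ n.+2 * z * b' j) = 0.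
    transitivity ((a *m map_mx (horner_eval t) M) 0 j); last by rewrite aM mxE.
    rewrite comb [RHS]mxE; apply: eq_bigr => i _; congr (_ * _).
    by rewrite [RHS]mxE /horner_eval ME LE.
  have az : a *m rowsub f G = 0.
    apply/rowP => j; rewrite !mxE -[RHS](ext' _ za b`_j); last by apply: hbm; apply: mem_nth.
    by rewrite comb; apply: eq_bigr => i _; rewrite !mxE.
  have fr := maxrowsub_free G.
  by move/eqP: az; rewrite -/f mulmx_free_eq0 // => /eqP.
- have w0 i : (w 0 i).[t] = 0.
    rewrite mxE horner_sum big1 // => j _; rewrite hornerM vE LE -/l -(addn1 n).
    by rewrite (prim k' _ (esym ek)) // mul0r.
  by rewrite XE WE big1 ?mulr0 ?subr0 // => i _; rewrite w0 rmorph0 mul0r.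
- move=> s; rewrite XE; apply: homB; first exact: homZ.
  by rewrite ek; apply: (ga_homM (Lh s) (Wh s)).
move=> s j y; rewrite ek => -[ej] hy; rewrite addn1; have hy' : ga_hom k' y by rewrite -ej.
exact: (ext' _ (prim' s) y hy').
Qed.

End Path.

Lemma HR_path (R : realType) (S : ga R) d (D : S -> R) l0 l1 : degfun d D ->
  ga_hom 1 l0 -> ga_hom 1 l1 -> HR d D l0 ->
  (forall t : R, 0 < t <= 1 -> HL d D (l0 + ga_sc S t * (l1 - l0))) -> HR d D l1.
Proof.
move=> hD h0 h1 hr hh.
have hB : ga_hom 1 (l1 - l0) by apply: homB.
have <- : l0 + ga_sc S 1 * (l1 - l0) = l1 by rewrite rmorph1; ring.
apply: (@real_connected R (fun t => HR d D (l0 + ga_sc S t * (l1 - l0)))).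
- by rewrite rmorph0 mul0r addr0.
- move=> t _ ht; have hA : ga_hom 1 (l0 + ga_sc S t * (l1 - l0)).
    by apply: ga_homD => //; apply: homZ.
  have [e e0 he] := HR_open hD hA hB ht; exists e => // s _ st.
  have -> : l0 + ga_sc S s * (l1 - l0) =
    l0 + ga_sc S t * (l1 - l0) + ga_sc S (s - t) * (l1 - l0) by rewrite rmorphB; ring.
  exact: he.
move=> t ht hs; have t0 : 0 < t by case/andP: ht.
exact: (HR_closed hD t0 h0 hB hs (hh t ht)).
Qed.

(** * Iterated blow-ups along a ranked order *)

Section BaseGa.
Variable R : comNzRingType.
Definition base_hom k (x : R) := k != 0%N -> x = 0.
Lemma base_hom0 k : base_hom k 0. Proof. by []. Qed.
Lemma base_homD k x y : base_hom k x -> base_hom k y -> base_hom k (x + y).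
Proof. by move=> hx hy k0; rewrite hx // hy // addr0. Qed.
Lemma base_homM j k x y : base_hom j x -> base_hom k y -> base_hom (j + k) (x * y).
Proof.
move=> hx hy; rewrite /base_hom addn_eq0 negb_and => /orP [/hx ->|/hy ->]; first by rewrite mul0r.
by rewrite mulr0.
Qed.
Lemma base_homsc (a : R) : base_hom 0 (idfun a). Proof. by []. Qed.
Lemma base_ind (P : R -> Prop) : (forall x y, P x -> P y -> P (x + y)) ->
  (forall k x, base_hom k x -> P x) -> forall x, P x.
Proof. by move=> _ h x; apply: (h 0%N). Qed.
Lemma base_span k : exists b : seq R, (forall x, x \in b -> base_hom k x) /\
  (forall x, base_hom k x -> lspan (idfun : R -> R) b x).
Proof.
case: k => [|k]; last by exists [::]; split=> // x /(_ isT).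
exists [:: 1]; split=> // x _ /=; exists x; by rewrite mulr1 subrr.
Qed.
Definition baseGA : ga R :=
  @Ga R R idfun base_hom base_hom0 base_homD base_homM base_homsc base_ind base_span.
End BaseGa.

Section ThStep.
Variables (R : comNzRingType) (S T : ga R) (f : {rmorphism S -> T}) (v : T).
Lemma thstep_comm : commr_rmorph f v. Proof. by move=> x; apply: mulrC. Qed.
Definition thstep : {rmorphism polyGA S -> T} :=
  GRing.RMorphism.clone (polyGA S) T (horner_morph thstep_comm) _.
Lemma thstepC a : thstep (a%:P : {poly S}) = f a. Proof. exact: horner_morphC. Qed.
Lemma thstepX : thstep ('X : {poly S}) = v. Proof. exact: horner_morphX. Qed.
End ThStep.

Section State.
Variables (L : finType) (le : rel L) (top : L -> L) (join : L -> L -> L).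
Definition olt x y := le x y && (x != y).

(** Every component of the order has a greatest element, [top x]. For a cone the components are the
    intervals of its chain, and the tower is a product of projective spaces, one per component,
    blown up repeatedly. *)
Record order_ax : Prop := OrderAx {
  ole_refl : forall x, le x x;
  ole_anti : forall x y, le x y -> le y x -> x = y;
  ole_trans : forall y x z, le x y -> le y z -> le x z;
  ole_top : forall x, le x (top x);
  top_max : forall x y, le (top x) y -> y = top x;
  top_le : forall x y, le x y -> top x = top y }.

(** For [F] below its top, [rho F] is the codimension of the centre attached to [F]. [g_sub] is
    submodularity against an absent bottom element of rank 0, [g_sub2] against an actual lower bound
    [K]. *)
Record good (U : pred L) (rho : L -> nat) : Prop := Good {
  g_top : forall F, U F -> U (top F);
  g_pos : forall F, U F -> (0 < rho F)%N;
  g_mono : forall F G, U F -> U G -> olt F G -> (rho F < rho G)%N;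
  g_join : forall F G, U F -> U G -> top F = top G -> U (join F G);
  g_joinl : forall F G, U F -> U G -> top F = top G -> le F (join F G);
  g_joinr : forall F G, U F -> U G -> top F = top G -> le G (join F G);
  g_lub : forall F G, U F -> U G -> top F = top G ->
    forall K, U K -> le F K -> le G K -> le (join F G) K;
  g_sub : forall F G, U F -> U G -> top F = top G -> (rho (join F G) <= rho F + rho G)%N;
  g_sub2 : forall F G K, U F -> U G -> U K -> top F = top G -> le K F -> le K G ->
    (rho (join F G) + rho K <= rho F + rho G)%N }.

(** The head is the element added last: everything above it is already in the tail, so tails are
    closed upwards in [U]. *)
Fixpoint ok (U : pred L) (s : seq L) : Prop :=
  if s is F :: s' then
    [/\ U F, F \notin s', (forall H, U H -> olt F H -> H \in s') & ok U s']
  else True.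

Hypothesis oax : order_ax.

Lemma top_top x : top (top x) = top x.
Proof. by rewrite -(top_le oax (ole_top oax x)). Qed.

Lemma olt_ole x y : olt x y -> le x y. Proof. by case/andP. Qed.

Section Ok.
Variable U : pred L.
Lemma ok_U s F : ok U s -> F \in s -> U F.
Proof.
elim: s => //= G s IH [UG _ _ /IH h]; rewrite inE => /orP [/eqP -> //|]; exact: h.
Qed.
Lemma ok_up s F H : ok U s -> F \in s -> U H -> le F H -> H \in s.
Proof.
elim: s => //= G s IH [UG Gs up /IH h]; rewrite !inE => /orP [/eqP -> | Fs] UH FH.
  by have [->|n] := eqVneq H G; rewrite //= up // /olt FH eq_sym.
by rewrite h ?orbT.
Qed.
End Ok.

Variable R : comNzRingType.

Record st := St { stS : ga R; stX : L -> stS; stD : stS -> R }.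

Section Rho.
Variable rho : L -> nat.

(* Adding [F] takes the product with a projective space of dimension [rho F - 1] when [F] is a
   top element, and otherwise blows up a centre of codimension [rho F] whose class is
   [b ^+ rho F]; the new variable ['X] is the pull-back of the nef class [- h F], so that the
   exceptional divisor is [b - 'X]. *)
Definition ststep (x : st) (F : L) : st :=
  let b := - \sum_(H | le F H) stX x H in
  @St (polyGA (stS x))
    (fun G => if G == F then (b%:P - 'X : {poly stS x}) else ((stX x G)%:P : {poly stS x}))
    (if top F == F then Dcoef 1 (rho F).-1 (@stD x) else Dbl (rho F) b (@stD x)).

Fixpoint stl (s : seq L) : st :=
  if s is F :: s' then ststep (stl s') F else @St (baseGA R) (fun=> 0) (fun x => x).

Local Notation S s := (stS (stl s)).
Local Notation X s := (@stX (stl s)).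
Local Notation D s := (@stD (stl s)).

Definition hsum s G : S s := \sum_(H | le G H) X s H.
Local Notation h := hsum.
Definition dims s := (\sum_(F <- s | top F == F) (rho F).-1)%N.

Lemma dims_nil : dims [::] = 0%N.
Proof. exact: big_nil. Qed.
Lemma dims_cons F s : dims (F :: s) = ((if top F == F then (rho F).-1 else 0) + dims s)%N.
Proof. by rewrite /dims big_cons; case: ifP. Qed.

Lemma X_out s G : G \notin s -> X s G = 0.
Proof.
elim: s => [|F s IH] //=; rewrite inE negb_or => /andP [/negbTE ->] /IH ->.
exact: polyC0.
Qed.

Lemma X_hom s G : ga_hom 1 (X s G).
Proof.
elim: s => [|F s IH] in G *; first exact: base_hom0.
have hb : ga_hom 1 (- \sum_(H | le F H) X s H) by apply: homN; apply: hom_sum.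
rewrite /=; case: eqP => _; last by apply: poly_homC.
by apply: (homB (S := polyGA (S s))); [apply: poly_homC | apply: poly_homX].
Qed.

Lemma h_hom s G : ga_hom 1 (h s G).
Proof. by apply: hom_sum => H _; apply: X_hom. Qed.

Lemma D_degfun s : degfun (dims s) (D s).
Proof.
elim: s => [|F s IH].
  rewrite /dims big_nil; split; first by [].
  by move=> k x hx k0; apply: hx.
rewrite /dims big_cons -/(dims s) /=; case: eqP => _.
  by rewrite addnC; apply: Dcoef_degfun.
by apply: Dbl_degfun => //; apply: homN; apply: h_hom.
Qed.

Lemma null_lift F s g : null (D s) g -> null (D (F :: s)) (g%:P : {poly S s}).
Proof.
move=> ng y /=; case: eqP => _; first by rewrite /Dcoef coefCM ng mulr0.
rewrite /Dbl (eq_bigr (fun q : 'I__ => g * ((- \sum_(H | le F H) X s H) ^+ q * (y : {poly S s})`_q))).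
  by rewrite -mulr_sumr ng.
by move=> i _; rewrite coefCM mulrCA.
Qed.

Lemma X_cons F s G : X (F :: s) G =
  if G == F then ((- h s F)%:P - 'X : {poly S s}) else ((X s G)%:P : {poly S s}).
Proof. by []. Qed.

Lemma h_consF F s : F \notin s -> h (F :: s) F = (- 'X : {poly S s}).
Proof.
move=> Fs; rewrite /h (bigD1 F) ?ole_refl //= eqxx.
rewrite (eq_bigr (fun H => (X s H)%:P : {poly S s})); last by move=> H /andP [_ /negbTE ->].
rewrite -(rmorph_sum (@polyC (S s))) /=.
have -> : \sum_(i | le F i && (i != F)) X s i = \sum_(H | le F H) X s H.
  by rewrite [RHS](bigD1 F) ?ole_refl //= X_out // add0r.
by rewrite polyCN addrAC addNr add0r.
Qed.

Lemma h_consN F s K : ~~ le K F -> h (F :: s) K = ((h s K)%:P : {poly S s}).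
Proof.
move=> KF; rewrite /h (rmorph_sum (@polyC (S s))); apply: eq_bigr => H KH /=.
by case: eqP KH KF => // -> ->.
Qed.

Lemma top_maxE F H : top F = F -> le F H -> H = F.
Proof. by move=> tF FH; have := top_max oax (x := F) (y := H); rewrite tF; apply. Qed.

Lemma h_top s F : top F = F -> h s F = X s F.
Proof.
move=> tF; rewrite /h (bigD1 F) ?ole_refl //= big1 ?addr0 // => H /andP [/(top_maxE tF) ->].
by rewrite eqxx.
Qed.

(** A monomial of top degree with integral 1, which fixes the normalisation of all degree
    functionals. *)
Definition m0 s : S s := \prod_(F <- s | top F == F) (- X s F) ^+ (rho F).-1.

Lemma m0_cons F s U : ok U (F :: s) -> m0 (F :: s) =
  ((if top F == F then 'X^((rho F).-1) * (m0 s)%:P else (m0 s)%:P) : {poly S s}).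
Proof.
move=> [_ Fs _ _]; rewrite /m0 big_cons.
have -> : \prod_(j <- s | top j == j) (- X (F :: s) j) ^+ (rho j).-1 = ((m0 s)%:P : {poly S s}).
  rewrite /m0 (rmorph_prod (@polyC (S s))) big_seq_cond [in RHS]big_seq_cond.
  apply: eq_bigr => G /andP [Gs _]; rewrite X_cons ifN; last first.
    by apply: contraNneq Fs => <-.
  by rewrite (rmorphXn (@polyC (S s))) /= polyCN.
case: eqP => // tF; rewrite X_cons eqxx h_top // X_out // oppr0 polyC0 sub0r opprK.
by [].
Qed.

Lemma D_m0 s U : good U rho -> ok U s -> D s (m0 s) = 1.
Proof.
move=> gU; elim: s => [|F s IH] oks; first by rewrite /m0 big_nil.
rewrite (m0_cons oks) /=; have [UF _ _ /IH e] := oks.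
have r0 := g_pos gU UF.
case: eqP => _; first by rewrite /Dcoef coefMC coefXn eqxx mul1r mul1r.
by rewrite -(prednK r0) Dbl_const.
Qed.

Lemma m0_hom s : ga_hom (dims s) (m0 s).
Proof.
have hh (r : seq L) : ga_hom (\sum_(F <- r | top F == F) (rho F).-1)%N
    (\prod_(F <- r | top F == F) (- X s F) ^+ (rho F).-1).
  elim: r => [|F r IH]; first by rewrite !big_nil; apply: hom1.
  rewrite !big_cons; case: eqP => _ //; apply: ga_homM => //.
  by apply: homX1; apply: homN; apply: X_hom.
exact: hh.
Qed.

Lemma m0E s : uniq s ->
  m0 s = \prod_(F | (F \in s) && (top F == F)) (- X s F) ^+ (rho F).-1.
Proof.
move=> us; rewrite /m0 -big_filter big_uniq ?filter_uniq //.
by apply: eq_bigl => F; rewrite mem_filter andbC.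
Qed.

Lemma hom0_sc s (x : S s) : ga_hom 0 x -> exists a, x = ga_sc (S s) a.
Proof.
elim: s x => [|F s IH] x; first by exists x.
move=> hx; have [a ea] := IH _ ((hx 0%N).1 0%N erefl); exists a.
apply/polyP => -[|i]; rewrite poly_scE coefC //=.
by rewrite (hx i.+1).2.
Qed.

(* The Feichtner-Yuzvinsky relations, which present the iterated blow-up. *)
Record rels (T : comNzRingType) (y : L -> T) (J : T -> Prop) (s : seq L) : Prop := Rels {
  r1 : forall G H, G \in s -> H \in s -> top G = top H -> ~~ le G H -> ~~ le H G ->
    J (y G * y H);
  r2 : forall G H, G \in s -> H \in s -> olt G H ->
    J (y G * (\sum_(K | le H K) y K) ^+ (rho H - rho G));
  r3 : forall G, G \in s -> J ((\sum_(K | le G K) y K) ^+ rho G) }.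

Section Relations.
Variable U : pred L.
Hypothesis gU : good U rho.

(** Variables of incomparable elements of a component have null product, so against [X s G] only the
    elements above both [G] and [H] survive in [h s H]. *)
Lemma null_join s G H : ok U s -> rels (X s) (null (D s)) s -> G \in s -> U H ->
  top H = top G -> ~~ le H G -> null (D s) (X s G * (h s H - h s (join H G))).
Proof.
move=> oks rs Gs UH tHG HG; have UG := ok_U oks Gs.
have -> : h s H - h s (join H G) = \sum_(K | le H K && ~~ le (join H G) K) X s K.
  rewrite /h (bigID (le (join H G)) (le H)) /=; apply/eqP; rewrite subr_eq addrC; apply/eqP.
  congr (_ + _); apply: eq_bigl => K; apply: andb_idl => JK.
  exact: (ole_trans oax (g_joinl gU UH UG tHG) JK).
rewrite mulr_sumr; apply: (null_sum (D_degfun s)) => K /andP [HK JK].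
have [Ks|/X_out ->] := boolP (K \in s); last by rewrite mulr0; apply: null0 (D_degfun s).
apply: (r1 rs) => //.
- by rewrite -tHG; apply: top_le HK.
- by apply: contra JK => GK; apply: (g_lub gU) => //; apply: ok_U oks Ks.
by apply: contra HG => KG; apply: (ole_trans oax HK KG).
Qed.

Lemma null_XhX s G H n : ok U s -> rels (X s) (null (D s)) s -> G \in s -> U H ->
  top H = top G -> ~~ le H G -> (rho (join H G) - rho G <= n)%N ->
  null (D s) (X s G * h s H ^+ n).
Proof.
move=> oks rs Gs UH tHG HG hn; have UG := ok_U oks Gs.
set J := join H G in hn *.
have hD := D_degfun s.
have -> : X s G * h s H ^+ n = X s G * h s J ^+ n + X s G * (h s H ^+ n - h s J ^+ n) by ring.
apply: (nullD hD); last first.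
  rewrite subrXX mulrA; apply: nullMr; exact: null_join.
have GJ : le G J by apply: (g_joinr gU).
have HJ : le H J by apply: (g_joinl gU).
have UJ : U J by apply: (g_join gU).
have Js := ok_up oks Gs UJ GJ.
have lGJ : olt G J by rewrite /olt GJ; apply: contra HG => /eqP ->.
rewrite -(subnK hn) exprD mulrCA mulrC mulrC; apply: nullM; exact: r2 rs _ _ Gs Js lGJ.
Qed.

(** The difference [h s F - h s H] runs over the [K] above [F] and not above [H]; for each of them
    the exponent [b] is large enough for [null_XhX]. *)
Lemma null_tele s F H a b : ok U s -> rels (X s) (null (D s)) s -> U F -> F \notin s ->
  H \in s -> olt F H ->
  (forall K, K \in s -> olt F K -> ~~ le H K -> (rho (join H K) - rho K <= b)%N) ->
  null (D s) (h s F ^+ a.+1 * h s H ^+ b - h s F ^+ a * h s H ^+ b.+1).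
Proof.
move=> oks rs UF Fs Hs FH hb; have hD := D_degfun s.
have UH := ok_U oks Hs.
have -> : h s F ^+ a.+1 * h s H ^+ b - h s F ^+ a * h s H ^+ b.+1 =
  h s F ^+ a * ((h s F - h s H) * h s H ^+ b) by rewrite !exprS; ring.
apply: nullM.
have -> : h s F - h s H = \sum_(K | le F K && ~~ le H K) X s K.
  rewrite /h (bigID (le H) (le F)) /=; apply/eqP; rewrite subr_eq addrC; apply/eqP.
  congr (_ + _); apply: eq_bigl => K; apply: andb_idl => HK.
  exact: (ole_trans oax (olt_ole FH) HK).
rewrite mulr_suml; apply: (null_sum hD) => K /andP [FK HK].
have [Ks|/X_out ->] := boolP (K \in s); last by rewrite mul0r; apply: null0 hD.
have lFK : olt F K by rewrite /olt FK; apply: contraNneq Fs => ->.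
apply: null_XhX => //; last exact: hb.
by rewrite -(top_le oax FK) (top_le oax (olt_ole FH)).
Qed.

(** Starting from [r3] for [H], factors [h s H] are turned into [h s F] one at a time, each exchange
    being legitimate by [g_sub2] with lower bound [F]. The result is the relation [r3] for [H] on
    the centre at [F]. *)
Lemma null_excpow s F H : ok U s -> rels (X s) (null (D s)) s -> U F -> F \notin s ->
  H \in s -> olt F H -> null (D s) (h s F ^+ rho F * h s H ^+ (rho H - rho F)).
Proof.
move=> oks rs UF Fs Hs FH; have hD := D_degfun s; have UH := ok_U oks Hs.
have rFH := g_mono gU UF UH FH.
suff hh a : (a <= rho F)%N -> null (D s) (h s F ^+ a * h s H ^+ (rho H - a)) by apply: hh.
elim: a => [|a IH] ha; first by rewrite expr0 mul1r subn0; apply: (r3 rs).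
rewrite -(subrK (h s F ^+ a * h s H ^+ (rho H - a)) (_ * _)); apply: (nullD hD); last first.
  by apply: IH; apply: ltnW.
have -> : (rho H - a = (rho H - a.+1).+1)%N by lia.
apply: null_tele => // K Ks FK HK.
have UK := ok_U oks Ks.
have := g_sub2 gU UH UK UF _ (olt_ole FH) (olt_ole FK).
by rewrite -(top_le oax (olt_ole FH)) -(top_le oax (olt_ole FK)) => /(_ erefl); lia.
Qed.

Lemma stl_rels s : ok U s -> rels (X s) (null (D s)) s.
Proof.
elim: s => [|F s IH] oks; first by split.
have [UF Fs up oks'] := oks; have rs := IH oks'; have hD := D_degfun s.
have notle G : G \in s -> ~~ le G F.
  move=> Gs; apply: contra Fs => GF; exact: ok_up oks' Gs UF GF.
have neF G : G \in s -> (G == F) = false.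
  by move=> Gs; apply/eqP => e; rewrite -e Gs in Fs.
(* By [Dbl_exc], a multiple of the exceptional divisor is null as soon as its cofactor is null on
   the centre. *)
have exc g : top F != F -> null (D s) (h s F ^+ rho F * g) ->
    null (D (F :: s)) (((- h s F)%:P - 'X) * g%:P : {poly S s}).
  move=> tF ng y /=; rewrite (negbTE tF) -mulrA -(prednK (g_pos gU UF)) Dbl_exc coefCM.
  rewrite prednK ?(g_pos gU) // mulrA exprNn -mulrA.
  by rewrite mulrA -(mulrA (_ ^+ _)) (mulrC (_ ^+ _)) -mulrA ng.
have R1 G : G \in s -> top F = top G -> ~~ le F G -> null (D (F :: s)) (X (F :: s) F * X (F :: s) G).
  move=> Gs tFG FG; rewrite !X_cons eqxx neF //; apply: exc.
    apply: contra (notle G Gs) => /eqP tF; rewrite -tF tFG; exact: ole_top.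
  rewrite mulrC; apply: null_XhX => //.
  have := g_sub gU UF (ok_U oks' Gs) tFG; lia.
split.
- move=> G H; rewrite !inE => /orP [/eqP ->|Gs] /orP [/eqP ->|Hs] tGH GH HG.
  + by rewrite ole_refl in GH.
  + exact: R1.
  + by rewrite mulrC; apply: R1.
  by rewrite !X_cons !neF // -polyCM; apply: null_lift; apply: (r1 rs).
- move=> G H; rewrite !inE => /orP [/eqP ->|Gs] /orP [/eqP ->|Hs] GH.
  + by move: GH; rewrite /olt eqxx andbF.
  + rewrite -/(hsum (F :: s) H) h_consN ?notle // X_cons eqxx -polyC_exp.
    have tF : top F != F.
      apply/eqP => tF; move: GH => /andP [FH] /eqP; apply.
      by rewrite (top_maxE tF FH).
    by apply: exc => //; apply: null_excpow.
  + by case/negP: (notle G Gs); apply: olt_ole.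
  rewrite -/(hsum (F :: s) H) h_consN ?notle // X_cons neF // -polyC_exp -polyCM.
  by apply: null_lift; apply: (r2 rs).
move=> G; rewrite inE => /orP [/eqP ->|Gs]; last first.
  rewrite -/(hsum (F :: s) G) h_consN ?notle // -polyC_exp.
  by apply: null_lift; apply: (r3 rs).
rewrite -/(hsum (F :: s) F) h_consF // exprNn => y /=; rewrite -mulrA.
have -> : ((-1) ^+ rho F * ('X^(rho F) * y) : {poly S s}) = 'X^(rho F) * ((-1) ^+ rho F * y) by ring.
case: eqP => _; last by apply: Dbl_Xn; apply: (lin0 hD.1).
by rewrite /Dcoef coefXnM ltn_predL (g_pos gU UF) (lin0 hD.1) mulr0.
Qed.

End Relations.
End Rho.

Local Notation S rho s := (stS (stl rho s)).
Local Notation X rho s := (@stX (stl rho s)).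
Local Notation D rho s := (@stD (stl rho s)).

Section Theta.
Variables (rho : L -> nat) (T : ga R).

(** Evaluates the tower at the values [y] of its divisors. The polynomial variable of a step is
    minus a partial sum of divisors, which dictates its image. *)
Fixpoint th (y : L -> T) (s : seq L) : {rmorphism stS (stl rho s) -> T} :=
  if s is F :: s' then thstep (th y s') (- \sum_(H | le F H) y H) else ga_sc T.

Lemma th_sc y s a : th y s (ga_sc (S rho s) a) = ga_sc T a.
Proof. by elim: s => //= F s IH; rewrite -IH; apply: thstepC. Qed.

Lemma th_consC y F s (c : S rho s) : th y (F :: s) (c%:P : {poly S rho s}) = th y s c.
Proof. exact: thstepC. Qed.
Lemma th_consX y F s : th y (F :: s) ('X : {poly S rho s}) = - \sum_(H | le F H) y H.
Proof. exact: thstepX. Qed.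
Lemma th_consMD y F s (g : {poly S rho s}) c : th y (F :: s) (g * 'X + c%:P : {poly S rho s}) =
  th y (F :: s) g * (- \sum_(H | le F H) y H) + th y s c.
Proof. by rewrite rmorphD rmorphM th_consC th_consX. Qed.

Lemma th_hom y s k f : (forall H, ga_hom 1 (y H)) -> ga_hom k f -> ga_hom k (th y s f).
Proof.
move=> hy; elim: s k f => [|F s IH] k f hf.
  case: k hf => [|k] hf; first exact: ga_homsc.
  have -> : f = 0 by apply: hf.
  by rewrite rmorph0; apply: ga_hom0.
rewrite (poly_expand (poly_hom_size hf)) rmorph_sum; apply: hom_sum => i _.
rewrite rmorphM rmorphXn /= thstepC thstepX.
have ei : ((k - i) + i)%N = k by have := ltn_ord i; lia.
apply: (homE ei); apply: ga_homM; first by apply: IH; apply: (hf i).1.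
by apply: homX1; apply: homN; apply: hom_sum.
Qed.

Definition ideal (J : T -> Prop) :=
  [/\ J 0, forall a b, J a -> J b -> J (a + b) & forall a b, J b -> J (a * b)].

Lemma ideal_sum J (I : Type) (r : seq I) (P : pred I) (F : I -> T) : ideal J ->
  (forall i, P i -> J (F i)) -> J (\sum_(i <- r | P i) F i).
Proof.
by move=> [J0 JD JM] h; elim/big_rec: _ => // i x Pi hx; apply: JD => //; apply: h.
Qed.
Lemma idealN J a : ideal J -> J a -> J (- a).
Proof. by move=> [_ _ JM] /(JM (-1)); rewrite mulN1r. Qed.
Lemma idealB J a b : ideal J -> J a -> J b -> J (a - b).
Proof. by move=> hJ ha hb; have [_ JD _] := hJ; apply: JD => //; apply: idealN. Qed.
Lemma idealMr J a b : ideal J -> J a -> J (a * b).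
Proof. by move=> [_ _ JM] ha; rewrite mulrC; apply: JM. Qed.
Lemma ideal_le J a m n : ideal J -> (m <= n)%N -> J (a ^+ m) -> J (a ^+ n).
Proof. by move=> [_ _ JM] mn h; rewrite -(subnK mn) exprD; apply: JM. Qed.

(** The map is built from the partial sums of [y] alone. *)
Lemma th_cong J y y' s : ideal J ->
  (forall K, K \in s -> J (\sum_(H | le K H) y H - \sum_(H | le K H) y' H)) ->
  forall f, J (th y s f - th y' s f).
Proof.
move=> hJ; have [J0 JD JM] := hJ; elim: s => [|F s IH] hy f; first by rewrite subrr.
have IH' : forall c, J (th y s c - th y' s c).
  by apply: IH => K Ks; apply: hy; rewrite inE Ks orbT.
elim/poly_ind: (f : {poly S rho s}) => [|g c hg].
  by rewrite !rmorph0 subrr.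
rewrite !rmorphD !rmorphM /= !thstepC !thstepX.
set a := thstep _ _ g in hg *; set a' := thstep _ _ g in hg *.
set v := - _; set v' := - \sum_(H | le F H) y' H.
have -> : a * v + th y s c - (a' * v' + th y' s c) =
  v * (a - a') + (a' * (v - v')) + (th y s c - th y' s c) by ring.
apply: (JD _ _ _ (IH' c)); apply: JD; first exact: JM.
apply: JM; rewrite /v /v' -opprD; apply: idealN => //; apply: hy; exact: mem_head.
Qed.

Lemma th_ext y y' s : (forall K, K \in s -> \sum_(H | le K H) y H = \sum_(H | le K H) y' H) ->
  forall f, th y s f = th y' s f.
Proof.
move=> h f; apply/eqP; rewrite -subr_eq0; apply/eqP.
apply: (th_cong (J := fun x => x = 0)) => [|K Ks].
  split=> // [a b -> ->|a b ->]; [by rewrite addr0 | by rewrite mulr0].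
by rewrite h // subrr.
Qed.

Lemma th_X U y s G : (forall H, ~~ U H -> y H = 0) -> ok U s ->
  th y s (X rho s G) = if G \in s then y G else 0.
Proof.
move=> hy; elim: s G => [|F s IH] G oks; first by rewrite /= rmorph0.
have [UF Fs up oks'] := oks.
rewrite X_cons inE; case: eqP => [->|_] /=; last by rewrite thstepC IH.
rewrite rmorphB /= thstepC thstepX /hsum rmorphN rmorph_sum opprK (bigD1 F) ?ole_refl //=.
rewrite IH // (negbTE Fs) add0r [W in _ + W](bigD1 F) ?ole_refl //= addrCA.
rewrite (eq_bigr y) ?addNr ?addr0 // => H /andP [FH HF]; rewrite IH //.
by case: ifP => // /negbT Hs; rewrite hy //; apply: contra Hs => UH; apply: up; rewrite // /olt FH eq_sym.
Qed.

End Theta.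

Lemma th_comp rho (T T' : ga R) (phi : {rmorphism T -> T'}) (y : L -> T) s f :
  (forall a, phi (ga_sc T a) = ga_sc T' a) ->
  phi (th rho y s f) = th rho (fun H => phi (y H)) s f.
Proof.
move=> hphi; elim: s f => [|F s IH] f; first exact: hphi.
elim/poly_ind: (f : {poly S rho s}) => [|g c hg]; first by rewrite !rmorph0.
rewrite !(rmorphD, rmorphM) /= !thstepC !thstepX IH; congr (_ * _ + _); first exact: hg.
by rewrite rmorphN rmorph_sum.
Qed.

Definition polyC_ga (A : ga R) : {rmorphism A -> polyGA A} :=
  GRing.RMorphism.clone A (polyGA A) (@polyC A) _.

Lemma th_id U rho s f : ok U s -> th rho (X rho s) s f = f.
Proof.
elim: s f => [|F s IH] f oks; first by [].
have [UF Fs up oks'] := oks.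
have hC c : th rho (X rho (F :: s)) s c = (c%:P : {poly S rho s}).
  transitivity (th rho (fun H => polyC_ga _ (X rho s H)) s c); last first.
    by rewrite -th_comp // IH.
  apply: th_ext => K Ks; rewrite -[RHS](rmorph_sum (polyC_ga _)).
  apply: h_consN; apply: contra Fs => KF; exact: ok_up oks' Ks UF KF.
elim/poly_ind: (f : {poly S rho s}) => [|g c hg]; first by rewrite rmorph0.
rewrite th_consMD hC; congr (_ * _ + _); first exact: hg.
by rewrite -/(hsum rho (F :: s) F) h_consF // opprK.
Qed.

(* Restriction to the centre of the blow-up at [F]. *)
Definition zP F H := (top H != top F) || olt F H.
Definition zrho rho F H : nat := if top H == top F then (rho H - rho F)%N else rho H.

Lemma zP_le F H K : le H K -> zP F H -> zP F K.
Proof.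
move=> HK; rewrite /zP (top_le oax HK) => /orP [->//|/andP [FH nFH]].
apply/orP; right; rewrite /olt (ole_trans oax FH HK) /=.
by apply: contra nFH => /eqP e; rewrite e in FH *; rewrite (ole_anti oax FH HK).
Qed.

(** In the component of [F], the bound [g_sub] for the new rank is [g_sub2] for the old rank with
    lower bound [F]. This closure under centres is the reason for [g_sub2]. *)
Lemma good_z U rho F : good U rho -> U F -> good (fun H => U H && zP F H) (zrho rho F).
Proof.
move=> gU UF.
have rz H : U H -> zP F H -> top H = top F -> olt F H /\ (rho F < rho H)%N.
  move=> UH; rewrite /zP => /orP [/eqP n /n //|FH _]; split=> //.
  exact: (g_mono gU UF UH FH).
split.
- move=> H /andP [UH zH]; rewrite (g_top gU) //=; exact: zP_le (ole_top oax H) zH.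
- move=> H /andP [UH zH]; rewrite /zrho; case: eqP => [e|_]; last exact: (g_pos gU UH).
  by rewrite subn_gt0; case: (rz H).
- move=> G H /andP [UG zG] /andP [UH zH] GH; rewrite /zrho -(top_le oax (olt_ole GH)).
  have := g_mono gU UG UH GH; case: eqP => // e; have [_ r1] := rz G UG zG e; lia.
- move=> G H /andP [UG zG] /andP [UH zH] t; rewrite (g_join gU) //=.
  exact: zP_le (g_joinl gU UG UH t) zG.
- by move=> G H /andP [UG zG] /andP [UH zH] t; apply: (g_joinl gU).
- by move=> G H /andP [UG zG] /andP [UH zH] t; apply: (g_joinr gU).
- move=> G H /andP [UG zG] /andP [UH zH] t K /andP [UK zK]; exact: (g_lub gU).
- move=> G H /andP [UG zG] /andP [UH zH] t; rewrite /zrho -(top_le oax (g_joinl gU UG UH t)) -t.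
  case: eqP => e; last exact: (g_sub gU).
  have [l1 r1] := rz G UG zG e; have [l2 r2] := rz H UH zH (etrans (esym t) e).
  have := g_sub2 gU UG UH UF t (olt_ole l1) (olt_ole l2); lia.
move=> G H K /andP [UG zG] /andP [UH zH] /andP [UK zK] t KG KH.
rewrite /zrho -(top_le oax (g_joinl gU UG UH t)) -t (top_le oax KG).
have := g_sub2 gU UG UH UK t KG KH; case: eqP => // e.
have [_ r1] := rz G UG zG e; have [_ r2] := rz H UH zH (etrans (esym t) e).
have [_ r3] := rz K UK zK (etrans (top_le oax KG) e).
have tJ := etrans (esym (top_le oax (g_joinl gU UG UH t))) e.
by have [_ r4] := rz _ (g_join gU UG UH t) (zP_le (g_joinl gU UG UH t) zG) tJ; lia.
Qed.

Lemma ok_z U F s : ok U s -> ok (fun H => U H && zP F H) (filter (zP F) s).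
Proof.
elim: s => //= G s IH [UG Gs up /IH h]; case: ifP => // zG; split=> //.
- by rewrite UG.
- by rewrite mem_filter (negbTE Gs) andbF.
by move=> H /andP [UH zH] GH; rewrite mem_filter zH up.
Qed.

Lemma rels_null_hom (T : ga R) d (D0 : T -> R) (hD : degfun d D0) : ideal (null D0).
Proof.
by split; [apply: (null0 hD) | move=> a b; apply: (nullD hD) | move=> a b; apply: nullM].
Qed.

(** In top degree every class is its integral times [m0] modulo null, so a map preserving null
    classes and the integral of [m0] preserves all integrals. The dimensions agree because [m0] has
    degree [dims rho s] and 1 is nonzero. *)
Lemma state_uniq U rho s (T : ga R) d (D0 : T -> R) (y : L -> T) : good U rho -> ok U s ->
  degfun d D0 -> (forall H, ga_hom 1 (y H)) ->
  (forall f, null (D rho s) f -> null D0 (th rho y s f)) -> D0 (th rho y s (m0 rho s)) = 1 ->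
  d = dims rho s /\ forall f, D0 (th rho y s f) = D rho s f.
Proof.
move=> gU oks hD hy hn h1; have hS := D_degfun rho s.
have ed : d = dims rho s.
  apply/eqP/negPn/negP => nd; have := oner_neq0 R; rewrite -h1 => /eqP; apply.
  by apply: (hD.2 _ _ (th_hom hy (m0_hom rho s))); rewrite eq_sym.
split=> //; apply: ga_ind => [f g hf hg|k f hf].
  by rewrite rmorphD (linD hD.1) (linD hS.1) hf hg.
have [ek|nk] := eqVneq k (dims rho s); last first.
  by rewrite (hS.2 k) // (hD.2 k) // ?ed //; apply: th_hom.
pose g := f - ga_sc _ (D rho s f) * m0 rho s.
have hg : ga_hom k g.
  by apply: homB => //; apply: homZ; rewrite ek; apply: m0_hom.
have ng : null (D rho s) g.
  apply: (null_hom hS hg) => j z ej hz; have j0 : j = 0%N by lia.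
  rewrite j0 in hz; have [a ->] := hom0_sc hz.
  rewrite mulrC (linZ hS.1) (linB hS.1) (linZ hS.1) (D_m0 gU oks) mulr1 subrr mulr0 //.
have := null_eq0 (hn g ng); rewrite /g rmorphB rmorphM th_sc (linB hD.1) (linZ hD.1) h1 mulr1.
by move=> /eqP; rewrite subr_eq0 => /eqP.
Qed.

(** The relations [rels] generate the annihilator, stated as a universal property: values satisfying
    them modulo an ideal [J] send null classes into [J]. The bound on the length lets this be the
    induction hypothesis for base and centre alike. *)
Definition null_to_rels n := forall s, (size s <= n)%N -> forall U rho, good U rho -> ok U s ->
  forall (T : ga R) (y : L -> T) (J : T -> Prop), ideal J -> (forall H, ~~ U H -> y H = 0) ->
  rels rho y J s -> forall f, null (D rho s) f -> J (th rho y s f).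

End State.

Section State.
Variables (L : finType) (le : rel L) (top : L -> L) (join : L -> L -> L).
Hypothesis oax : order_ax le top.
Variable R : comNzRingType.
Local Notation olt := (olt le).
Local Notation zP := (zP le top).
Local Notation zrho := (zrho top).
Local Notation dims := (dims top).
Local Notation good := (good le top join).
Local Notation ok := (ok le).
Local Notation stl := (stl le top R).
Local Notation th := (th le top).
Local Notation rels := (rels le top).
Local Notation m0 := (m0 le top R).
Local Notation S rho s := (stS (stl rho s)).
Local Notation X rho s := (@stX _ _ (stl rho s)).
Local Notation D rho s := (@stD _ _ (stl rho s)).
Local Notation hsum := (hsum le top R).
Local Notation null_to_rels := (null_to_rels le top join R).

Lemma leq_subS (a b c : nat) : (b < c)%N -> (a - c <= (a - b).-1)%N.
Proof. by move=> h; rewrite -subnS leq_sub2l. Qed.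

(** * The centre of a blow-up as a smaller tower *)

Section Centre.
Variables (U : pred L) (rho : L -> nat) (F : L) (s : seq L).
Hypotheses (gU : good U rho) (oks : ok U (F :: s)) (tF : top F != F).
Let UF : U F. Proof. by case: oks. Qed.
Let Fs : F \notin s. Proof. by case: oks. Qed.
Let up : forall H, U H -> olt F H -> H \in s. Proof. by case: oks. Qed.
Let oks' : ok U s. Proof. by case: oks. Qed.
Let rs := stl_rels oax R gU oks'.
Let z := filter (zP F) s.
Let Uz := fun H => U H && zP F H.
Let rz := zrho rho F.
Let gz : good Uz rz := good_z oax gU UF.
Let okz : ok Uz z := ok_z top F oks'.
Let hD := D_degfun le top R rho s.

(** The class of the centre is the [rho F]-th power of [- hsum rho s F], so this is integration over
    the centre. *)
Definition Dcen (x : S rho s) : R := D rho s ((- hsum rho s F) ^+ rho F * x).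

Lemma Dcen_degfun : degfun (dims rho s - rho F) Dcen.
Proof.
split; first by split=> *; rewrite /Dcen ?mulrDr ?(linD hD.1) // mulrCA (linZ hD.1).
move=> k x hx kd.
have [e|e] := eqVneq (rho F + k)%N (dims rho s); first by rewrite -e addKn eqxx in kd.
by apply: (hD.2 _ _ _ e); apply: ga_homM => //; apply: homX1; apply: homN; apply: h_hom.
Qed.

Let hc := Dcen_degfun.

Definition yz H := if zP F H then X rho s H else 0.
Lemma yz_hom H : ga_hom 1 (yz H).
Proof. by rewrite /yz; case: ifP => _; [apply: X_hom | apply: ga_hom0]. Qed.

Lemma yz_U H : ~~ Uz H -> yz H = 0.
Proof.
rewrite /Uz negb_and /yz => /orP [nU|/negbTE ->] //; case: ifP => // _.
by apply: X_out; apply: contra nU; exact: (ok_U oks').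
Qed.

Let sum_yz G : G \in z -> \sum_(K | le G K) yz K = hsum rho s G.
Proof.
rewrite mem_filter => /andP [zG _]; apply: eq_bigr => K GK.
by rewrite /yz (zP_le oax GK zG).
Qed.

Let zin G : G \in z -> G \in s /\ zP F G.
Proof. by rewrite mem_filter => /andP []. Qed.

Let lt_zP G : top G = top F -> zP F G -> olt F G.
Proof. by rewrite /zP => -> /orP [/eqP|]. Qed.

Let nullc x : null (D rho s) x -> null Dcen x.
Proof. by move=> nx w; rewrite /Dcen mulrCA nx. Qed.

Let rz_sub G H : G \in z -> H \in z -> olt G H -> (rz H - rz G = rho H - rho G)%N.
Proof.
move=> /zin [Gs zG] /zin [Hs zH] GH.
rewrite /rz /zrho -(top_le oax (olt_ole GH)); case: eqP => // e.
have := g_mono gU UF (ok_U oks' Gs) (lt_zP e zG).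
by have := g_mono gU (ok_U oks' Gs) (ok_U oks' Hs) GH; lia.
Qed.

(** Only [r3] in the component of [F] is new, and it is [null_excpow]; the other relations restrict
    from the base. *)
Lemma rels_centre : rels rz yz (null Dcen) z.
Proof.
split.
- move=> G H /zin [Gs zG] /zin [Hs zH] t GH HG; rewrite /yz zG zH; apply: nullc; exact: (r1 rs).
- move=> G H Gz Hz GH; have [Gs zG] := zin Gz; have [Hs zH] := zin Hz.
  rewrite sum_yz // /yz zG; apply: nullc.
  rewrite rz_sub //.
  exact: (r2 rs).
move=> G Gz; have [Gs zG] := zin Gz; rewrite sum_yz // /rz /zrho.
case: eqP => e; last by apply: nullc; apply: (r3 rs).
move=> w; rewrite /Dcen exprNn -mulrA (mulrA (hsum _ _ _ ^+ _)) mulrCA.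
by apply: (null_excpow oax gU) => //; exact: lt_zP.
Qed.

Let T0 := top F.
Let T0s : T0 \in s.
Proof. by apply: up; [apply: (g_top gU UF) | rewrite /olt (ole_top oax) eq_sym]. Qed.
Let T0z : T0 \in z.
Proof.
by rewrite mem_filter T0s andbT /zP (top_top oax F) eqxx /= /olt (ole_top oax) eq_sym.
Qed.
Let T0lt : olt F T0. Proof. by rewrite /olt (ole_top oax) eq_sym. Qed.

Let uniq_s : uniq s.
Proof.
elim: (s) oks' => //= G s' IH [_ -> _ /IH ->] //.
Qed.

Lemma centre_le : (rho F <= dims rho s)%N.
Proof.
have rT : (rho F < rho T0)%N := g_mono gU UF (g_top gU UF) T0lt.
apply: (@leq_trans (rho T0).-1); first by rewrite -ltnS (ltn_predK rT).
by rewrite /dims (big_rem T0) //= (top_top oax) eqxx leq_addr.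
Qed.

(** Trading the factors [hsum F] for the divisor of [top F] turns the product with the class of the
    centre into [m0], which normalises integration over the centre. *)
Lemma centre_prod : Dcen ((- X rho s T0) ^+ (rho T0 - rho F).-1 *
  \prod_(G | (G \in s) && (top G == G) && (G != T0)) (- X rho s G) ^+ (rho G).-1) = 1.
Proof.
set P := \prod_(G | _) _.
have rT : (rho F < rho T0)%N := g_mono gU UF (g_top gU UF) T0lt.
have tT : top T0 = T0 by apply: (top_top oax).
have e1 : m0 rho s = (- X rho s T0) ^+ (rho T0).-1 * P.
  by rewrite m0E // (bigD1 T0) ?T0s ?tT ?eqxx.
rewrite /Dcen -(D_m0 oax R gU oks') e1.
have hT : hsum rho s T0 = X rho s T0 by apply: (h_top oax).
pose b0 := (rho T0 - rho F).-1.
have tele a : (a <= rho F)%N -> null (D rho s)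
    (hsum rho s F ^+ a * X rho s T0 ^+ (rho F - a + b0) - X rho s T0 ^+ (rho F + b0)).
  elim: a => [|a IH] ha.
    by rewrite expr0 mul1r subn0 subrr; apply: null0 hD.
  rewrite -(subrK (hsum rho s F ^+ a * X rho s T0 ^+ (rho F - a + b0)) (_ * _)) -addrA.
  apply: (nullD hD); last by apply: IH; apply: ltnW.
  have -> : (rho F - a + b0 = (rho F - a.+1 + b0).+1)%N by lia.
  rewrite -hT; apply: (null_tele oax gU) => // K Ks FK TK.
  have UK := ok_U oks' Ks.
  have tTK : top T0 = top K by rewrite tT /T0; apply: top_le (olt_ole FK).
  have eJ : join T0 K = T0.
    by apply: (top_maxE oax tT); apply: (g_joinl gU) => //; apply: (g_top gU UF).
  rewrite eJ; apply: (leq_trans (leq_subS _ (g_mono gU UF UK FK))); exact: leq_addl.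
have nt := tele (rho F) (leqnn _); rewrite subnn add0n in nt.
have -> : (rho T0).-1 = (rho F + b0)%N by rewrite /b0; lia.
apply: (null_congr hD); set h0 := hsum rho s F in nt *; set x0 := X rho s T0 in nt *.
have -> : (- h0) ^+ rho F * ((- x0) ^+ b0 * P) - (- x0) ^+ (rho F + b0) * P =
   (-1) ^+ (rho F + b0) * P * (h0 ^+ rho F * x0 ^+ b0 - x0 ^+ (rho F + b0)).
  by rewrite !(exprNn h0) !(exprNn x0) !exprD; ring.
exact: nullM.
Qed.

Lemma centre_m0 : Dcen (th rz yz z (m0 rz z)) = 1.
Proof.
rewrite -centre_prod; congr Dcen.
pose P := \prod_(G | (G \in s) && (top G == G) && (G != T0)) (- X rho s G) ^+ (rho G).-1.
have tT : top T0 = T0 by apply: (top_top oax).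
  rewrite m0E ?filter_uniq // rmorph_prod (bigD1 T0) ?T0z ?tT ?eqxx //=.
  rewrite rmorphXn rmorphN /= (th_X oax rz T0 yz_U okz) T0z /yz.
  have [_ ->] := zin T0z; rewrite /rz {1}/zrho tT eqxx; congr (_ * _).
  apply: eq_big => [G|G /andP [/andP [Gz /eqP tG] GT]] /=.
    case tG: (top G == G) => /=; rewrite ?andbF // !andbT /z mem_filter.
    have [->|nGT] := eqVneq G T0; rewrite ?andbF //= !andbT.
    rewrite /zP; have [e|//] := eqVneq (top G) (top F).
    by move/eqP: tG nGT; rewrite e => <-; rewrite eqxx.
  rewrite rmorphXn rmorphN /= (th_X oax rz G yz_U okz) Gz /yz.
  have [_ ->] := zin Gz; rewrite /rz /zrho; case: eqP => // e.
  by move: GT; rewrite -tG e eqxx.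
Qed.

Let phi := th rho (X rz z) s.

Let th_sumE (T : ga R) (J : T -> Prop) (y w : L -> T) K : ideal J -> K \in s ->
  (forall H, H != F -> ~~ U H -> J (y H - w H)) ->
  (forall H, H \in s -> zP F H -> J (y H - w H)) ->
  (forall H, H \in s -> top H = top F -> ~~ le F H -> ~~ le H F -> J (y H - w H)) ->
  J (\sum_(H | le K H) y H - \sum_(H | le K H) w H).
Proof.
move=> hJ Ks h1 h2 h3; rewrite -sumrB; apply: ideal_sum => // H KH.
have HF : H != F by apply: contraNneq Fs => e; rewrite e in KH; exact: (ok_up oks' Ks UF KH).
have [Hs|Hs] := boolP (H \in s); last first.
  by apply: h1 => //; apply: contra Hs => UH; apply: (ok_up oks' Ks UH KH).
have [|nz] := boolP (zP F H); first exact: h2.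
move: nz; rewrite /zP negb_or negbK => /andP [/eqP tH nFH].
apply: h3 => //; first by apply: contra nFH => FH; rewrite /olt FH eq_sym.
by apply: contra Fs => FH; exact: (ok_up oks' Hs UF FH).
Qed.

Hypothesis IHz : null_to_rels (size s).
Let size_z : (size z <= size s)%N. Proof. by rewrite size_filter count_size. Qed.

Lemma centre_deg : (dims rho s - rho F = dims rz z)%N /\
  forall f, Dcen (th rz yz z f) = D rz z f.
Proof.
apply: (state_uniq oax gz okz hc yz_hom) centre_m0 => f.
apply: (IHz size_z gz okz) yz_U rels_centre _; exact: rels_null_hom hc.
Qed.

(** By [g_sub] the exponent [rho F] suffices for [null_XhX]: such divisors do not meet the
    centre. *)
Lemma centre_incomp H : H \in s -> ~~ zP F H -> null Dcen (X rho s H).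
Proof.
move=> Hs; rewrite /zP negb_or negbK => /andP [/eqP tH nFH].
have FH : ~~ le F H.
  by apply: contra nFH => FH; rewrite /olt FH; apply: contraNneq Fs => ->.
have n1 : null (D rho s) (X rho s H * hsum rho s F ^+ rho F).
  apply: (null_XhX oax gU) => //; rewrite leq_subLR addnC.
  exact: (g_sub gU UF (ok_U oks' Hs) (esym tH)).
move=> w; rewrite /Dcen exprNn.
set a := X rho s H in n1 *; set b := hsum rho s F ^+ rho F in n1 *.
have -> : (-1) ^+ rho F * b * (a * w) = a * b * ((-1) ^+ rho F * w) by ring.
exact: n1.
Qed.

Lemma centre_onto f : null Dcen (th rz yz z (phi f) - f).
Proof.
rewrite /phi (th_comp (T := S rz z) (phi := th rz yz z)); last exact: th_sc.
have {2}-> : f = th rho (X rho s) s f by rewrite (th_id oax _ oks').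
have hJ := rels_null_hom hc.
apply: (th_cong (J := null Dcen) hJ) => // K Ks; apply: th_sumE => // H.
- move=> HF nU; rewrite (th_X oax rz H yz_U okz) X_out ?subr0; last first.
    by apply: contra nU; exact: (ok_U oks').
  case: ifP => [/zin [Hs]|_]; last by case: hJ.
  by rewrite (ok_U oks' Hs) in nU.
- move=> Hs zH; rewrite (th_X oax rz H yz_U okz) mem_filter zH Hs /yz zH subrr.
  by case: hJ.
move=> Hs tH FH HF; rewrite (th_X oax rz H yz_U okz) mem_filter.
have -> : zP F H = false by rewrite /zP tH eqxx /olt (negbTE FH).
rewrite sub0r; apply: (nullN hc); apply: centre_incomp => //.
by rewrite /zP tH eqxx /olt (negbTE FH).
Qed.

Lemma centre_null g : null Dcen g -> null (D rz z) (phi g).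
Proof.
move=> ng w; have [_ <-] := centre_deg; rewrite rmorphM.
rewrite (null_congr (x := _) (y := g * th rz yz z w) hc) ?ng //.
rewrite -mulrBl; apply: nullMr; exact: centre_onto.
Qed.

Variables (T : ga R) (y : L -> T) (J : T -> Prop).
Hypotheses (hJ : ideal J) (yU : forall H, ~~ U H -> y H = 0) (rJ : rels rho y J (F :: s)).
Let J' t := J (y F * t).
Let hJ' : ideal J'.
Proof.
have [J0 JD JM] := hJ; split; rewrite /J'; first by rewrite mulr0.
  by move=> a b ha hb; rewrite mulrDr; apply: JD.
by move=> a b hb; rewrite mulrCA; apply: JM.
Qed.
Let JJ' t : J t -> J' t. Proof. by case: hJ => _ _; apply. Qed.
Let w H := if zP F H then y H else 0.
Let sum_w G : G \in z -> \sum_(K | le G K) w K = \sum_(K | le G K) y K.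
Proof.
rewrite mem_filter => /andP [zG _]; apply: eq_bigr => K GK.
by rewrite /w (zP_le oax GK zG).
Qed.

Let w_U H : ~~ Uz H -> w H = 0.
Proof. by rewrite /Uz negb_and /w => /orP [nU|/negbTE ->] //; rewrite yU // if_same. Qed.

Let rels_w : rels rz w J' z.
Proof.
have sin G : G \in s -> G \in F :: s by rewrite inE orbC => ->.
split.
- move=> G H /zin [Gs zG] /zin [Hs zH] t GH HG; rewrite /w zG zH; apply: JJ'.
  by apply: (r1 rJ); rewrite ?sin.
- move=> G H Gz Hz GH; have [Gs zG] := zin Gz; have [Hs zH] := zin Hz.
  rewrite sum_w // /w zG; apply: JJ'.
  rewrite rz_sub //.
  by apply: (r2 rJ); rewrite ?sin.
move=> G Gz; have [Gs zG] := zin Gz; rewrite sum_w // /rz /zrho.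
case: eqP => e; last by apply: JJ'; apply: (r3 rJ); rewrite sin.
by apply: (r2 rJ); rewrite ?mem_head ?sin ?lt_zP.
Qed.

(** Modulo the colon ideal of [J] by [y F] the values [w] satisfy the relations of the centre: its
    [r3] in the component of [F] is [r2] for the pair of [F] and the element. The universal property
    of the centre then applies, and elements missing the centre contribute nothing by [r1]. *)
Lemma centre_ideal g : null Dcen g -> J (y F * th rho y s g).
Proof.
move=> /centre_null ng; have [J0 JD JM] := hJ'.
have j1 : J' (th rz w z (phi g)) := IHz size_z gz okz hJ' w_U rels_w ng.
move: j1; rewrite /phi (th_comp (T := S rz z) (phi := th rz w z)); last exact: th_sc.
move=> j1; rewrite -/(J' _) -(subKr (th rho (fun H => th rz w z (X rz z H)) s g) (th rho y s g)).
apply: (idealB hJ' j1); apply: (th_cong hJ') => // K Ks; apply: th_sumE => // H.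
- move=> HF nU; rewrite (th_X oax rz H w_U okz) yU // subr0.
  case: ifP => [/zin [Hs]|_] //; by rewrite (ok_U oks' Hs) in nU.
- by move=> Hs zH; rewrite (th_X oax rz H w_U okz) mem_filter zH Hs /w zH subrr.
move=> Hs tH FH HF; rewrite (th_X oax rz H w_U okz) mem_filter.
have -> : zP F H = false by rewrite /zP tH eqxx /olt (negbTE FH).
rewrite sub0r; apply: idealN => //; apply: (r1 rJ) => //; first exact: mem_head.
by rewrite inE Hs orbT.
Qed.
End Centre.

Lemma rels_tail rho (T : ga R) (y : L -> T) (J : T -> Prop) F s :
  rels rho y J (F :: s) -> rels rho y J s.
Proof.
have sin G : G \in s -> G \in F :: s by rewrite inE orbC => ->.
by move=> [h1 h2 h3]; split=> *; [apply: h1|apply: h2|apply: h3]; rewrite ?sin.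
Qed.

Lemma th_expand rho (T : ga R) (y : L -> T) F s (f : {poly S rho s}) n : (size f <= n)%N ->
  th rho y (F :: s) f = \sum_(i < n) th rho y s f`_i * (- \sum_(H | le F H) y H) ^+ i.
Proof.
move=> hn; rewrite (poly_expand hn) rmorph_sum; apply: eq_bigr => i _.
by rewrite rmorphM rmorphXn /= thstepC thstepX -poly_expand.
Qed.

(** High powers of the last variable are killed by [r3]. For a product, the low coefficients are
    null on the base. For a blow-up, they are null on the centre, and putting [beta] for the
    variable gives a null class of the base; the two substitutions differ by multiples of [y F]
    times coefficients null on the centre, which [centre_ideal] handles. *)
Lemma null_to_relsP n : null_to_rels n.
Proof.
elim: n => [|n IH] [|F s] // hs U rho gU oks T y J hJ yU rJ f nf; have [J0 JD JM] := hJ.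
- by have := nf 1; rewrite mulr1 => /= ->; rewrite rmorph0.
- by have := nf 1; rewrite mulr1 => /= ->; rewrite rmorph0.
have [UF Fs up oks'] := oks.
have IHs := IH s hs U rho gU oks' T y J hJ yU (rels_tail rJ).
have rF := g_pos gU UF.
rewrite (th_expand y (n := size f) F) //; set v := - _.
have jv : J (v ^+ rho F) by rewrite exprNn; apply: JM; apply: (r3 rJ); apply: mem_head.
have [tF|tF] := eqVneq (top F) F.
  apply: ideal_sum => // i _; have [ci|ic] := leqP (rho F) i.
    by apply: JM; apply: (ideal_le hJ ci jv).
  apply: idealMr => //; apply: IHs => e.
  have := nf (e%:P * 'X^((rho F).-1 - i) : {poly S rho s}).
  rewrite /= tF eqxx /Dcoef mul1r mulrA coefMXn ifF; last by apply/negbTE; lia.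
  have -> : ((rho F).-1 - ((rho F).-1 - i) = i)%N by lia.
  by rewrite coefMC.
have hz : null_to_rels (size s) by move=> s0 hs0; apply: IH; exact: (leq_trans hs0 hs).
(* Pairing with the exceptional divisor times a power of the variable reads off a single coefficient
   on the centre. *)
have nc (i : nat) : (i < rho F)%N -> null (Dcen (rho := rho) F (s := s)) f`_i.
  move=> ic e; have := nf (((- hsum rho s F)%:P - 'X) * (e%:P * 'X^((rho F).-1 - i)) : {poly S rho s}).
  rewrite /= (negbTE tF) mulrCA -[in Dbl (rho F)](prednK rF) Dbl_exc prednK // mulrA coefMXn ifF; last first.
    by apply/negbTE; lia.
  have -> : ((rho F).-1 - ((rho F).-1 - i) = i)%N by lia.
  by rewrite coefMC.
pose b := - \sum_(H | le F H && (H != F)) y H.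
have bE : th rho y s (- hsum rho s F) = b.
  rewrite /b rmorphN rmorph_sum (bigD1 F) ?(ole_refl oax) //= X_out // rmorph0 add0r; congr (- _).
  apply: eq_bigr => H /andP [FH HF]; rewrite (th_X oax rho H yU oks').
  case: ifP => // /negbT Hs; rewrite yU //; apply: contra Hs => UH; apply: up => //.
  by rewrite /olt FH eq_sym.
have vE : v = b - y F.
  by rewrite /v /b [in LHS](bigD1 F) ?(ole_refl oax) //= opprD addrC.
have ns : null (D rho s) (\sum_(i < rho F) (- hsum rho s F) ^+ i * f`_i).
  move=> e; have := nf (e%:P : {poly S rho s}); rewrite /= (negbTE tF) /Dbl => e0.
  by rewrite mulr_suml; apply: etrans e0; congr (D rho s _); apply: eq_bigr => i _; rewrite coefMC mulrA.
have := IHs _ ns; rewrite rmorph_sum => j1.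
have sE : \sum_(i < size f) th rho y s f`_i * v ^+ i =
   \sum_(i < maxn (size f) (rho F)) th rho y s f`_i * v ^+ i.
  rewrite (big_ord_widen _ (fun i => th rho y s f`_i * v ^+ i) (leq_maxl (size f) (rho F))) big_mkcond.
  by apply: eq_bigr => i _; case: ltnP => // hi; rewrite nth_default // rmorph0 mul0r.
rewrite sE; set n0 := maxn _ _.
have hn0 : (rho F <= n0)%N by apply: leq_maxr.
rewrite (bigID (fun i : 'I_n0 => (i < rho F)%N)) /=; apply: (JD _ _); last first.
  apply: ideal_sum => // i; rewrite -leqNgt => ci; apply: JM; exact: (ideal_le hJ ci jv).
rewrite -(big_ord_widen _ (fun i => th rho y s f`_i * v ^+ i) hn0).
rewrite -(subrK (\sum_(i < rho F) th rho y s ((- hsum rho s F) ^+ i * f`_i)) (\sum_(_ < _) _)).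
apply: (JD _ _ _ j1); rewrite -sumrB; apply: ideal_sum => // i _.
(* The difference of the [i]-th powers of [v] and [b] is a multiple of [v - b = - y F]. *)
rewrite rmorphM rmorphXn /= bE (mulrC (_ ^+ _)) -mulrBr subrXX vE addrAC subrr add0r.
rewrite mulNr mulrN; apply: idealN => //; rewrite mulrCA mulrA; apply: idealMr => //.
by apply: (centre_ideal gU oks tF hz hJ yU rJ); apply: nc.
Qed.
End State.

(** * Poincare duality over an arbitrary ring of coefficients *)

Section Functional.
Variables (R : comNzRingType) (S : ga R).
Implicit Types (D psi : S -> R).

Definition flin k psi := forall a x y, ga_hom k x -> ga_hom k y ->
  psi (ga_sc S a * x + y) = a * psi x + psi y.

Lemma flin0 k psi : flin k psi -> psi 0 = 0.
Proof.
by move=> /(_ (-1) 0 0); rewrite mulr0 addr0 mulN1r addNr; apply; apply: ga_hom0.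
Qed.
Lemma flinD k psi x y : flin k psi -> ga_hom k x -> ga_hom k y -> psi (x + y) = psi x + psi y.
Proof. by move=> h hx hy; have := h 1 x y hx hy; rewrite rmorph1 !mul1r. Qed.
Lemma flinZ k psi a x : flin k psi -> ga_hom k x -> psi (ga_sc S a * x) = a * psi x.
Proof.
by move=> h hx; have := h a x 0 hx (ga_hom0 _ _); rewrite !addr0 (flin0 h) addr0.
Qed.
Lemma flinB k psi x y : flin k psi -> ga_hom k x -> ga_hom k y -> psi (x - y) = psi x - psi y.
Proof.
move=> h hx hy; have := h (-1) y x hy hx; rewrite rmorphN rmorph1 !mulN1r.
by rewrite ![- _ + _]addrC.
Qed.
Lemma flin_sum k psi (I : Type) (r : seq I) (P : pred I) (F : I -> S) : flin k psi ->
  (forall i, P i -> ga_hom k (F i)) -> psi (\sum_(i <- r | P i) F i) = \sum_(i <- r | P i) psi (F i).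
Proof.
move=> h hF; suff [//] : psi (\sum_(i <- r | P i) F i) = \sum_(i <- r | P i) psi (F i) /\
  ga_hom k (\sum_(i <- r | P i) F i).
apply: (big_ind2 (fun a b => psi a = b /\ ga_hom k a)).
- by split; [apply: flin0 h | apply: ga_hom0].
- by move=> a b c e [<- ha] [<- hc]; split; [apply: (flinD h) | apply: ga_homD].
by move=> i Pi; split=> //; apply: hF.
Qed.

(* [x] has degree [a - b], computed in the integers. *)
Definition dhom (a b : nat) (x : S) :=
  (forall j, (j + b)%N = a -> ga_hom j x) /\ ((a < b)%N -> x = 0).

Lemma dhom0 a b : dhom a b 0.
Proof. by split=> // j _; apply: ga_hom0. Qed.
Lemma dhomB a b x y : dhom a b x -> dhom a b y -> dhom a b (x - y).
Proof.
move=> [h1 h2] [h3 h4]; split=> [j e|l]; first by apply: homB; [apply: h1|apply: h3].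
by rewrite h2 // h4 // subrr.
Qed.
Lemma dhomD a b x y : dhom a b x -> dhom a b y -> dhom a b (x + y).
Proof.
by move=> hx hy; rewrite -[y]opprK -[- y]sub0r; do 2! apply: dhomB => //; exact: dhom0.
Qed.
Lemma dhomE a b a' b' x : (a + b' = a' + b)%N -> dhom a b x -> dhom a' b' x.
Proof. by move=> e [h1 h2]; split=> [j ej|l]; [apply: h1|apply: h2]; lia. Qed.
Lemma dhom_sum a b (I : Type) (r : seq I) (P : pred I) (F : I -> S) :
  (forall i, P i -> dhom a b (F i)) -> dhom a b (\sum_(i <- r | P i) F i).
Proof.
move=> h; elim/big_rec: _ => [|i x Pi hx]; first exact: dhom0.
rewrite -[x]opprK; apply: dhomB; first exact: h.
rewrite -sub0r; apply: dhomB => //; exact: dhom0.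
Qed.
Lemma dhomM a b j x y : dhom a b x -> ga_hom j y -> dhom (a + j) b (x * y).
Proof.
move=> [h1 h2] hy; have [ab|ba] := ltnP a b.
  by rewrite h2 // mul0r; apply: dhom0.
split=> [i ei|l]; last lia.
have e : ((a - b) + j)%N = i by lia.
by apply: (homE e); apply: ga_homM => //; apply: h1; lia.
Qed.

(** The surjective half of Poincare duality; the injective half is built into [null]. Over a ring
    that is not a field it has to be carried through the tower. *)
Definition represents d D := forall k psi, flin k psi ->
  (forall w, ga_hom k w -> null D w -> psi w = 0) ->
  exists2 x, dhom d k x & forall w, ga_hom k w -> psi w = D (x * w).

End Functional.

Section RepTransfer.
Variables (R : comNzRingType) (S T : ga R) (f : {rmorphism T -> S}) (g : {rmorphism S -> T}).
Variables (d : nat) (D : S -> R) (E : T -> R).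
Hypotheses (hf : forall a, f (ga_sc T a) = ga_sc S a) (fh : forall k x, ga_hom k x -> ga_hom k (f x)).
Hypotheses (gh : forall k x, ga_hom k x -> ga_hom k (g x)).
Hypotheses (fD : forall x, D (f x) = E x) (fn : forall x, null E x -> null D (f x)).
Hypotheses (hD : degfun d D) (fg : forall x, null D (f (g x) - x)).

Lemma represents_transfer : represents d E -> represents d D.
Proof.
move=> hE k psi hp pn.
have [x hx px] : exists2 x, dhom d k x & forall w, ga_hom k w -> psi (f w) = E (x * w).
  apply: (hE k (fun w => psi (f w))).
    by move=> a x y hx hy; rewrite rmorphD rmorphM hf hp //; apply: fh.
  by move=> w hw nw; apply: pn; [apply: fh | apply: fn].
exists (f x).
  by split=> [j ej|l]; [apply: fh; apply: hx.1 | rewrite hx.2 // rmorph0].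
move=> w hw; have hgw : ga_hom k (f (g w)) by apply: fh; apply: gh.
have -> : psi w = psi (f (g w)).
  apply/eqP; rewrite eq_sym -subr_eq0 -(flinB hp) //; apply/eqP/pn => //.
  exact: homB.
rewrite px; last exact: gh.
rewrite -fD rmorphM; apply: (null_congr hD); rewrite -mulrBr; exact: nullM.
Qed.
End RepTransfer.

Section RepPoly.
Variables (R : comNzRingType) (S : ga R) (d : nat) (D : S -> R).
Hypotheses (hD : degfun d D) (hr : represents d D).

Lemma dhomC a b (x : S) : dhom a b x -> dhom (S := polyGA S) a b (x%:P : {poly S}).
Proof.
by move=> [h1 h2]; split=> [j e|l]; [apply: poly_homC; apply: h1 | rewrite h2 // polyC0].
Qed.

Lemma flinC k psi i : flin (S := polyGA S) (k + i) psi ->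
  flin k (fun g : S => psi (g%:P * 'X^i : {poly S})).
Proof.
move=> hp a x y hx hy; rewrite polyCD polyCM mulrDl -mulrA.
apply: hp.
- by apply: poly_homM; [apply: poly_homC | apply: poly_homXn].
- by apply: poly_homM; [apply: poly_homC | apply: poly_homXn].
Qed.

(** The coefficient of ['X^i] in a test class meets that of ['X^(c - i)] in the representative, so
    each coefficient is found on the base separately. *)
Lemma represents_top c : represents (S := polyGA S) (d + c) (Dcoef 1 c D).
Proof.
move=> k psi hp pn.
have /choice [x hx] i : exists x : S, (i <= c)%N -> (i <= k)%N -> dhom d (k - i) x /\
    forall w, ga_hom (k - i) w -> psi (w%:P * 'X^i : {poly S}) = D (x * w).
  have [ik|ik] := leqP i k; last by exists 0; lia.
  have [|w hw nw|x hx px] := hr (k := (k - i)%N) (psi := fun g => psi (g%:P * 'X^i : {poly S})).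
  - by apply: flinC; rewrite subnK.
  - apply: pn.
      have e : ((k - i) + i)%N = k by lia.
      by apply: (homE e); apply: poly_homM; [apply: poly_homC | apply: poly_homXn].
    by move=> y; rewrite /Dcoef -mulrA coefCM nw mulr0.
  by exists x.
pose X := \sum_(i < c.+1 | (i <= k)%N) (x i)%:P * 'X^(c - i) : {poly S}.
exists X.
  apply: dhom_sum => i ik; have ic := ltn_ord i.
  have [h1 _] := hx i ic ik.
  apply: (dhomE (a := (d + (c - i))%N) (b := (k - i)%N)); first lia.
  by apply: dhomM; [apply: dhomC | apply: poly_homXn].
move=> w hw; rewrite {1}(poly_expand (poly_hom_size hw)).
have hwi i : (i <= k)%N -> ga_hom (k - i) w`_i by move=> ik; apply: (hw i).1; lia.
rewrite (flin_sum _ hp); last first.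
  move=> i _; have ik := ltn_ord i; have e : ((k - i) + i)%N = k by lia.
  by apply: (homE e); apply: poly_homM; [apply: poly_homC; apply: hwi | apply: poly_homXn].
rewrite /Dcoef mul1r coefM.
have -> : D (\sum_(j < c.+1) X`_j * w`_(c - j)) = \sum_(i < c.+1 | (i <= k)%N) D (x i * w`_i).
  rewrite (lin_sum hD.1) (reindex_inj rev_ord_inj) [RHS]big_mkcond; apply: eq_bigr => i _ /=.
  have ic := ltn_ord i; rewrite subSS.
  have -> : (c - (c - i) = i)%N by lia.
  have -> : X`_(c - i) = if (i <= k)%N then x i else 0.
    rewrite /X coef_sum (bigID (eq_op^~ i)) /= [X in _ + X]big1 ?addr0; last first.
      move=> j /andP [_ ji]; rewrite coefCM coefXn; case: eqP => [e|_]; last by rewrite mulr0.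
      have jc := ltn_ord j; case/eqP: ji; apply: val_inj => /=; lia.
    case: ifP => ik.
      rewrite (big_pred1 i) ?coefCM ?coefXn ?eqxx ?mulr1 // => j /=.
      by case: eqP => [->|]; rewrite ?ik ?andbF.
    by rewrite big1 // => j /andP [jk /eqP ej]; rewrite ej ik in jk.
  by case: ifP => // _; rewrite mul0r (lin0 hD.1).
have nX i (y : S) : (c < i)%N -> ga_hom k (y%:P * 'X^i : polyGA S) -> psi (y%:P * 'X^i : {poly S}) = 0.
  move=> ci hy; apply: pn => // z; rewrite /Dcoef.
  have -> : y%:P * 'X^i * (z : {poly S}) = 'X^i * (y%:P * z) by ring.
  by rewrite coefXnM ci (lin0 hD.1) mulr0.
transitivity (\sum_(i < maxn k.+1 c.+1 | (i <= k)%N && (i <= c)%N) D (x i * w`_i)).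
  rewrite [RHS]big_mkcondr /= (big_ord_widen _ (fun i => psi ((w`_i)%:P * 'X^i : {poly S})) (leq_maxl k.+1 c.+1)).
  apply: eq_bigr => i; rewrite ltnS => ik; case: leqP => ic.
    by have [_ ->] := hx i ic ik; last exact: hwi.
  apply: nX => //; have e : ((k - i) + i)%N = k by lia.
  by apply: (homE e); apply: poly_homM; [apply: poly_homC; apply: hwi | apply: poly_homXn].
rewrite (big_ord_widen_cond _ (fun i => (i <= k)%N) (fun i => D (x i * w`_i)) (leq_maxr k.+1 c.+1)).
by [].
Qed.

Variables (c : nat) (beta : S).
Hypotheses (hb : ga_hom 1 beta) (cd : (c.+1 <= d)%N).
Hypothesis hz : represents (d - c.+1) (fun x => D (beta ^+ c.+1 * x)).
Local Notation e := (beta%:P - 'X : {poly S}).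
Local Notation DB := (Dbl c.+1 beta D).

Let e_hom : ga_hom 1 (e : polyGA S).
Proof. by apply: (homB (S := polyGA S)); [apply: poly_homC | apply: poly_homX]. Qed.

Let null_DX i : (c < i)%N -> null (S := polyGA S) DB ('X^i : {poly S}).
Proof.
move=> ci y; rewrite -(subnK ci) exprD mulrC mulrA mulrC.
by rewrite Dbl_Xn // (lin0 hD.1).
Qed.

(** A base class [y] represents [psi] on constants. On the classes [e X^i] the remainder [psi1] is
    represented by [z i] on the centre, and a correction [e u] is sought; expanding [e u e X^i] by
    [Dbl_exc] gives the recursion [v] for the coefficients of [u]. *)
Lemma represents_blowup : represents (S := polyGA S) d DB.
Proof.
have hDB : degfun (S := polyGA S) d DB by apply: Dbl_degfun.
move=> k psi hp pn.
have [||y hy py] := hr (k := k) (psi := fun g => psi (g%:P : {poly S})).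
- by move=> a u v hu hv; rewrite polyCD polyCM hp //; apply: poly_homC.
- move=> w hw nw; apply: pn; first exact: poly_homC.
  move=> z; rewrite /Dbl (eq_bigr (fun q : 'I__ => w * (beta ^+ q * (z : {poly S})`_q))).
    by rewrite -mulr_sumr nw.
  by move=> i _; rewrite coefCM mulrCA.
pose psi1 (w : polyGA S) := psi w - DB (y%:P * w).
have hp1 : flin k psi1.
  move=> a u v hu hv; rewrite /psi1 hp // mulrDr (linD hDB.1) mulrCA (linZ hDB.1); ring.
have pn1 w : ga_hom k w -> null DB w -> psi1 w = 0.
  by move=> hw nw; rewrite /psi1 pn // mulrC nw subrr.
have p1C w : ga_hom k w -> psi1 (w%:P : {poly S}) = 0.
  by move=> hw; rewrite /psi1 py // -polyCM Dbl_const subrr.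
have /choice [z hzz] i : exists z : S, (i < k)%N -> dhom (d - c.+1) (k - i.+1) z /\
    forall w, ga_hom (k - i.+1) w -> psi1 (e * 'X^i * w%:P) = D (beta ^+ c.+1 * (z * w)).
  have [ik|ik] := ltnP i k; last by exists 0; lia.
  have he w : ga_hom (k - i.+1) w -> ga_hom k (e * 'X^i * w%:P : polyGA S).
    move=> hw; have ek : ((1 + i) + (k - i.+1))%N = k by lia.
    apply: (homE ek); apply: poly_homM; last exact: poly_homC.
    by apply: poly_homM; [apply: e_hom | apply: poly_homXn].
  have [|w hw nw|x hx px] := hz (k := (k - i.+1)%N) (psi := fun g => psi1 (e * 'X^i * g%:P : {poly S})).
  - move=> a u v hu hv; rewrite polyCD polyCM mulrDr mulrCA.
    by rewrite hp1 //; apply: he.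
  - apply: pn1; first exact: he.
    move=> x; rewrite -!mulrA Dbl_exc.
    have -> : 'X^i * (w%:P * (x : {poly S})) = w%:P * ('X^i * x) by ring.
    by rewrite coefCM nw.
  by exists x.
pose z' i := if (i < k)%N then z i else 0.
pose v := fix v i := if i is i'.+1 then beta * v i' - z' i' else 0 : S.
have vE i : v i.+1 = beta * v i - z' i by [].
have hv i : (i <= c)%N -> dhom d (k.+1 + (c - i)) (v i).
  elim: i => [|i IH] ic; first exact: dhom0.
  rewrite vE; apply: dhomB.
    rewrite mulrC; apply: (dhomE (a := (d + 1)%N) (b := (k.+1 + (c - i))%N)); first lia.
    by apply: dhomM => //; apply: IH; apply: ltnW.
  rewrite /z'; case: ltnP => ik; last exact: dhom0.
  by apply: (dhomE _ (hzz i ik).1); lia.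
pose u : {poly S} := \poly_(j < c.+1) v (c - j)%N.
exists (y%:P + e * u).
  apply: dhomD; first exact: dhomC.
  rewrite mulrC; apply: (dhomE (a := (d + 1)%N) (b := k.+1)); first lia.
  apply: dhomM; last exact: e_hom.
  rewrite /u poly_def; apply: dhom_sum => j _; have jc := ltn_ord j; rewrite -mul_polyC.
  apply: (dhomE (a := (d + j)%N) (b := (k.+1 + (c - (c - j)))%N)); first lia.
  by apply: dhomM; [apply: dhomC; apply: hv; lia | apply: poly_homXn].
move=> w hw; rewrite mulrDl (linD hDB.1) -[psi w](subrK (DB (y%:P * w))) addrC; congr (_ + _).
rewrite -/(psi1 w).
have hX i g : (i <= k)%N -> ga_hom (k - i) g -> ga_hom k (g%:P * 'X^i : polyGA S).
  move=> ik hg; have ek : ((k - i) + i)%N = k by lia.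
  by apply: (homE ek); apply: poly_homM; [apply: poly_homC | apply: poly_homXn].
have main i g : (i <= k)%N -> ga_hom (k - i) g ->
    psi1 (g%:P * 'X^i : {poly S}) = DB (e * u * (g%:P * 'X^i)).
  elim: i g => [|i IH] g ik hg.
    rewrite subn0 in hg; rewrite expr0 mulr1 p1C // -mulrA Dbl_exc coefMC coef_poly ltnSn.
    by rewrite subnn mul0r mulr0 (lin0 hD.1).
  have [ci|ic] := leqP c i.
    have n1 : null DB (g%:P * 'X^(i.+1) : {poly S}) by apply: nullM; apply: null_DX.
    by rewrite (pn1 _ (hX _ _ ik hg) n1) [e * u * _]mulrC; apply: esym; apply: n1.
  have hbg : ga_hom (k - i) (beta * g).
    have ek : (1 + (k - i.+1))%N = (k - i)%N by lia.
    by apply: (homE ek); apply: ga_homM.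
  have -> : g%:P * 'X^(i.+1) = (beta * g)%:P * 'X^i - e * 'X^i * g%:P.
    by rewrite polyCM exprS; ring.
  rewrite (flinB hp1); first last.
  - have ek : ((1 + i) + (k - i.+1))%N = k by lia.
    apply: (homE ek); apply: poly_homM; last exact: poly_homC.
    by apply: poly_homM; [apply: e_hom | apply: poly_homXn].
  - by apply: hX => //; apply: ltnW.
  rewrite mulrBr (linB hDB.1) IH ?(ltnW ik) //; congr (_ - _).
  have [_ ->] := hzz i ik; last exact: hg.
  have -> : e * u * (e * 'X^i * g%:P) = e * (u * e * 'X^i * g%:P) by rewrite !mulrA.
  rewrite Dbl_exc coefMC coefMXn ltnNge (ltnW ic) /=; congr (D (_ * (_ * _))).
  have -> : (c - i = (c - i.+1).+1)%N by lia.
  rewrite mulrBr coefB coefMC coefMX /= !coef_poly !ifT; try lia.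
  have -> : (c - (c - i.+1).+1 = i)%N by lia.
  have -> : (c - (c - i.+1) = i.+1)%N by lia.
  by rewrite vE /z' ik; ring.
rewrite (poly_expand (poly_hom_size hw)) (flin_sum _ hp1) => [|i _]; last first.
  by have ik := ltn_ord i; apply: hX; [lia | apply: (hw i).1; lia].
rewrite mulr_sumr (lin_sum hDB.1); apply: eq_bigr => i _.
by have ik := ltn_ord i; apply: main; [lia | apply: (hw i).1; lia].
Qed.
End RepPoly.

Section State.
Variables (L : finType) (le : rel L) (top : L -> L) (join : L -> L -> L).
Hypothesis oax : order_ax le top.
Variable R : comNzRingType.
Local Notation olt := (olt le).
Local Notation zP := (zP le top).
Local Notation zrho := (zrho top).
Local Notation dims := (dims top).
Local Notation good := (good le top join).
Local Notation ok := (ok le).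
Local Notation stl := (stl le top R).
Local Notation th := (th le top).
Local Notation rels := (rels le top).
Local Notation m0 := (m0 le top R).
Local Notation S rho s := (stS (stl rho s)).
Local Notation X rho s := (@stX _ _ (stl rho s)).
Local Notation D rho s := (@stD _ _ (stl rho s)).
Local Notation hsum := (hsum le top R).
Local Notation null_to_rels := (null_to_rels le top join R).

Lemma represents_base : represents (S := baseGA R) 0 (fun x : baseGA R => x).
Proof.
move=> k psi hp _; case: k hp => [|k] hp.
  exists (psi 1) => [|w _]; first by split=> // j; rewrite addn0 => ->.
  have /= := flinZ (k := 0%N) w (x := 1) hp (hom1 _); rewrite mulr1 => ->; exact: mulrC.
exists 0 => [|w hw]; first exact: dhom0.
have -> : w = 0 by apply: hw.
by rewrite mulr0 (flin0 hp).
Qed.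

Lemma state_represents n s : (size s <= n)%N -> forall U rho, good U rho -> ok U s ->
  represents (dims rho s) (D rho s).
Proof.
elim: n s => [|n IH] [|F s] // hs U rho gU oks.
- by rewrite dims_nil; apply: represents_base.
- by rewrite dims_nil; apply: represents_base.
have [UF Fs up oks'] := oks; have hD := D_degfun le top R rho s.
have rs := IH s hs U rho gU oks'.
have rF := g_pos gU UF.
rewrite dims_cons.
have [tF|tF] := eqVneq (top F) F.
  rewrite /= tF eqxx addnC; exact: represents_top hD rs _.
rewrite /= (negbTE tF) add0n -(prednK rF); apply: represents_blowup => //; rewrite ?prednK //.
- by apply: homN; apply: h_hom.
- exact: (centre_le oax gU oks tF).
have hz : null_to_rels (size s) := null_to_relsP oax (n := _).
have [ed eD] := centre_deg oax gU oks tF hz.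
apply: (represents_transfer (f := th (zrho rho F) (yz le top R rho F s) (filter (zP F) s))
   (g := th rho (X (zrho rho F) (filter (zP F) s)) s) (E := D (zrho rho F) (filter (zP F) s))).
- exact: th_sc.
- by move=> k x; apply: th_hom; apply: yz_hom.
- by move=> k x; apply: th_hom; apply: X_hom.
- exact: eD.
- move=> x; apply: (null_to_relsP oax (leqnn _)).
  + exact: (good_z oax gU UF).
  + exact: (ok_z top F oks').
  + exact: (rels_null_hom (Dcen_degfun le top R rho F s)).
  + by move=> H; apply: (yz_U R rho oks).
  + exact: (rels_centre oax R gU oks tF).
- exact: (Dcen_degfun le top R rho F s).
- exact: (centre_onto oax gU oks).
rewrite ed; apply: IH; last exact: (ok_z top F oks').
- by apply: (@leq_trans (size s)) => //; rewrite size_filter count_size.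
exact: (good_z oax gU UF).
Qed.
End State.

(** * Lexicographically small parameters and the class of the tower *)

Section Eventually.
Variables (R : rcfType) (L : finType).

Definition upd (ep : L -> R) F t : L -> R := fun G => if G == F then t else ep G.

(* [Ev s P]: [P] holds for all parameters supported on [s], small enough in the
   lexicographic sense, the head of [s] being the smallest. *)
Fixpoint Ev (s : seq L) (P : (L -> R) -> Prop) : Prop :=
  if s is F :: s' then Ev s' (fun ep => exists2 del, 0 < del & forall t, 0 < t < del -> P (upd ep F t))
  else P (fun=> 0).

Lemma Ev_mono s (P Q : (L -> R) -> Prop) : (forall ep, P ep -> Q ep) -> Ev s P -> Ev s Q.
Proof.
elim: s P Q => [|F s IH] P Q PQ /=; first exact: PQ.
by apply: IH => ep [del d0 h]; exists del => // t /h /PQ.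
Qed.

Lemma Ev_and s (P Q : (L -> R) -> Prop) : Ev s P -> Ev s Q -> Ev s (fun ep => P ep /\ Q ep).
Proof.
elim: s P Q => [|F s IH] P Q //= hP hQ; have := IH _ _ hP hQ.
apply: Ev_mono => ep [[d1 d10 h1] [d2 d20 h2]]; exists (Num.min d1 d2).
  by rewrite lt_min d10.
by move=> t /andP [t0]; rewrite lt_min => /andP [t1 t2]; split; [apply: h1|apply: h2]; rewrite t0.
Qed.

Lemma Ev_ex s P : Ev s P -> exists ep, P ep.
Proof.
elim: s P => [|F s IH] P /=; first by exists (fun=> 0).
move=> /IH [ep [del d0 h]]; exists (upd ep F (del / 2)); apply: h; lra.
Qed.

(** The parameters of the centre are a subfamily; inserting the others does not disturb the order in
    which the bounds are chosen. *)
Lemma Ev_filter (p : pred L) s P : Ev (filter p s) P ->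
  Ev s (fun ep => P (fun G => if p G then ep G else 0)).
Proof.
elim: s P => [|F s IH] P /=.
  by have -> : (fun G => if p G then 0 else 0 : R) = (fun=> 0) by apply/funext => G; rewrite if_same.
case: ifP => pF /=.
  move=> /IH; apply: Ev_mono => ep [del d0 h]; exists del => // t /h.
  congr (P _); apply/funext => G; rewrite /upd.
  by case: eqP => [->|]; rewrite ?pF.
move=> /IH; apply: Ev_mono => ep h; exists 1 => // t _.
move: h; congr (P _); apply/funext => G; rewrite /upd.
by case: eqP => [->|]; rewrite ?pF.
Qed.

Lemma pos_lower (I : eqType) (r : seq I) (f : I -> R) : (forall i, i \in r -> 0 < f i) ->
  exists2 del, 0 < del & forall i, i \in r -> del <= f i.
Proof.
elim: r => [|i r IH] h; first by exists 1.
have [|del d0 hd] := IH; first by move=> j jr; apply: h; rewrite inE jr orbT.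
exists (Num.min del (f i)); first by rewrite lt_min d0 h ?mem_head.
move=> j; rewrite inE ge_min => /orP [/eqP ->|/hd ->//]; by rewrite lexx orbT.
Qed.
End Eventually.

Section State.
Variables (L : finType) (le : rel L) (top : L -> L) (join : L -> L -> L).
Hypothesis oax : order_ax le top.
Variable R : rcfType.
Local Notation olt := (olt le).
Local Notation zP := (zP le top).
Local Notation zrho := (zrho top).
Local Notation dims := (dims top).
Local Notation good := (good le top join).
Local Notation ok := (ok le).
Local Notation stl := (stl le top R).
Local Notation th := (th le top).
Local Notation rels := (rels le top).
Local Notation m0 := (m0 le top R).
Local Notation S rho s := (stS (stl rho s)).
Local Notation X rho s := (@stX _ _ (stl rho s)).
Local Notation D rho s := (@stD _ _ (stl rho s)).
Local Notation hsum := (hsum le top R).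
Local Notation null_to_rels := (null_to_rels le top join R).

Definition lform rho (s : seq L) (ep : L -> R) : S rho s :=
  - \sum_F ga_sc (S rho s) (ep F) * X rho s F.

Lemma lform_hom rho s ep : ga_hom 1 (lform rho s ep).
Proof. by apply: homN; apply: hom_sum => F _; apply: homZ; apply: X_hom. Qed.

(** A new coefficient [t] at [F] is exactly the passage from [l] to [l] minus [t] times the
    exceptional divisor in [HR_blowup]. *)
Lemma lform_cons rho F (s : seq L) ep t : F \notin s ->
  lform rho (F :: s) (upd ep F t) = ((lform rho s ep)%:P -
    (ga_sc (S rho s) t)%:P * ((- hsum rho s F)%:P - 'X) : {poly S rho s}).
Proof.
move=> Fs; rewrite /lform (bigD1 F) //= {1}/upd !eqxx [in RHS](bigD1 F) //= X_out //.
rewrite mulr0 add0r opprD addrC; congr (_ - _).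
rewrite [RHS]polyCN (rmorph_sum (@polyC (S rho s))); congr (- _).
by apply: eq_bigr => G /negbTE GF; rewrite /upd GF; apply: esym; apply: (@polyCM (S rho s)).
Qed.

(** Each new parameter is chosen below the finitely many positive gaps left so far. This dominance
    is the hypothesis of [ordered_moebius]. *)
Lemma Ev_dom U s : ok U s -> Ev s (fun ep : L -> R => (forall F, F \notin s -> ep F = 0) /\
  forall H, H \in s -> \sum_(G | olt G H) ep G < ep H).
Proof.
elim: s => [|F s IH] //= oks; have [UF Fs up oks'] := oks.
apply: Ev_mono (IH oks') => ep [h0 h].
have [del d0 hd] := pos_lower (f := fun H => ep H - \sum_(G | olt G H) ep G)
  (fun H Hs => (etrans (subr_gt0 _ _) (h H Hs))).
exists del => // t /andP [t0 td]; split=> [G|H].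
  by rewrite inE negb_or /upd => /andP [/negbTE -> /h0].
rewrite inE => /orP [/eqP ->|Hs].
  rewrite {2}/upd eqxx big1 // => G /andP [GF nGF]; rewrite /upd (negbTE nGF).
  apply: h0; apply: contra Fs => Gs; exact: (ok_up oks' Gs UF GF).
have HF : H != F by apply: contraNneq Fs => <-.
rewrite {2}/upd (negbTE HF); have := hd H Hs.
have [FH|FH] := boolP (olt F H); last first.
  rewrite (eq_bigr ep) => [|G GH]; first lra.
  by rewrite /upd; case: eqP => // e; rewrite -e GH in FH.
have -> : \sum_(G | olt G H) upd ep F t G = t + \sum_(G | olt G H && (G != F)) upd ep F t G.
  by rewrite (bigD1 F) //=; congr (_ + _); rewrite /upd eqxx.
have -> : \sum_(G | olt G H && (G != F)) upd ep F t G = \sum_(G | olt G H) ep G.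
  rewrite [RHS](bigD1 F) //= h0 // add0r; apply: eq_bigr => G /andP [_ /negbTE GF].
  by rewrite /upd GF.
by lra.
Qed.

Lemma base_HR (l : baseGA R) : HR 0 (fun x : baseGA R => x) l.
Proof.
move=> [|k] // _ x hx _; rewrite !expr0 !mul1r; split; first exact: sqr_ge0.
by move=> /eqP; rewrite mulf_eq0 orbb => /eqP -> y; rewrite mul0r.
Qed.

Lemma state_HR n s : (size s <= n)%N -> forall U rho, good U rho -> ok U s ->
  Ev s (fun ep => HR (dims rho s) (D rho s) (lform rho s ep)).
Proof.
elim: n s => [|n IH] [|F s] // hs U rho gU oks.
- by rewrite dims_nil; apply: base_HR.
- by rewrite dims_nil; apply: base_HR.
have [UF Fs up oks'] := oks; have hD := D_degfun le top R rho s.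
have IHs := IH s hs U rho gU oks'.
have rF := g_pos gU UF; rewrite dims_cons.
have [tF|tF] := eqVneq (top F) F.
  apply: Ev_mono IHs => ep h; exists 1 => // t /andP [t0 _]; rewrite lform_cons //= tF eqxx.
  rewrite h_top // X_out // oppr0 polyC0 sub0r mulrN opprK addnC.
  apply: HR_projn => //; first exact: lform_hom.
  by rewrite mul1r exprn_gt0.
have hz : null_to_rels (size s) := null_to_relsP oax (n := _).
have [ed eD] := centre_deg oax gU oks tF hz.
have okz := ok_z top F oks'.
have sz : (size (filter (zP F) s) <= n)%N.
  by apply: (@leq_trans (size s)) => //; rewrite size_filter count_size.
have := Ev_and IHs (Ev_filter (IH _ sz _ _ (good_z oax gU UF) okz)).
apply: Ev_mono => ep [h1 h2].
have hc := Dcen_degfun le top R rho F s.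
(* On the centre the class is the [lform] of the smaller tower, because the divisors that miss the
   centre are null there. *)
have h3 : HR (dims rho s - rho F) (Dcen (rho := rho) F (s := s)) (lform rho s ep).
  have h3 : HR (dims rho s - rho F) (Dcen (rho := rho) F (s := s))
      (th (zrho rho F) (yz le top R rho F s) (filter (zP F) s)
         (lform (zrho rho F) (filter (zP F) s) (fun G => if zP F G then ep G else 0))).
    rewrite ed; apply: (HR_transfer (DS := D (zrho rho F) (filter (zP F) s))) => //.
    - by rewrite -ed.
    - by move=> k x; apply: th_hom; apply: yz_hom.
    - move=> k y hy; exists (th rho (X (zrho rho F) (filter (zP F) s)) s y).
        by apply: th_hom => // H; apply: X_hom.
      rewrite -opprB; apply: (nullN hc); exact: (centre_onto oax gU oks).
  apply: (HR_congr hc) h3.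
  rewrite /lform rmorphN rmorph_sum opprK addrC -sumrB; apply: (null_sum hc) => G _.
  rewrite rmorphM th_sc (th_X oax _ _ (fun H => yz_U R rho oks (H := H)) okz) mem_filter /yz.
  have [Gs|Gs] := boolP (G \in s); last first.
    by rewrite andbF X_out // !mulr0 subrr; apply: (null0 hc).
  have [zG|zG] := boolP (zP F G); first by rewrite subrr; apply: (null0 hc).
  rewrite rmorph0 mulr0 subr0; apply: nullM.
  exact: (centre_incomp oax gU oks Gs zG).
have eF := prednK rF.
have cd : ((rho F).-1.+1 <= dims rho s)%N by rewrite eF; apply: (centre_le oax gU oks tF).
have h4 : HR (dims rho s - (rho F).-1.+1) (fun y => D rho s ((- hsum rho s F) ^+ (rho F).-1.+1 * y))
  (lform rho s ep) by rewrite eF.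
have hb : ga_hom 1 (- hsum rho s F) by apply: homN; apply: h_hom.
have [del d0 h] := HR_blowup hD hb (lform_hom rho s ep) cd h1 h4.
exists del => // t /h; rewrite lform_cons //= (negbTE tF) add0n -[in Dbl (rho F)]eF; apply.
Qed.
End State.

(** * Cones of the augmented Bergman fan *)

Section Cones.
Variables (m n : nat) (a : 'I_m -> nat) (pi : 'I_n -> 'I_m).
Hypothesis hpi : forall i : 'I_m, #|pi @^-1: [set i]| = a i.
Variables (rk : {set 'I_m} -> nat).
Hypothesis hP : is_polymatroid a rk.
Implicit Types (A B F G H K : {set 'I_m}) (S : {set 'I_n}) (C : {set {set 'I_m}}).

Lemma rk_mono A B : A \subset B -> (rk A <= rk B)%N. Proof. by case: hP => _ h _ _; apply: h. Qed.
Lemma rk_sub A B : (rk (A :|: B) + rk (A :&: B) <= rk A + rk B)%N. Proof. by case: hP. Qed.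

Definition nS S A := #|S :&: pi @^-1: A|.
Lemma nS_mod S A B : (nS S (A :|: B) + nS S (A :&: B) = nS S A + nS S B)%N.
Proof.
by rewrite /nS preimsetU preimsetI setIUr setIIr cardsUI.
Qed.
Lemma nS_mono S A B : A \subset B -> (nS S A <= nS S B)%N.
Proof. by move=> AB; apply: subset_leq_card; apply: setIS; apply: preimsetS. Qed.
Lemma nS0 A : nS set0 A = 0%N. Proof. by rewrite /nS set0I cards0. Qed.

Lemma nS_setU1 S j A : j \notin S -> nS (j |: S) A = ((pi j \in A) + nS S A)%N.
Proof.
move=> jS; rewrite /nS setIUl; have [jA|jA] := boolP (pi j \in A).
  have -> : [set j] :&: pi @^-1: A = [set j].
    by apply/setIidPl; rewrite sub1set inE.
  by rewrite cardsU1 inE (negbTE jS).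
have -> : [set j] :&: pi @^-1: A = set0; last by rewrite set0U.
by apply/setP => i; rewrite !inE; case: eqP => // ->; rewrite (negbTE jA).
Qed.

(** Removes the elements of [B] outside [F] one at a time; each costs at most [a i], the size of its
    fibre. *)
Lemma rk_pre F B : F \subset B -> (rk B <= rk F + #|pi @^-1: (B :\: F)|)%N.
Proof.
move: {2}#|B :\: F| (erefl #|B :\: F|) => k; elim: k B => [|k IH] B.
  move=> /eqP; rewrite cards_eq0 setD_eq0 => BF FB.
  by rewrite (leq_trans (rk_mono BF)) ?leq_addr.
move=> eB FB; have [i iB] : exists i, i \in B :\: F by apply/set0Pn; rewrite -card_gt0 eB.
have [iF iB'] : i \notin F /\ i \in B by move: iB; rewrite inE => /andP [].
have FBi : F \subset B :\ i by rewrite subsetD1 FB.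
have eD : (B :\ i) :\: F = (B :\: F) :\ i by rewrite setDDl setUC -setDDl.
have := IH (B :\ i); rewrite eD => /(_ _ FBi) h.
have {}h : (rk (B :\ i) <= rk F + #|pi @^-1: ((B :\: F) :\ i)|)%N.
  by apply: h; have := cardsD1 i (B :\: F); rewrite iB eB => -[].
have h1 : (rk B <= rk (B :\ i) + a i)%N.
  have := rk_sub [set i] (B :\ i); rewrite setD1K // => h2.
  have [_ _ _ h3] := hP; have := h3 i; lia.
have h4 : (#|pi @^-1: ((B :\: F) :\ i)| + a i <= #|pi @^-1: (B :\: F)|)%N.
  rewrite -hpi -cardsUI -preimsetU -preimsetI.
  have -> : ((B :\: F) :\ i) :&: [set i] = set0.
    by apply/setP => j; rewrite !inE; case: eqP; rewrite ?andbF.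
  by rewrite preimset0 cards0 addn0; apply: subset_leq_card; rewrite setUC setD1K.
lia.
Qed.

(** A flat of the set function [rk A - nS S A], with the terms crossed over to stay in the naturals.
    The single condition unites flatness with the strict inequalities of the fan ([cone_sflat]). *)
Definition sflat S F := [forall A : {set 'I_m}, (F \proper A) ==> (rk F + nS S A < rk A + nS S F)%N].
Definition ind S := [forall A : {set 'I_m}, (nS S A <= rk A)%N].
Definition chain C := [forall F in C, forall G in C, (F \subset G) || (G \subset F)].
Definition conep S C := [&& ind S, [forall F in C, sflat S F && (F != setT)] & chain C].

Lemma sflatP S F A : sflat S F -> F \proper A -> (rk F + nS S A < rk A + nS S F)%N.
Proof. by move=> /forallP /(_ A) /implyP; apply. Qed.
Lemma indP S A : ind S -> (nS S A <= rk A)%N. Proof. by move=> /forallP. Qed.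
Lemma conepP S C : reflect [/\ ind S, (forall F, F \in C -> sflat S F /\ F != setT) &
  forall F G, F \in C -> G \in C -> (F \subset G) || (G \subset F)] (conep S C).
Proof.
apply: (iffP and3P) => [[h1 /forall_inP h2 /forall_inP h3]|[h1 h2 h3]]; split=> //.
- by move=> F /h2 /andP.
- by move=> F G /h3 /forall_inP; apply.
- by apply/forall_inP => F /h2 [-> ->].
by apply/forall_inP => F FC; apply/forall_inP => G GC; apply: h3.
Qed.

Lemma sflatT S : sflat S setT.
Proof. by apply/forallP => A; rewrite properE subsetT andbF. Qed.

(** For an [S]-flat [K], submodularity makes [rk - nS S] drop strictly from [B] to the intersection
    with [K] unless [B] is inside [K]; at most two such steps lead from [A] to [F :&: G]. *)
Lemma sflatI S F G : sflat S F -> sflat S G -> sflat S (F :&: G).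
Proof.
move=> sF sG; apply/forallP => A; apply/implyP => FGA.
have step K B : sflat S K -> ~~ (B \subset K) ->
    (rk (B :&: K) + nS S B < rk B + nS S (B :&: K))%N.
  move=> sK BK; have KB : K \proper B :|: K by rewrite properE subsetUr subUset subxx andbT.
  have := sflatP sK KB.
  have := rk_sub B K; have := nS_mod S B K; lia.
have [AF|AF] := boolP (A \subset F).
  have AG : ~~ (A \subset G).
    by apply: contraL FGA => AG; rewrite properE subsetI AF AG andbF.
  have := step G A sG AG; suff -> : A :&: G = F :&: G by [].
  apply/eqP; rewrite eqEsubset setSI //= subsetI subsetIr andbT.
  exact: proper_sub.
have h1 := step F A sF AF.
have [AFG|AFG] := boolP (A :&: F \subset G).
  suff <- : A :&: F = F :&: G by [].
  apply/eqP; rewrite eqEsubset !subsetI AFG subsetIr subsetIl (proper_sub FGA).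
  by [].
have h2 := step G (A :&: F) sG AFG.
have e : A :&: F :&: G = F :&: G.
  by rewrite -setIA; apply/setIidPr; apply: proper_sub.
by rewrite e in h2; lia.
Qed.

Lemma cone_sflat S F : sflat S F <-> is_flat rk F /\ (forall T : {set 'I_n},
   T \subset S :\: pi @^-1: F -> T != set0 -> (rk F + #|T| < rk (F :|: pi @: T))%N).
Proof.
have cT (T : {set 'I_n}) B : T \subset S :\: pi @^-1: F -> F :|: pi @: T \subset B ->
    (#|T| + nS S F <= nS S B)%N.
  move=> TS TB; rewrite /nS -cardsUI.
  have -> : T :&: (S :&: pi @^-1: F) = set0.
    apply/setP => j; rewrite !inE; have [jT|//] := boolP (j \in T).
    by have := subsetP TS j jT; rewrite !inE => /andP [/negbTE -> ->].
  rewrite cards0 addn0; apply: subset_leq_card; rewrite subUset; apply/andP; split.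
    apply/subsetP => j jT; have := subsetP TS j jT; rewrite !inE => /andP [_ ->] /=.
    by apply: (subsetP TB); rewrite inE imset_f ?orbT.
  by apply: setIS; apply: preimsetS; apply: subset_trans TB; apply: subsetUl.
split=> [sF|[/forallP fF h]].
  split=> [|T TS T0].
    apply/forallP => e; apply/implyP => eF.
    have := sflatP (A := e |: F) sF; rewrite properE subsetUr subUset sub1set (negbTE eF) /=.
    by move=> /(_ isT); have := nS_mono S (subsetUr [set e] F); lia.
  have FT : F \proper F :|: pi @: T.
    have /set0Pn [j jT] := T0; rewrite properE subsetUl /=; apply/subsetPn; exists (pi j).
      by rewrite inE imset_f ?orbT.
    by have := subsetP TS j jT; rewrite !inE => /andP [].
  by have := sflatP sF FT; have := cT T _ TS (subxx _); lia.
apply/forallP => A; apply/implyP => FA.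
pose T := (S :&: pi @^-1: A) :\: pi @^-1: F.
have nA : nS S A = (#|T| + nS S F)%N.
  rewrite /nS /T -(cardsID (pi @^-1: F) (S :&: pi @^-1: A)) addnC -setIA -preimsetI.
  by rewrite (setIidPr (proper_sub FA)).
have [T0|T0] := eqVneq T set0.
  rewrite nA T0 cards0 add0n ltn_add2r; have [_ [e eA eF]] := properP FA.
  have := fF e; rewrite eF /= => h1; apply: (leq_trans h1); apply: rk_mono.
  by rewrite subUset sub1set eA proper_sub.
have TS : T \subset S :\: pi @^-1: F by apply: setSD; apply: subsetIl.
have := h T TS T0; have : (rk (F :|: pi @: T) <= rk A)%N.
  apply: rk_mono; rewrite subUset proper_sub //=; apply/subsetP => i /imsetP [j jT ->].
  by move: jT; rewrite !inE => /andP [_ /andP [_]].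
lia.
Qed.

Lemma cone_indE S : ind S <-> (forall T : {set 'I_n}, T \subset S -> (#|T| <= rk (pi @: T))%N).
Proof.
split=> [iS T TS|h].
  apply: leq_trans (indP (pi @: T) iS); apply: subset_leq_card.
  by rewrite subsetI TS; apply/subsetP => j jT; rewrite inE imset_f.
apply/forallP => A; apply: (leq_trans (h _ (subsetIl _ _))); apply: rk_mono.
by apply/subsetP => i /imsetP [j]; rewrite !inE => /andP [_ jA] ->.
Qed.

(** If the fibres over [A] minus [F] lay in [S], [rk_pre] would contradict the strict inequality of
    an [S]-flat. The element [j] drives the inductions on Chow relations. *)
Lemma sflat_pre S F A : sflat S F -> F \proper A -> exists2 j, j \notin S & (pi j \in A) && (pi j \notin F).
Proof.
move=> sF FA.
have [/existsP [j /and3P [h1 h2 h3]]|] := boolP [exists j, [&& j \notin S, pi j \in A & pi j \notin F]].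
  by exists j; rewrite ?h2.
rewrite negb_exists => /forallP h; have := sflatP sF FA; have := rk_pre (proper_sub FA).
suff : (#|pi @^-1: (A :\: F)| + nS S F <= nS S A)%N by lia.
rewrite /nS -cardsUI.
have -> : pi @^-1: (A :\: F) :&: (S :&: pi @^-1: F) = set0.
  by apply/setP => j; rewrite !inE; case: (pi j \in F); rewrite ?andbF.
rewrite cards0 addn0.
apply: subset_leq_card; apply/subsetP => j; rewrite !inE => /orP [/andP [jF jA]|/andP [-> jF]].
  by have := h j; rewrite jF jA !andbT negbK => ->.
by rewrite (subsetP (proper_sub FA)).
Qed.

Lemma conep_augBergman S C : conep S C = augBergman_cone rk pi S C.
Proof.
apply/idP/idP => [/conepP [iS sC cC]|/and4P [/andP [/forall_inP fC /forall_inP cC] _ /forallP iS /forall_inP sC]].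
  apply/and4P; split.
  - apply/andP; split; last first.
      by apply/forall_inP => F FC; apply/forall_inP => G GC; apply: cC.
    by apply/forall_inP => F /sC [/cone_sflat [-> _] ->].
  (* Compatibility: were [A] not inside [F], [sflat_pre] would give an element over [A] outside
     [S]. *)
  - apply/forallP => A; apply/implyP => AS; apply/forall_inP => F /sC [sF _].
    apply/negPn/negP => AF.
    have FA : F \proper F :|: A by rewrite properE subsetUl subUset subxx /= (negbTE AF).
    have [j jS /andP [jA jF]] := sflat_pre sF FA.
    case/negP: jS; apply: (subsetP AS); rewrite inE; move: jA; rewrite inE (negbTE jF) //.
  - by apply/forallP => T; apply/implyP => TS; apply: (cone_indE S).1.
  apply/forall_inP => F /sC [/cone_sflat [_ h] _]; apply/forallP => T; apply/implyP.
  by move=> /andP [TS T0]; apply: h.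
apply/conepP; split.
- by apply/cone_indE => T TS; have := iS T; rewrite TS.
- move=> F FC; have /andP [fF nF] := fC F FC; split=> //; apply/cone_sflat; split=> // T TS T0.
  by have /forallP/(_ T) := sC F FC; rewrite TS T0.
by move=> F G /cC /forall_inP; apply.
Qed.

Definition labS (T : {set Lab m n}) : {set 'I_n} := [set j | inr j \in T].
Definition labC (T : {set Lab m n}) : {set {set 'I_m}} := [set F | inl F \in T].

Lemma cone_labelsK S C : labS (cone_labels S C) = S /\ labC (cone_labels S C) = C.
Proof.
split; apply/setP => u; rewrite !inE.
  apply/orP/idP => [[/imsetP [//]|/imsetP [j jS [->]]//]|uS]; right; exact: imset_f.
apply/orP/idP => [[/imsetP [j jS [->]]//|/imsetP [//]]|uS]; left; exact: imset_f.
Qed.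
Lemma cone_labels_lab T : cone_labels (labS T) (labC T) = T.
Proof.
apply/setP => -[F|j]; rewrite !inE.
  apply/orP/idP => [[/imsetP [G + [->]]|/imsetP [//]]|FT]; first by rewrite inE.
  by left; apply: imset_f; rewrite inE.
apply/orP/idP => [[/imsetP [//]|/imsetP [i + [->]]]|jT]; first by rewrite inE.
by right; apply: imset_f; rewrite inE.
Qed.
Lemma is_coneE T : is_cone rk pi T = conep (labS T) (labC T).
Proof.
apply/existsP/idP => [[S /existsP [C /andP [h /eqP ->]]]|h].
  by have [-> ->] := cone_labelsK S C; rewrite conep_augBergman.
exists (labS T); apply/existsP; exists (labC T).
by rewrite -conep_augBergman h cone_labels_lab eqxx.
Qed.

End Cones.

(** * Feichtner-Yuzvinsky relations deduced from the Chow relations *)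

Section Chow.
Variables (m n : nat) (a : 'I_m -> nat) (pi : 'I_n -> 'I_m).
Hypothesis hpi : forall i : 'I_m, #|pi @^-1: [set i]| = a i.
Variables (rk : {set 'I_m} -> nat).
Hypothesis hP : is_polymatroid a rk.
Implicit Types (A B F G H K : {set 'I_m}) (S : {set 'I_n}) (C : {set {set 'I_m}}).
Local Notation nS := (nS pi).
Local Notation sflat := (sflat pi rk).
Local Notation ind := (ind pi rk).
Local Notation conep := (conep pi rk).

Section Ideal.
Variables (R : comNzRingType) (T : ga R) (x : Lab m n -> T) (J : T -> Prop).

Definition xC C := \prod_(F in C) x (inl F).
Definition xS S := \prod_(j in S) x (inr j).

(** The Chow relations modulo an arbitrary ideal, so that the same lemmas apply to the Chow ideal
    and to annihilators of degree functionals. *)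
Record chow : Prop := Chow {
  chow_ideal_J : ideal J;
  chow_SR : forall S C, ~~ conep S C -> J (xC C * xS S);
  chow_LIN : forall j, J (x (inr j) - \sum_(F : {set 'I_m} | pi j \notin F) x (inl F)) }.

(* [xf setT] is minus the sum of the other flat variables, so that all the [xf] sum to zero. *)
Definition xf F := if F == setT then - \sum_(G : {set 'I_m} | G != setT) x (inl G) else x (inl F).
Definition hh G := \sum_(H : {set 'I_m} | G \subset H) xf H.

Lemma hh0 : hh set0 = 0.
Proof.
rewrite /hh (bigD1 setT) ?sub0set //= /xf eqxx; apply/eqP; rewrite addrC subr_eq0; apply/eqP.
by apply: eq_big => [H|H /andP [_ /negbTE ->]] //; rewrite sub0set.
Qed.

Hypothesis hch : chow.
Let hJ : ideal J. Proof. by case: hch. Qed.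
Let J0 : J 0. Proof. by case: hJ. Qed.
Let JD u v : J u -> J v -> J (u + v). Proof. by case: hJ => _ h _; apply: h. Qed.
Let JM u v : J v -> J (u * v). Proof. by case: hJ => _ _; apply. Qed.
Let JMr u v : J u -> J (u * v). Proof. exact: idealMr. Qed.

Lemma chow_xj j : J (x (inr j) + hh [set pi j]).
Proof.
suff -> : hh [set pi j] = - \sum_(F : {set 'I_m} | pi j \notin F) x (inl F) by apply: chow_LIN.
apply/eqP; rewrite -addr_eq0; apply/eqP; rewrite -[RHS]hh0 [in RHS]/hh.
rewrite [RHS](bigID (fun H : {set 'I_m} => pi j \in H)) /=; congr (_ + _).
  by apply: eq_bigl => H; rewrite sub1set sub0set.
apply: eq_big => [H|H Hj]; rewrite ?sub0set //.
by rewrite /xf ifN //; apply: contraNneq Hj => ->; rewrite inE.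
Qed.

Lemma J_xf_xS S F : F != setT -> ~~ (ind S && sflat S F) -> J (xf F * xS S).
Proof.
move=> FT h; have := chow_SR hch (S := S) (C := [set F]); rewrite /xC big_set1 /xf (negbTE FT); apply.
apply: contra h => /conepP [-> h _]; by have [|->] := h F; rewrite ?inE.
Qed.

Lemma J_xf_xf F H : F != setT -> H != setT -> ~~ (F \subset H) -> ~~ (H \subset F) -> J (xf F * xf H).
Proof.
move=> FT HT FH HF; have := chow_SR hch (S := set0) (C := [set F; H]).
rewrite /xC /xS big_set0 mulr1 big_setU1 ?inE ?big_set1; last first.
  by apply: contraNneq FH => ->.
rewrite /xf (negbTE FT) (negbTE HT); apply; apply/negP => /conepP [_ _ /(_ F H)].
by rewrite !inE !eqxx orbT (negbTE FH) (negbTE HF); move/(_ isT isT).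
Qed.

Lemma J_hh_repl H G k : H != setT -> ~~ (G \subset H) -> J (xf H * (hh G ^+ k - hh (G :|: H) ^+ k)).
Proof.
move=> HT GH; rewrite subrXX mulrA; apply: JMr.
have -> : hh G - hh (G :|: H) = \sum_(K : {set 'I_m} | (G \subset K) && ~~ (H \subset K)) xf K.
  rewrite /hh (bigID (fun K => H \subset K) (fun K => G \subset K)) /= addrAC.
  rewrite [X in X - _ + _](eq_bigl (fun K => G :|: H \subset K)); last by move=> K; rewrite subUset.
  by rewrite subrr add0r.
rewrite mulr_sumr; apply: ideal_sum => // K /andP [GK HK].
have KT : K != setT by apply: contraNneq HK => ->; apply: subsetT.
apply: J_xf_xf => //; apply: contra GH => KH; exact: subset_trans GK KH.
Qed.

Lemma hh_split G j : pi j \in G ->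
  hh [set pi j] = hh G + \sum_(H : {set 'I_m} | (pi j \in H) && ~~ (G \subset H)) xf H.
Proof.
move=> jG; rewrite /hh (bigID (fun K => G \subset K)) /=; congr (_ + _); apply: eq_bigl => K.
  by rewrite sub1set; apply: andb_idl => GK; apply: (subsetP GK).
by rewrite sub1set.
Qed.

(** Modulo [J], a factor [hh G] is minus [x_j] minus the flats that contain [pi j] but not [G].
    Trading it lowers the exponent, which is the induction step of [chow_rel] and [chow_rel0]. *)
Lemma hh_xj G j (u : T) k : pi j \in G -> J (u * x (inr j) * hh G ^+ k) ->
  (forall H, pi j \in H -> ~~ (G \subset H) -> J (u * xf H * hh G ^+ k)) -> J (u * hh G ^+ k.+1).
Proof.
move=> jG h1 h2; have jx := chow_xj j; rewrite (hh_split jG) in jx.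
set s := \sum_(H : {set 'I_m} | _) _ in jx.
have -> : u * hh G ^+ k.+1 = (u * hh G ^+ k) * (x (inr j) + (hh G + s)) -
   u * x (inr j) * hh G ^+ k - u * s * hh G ^+ k by rewrite exprS; ring.
apply: idealB => //; first by apply: idealB => //; apply: JM.
rewrite /s mulr_sumr mulr_suml; apply: ideal_sum => // H /andP [jH GH]; exact: h2.
Qed.

Lemma xS_setU1 S j : j \notin S -> xS (j |: S) = x (inr j) * xS S.
Proof. by move=> jS; rewrite /xS big_setU1. Qed.

(** For exponent 0 the hypothesis denies that [F] is [S]-flat. Otherwise trade one [hh G] by
    [hh_xj]: adding [j] to [S] lowers the required exponent by one, and for a flat [H] above [F] the
    pair [F], [G] is replaced by [H], [G :|: H], where submodularity gives the bound. *)
Lemma chow_rel k S F G : F \proper G -> (rk G + nS S F <= k + rk F + nS S G)%N ->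
  J (xf F * xS S * hh G ^+ k).
Proof.
elim: k S F G => [|k IH] S F G FG hk.
  have FT : F != setT by apply: contraTneq FG => ->; rewrite properE subsetT andbF.
  rewrite mulr1; apply: J_xf_xS => //; apply/negP => /andP [_ sF]; have := sflatP sF FG; lia.
have FT : F != setT by apply: contraTneq FG => ->; rewrite properE subsetT andbF.
have [/andP [iS sF]|ns] := boolP (ind S && sflat S F); last by apply: JMr; apply: J_xf_xS.
have [j jS /andP [jG jF]] := sflat_pre hpi hP sF FG.
apply: (hh_xj jG).
  have := IH (j |: S) F G FG; rewrite xS_setU1 // !nS_setU1 // jG (negbTE jF) => h.
  have -> : xf F * xS S * x (inr j) = xf F * (x (inr j) * xS S) by ring.
  apply: h; lia.
move=> H jH GH.
have HT : H != setT by apply: contraNneq GH => ->; apply: subsetT.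
have -> : xf F * xS S * xf H * hh G ^+ k = xf F * xf H * (xS S * hh G ^+ k) by ring.
have [FH|FH] := boolP (F \subset H); last first.
  apply: JMr; apply: J_xf_xf => //; apply: contra jF => HF; exact: (subsetP HF).
have -> : xf F * xf H * (xS S * hh G ^+ k) = xf F * (xS S * (xf H * (hh G ^+ k - hh (G :|: H) ^+ k))
   + xf H * xS S * hh (G :|: H) ^+ k) by ring.
apply: JM; apply: JD; first by apply: JM; apply: J_hh_repl.
apply: IH; first by rewrite properE subsetUr subUset subxx andbT.
have FGH : F \proper G :&: H.
  rewrite properE subsetI (proper_sub FG) FH /=; apply/subsetPn; exists (pi j) => //.
  by rewrite inE jG.
by move: hk (sflatP sF FGH) (rk_sub hP G H) (nS_mod pi S G H); clear; lia.
Qed.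

(** The same induction without a flat. When every element over [G] lies in [S], a flat not
    containing [G] cannot be [S]-flat, so [hh G] itself dies against [xS S]. *)
Lemma chow_rel0 k S G : (rk G + 1 <= k + nS S G)%N -> J (xS S * hh G ^+ k).
Proof.
move=> hk; have [iS|nS0] := boolP (ind S); last first.
  have := chow_SR hch (S := S) (C := set0); rewrite /xC big_set0 mul1r => h.
  by apply: JMr; apply: h; apply: contra nS0 => /conepP [].
elim: k S iS hk => [|k IH] S iS hk; first by have := indP G iS; lia.
have [/existsP [j /andP [jS jG]]|] := boolP [exists j, (j \notin S) && (pi j \in G)].
  apply: (hh_xj jG).
    rewrite (mulrC (xS S)) -xS_setU1 //.
    have [iS'|nS'] := boolP (ind (j |: S)); last first.
      have := chow_SR hch (S := j |: S) (C := set0); rewrite /xC big_set0 mul1r => h.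
      by apply: JMr; apply: h; apply: contra nS' => /conepP [].
    by apply: IH => //; rewrite nS_setU1 // jG; lia.
  move=> H jH GH; have HT : H != setT by apply: contraNneq GH => ->; apply: subsetT.
  have -> : xS S * xf H * hh G ^+ k = xS S * (xf H * (hh G ^+ k - hh (G :|: H) ^+ k))
     + xf H * xS S * hh (G :|: H) ^+ k by ring.
  apply: JD; first by apply: JM; apply: J_hh_repl.
  apply: chow_rel; first by rewrite properE subsetUr subUset subxx andbT.
  by move: hk (indP (G :&: H) iS) (rk_sub hP G H) (nS_mod pi S G H); clear; lia.
rewrite negb_exists => /forallP hS; rewrite exprS mulrA; apply: JMr.
have -> : hh G = - \sum_(H : {set 'I_m} | ~~ (G \subset H)) xf H.
  apply/eqP; rewrite -addr_eq0; apply/eqP; rewrite -[RHS]hh0 [in RHS]/hh.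
  rewrite [RHS](bigID (fun H : {set 'I_m} => G \subset H)) /=.
  by congr (_ + _); apply: eq_bigl => H; rewrite sub0set.
rewrite mulrN mulr_sumr; apply: idealN => //; apply: ideal_sum => // H GH.
have HT : H != setT by apply: contraNneq GH => ->; apply: subsetT.
rewrite mulrC; apply: J_xf_xS => //; apply/negP => /andP [_ sH].
have HGH : H \proper G :|: H by rewrite properE subsetUr subUset subxx andbT.
have [j jS /andP [jG jH]] := sflat_pre hpi hP sH HGH.
by have := hS j; move: jG; rewrite inE (negbTE jH) orbF jS => ->.
Qed.
End Ideal.

(** * The ranked order of a cone *)

Section Order.
Variables (S : {set 'I_n}) (C : {set {set 'I_m}}).
(** Inclusion inside one interval of the chain: no member of [C] separates [F] from [G]. The link
    thus splits into one component per interval. *)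
Definition leC F G := (F \subset G) && [forall K in C, (F \subset K) ==> (G \subset K)].
Definition topC F := \bigcap_(K in C | F \subset K) K.
Definition Uc F := sflat S F && [forall K in C, (F \subset K) || (K \subset F)].
Definition fS F := (rk F - nS S F)%N.
(** One more than the rank of the chain member below the interval. The empty maximum is 0, so the
    lowest interval gets an extra 1 in [rhoC], matching the exponent in [chow_rel0]. *)
Definition bC F := \max_(K in C | K \proper F) (fS K).+1.
Definition rhoC F := ((fS F).+1 - bC (topC F))%N.
Definition cl A := \bigcap_(F | sflat S F && (A \subset F)) F.

Lemma fSE F : fS F = (rk F - nS S F)%N. Proof. by []. Qed.
Lemma rhoCE F : rhoC F = ((fS F).+1 - bC (topC F))%N. Proof. by []. Qed.

Lemma leCP F G : reflect (F \subset G /\ forall K, K \in C -> F \subset K -> G \subset K) (leC F G).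
Proof.
apply: (iffP andP) => [[-> /forall_inP h]|[-> h]]; split=> //.
  by move=> K KC; move/(_ K KC): h => /implyP.
by apply/forall_inP => K KC; apply/implyP; apply: h.
Qed.

Lemma sub_topC F : F \subset topC F. Proof. by apply/bigcapsP => K /andP []. Qed.
Lemma topC_sub F K : K \in C -> F \subset K -> topC F \subset K.
Proof. by move=> KC FK; apply: bigcap_inf; rewrite KC. Qed.

Lemma orderC : order_ax leC topC.
Proof.
split.
- by move=> F; apply/leCP.
- by move=> F G /leCP [FG _] /leCP [GF _]; apply/eqP; rewrite eqEsubset FG.
- move=> G F H /leCP [FG h] /leCP [GH h']; apply/leCP; split; first exact: subset_trans FG GH.
  by move=> K KC FK; apply: h' => //; apply: h.
- by move=> F; apply/leCP; split=> [|K]; [apply: sub_topC | apply: topC_sub].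
- move=> F G /leCP [FG h]; apply/eqP; rewrite eqEsubset FG andbT.
  by apply/bigcapsP => K /andP [KC FK]; apply: h => //; apply: topC_sub.
move=> F G /leCP [FG h]; apply: eq_bigl => K; apply: andb_id2l => KC.
by apply/idP/idP => [/h|]; [apply | apply: subset_trans FG].
Qed.

Hypothesis hc : conep S C.
Let iS : ind S. Proof. by case/conepP: hc. Qed.
Let sC F : F \in C -> sflat S F. Proof. by case/conepP: hc => _ h _ /h []. Qed.

Lemma topC_in F : topC F \in C \/ topC F = setT.
Proof.
have [/existsP [K0 h0]|] := boolP [exists K, (K \in C) && (F \subset K)]; last first.
  rewrite negb_exists => /forallP h; right; apply: big1 => K h1; by have := h K; rewrite h1.
left; case: (arg_minnP (P := fun K => (K \in C) && (F \subset K)) (fun K : {set 'I_m} => #|K|) h0) => K /andP [KC FK] hK.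
suff -> : topC F = K by [].
apply/eqP; rewrite eqEsubset topC_sub //=; apply/bigcapsP => G /andP [GC FG].
have /conepP [_ _ /(_ G K GC KC)/orP [GK|//]] := hc.
have := hK G; rewrite GC FG => /(_ isT) => le.
by have /eqP -> : G == K by rewrite eqEcard GK.
Qed.

Lemma topC_id F : (topC F == F) = (F \in C) || (F == setT).
Proof.
apply/idP/orP => [/eqP e|[FC|/eqP ->]].
- by have [h|h] := topC_in F; rewrite -e; [left | right; apply/eqP].
- by rewrite eqEsubset sub_topC topC_sub.
by rewrite eqEsubset subsetT sub_topC.
Qed.

Lemma fS_mono F A : sflat S F -> F \proper A -> (fS F < fS A)%N.
Proof. by move=> sF /(sflatP sF); rewrite /fS; have := indP F iS; have := indP A iS; lia. Qed.
Lemma fS_le F A : sflat S F -> F \subset A -> (fS F <= fS A)%N.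
Proof. by move=> sF; rewrite subEproper => /orP [/eqP -> //|/(fS_mono sF)/ltnW]. Qed.
Lemma fS_sub A B : (fS (A :|: B) + fS (A :&: B) <= fS A + fS B)%N.
Proof.
rewrite /fS; have := rk_sub hP A B; have := nS_mod pi S A B.
have := indP A iS; have := indP B iS; have := indP (A :|: B) iS; have := indP (A :&: B) iS; lia.
Qed.

Lemma sflat_bigI (P : pred {set 'I_m}) : (forall F, P F -> sflat S F) -> sflat S (\bigcap_(F | P F) F).
Proof.
move=> h; elim/big_rec: _ => [|F A PF sA]; first exact: sflatT.
by apply: (sflatI hP) => //; apply: h.
Qed.

Lemma cl_sflat A : sflat S (cl A). Proof. by apply: sflat_bigI => F /andP []. Qed.
Lemma sub_cl A : A \subset cl A. Proof. by apply/bigcapsP => F /andP []. Qed.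
Lemma cl_sub A F : sflat S F -> A \subset F -> cl A \subset F.
Proof. by move=> sF AF; apply: bigcap_inf; rewrite sF. Qed.

(** If [A] is not [S]-flat, some larger set has no larger [fS]; iterating reaches an [S]-flat. *)
Lemma fS_cl A : (fS (cl A) <= fS A)%N.
Proof.
suff [B [AB sB hB]] : exists B, [/\ A \subset B, sflat S B & (fS B <= fS A)%N].
  by apply: leq_trans hB; apply: fS_le; [apply: cl_sflat | apply: cl_sub].
move: {2}(#|~: A|) (leqnn #|~: A|) => k; elim: k A => [|k IH] A hA.
  exists setT; split; rewrite ?subsetT ?sflatT //.
  have -> : A = setT by apply: setC_inj; rewrite setCT; apply/eqP; rewrite -cards_eq0 -leqn0.
  by [].
have [sA|] := boolP (sflat S A); first by exists A.
rewrite negb_forall => /existsP [B]; rewrite negb_imply -leqNgt => /andP [AB hB].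
have [|B' [BB' sB' hB']] := IH B.
  have := proper_card AB; have := cardsC A; have := cardsC B; lia.
exists B'; split=> //; first exact: subset_trans (proper_sub AB) BB'.
apply: (leq_trans hB'); move: hB; rewrite /fS.
have := indP A iS; have := indP B iS; lia.
Qed.

Lemma UcP F : reflect (sflat S F /\ forall K, K \in C -> (F \subset K) || (K \subset F)) (Uc F).
Proof.
by apply: (iffP andP) => -[sF h]; split=> //; apply/forall_inP.
Qed.

Lemma Uc_below F K : Uc F -> K \in C -> K \proper topC F -> K \proper F.
Proof.
move=> /UcP [_ h] KC KT.
have FK : ~~ (F \subset K).
  by apply: contraL KT => FK; rewrite properE (topC_sub KC FK) andbF.
by have := h K KC; rewrite properE FK andbT (negbTE FK).
Qed.

Lemma bC_le F A : Uc F -> (forall K, K \in C -> K \proper F -> K \subset A) -> (bC (topC F) <= (fS A).+1)%N.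
Proof.
move=> UF h; apply/bigmax_leqP => K /andP [KC /(Uc_below UF KC) KF].
by rewrite ltnS; apply: fS_le; [apply: sC | apply: h].
Qed.

Lemma bC_lt F : Uc F -> (bC (topC F) < (fS F).+1)%N.
Proof.
move=> UF; rewrite ltnS; apply/bigmax_leqP => K /andP [KC /(Uc_below UF KC)].
by apply: fS_mono; apply: sC.
Qed.

Lemma Uc_top F : Uc F -> Uc (topC F).
Proof.
move=> /UcP [sF h]; apply/UcP; split.
  by apply: sflat_bigI => K /andP [/sC].
move=> K KC; have /orP [FK|KF] := h K KC; first by rewrite topC_sub.
by rewrite (subset_trans KF (sub_topC F)) orbT.
Qed.
Lemma UcC F : F \in C -> Uc F.
Proof. by move=> FC; apply/UcP; split=> [|K KC]; [apply: sC | case/conepP: hc => _ _; apply]. Qed.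
Lemma UcT : Uc setT. Proof. by apply/UcP; split=> [|K _]; rewrite ?sflatT ?subsetT ?orbT. Qed.

Definition joinC F G := cl (F :|: G).

Lemma leC_joinC F G : Uc F -> Uc G -> topC F = topC G -> leC F (joinC F G).
Proof.
move=> UF UG t; apply/leCP; split; first exact: subset_trans (subsetUl F G) (sub_cl _).
move=> K KC FK; apply: cl_sub; first exact: sC.
rewrite subUset FK; apply: subset_trans (sub_topC G) _; rewrite -t; exact: topC_sub.
Qed.

Lemma leC_same F G : topC F = topC G -> F \subset G -> leC F G.
Proof.
move=> t FG; apply/leCP; split=> // K KC FK.
by apply: subset_trans (sub_topC G) _; rewrite -t; apply: topC_sub.
Qed.

Lemma leC_same_proper F G : olt leC F G -> F \proper G.
Proof.
move=> /andP [/leCP [FG _] n0]; rewrite properEneq FG andbT //.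
Qed.

(** The rank axioms come from submodularity of [fS] and [fS_cl]; in [g_sub] the chain member below
    the interval plays the lower bound, through [bC_le]. *)
Lemma goodC : good leC topC joinC Uc rhoC.
Proof.
have sub_below F G K : Uc F -> Uc G -> topC F = topC G -> K \in C -> K \proper F -> K \subset F :&: G.
  move=> UF UG t KC KF; rewrite subsetI (proper_sub KF) /=; apply: proper_sub.
  apply: (Uc_below UG KC); rewrite -t; exact: proper_sub_trans KF (sub_topC F).
split.
- exact: Uc_top.
- by move=> F UF; rewrite subn_gt0 bC_lt.
- move=> F G UF UG FG; rewrite /rhoC -(top_le orderC (olt_ole FG)).
  have := bC_lt UF; have /UcP [sF _] := UF; have := fS_mono sF (leC_same_proper FG); lia.
- move=> F G UF UG t; apply/UcP; split=> [|K KC]; first exact: cl_sflat.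
  have /UcP [_ h] := UF; have /orP [FK|KF] := h K KC; last first.
    by rewrite (subset_trans KF) ?orbT // (subset_trans (subsetUl F G)) // sub_cl.
  have /leCP [_ h'] := leC_joinC UF UG t; by rewrite (h' K).
- by move=> F G UF UG t; apply: leC_joinC.
- by move=> F G UF UG t; rewrite /joinC setUC; apply: leC_joinC.
- move=> F G UF UG t K UK /leCP [FK h] /leCP [GK _]; apply/leCP; split.
    by apply: cl_sub; [case/UcP: UK | rewrite subUset FK].
  move=> H HC JH; apply: h => //; apply: subset_trans JH.
  exact: subset_trans (subsetUl F G) (sub_cl _).
- move=> F G UF UG t; have lJ := leC_joinC UF UG t; rewrite /rhoC -(top_le orderC lJ) -t.
  have h1 := bC_le UF (fun K KC KF => sub_below F G K UF UG t KC KF).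
  have := fS_cl (F :|: G); have := fS_sub F G; rewrite -/(joinC F G); lia.
move=> F G K UF UG UK t KF KG; have lJ := leC_joinC UF UG t.
rewrite /rhoC -(top_le orderC lJ) -t (top_le orderC KF).
have := bC_lt UK; have := fS_cl (F :|: G); have := fS_sub F G; rewrite -/(joinC F G).
rewrite (top_le orderC KF).
have /UcP [sK _] := UK; have : (fS K <= fS (F :&: G))%N.
  by apply: fS_le => //; rewrite subsetI; move: KF KG => /leCP [-> _] /leCP [-> _].
have : (fS K <= fS (joinC F G))%N.
  apply: fS_le => //; move: KF => /leCP [KF _]; apply: (subset_trans KF).
  exact: subset_trans (subsetUl F G) (sub_cl _).
by have := bC_lt UF; have := bC_lt UG; rewrite -t; clear; lia.
Qed.
End Order.
End Chow.

Lemma ok_filter (L : finType) (le : rel L) (U : pred L) (w : L -> nat) (s : seq L) :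
  (forall F G, olt le F G -> (w F < w G)%N) -> uniq s -> sorted (relpre w leq) s ->
  (forall F, F \in s -> U F) -> (forall F G, F \in s -> U G -> olt le F G -> G \in s) -> ok le U s.
Proof.
move=> hw; elim: s => //= F s IH /andP [Fs us] ss sU up.
have hmin : all (fun G => (w F <= w G)%N) s.
  by apply: (order_path_min (leT := relpre w leq)) => // a b c; apply: leq_trans.
split; rewrite ?sU ?mem_head //.
  move=> H UH FH; have := up F H (mem_head _ _) UH FH; rewrite inE => /orP [/eqP e|//].
  by have := hw _ _ FH; rewrite e ltnn.
apply: IH => //; first exact: (path_sorted ss).
  by move=> G Gs; apply: sU; rewrite inE Gs orbT.
move=> G H Gs UH GH; have := up G H; rewrite !inE Gs orbT => /(_ isT UH GH) /orP [/eqP e|//].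
by have := hw _ _ GH; have := allP hmin G Gs; rewrite e; lia.
Qed.

(** * The star of a cone satisfies the relations of its tower *)

Section ConeRel.
Variables (m n : nat) (a : 'I_m -> nat) (pi : 'I_n -> 'I_m).
Hypothesis hpi : forall i : 'I_m, #|pi @^-1: [set i]| = a i.
Variables (rk : {set 'I_m} -> nat).
Hypothesis hP : is_polymatroid a rk.
Implicit Types (A B F G H K : {set 'I_m}) (S : {set 'I_n}) (C : {set {set 'I_m}}).
Local Notation nS := (nS pi).
Local Notation sflat := (sflat pi rk).
Local Notation ind := (ind pi rk).
Local Notation conep := (conep pi rk).
Local Notation Uc := (Uc pi rk).
Local Notation fS := (fS pi rk).
Local Notation rhoC := (rhoC pi rk).

Definition seqC S C := sort (relpre (fun F : {set 'I_m} => #|F|) leq) (enum (Uc S C)).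
Lemma mem_seqC S C F : (F \in seqC S C) = Uc S C F.
Proof. by rewrite mem_sort mem_enum. Qed.
Lemma ok_seqC S C : ok (leC C) (Uc S C) (seqC S C).
Proof.
apply: (ok_filter (w := fun F : {set 'I_m} => #|F|)).
- by move=> F G /leC_same_proper /proper_card.
- by rewrite sort_uniq enum_uniq.
- by apply: sort_sorted => F G; apply: leq_total.
- by move=> F; rewrite mem_seqC.
by move=> F G _ UG _; rewrite mem_seqC.
Qed.

Variables (S : {set 'I_n}) (C : {set {set 'I_m}}).
Hypothesis hc : conep S C.
Variables (R : comNzRingType) (T : ga R) (x : Lab m n -> T) (J : T -> Prop).
Hypothesis hch : chow pi rk x J.
Local Notation xf := (xf x).
Local Notation hh := (hh x).
Let hJ : ideal J := chow_ideal_J hch.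
Let J0 : J 0. Proof. by case: hJ. Qed.
Let JD u v : J u -> J v -> J (u + v). Proof. by case: hJ => _ h _; apply: h. Qed.
Let JM u v : J v -> J (u * v). Proof. by case: hJ => _ _; apply. Qed.
Let JMr u v : J u -> J (u * v). Proof. exact: idealMr. Qed.

Definition xsig := xC x C * xS x S.
Lemma xsigE : xsig = xC x C * xS x S. Proof. by []. Qed.
(** Values at which the tower of the cone is evaluated. At chain members and the full set the value
    is [hh F], because in the tower a top divisor equals its own [hsum]. *)
Definition yC F := if Uc S C F then if topC C F == F then hh F else xf F else 0.
Definition Jsig t := J (xsig * t).

Lemma ideal_Jsig : ideal Jsig.
Proof.
split; rewrite /Jsig; first by rewrite mulr0.
  by move=> u v hu hv; rewrite mulrDr; apply: JD.
by move=> u v hv; rewrite mulrCA; apply: JM.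
Qed.
Let hJs := ideal_Jsig.
Lemma Jsig_J t : J t -> Jsig t. Proof. exact: JM. Qed.

Lemma xC_D1 F : F \in C -> xC x C = xf F * xC x (C :\ F).
Proof.
move=> FC; rewrite /xC (big_setD1 F FC) /= /xf ifN //.
by have /conepP [_ /(_ F FC) [_]] := hc.
Qed.

Lemma Jsig_U F : ~~ Uc S C F -> Jsig (xf F).
Proof.
move=> nU; have FT : F != setT by apply: contraNneq nU => ->; exact: UcT.
have FC : F \notin C by apply: contra nU; exact: UcC.
have := chow_SR hch (S := S) (C := F |: C); rewrite /Jsig /xsig /xf (negbTE FT).
have -> : xC x (F |: C) = x (inl F) * xC x C by rewrite /xC big_setU1.
rewrite -mulrA mulrC; apply.
apply: contra nU => /conepP [_ h1 h2]; apply/UcP; split; first by have [] := h1 F (setU11 _ _).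
by move=> K KC; apply: h2; rewrite !inE ?eqxx // KC orbT.
Qed.

Lemma topC_top F : topC C (topC C F) = topC C F.
Proof. exact: (top_top (orderC C)). Qed.

Lemma le_topC_E F G : Uc S C F -> Uc S C G ->
  leC C F G && (G != topC C F) = (F \subset G) && ~~ (topC C F \subset G).
Proof.
move=> /UcP [_ hF] /UcP [_ hG]; apply/idP/idP.
  move=> /andP [/leCP [FG h] nG]; rewrite FG; apply: contra nG => TG.
  by rewrite eqEsubset TG andbT; apply/bigcapsP => K /andP [KC FK]; apply: h.
move=> /andP [FG TG]; apply/andP; split; last by apply: contraNneq TG => ->.
apply/leCP; split=> // K KC FK; have /orP [//|KG] := hG K KC.
by case/negP: TG; apply: subset_trans KG; apply: topC_sub.
Qed.

(** Flats outside the link are killed by [xsig], and the flats beyond the interval of [G] are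
    gathered in the value [hh] at its top. *)
Lemma yC_sum G : Uc S C G -> Jsig (\sum_(K | leC C G K) yC K - hh G).
Proof.
move=> UG; set t := topC C G.
have Ut : Uc S C t by exact: (Uc_top hP hc).
have Gt : leC C G t by apply: (ole_top (orderC C)).
rewrite (bigD1 t) //= {1}/yC Ut topC_top eqxx /hh (bigID (fun K : {set 'I_m} => t \subset K) (fun K : {set 'I_m} => G \subset K)) /=.
rewrite [X in X + _ - _](_ : _ = \sum_(K : {set 'I_m} | (G \subset K) && (t \subset K)) xf K); last first.
  apply: eq_bigl => K; apply/idP/andP => [tK|[]//]; split=> //.
  exact: subset_trans (sub_topC C G) tK.
rewrite opprD addrACA subrr add0r big_mkcond [X in _ - X]big_mkcond -sumrB /=.
apply: ideal_sum => // K _; have [UK|nU] := boolP (Uc S C K); last first.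
  rewrite /yC (negbTE nU) if_same sub0r; apply: idealN => //.
  by case: ifP => _; [apply: Jsig_U | rewrite /Jsig mulr0].
rewrite -le_topC_E // -/t; case: ifP => [/andP [GK Kt]|_]; last by rewrite subrr /Jsig mulr0.
by rewrite /yC UK -(top_le (orderC C) GK) eq_sym (negbTE Kt) subrr /Jsig mulr0.
Qed.

Lemma Jsig_pow u v w k : Jsig (u - v) -> Jsig (w * v ^+ k) -> Jsig (w * u ^+ k).
Proof.
move=> h1 h2; rewrite -(subrK (w * v ^+ k) (w * u ^+ k)); have [_ h _] := hJs; apply: h => //.
rewrite -mulrBr subrXX; have [_ _ hM] := hJs; apply: hM; exact: idealMr.
Qed.

Lemma xf_nontop F : topC C F != F -> Uc S C F -> yC F = xf F.
Proof. by move=> tF UF; rewrite /yC UF (negbTE tF). Qed.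

Lemma nontopT F : topC C F != F -> F != setT.
Proof. by apply: contraNneq => ->; rewrite (topC_id hc) eqxx orbT. Qed.

Lemma rels_cone : rels (leC C) (topC C) (rhoC S C) yC Jsig (seqC S C).
Proof.
have oC := orderC C.
have mulE1 (u v w z : T) : u * v * (w * z) = u * (w * v * z) by ring.
have mulE2 (u v w z : T) : u * v * w * z = v * (u * w * z) by ring.
split.
- move=> G H; rewrite !mem_seqC => UG UH t GH HG.
  have tG : topC C G != G by apply: contra HG => /eqP <-; rewrite t; apply: (ole_top oC).
  have tH : topC C H != H by apply: contra GH => /eqP <-; rewrite -t; apply: (ole_top oC).
  rewrite !xf_nontop //; apply: Jsig_J; apply: (J_xf_xf hch); rewrite ?nontopT //.
    by apply: contra GH; apply: (leC_same t).
  by apply: contra HG; apply: (leC_same (esym t)).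
- move=> G H; rewrite !mem_seqC => UG UH GH; apply: (Jsig_pow (yC_sum UH)).
  have tGH := top_le oC (olt_ole GH).
  have tG : topC C G != G.
    apply: contraTneq GH => tG; rewrite /olt; apply/negP => /andP [GH /eqP []].
    by rewrite (top_maxE oC tG GH).
  rewrite xf_nontop // /Jsig /xsig; set k := (_ - _)%N.
  have := chow_rel hpi hP hch (k := k) (S := S) (leC_same_proper GH).
  rewrite mulE1 => h; apply: JM; apply: h; rewrite /k !rhoCE tGH.
  have := bC_lt hc UG; rewrite tGH; have := bC_lt hc UH.
  have /conepP [iS _ _] := hc; have := indP G iS; have := indP H iS; rewrite !fSE; lia.
move=> G; rewrite mem_seqC => UG; rewrite -[X in Jsig X]mul1r; apply: (Jsig_pow (yC_sum UG)); rewrite mul1r.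
have /conepP [iS sC _] := hc; have iG := indP G iS.
(* In the lowest interval [chow_rel0] applies; otherwise the factor of [xsig] at the chain member
   below serves as the flat in [chow_rel]. *)
rewrite rhoCE; have [c0|c0] := posnP #|[pred K | (K \in C) && (K \proper topC C G)]|.
  rewrite /bC big_pred0 ?subn0; last by move=> K; exact: (card0_eq c0).
  rewrite /Jsig /xsig -mulrA; apply: JM; apply: (chow_rel0 hpi hP hch).
  by rewrite !fSE; lia.
have [K /andP [KC KT] e] := eq_bigmax_cond (fun K => (fS S K).+1) c0.
rewrite /bC e subSS; have KG := Uc_below UG KC KT.
have := chow_rel hpi hP hch (k := (fS S G - fS S K)%N) (S := S) KG.
rewrite /Jsig /xsig (xC_D1 KC) => h.
rewrite mulE2; apply: JM; apply: h; have := indP K iS; have := fS_mono hc (sC K KC).1 KG; rewrite !fSE; lia.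
Qed.
End ConeRel.

(** * Conversely, Chow relations from the tower of the whole fan *)

Section BaseChow.
Variables (m n : nat) (a : 'I_m -> nat) (pi : 'I_n -> 'I_m).
Hypothesis hpi : forall i : 'I_m, #|pi @^-1: [set i]| = a i.
Variables (rk : {set 'I_m} -> nat).
Hypothesis hP : is_polymatroid a rk.
Implicit Types (A B F G H K : {set 'I_m}) (S : {set 'I_n}) (C : {set {set 'I_m}}).
Local Notation flat := (sflat pi rk set0).

Lemma conep0 : conep pi rk set0 set0.
Proof.
apply/conepP; split=> [|F|F G]; rewrite ?inE //.
by apply/forallP => A; rewrite nS0.
Qed.

Lemma leC0 F G : leC set0 F G = (F \subset G).
Proof. by apply/leCP/idP => [[]//|FG]; split=> // K; rewrite inE. Qed.
Lemma topC0 F : topC set0 F = setT.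
Proof. by rewrite /topC big_pred0 // => K; rewrite inE. Qed.
Lemma fS0 F : fS pi rk set0 F = rk F. Proof. by rewrite fSE nS0 subn0. Qed.
Lemma rhoC0 F : rhoC pi rk set0 set0 F = (rk F).+1.
Proof. by rewrite rhoCE fS0 /bC big_pred0 ?subn0 // => K; rewrite inE. Qed.
Lemma Uc0 F : Uc pi rk set0 set0 F = flat F.
Proof. by apply/UcP/idP => [[]//|fF]; split=> // K; rewrite inE. Qed.
Lemma rk_cl A : (rk (cl pi rk set0 A) <= rk A)%N.
Proof. by have := fS_cl hP conep0 A; rewrite !fS0. Qed.

Section Mixed.
Variables (R : comNzRingType) (P : ga R) (X : {set 'I_m} -> P) (N : P -> Prop).
Hypothesis hN : ideal N.
Hypothesis X0 : forall F, ~~ flat F -> X F = 0.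
Let h G := \sum_(H : {set 'I_m} | G \subset H) X H.
Hypothesis hXX : forall F G, flat F -> flat G -> ~~ (F \subset G) -> ~~ (G \subset F) -> N (X F * X G).
Hypothesis hXh : forall F G, flat F -> flat G -> F \proper G -> N (X F * h G ^+ (rk G - rk F)).
Hypothesis hh1 : forall G, flat G -> N (h G ^+ (rk G).+1).
Let N0 : N 0. Proof. by case: hN. Qed.
Let ND u v : N u -> N v -> N (u + v). Proof. by case: hN => _ + _; apply. Qed.
Let NM u v : N v -> N (u * v). Proof. by case: hN => _ _; apply. Qed.
Let NMr u v : N u -> N (u * v). Proof. exact: idealMr. Qed.

Let h_cl G : h G = h (cl pi rk set0 G).
Proof.
rewrite /h big_mkcond [RHS]big_mkcond; apply: eq_bigr => K _.
have [fK|/X0 ->] := boolP (flat K); last by rewrite !if_same.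
congr (if _ then _ else _); apply/idP/idP => [|/(subset_trans (sub_cl _ _ _ _)) //].
exact: cl_sub.
Qed.

Definition fac (o : option {set 'I_m}) : P := if o is Some F then X F else 1.
Definition frk (o : option {set 'I_m}) : nat := if o is Some F then (rk F).+1 else 0.
Definition fab (o : option {set 'I_m}) G : bool := if o is Some F then ~~ (G \subset F) else true.
Definition fle (o : option {set 'I_m}) G : bool := if o is Some F then flat F && (F \subset G) else true.

(* Replace the first [h A] by [h G]; the error terms contain some [X K] with [A] inside [K] but not
   [G], and either the factors lying in [K :&: G] or the remaining ones together with [X K] vanish
   by induction. *)
Lemma mixed M o G (l : seq {set 'I_m}) k : ((size l + k) * m.+1 + #|G| < M)%N ->
  fle o G -> fab o G -> all (fun A => (A \subset G) && fab o A) l ->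
  (rk G < size l + k + frk o)%N ->
  N (fac o * \prod_(A <- l) h A * h G ^+ k).
Proof.
elim: M o G l k => // M IHM o G; elim=> [|A l IHl] k hM oG aG; rewrite ?[all _ _]/= => al hk.
  rewrite big_nil mulr1 h_cl; have kG := rk_cl G; set G' := cl pi rk set0 G in kG *.
  have fG : flat G' := cl_sflat pi hP _ _.
  have GG' : G \subset G' := sub_cl _ _ _ _.
  case: o oG aG hk {hM} => [F|] /= oG aG hk; last first.
    by rewrite mul1r; apply: (ideal_le hN _ (hh1 fG)); rewrite add0n addn0 in hk; apply: leq_ltn_trans hk.
  have /andP [fF FG] := oG.
  have FG' : F \proper G'.
    by rewrite properE (subset_trans FG GG') /=; apply: contra aG; apply: subset_trans.
  have -> : k = (k - (rk G' - rk F) + (rk G' - rk F))%N by rewrite subnK //; lia.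
  by rewrite exprD mulrCA; apply: NM; apply: hXh.
have /andP [/andP [AG aA] {}al] := al.
have -> : fac o * \prod_(B <- A :: l) h B * h G ^+ k =
   fac o * \prod_(B <- l) h B * h G ^+ k.+1 +
   \sum_(K : {set 'I_m} | (A \subset K) && ~~ (G \subset K)) fac o * X K * (\prod_(B <- l) h B * h G ^+ k).
  rewrite big_cons -mulr_suml -mulr_sumr.
  have -> : h A = h G + \sum_(K : {set 'I_m} | (A \subset K) && ~~ (G \subset K)) X K.
    rewrite /h (bigID (fun K : {set 'I_m} => G \subset K)) /=; congr (_ + _); apply: eq_bigl => K.
    by apply: andb_idl => GK; apply: subset_trans GK.
  by rewrite exprS; ring.
apply: ND; first by apply: IHl => //; move: hM hk => /=; rewrite !addSn addnS.
apply: ideal_sum => // K /andP [AK GK].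
have [fK|/X0 ->] := boolP (flat K); last by rewrite mulr0 mul0r.
case oK: (if o is Some F then F \subset K else true); last first.
  case: o oG aA oK {IHl hM aG al hk} => [F|//] /= /andP [fF FG] AF FK.
  apply: NMr; apply: hXX => //; first by rewrite FK.
  by apply: contra AF; apply: subset_trans.
pose l1 := filter (fun B => B \subset K) l; pose l2 := filter (fun B => ~~ (B \subset K)) l.
have el : \prod_(B <- l) h B = \prod_(B <- l1) h B * \prod_(B <- l2) h B.
  by rewrite (bigID (fun B => B \subset K)) /= !big_filter.
have sl : (size l1 + size l2)%N = size l by rewrite !size_filter count_predC.
have cm (B : {set 'I_m}) : (#|B| <= m)%N by rewrite -[X in (_ <= X)%N]card_ord max_card.
have hM' b : (b <= size l + k)%N -> (b * m.+1 + m < M)%N.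
  move=> hb; move: hM; rewrite ltnS /= addSn mulSn => hM.
  by move: hM (leq_mul hb (leqnn m.+1)); clear; lia.
have [hlt|hge] := ltnP (rk (G :&: K)) (size l1 + frk o).
  have -> : fac o * X K * (\prod_(B <- l) h B * h G ^+ k) =
      fac o * \prod_(B <- l1) h B * h (G :&: K) ^+ 0 * (X K * \prod_(B <- l2) h B * h G ^+ k).
    by rewrite el; ring.
  apply: NMr; apply: IHM.
  - by rewrite addn0; apply: leq_ltn_trans (hM' (size l1) _); [rewrite leq_add2l | move: sl; clear; lia].
  - by case: o oG oK {IHl hM aG aA al hk hlt} => [F|//] /= /andP [-> FG] FK; rewrite subsetI FG.
  - case: o aA {IHl hM aG oG al hk hlt oK} => [F|//] /=; apply: contra; apply: subset_trans.
    by rewrite subsetI AG.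
  - rewrite all_filter; apply: sub_all al => B /= /andP [BG aB]; apply/implyP => BK.
    by rewrite subsetI BG BK.
  by rewrite addn0.
have -> : fac o * X K * (\prod_(B <- l) h B * h G ^+ k) =
    X K * \prod_(B <- l2 ++ nseq k G) h B * h (G :|: K) ^+ 0 * (fac o * \prod_(B <- l1) h B).
  by rewrite el big_cat big_nseq /= -Monoid.iteropE -/(_ ^+ k); ring.
apply: NMr; apply: (IHM (Some K)).
- rewrite size_cat size_nseq addn0; apply: leq_ltn_trans (hM' (size l2 + k)%N _); last by move: sl; clear; lia.
  by rewrite leq_add2l.
- by rewrite /= fK subsetUr.
- by rewrite /= subUset subxx andbT.
- rewrite all_cat all_nseq subsetUl /= GK orbT andbT all_filter.
  apply: sub_all al => B /= /andP [BG _]; apply/implyP => ->; rewrite andbT.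
  exact: subset_trans BG (subsetUl _ _).
rewrite size_cat size_nseq /=; move: (rk_sub hP G K) hk hge sl => /=; clear; lia.
Qed.

(** The case of [mixed] with [G] empty, no factors and exponent 1, which applies because
    [rk set0 = 0]. *)
Lemma sumX_null : N (\sum_F X F).
Proof.
have -> : \sum_F X F = h set0 by apply: eq_bigl => F; rewrite sub0set.
have := mixed (M := m.+2) (o := None) (G := set0) (l := [::]) (k := 1%N).
  rewrite big_nil !mul1r expr1; apply=> //=; first by rewrite cards0 add0n mul1n addn0.
  by have [-> _ _ _] := hP.
Qed.

(** The value of [x_j] is forced by its linear relation; the full set labels no ray and gets 0. *)
Definition zlab (L : Lab m n) : P :=
  match L with inl F => if F == setT then 0 else X F | inr j => - h [set pi j] end.

Lemma chow_base : chow pi rk zlab N.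
Proof.
have hall : N (h set0).
  by have := sumX_null; congr N; apply: eq_bigl => F; rewrite sub0set.
split=> // [S C nc|j]; last first.
  rewrite /= -opprD; apply: idealN => //.
  have -> : h [set pi j] + \sum_(F : {set 'I_m} | pi j \notin F) (if F == setT then 0 else X F) = h set0; last exact: hall.
  rewrite /h [RHS](bigID (fun F : {set 'I_m} => pi j \in F)) /=; congr (_ + _).
    by apply: eq_bigl => F; rewrite sub1set sub0set.
  apply: eq_big => [F|F jF]; rewrite ?sub0set // ifN //.
  by apply: contraNneq jF => ->; rewrite inE.
have prodC F : F \in C -> N (zlab (inl F)) -> N (xC zlab C * xS zlab S).
  by move=> FC hF; rewrite /xC (big_setD1 F FC) /=; do 2! apply: NMr.
have [/forall_inP fC|] := boolP [forall F in C, flat F && (F != setT)]; last first.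
  move=> /forall_inPn [F FC]; rewrite negb_and negbK => h1; apply: (prodC F FC) => /=.
  by case: eqP h1 => // _; rewrite orbF => /X0 ->.
have zF F : F \in C -> zlab (inl F) = X F.
  by move=> /fC /andP [_ /negbTE e]; rewrite /zlab e.
have [cC|] := boolP (chain C); last first.
  move=> /forall_inPn [F FC /forall_inPn [G GC]]; rewrite negb_or => /andP [FG GF].
  have GCF : G \in C :\ F by rewrite !inE GC andbT; apply: contraNneq FG => ->.
  rewrite /xC (big_setD1 F FC) (big_setD1 G GCF) /= -/(zlab (inl F)) -/(zlab (inl G)) !zF //.
  rewrite mulrA; do 2! apply: NMr; apply: hXX => //.
    by have /andP [] := fC F FC.
  by have /andP [] := fC G GC.
(* The factors [x_j] with [j] in [T] are, up to sign, classes [h [set pi j]], so [mixed] with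
   exponent 0 kills the monomial once [T] exceeds the available rank. *)
have main o G (T : {set 'I_n}) : T \subset S -> fle o G -> fab o G ->
    (forall j, j \in T -> (pi j \in G) && fab o [set pi j]) -> (rk G < #|T| + frk o)%N ->
    N (fac o * xS zlab S).
  move=> TS oG aG hT hr.
  have e1 : xS zlab S = \prod_(j in T) zlab (inr j) * \prod_(j in S :\: T) zlab (inr j).
    rewrite /xS (big_setID T) /=; congr (_ * _); apply: eq_bigl => j; rewrite !inE.
    by apply: andb_idl; apply: (subsetP TS).
  have e2 : \prod_(j in T) zlab (inr j) = (-1) ^+ #|T| * \prod_(A <- [seq [set pi j] | j <- enum T]) h A.
    rewrite big_map big_enum /= (eq_bigr (fun j => -1 * h [set pi j])); last by move=> j _; rewrite mulN1r.
    by rewrite big_split /= prodr_const.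
  have := mixed (M := (#|T| * m.+1 + #|G|).+1) (o := o) (G := G) (l := [seq [set pi j] | j <- enum T]) (k := 0%N).
  rewrite size_map -cardE !addn0 ltnSn => /(_ isT oG aG) h1.
  rewrite e1 e2.
  have -> : fac o * ((-1) ^+ #|T| * \prod_(A <- [seq [set pi j] | j <- enum T]) h A * \prod_(j in S :\: T) zlab (inr j))
    = (-1) ^+ #|T| * \prod_(j in S :\: T) zlab (inr j) *
      (fac o * \prod_(A <- [seq [set pi j] | j <- enum T]) h A * h G ^+ 0) by ring.
  apply: NM; apply: h1 => //; apply/allP => A /mapP [j]; rewrite mem_enum => /hT /andP [jG aj] ->.
  by rewrite sub1set jG.
have [iS|] := boolP (ind pi rk S); last first.
  rewrite negb_forall => /existsP [A]; rewrite -ltnNge => hA; apply: NM.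
  have := main None A (S :&: pi @^-1: A) (subsetIl _ _) isT isT; rewrite mul1r; apply.
    by move=> j; rewrite !inE => /andP [_ ->].
  by rewrite addn0.
have [/forall_inP sC|] := boolP [forall F in C, sflat pi rk S F].
  case/negP: nc; apply/conepP; split=> //; last by move=> F G FC /(forall_inP (forall_inP cC F FC)).
  by move=> F FC; have /andP [_ ->] := fC F FC; rewrite sC.
move=> /forall_inPn [F FC]; rewrite negb_forall => /existsP [A].
have arith (r1 r2 u v t : nat) : (r2 + u <= r1 + v)%N -> (u + t = v)%N -> (r2 < t + r1.+1)%N by lia.
rewrite negb_imply -leqNgt => /andP [FA hA].
have /andP [fF FT] := fC F FC.
rewrite /xC (big_setD1 F FC) /= -/(zlab (inl F)) zF // -mulrA mulrCA; apply: NM.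
apply: (main (Some F) A ((S :&: pi @^-1: A) :\: pi @^-1: F)).
- by apply: subset_trans (subsetDl _ _) (subsetIl _ _).
- by rewrite /= fF proper_sub.
- by move: FA; rewrite properE => /andP [].
- by move=> j; rewrite !inE /= sub1set => /andP [-> /andP [_ ->]].
have := cardsID (pi @^-1: F) (S :&: pi @^-1: A).
rewrite -setIA -preimsetI (setIidPr (proper_sub FA)) => e.
exact: (arith _ _ _ _ _ hA e).
Qed.
End Mixed.
End BaseChow.

(** * The Chow ring of the fan *)

Section MpolyGa.
Variables (R : comNzRingType) (N : nat).
Local Notation T := {mpoly R[N]}.

Definition mp_hom k (p : T) : Prop := p \is k.-homog.

Lemma mp_ind (P : T -> Prop) : (forall p q, P p -> P q -> P (p + q)) ->
  (forall k p, mp_hom k p -> P p) -> forall p, P p.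
Proof.
move=> PD Ph p; rewrite (mpolyE p); elim/big_rec: _ => [|m q _ hq].
  by apply: (Ph 0%N); apply: dhomog0.
by apply: PD => //; apply: (Ph (mdeg m)); apply: dhomogZ; rewrite [_ \in _]dhomogX.
Qed.

Lemma mp_span k : exists b : seq T, (forall x, x \in b -> mp_hom k x) /\
  (forall x, mp_hom k x -> lspan (@mpolyC N R) b x).
Proof.
exists [seq 'X_[R, bmnm m] | m <- enum {: 'X_{1..N < k.+1}} & mdeg (bmnm m) == k]; split.
  by move=> x /mapP [m]; rewrite mem_filter => /andP [mk _] ->; rewrite /mp_hom dhomogX.
move=> x hx; have sx : (msize x <= k.+1)%N.
  by rewrite mmeasureE; apply/bigmax_leqP_seq => u ux _; rewrite ltnS; move/dhomogP: hx => /(_ u ux) ->.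
rewrite (mpolywE sx); elim/big_rec: _ => [|m q _ hq]; first exact: lspan0.
apply: lspanD => //; have [mk|mk] := eqVneq (mdeg (bmnm m)) k.
  rewrite -mul_mpolyC; apply: lspanZ; apply: lspan_mem; apply/mapP; exists m => //.
  by rewrite mem_filter mk eqxx mem_enum.
by rewrite (dhomog_nemf_coeff hx mk) scale0r; apply: lspan0.
Qed.

Definition mpolyGA : ga R.
Proof.
apply: (@Ga R {mpoly R[N]} (GRing.RMorphism.clone R {mpoly R[N]} (@mpolyC N R) _) mp_hom).
- by move=> k; apply: dhomog0.
- by move=> k x y; apply: dhomogD.
- by move=> j k x y; apply: dhomogM.
- by move=> c; apply/dhomogP => m; rewrite msuppC; case: eqP => // _; rewrite inE => /eqP ->; apply: mdeg0.
- exact: mp_ind.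
- exact: mp_span.
Defined.

Lemma mpoly_gen_ind (P : T -> Prop) : (forall p q, P p -> P q -> P (p + q)) ->
  (forall p q, P p -> P q -> P (p * q)) -> (forall c, P c%:MP) -> (forall i, P 'X_i) -> forall p, P p.
Proof.
move=> PD PM PC PX p; rewrite (mpolyE p); elim/big_rec: _ => [|m q _ hq]; first by rewrite -mpolyC0.
apply: PD => //; rewrite -mul_mpolyC mpolyXE_id; apply: (PM _ _) => //.
elim/big_rec: _ => [|i u _ hu]; first by rewrite -mpolyC1.
apply: (PM _ _) => //; elim: (m i) => [|k IH]; first by rewrite expr0 -mpolyC1.
by rewrite exprS; apply: (PM _ _).
Qed.

Variables (P : ga R) (z : 'I_N -> P).
Definition evz : {rmorphism mpolyGA -> P} := GRing.RMorphism.clone mpolyGA P (mmap (@ga_sc R P) z) _.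
Lemma evz_X i : evz ('X_i : T) = z i. Proof. by rewrite /= mmapX mmap1U. Qed.
Lemma evz_C c : evz (c%:MP : T) = ga_sc P c. Proof. exact: mmapC. Qed.
Lemma evz_hom k p : (forall i, ga_hom 1 (z i)) -> ga_hom k p -> ga_hom k (evz p).
Proof.
move=> hz hp; rewrite (mpolyE p) rmorph_sum big_seq; apply: hom_sum => m mp.
rewrite -mul_mpolyC rmorphM evz_C; apply: homZ.
rewrite mpolyXE_id rmorph_prod; move/dhomogP: hp => /(_ m mp) <-; rewrite /= mdegE.
elim/big_rec2: _ => [|i d u _ hu]; first exact: hom1.
by rewrite rmorphXn; apply: ga_homM => //; rewrite -/(evz _) evz_X; apply: homX1.
Qed.

Lemma rmorph_agree (f g : {rmorphism mpolyGA -> P}) (J : P -> Prop) : ideal J ->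
  (forall c, f (c%:MP : T) = g (c%:MP : T)) -> (forall i, J (f ('X_i : T) - g ('X_i : T))) ->
  forall p : T, J (f p - g p).
Proof.
move=> hJ hc hX; have [J0 JD JM] := hJ.
apply: mpoly_gen_ind => [p q hp hq|p q hp hq|c|i] //; last by rewrite hc subrr.
  by rewrite !rmorphD opprD addrACA; apply: JD.
rewrite !rmorphM; have -> : f p * f q - g p * g q = f p * (f q - g q) + (f p - g p) * g q by ring.
by apply: JD; [apply: JM | apply: idealMr].
Qed.
End MpolyGa.

Section ChowRing.
Variables (m n : nat) (a : 'I_m -> nat) (pi : 'I_n -> 'I_m).
Hypothesis hpi : forall i : 'I_m, #|pi @^-1: [set i]| = a i.
Variables (rk : {set 'I_m} -> nat).
Hypothesis hP : is_polymatroid a rk.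
Implicit Types (A B F G H K : {set 'I_m}) (S : {set 'I_n}) (C : {set {set 'I_m}}).
Local Notation N := (nrays rk pi).
Local Notation rayi := (@ray_of m n rk pi).

Section Labels.
Variables (R : comNzRingType) (T : ga R) (w : Lab m n -> T).
Lemma lab_prod (V : {set Lab m n}) : \prod_(L in V) w L = xC w (labC V) * xS w (labS V).
Proof.
rewrite big_sumType /= /xC /xS; congr (_ * _); apply: eq_bigl => u; by rewrite inE.
Qed.
Lemma lab_sum j : \sum_L (ray_vec pi L j)%:~R * w L =
  w (inr j) - \sum_(F : {set 'I_m} | pi j \notin F) w (inl F).
Proof.
rewrite big_sumType /= addrC; congr (_ + _).
  rewrite (bigD1 j) //= eqxx mul1r big1 ?addr0 // => i /negbTE ij.
  by rewrite eq_sym ij mul0r.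
rewrite -sumrN big_mkcond [RHS]big_mkcond; apply: eq_bigr => F _ /=.
by case: ifP; rewrite ?mul0r ?mulN1r.
Qed.
End Labels.

Section Fixed.
Variable (R : comNzRingType).
Local Notation T := (mpolyGA R N).
Local Notation I := (@chow_ideal R m n rk pi).

(** Extension by 0 to labels that are not rays lets sums and products range over labels instead of
    ray indices. *)
Definition xl (L : Lab m n) : T := \sum_(i < N | rayi i == L) ('X_i : {mpoly R[N]}).
Lemma xl_ray i : xl (rayi i) = ('X_i : {mpoly R[N]}).
Proof.
rewrite /xl (big_pred1 i) // => j /=; apply/eqP/eqP => [|-> //]; exact: enum_val_inj.
Qed.
Lemma xl_nonray L : L \notin rays rk pi -> xl L = 0.
Proof.
move=> nL; rewrite /xl big1 // => i /eqP e; case/negP: nL; rewrite -e; exact: enum_valP.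
Qed.
Lemma xl_hom L : ga_hom 1 (xl L).
Proof. by apply: hom_sum => i _; rewrite /= /mp_hom dhomogX /= mdeg1. Qed.
Lemma sum_xl (c : Lab m n -> T) : \sum_i c (rayi i) * ('X_i : {mpoly R[N]}) = \sum_L c L * xl L.
Proof.
rewrite /xl; under [RHS]eq_bigr => L _ do rewrite mulr_sumr.
rewrite (exchange_big_dep xpredT) //=; apply: eq_bigr => i _.
by rewrite (big_pred1 (rayi i)).
Qed.
Lemma raysP L : (L \in rays rk pi) = conep pi rk (labS [set L]) (labC [set L]).
Proof. by rewrite inE (is_coneE hpi hP). Qed.
Lemma ray_ex L : L \in rays rk pi -> exists i, rayi i = L.
Proof. by move=> h; exists (enum_rank_in h L); rewrite /ray_of enum_rankK_in. Qed.

Lemma I_gen g : chow_gen g -> I g.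
Proof.
move=> h; exists [:: (1, g)]; rewrite big_seq1 mul1r; split=> // q.
by rewrite inE => /eqP ->.
Qed.
Lemma ideal_I : @ideal R T I.
Proof.
split; first by exists [::]; rewrite big_nil.
  move=> p q [s [hs ->]] [t [ht ->]]; exists (s ++ t); rewrite big_cat; split=> // u.
  by rewrite mem_cat => /orP [/hs|/ht].
move=> p q [s [hs ->]]; exists [seq (p * u.1, u.2) | u <- s]; split.
  by move=> u /mapP [v vs ->] /=; apply: hs.
by rewrite big_map mulr_sumr; apply: eq_bigr => u _ /=; rewrite mulrA.
Qed.

Lemma chow_xl : chow pi rk xl I.
Proof.
split; first exact: ideal_I.
  move=> S C nc; rewrite -(cone_labelsK S C).1 -{1}(cone_labelsK S C).2 -lab_prod.
  have [hr|] := boolP [forall L in cone_labels S C, L \in rays rk pi]; last first.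
    move=> /forall_inPn [L LV nL]; rewrite (bigD1 L) //= xl_nonray // mul0r; by case: ideal_I.
  pose V := [set i | rayi i \in cone_labels S C].
  have eV : cone_labels S C = [set rayi i | i in V].
    apply/setP => L; apply/idP/imsetP => [LV|[i]]; last by rewrite inE => h ->.
    have [i ei] := ray_ex (forall_inP hr L LV); exists i => //; by rewrite inE ei.
  apply: I_gen; left; exists V; split; first by rewrite -eV (is_coneE hpi hP) (cone_labelsK S C).1 (cone_labelsK S C).2.
  rewrite {1}eV big_imset => [|i j _ _]; last exact: enum_val_inj.
  by apply: eq_bigr => i _; rewrite xl_ray.
move=> j; rewrite -lab_sum -(sum_xl (fun L => (ray_vec pi L j)%:~R)); apply: I_gen; right.
exists (fun i => (i == j)%:R); apply: eq_bigr => i _.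
rewrite (bigD1 j) //= eqxx mulr1 big1 ?addr0; last by move=> k /negbTE ->; rewrite mulr0.
by rewrite -mul_mpolyC rmorph_int.
Qed.

Section Universal.
Variables (P : ga R) (z : Lab m n -> P) (J : P -> Prop).
Hypothesis hz : chow pi rk z J.
Let hJ : ideal J := chow_ideal_J hz.
Definition evl := evz (fun i => z (rayi i)).

Lemma chow_nonray L : L \notin rays rk pi -> J (z L).
Proof.
rewrite raysP => nL; have := chow_SR hz nL; rewrite -lab_prod; by rewrite big_set1.
Qed.

Lemma evl_xl L : J (evl (xl L) - z L).
Proof.
have [/ray_ex [i <-]|nL] := boolP (L \in rays rk pi).
  by rewrite xl_ray /evl evz_X subrr; case: hJ.
by rewrite xl_nonray // rmorph0 sub0r; apply: idealN => //; apply: chow_nonray.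
Qed.

(** Universal property of the Chow ring. The linear generator of a general vector [v] is a
    combination of the coordinate relations in [chow]. *)
Lemma I_evl p : I p -> J (evl p).
Proof.
have [J0 JD JM] := hJ.
move=> [s [hs ->]]; rewrite rmorph_sum big_seq; apply: ideal_sum => // q qs.
rewrite rmorphM; apply: (JM _ _); have [[V [nV ->]]|[v ->]] := hs _ qs.
  rewrite rmorph_prod (eq_bigr (fun i => z (rayi i))); last by move=> i _; rewrite /evl evz_X.
  have := nV; rewrite (is_coneE hpi hP) => /(chow_SR hz); rewrite -lab_prod big_imset // => i j _ _.
  exact: enum_val_inj.
have e : evl (\sum_(i < N) (\sum_(j < n) ray_vec pi (rayi i) j * v j)%:~R *: 'X_i) =
    \sum_(i < N) (\sum_(j < n) ray_vec pi (rayi i) j * v j)%:~R * evl (xl (rayi i)).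
  by rewrite rmorph_sum; apply: eq_bigr => i _; rewrite -mul_mpolyC rmorphM evz_C rmorph_int xl_ray.
rewrite e; have -> : \sum_(i < N) (\sum_(j < n) ray_vec pi (rayi i) j * v j)%:~R * evl (xl (rayi i)) =
    evl (\sum_L (\sum_(j < n) ray_vec pi L j * v j)%:~R * xl L).
  rewrite -(sum_xl (fun L => (\sum_(j < n) ray_vec pi L j * v j)%:~R)) rmorph_sum.
  by apply: eq_bigr => i _; rewrite rmorphM rmorph_int xl_ray.
have -> : \sum_L (\sum_(j < n) ray_vec pi L j * v j)%:~R * xl L =
   \sum_j (v j)%:~R * \sum_L (ray_vec pi L j)%:~R * xl L.
  under eq_bigr => L _ do rewrite rmorph_sum mulr_suml.
  rewrite exchange_big; apply: eq_bigr => j _; rewrite mulr_sumr; apply: eq_bigr => L _.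
  by rewrite rmorphM /=; ring.
rewrite rmorph_sum; apply: ideal_sum => // j _; rewrite rmorphM; apply: (JM _ _).
rewrite rmorph_sum -(subrK (\sum_L (ray_vec pi L j)%:~R * z L) (\sum_L _)); apply: JD.
  rewrite -sumrB; apply: ideal_sum => // L _; rewrite rmorphM rmorph_int -mulrBr; apply: (JM _ _).
  exact: evl_xl.
rewrite lab_sum; exact: chow_LIN hz j.
Qed.
End Universal.
End Fixed.
End ChowRing.

Section State.
Variables (L : finType) (le : rel L) (top : L -> L) (join : L -> L -> L).
Hypothesis oax : order_ax le top.
Variable R : comNzRingType.
Local Notation olt := (olt le).
Local Notation zP := (zP le top).
Local Notation zrho := (zrho top).
Local Notation dims := (dims top).
Local Notation good := (good le top join).
Local Notation ok := (ok le).
Local Notation stl := (stl le top R).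
Local Notation th := (th le top).
Local Notation rels := (rels le top).
Local Notation m0 := (m0 le top R).
Local Notation S rho s := (stS (stl rho s)).
Local Notation X rho s := (@stX _ _ (stl rho s)).
Local Notation D rho s := (@stD _ _ (stl rho s)).
Local Notation hsum := (hsum le top R).
Local Notation null_to_rels := (null_to_rels le top join R).

(** The monomial is the divisor of [F], the top power of the fibre class and the product of
    [centre_prod], so its integral is 1 right after [F] is added. A later product step adds the top
    power of its variable, and a later blow-up leaves a constant polynomial. *)
Lemma D_exc_m0 U rho F s : good U rho -> ok U s -> F \in s -> top F != F ->
  D rho s (X rho s F * (- hsum rho s F) ^+ (rho F).-1 *
    ((- X rho s (top F)) ^+ (rho (top F) - rho F).-1 *
     \prod_(G | (G \in s) && (top G == G) && (G != top F)) (- X rho s G) ^+ (rho G).-1)) = 1.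
Proof.
move=> gU + + tF; elim: s => // G s IH oks; have [UG Gs up oks'] := oks.
have XC K : K != G -> X rho (G :: s) K = ((X rho s K)%:P : {poly S rho s}).
  by rewrite X_cons => /negbTE ->.
have sG K : K \in s -> K != G by move=> Ks; apply: contraNneq Gs => <-.
have prodC (P : pred L) : (forall K, P K -> K \in s) ->
    \prod_(K | P K) (- X rho (G :: s) K) ^+ (rho K).-1 =
    ((\prod_(K | P K) (- X rho s K) ^+ (rho K).-1)%:P : {poly S rho s}).
  move=> hPs; rewrite (rmorph_prod (@polyC (S rho s))); apply: eq_bigr => K /hPs /sG KG.
  by rewrite (XC _ KG) (rmorphXn (@polyC (S rho s))) /= polyCN.
rewrite inE => /orP [/eqP e|Fs]; last have FG := sG _ Fs.
  rewrite -e in UG Gs up oks oks' XC sG prodC *.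
  have ts : top F \in s by apply: up; [apply: (g_top gU UG) | rewrite /olt (ole_top oax) eq_sym].
  have -> : \prod_(K | (K \in F :: s) && (top K == K) && (K != top F)) (- X rho (F :: s) K) ^+ (rho K).-1 =
     ((\prod_(K | (K \in s) && (top K == K) && (K != top F)) (- X rho s K) ^+ (rho K).-1)%:P : {poly S rho s}).
    rewrite -prodC; last by move=> K /andP [/andP []].
    apply: eq_bigl => K; rewrite inE; case: eqP => [->|//]; rewrite (negbTE tF) ?andbF //=.
  rewrite (XC _ (sG _ ts)) X_cons eqxx h_consF // opprK -polyCN -(rmorphXn (@polyC (S rho s))) /= -polyCM.
  have := centre_prod oax R gU oks tF; rewrite /Dcen; set w := _ * \prod_(K | _) _ => hw.
  have r0 := g_pos gU UG.
  rewrite /= (negbTE tF) -mulrA -[in Dbl (rho F)](prednK r0) Dbl_exc prednK // coefMC coefXn eqxx mul1r.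
  exact: hw.
have UF := ok_U oks' Fs.
have FT : olt F (top F) by rewrite /olt (ole_top oax) eq_sym.
have ts := ok_up oks' Fs (g_top gU UF) (olt_ole FT).
have FnG : ~~ le F G by apply: contra Gs => FG'; apply: (ok_up oks' Fs UG FG').
rewrite (XC _ FG) (XC _ (sG _ ts)) h_consN //.
have := IH oks' Fs; set w := (X in D rho s X = 1) => hw.
have [tG|tG] := eqVneq (top G) G.
  rewrite (bigD1 G) ?inE ?eqxx ?tG ?eqxx ?(eq_sym G) ?(sG _ ts) //.
  rewrite (eq_bigl (fun K => (K \in s) && (top K == K) && (K != top F))); last first.
    by move=> K; rewrite inE; case: eqP => [->|_]; rewrite ?(negbTE Gs) ?andbT ?andbF.
  rewrite prodC; last by move=> K /andP [/andP []].
  set P := \prod_(K | _) _ in w hw *.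
  have eG : X rho (G :: s) G = (- 'X : {poly S rho s}).
    by rewrite X_cons eqxx (h_top oax) // X_out // oppr0 polyC0 sub0r.
  rewrite eG opprK.
  have -> : (X rho s F)%:P * (- (hsum rho s F)%:P) ^+ (rho F).-1 *
      ((- (X rho s (top F))%:P) ^+ (rho (top F) - rho F).-1 * ('X ^+ (rho G).-1 * P%:P)) =
      ('X^((rho G).-1) * w%:P : {poly S rho s}).
    by rewrite /w !polyCM !polyC_exp !polyCN; ring.
  by rewrite /= tG eqxx /Dcoef mul1r coefXnM ltnn subnn coefC.
have -> : \prod_(K | (K \in G :: s) && (top K == K) && (K != top F)) (- X rho (G :: s) K) ^+ (rho K).-1 =
    ((\prod_(K | (K \in s) && (top K == K) && (K != top F)) (- X rho s K) ^+ (rho K).-1)%:P : {poly S rho s}).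
  rewrite -prodC; last by move=> K /andP [/andP []].
  by apply: eq_bigl => K; rewrite inE; case: eqP => [->|//]; rewrite (negbTE tG) ?andbF.
set P := \prod_(K | _) _ in w hw *.
have -> : (X rho s F)%:P * (- (hsum rho s F)%:P) ^+ (rho F).-1 *
      ((- (X rho s (top F))%:P) ^+ (rho (top F) - rho F).-1 * P%:P) = (w%:P : {poly S rho s}).
  by rewrite /w !polyCM !polyC_exp !polyCN; ring.
by rewrite /= (negbTE tG) -(prednK (g_pos gU UG)) Dbl_const.
Qed.
End State.

(** * Degree functionals of the cones *)

Section ConeDegree.
Variables (m n : nat) (a : 'I_m -> nat) (pi : 'I_n -> 'I_m).
Hypothesis hpi : forall i : 'I_m, #|pi @^-1: [set i]| = a i.
Variables (rk : {set 'I_m} -> nat).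
Hypothesis hP : is_polymatroid a rk.
Variable R : comNzRingType.
Implicit Types (A B F G H K : {set 'I_m}) (S : {set 'I_n}) (C : {set {set 'I_m}}).
Local Notation nS := (nS pi).
Local Notation sflat := (sflat pi rk).
Local Notation conep := (conep pi rk).
Local Notation Uc := (Uc pi rk).
Local Notation fS := (fS pi rk).
Local Notation rhoC := (rhoC pi rk).
Local Notation seqC := (seqC pi rk).
Local Notation T := (mpolyGA R (nrays rk pi)).
Local Notation xl := (xl pi rk R).
Local Notation xf := (xf xl).
Local Notation hh := (hh xl).
Local Notation xsig S C := (xsig S C xl).
Local Notation yC S C := (yC pi rk S C xl).

Definition stC S C := stl (leC C) (topC C) R (rhoC S C) (seqC S C).
Local Notation z0 := (zlab pi (@stX _ _ (stC set0 set0))).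
Local Notation ev := (evl pi rk z0).

Lemma stX_nonU S C F : ~~ Uc S C F -> stX (stC S C) F = 0.
Proof. by move=> nU; apply: X_out; rewrite mem_seqC. Qed.

Let r0 : rels (leC set0) (topC set0) (rhoC set0 set0) (@stX _ _ (stC set0 set0))
  (null (@stD _ _ (stC set0 set0))) (seqC set0 set0).
Proof.
exact: (stl_rels (orderC set0) R (goodC hP (conep0 pi rk)) (ok_seqC pi rk set0 set0)).
Qed.
Let hD0 := D_degfun (leC set0) (topC set0) R (rhoC set0 set0) (seqC set0 set0).
Let hN0 : ideal (null (@stD _ _ (stC set0 set0))) := rels_null_hom hD0.

Let p0 F : ~~ sflat set0 F -> stX (stC set0 set0) F = 0.
Proof. by move=> nF; apply: stX_nonU; rewrite Uc0. Qed.
Let p1 F G : sflat set0 F -> sflat set0 G -> ~~ (F \subset G) -> ~~ (G \subset F) ->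
  null (@stD _ _ (stC set0 set0)) (stX (stC set0 set0) F * stX (stC set0 set0) G).
Proof.
move=> fF fG FG GF; apply: (r1 r0); rewrite ?mem_seqC ?Uc0 ?topC0 ?leC0 //.
Qed.
Let p2 F G : sflat set0 F -> sflat set0 G -> F \proper G ->
  null (@stD _ _ (stC set0 set0)) (stX (stC set0 set0) F *
     (\sum_(H : {set 'I_m} | G \subset H) stX (stC set0 set0) H) ^+ (rk G - rk F)).
Proof.
move=> fF fG FG; have := r2 r0 (G := F) (H := G); rewrite !mem_seqC !Uc0 !rhoC0 subSS => h.
rewrite (eq_bigl (leC set0 G)) => [|H]; last by rewrite leC0.
apply: h => //; rewrite /olt leC0 proper_sub //; by apply: contraTneq FG => ->; rewrite properxx.
Qed.
Let p3 G : sflat set0 G ->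
  null (@stD _ _ (stC set0 set0)) ((\sum_(H : {set 'I_m} | G \subset H) stX (stC set0 set0) H) ^+ (rk G).+1).
Proof.
move=> fG; have := r3 r0 (G := G); rewrite !mem_seqC !Uc0 !rhoC0 => h.
by rewrite (eq_bigl (leC set0 G)) => [|H]; [apply: h | rewrite leC0].
Qed.

Lemma base_chow : chow pi rk z0 (null (@stD _ _ (stC set0 set0))).
Proof. exact: (chow_base hP hN0 p0 p1 p2 p3). Qed.
Lemma base_sumX : null (@stD _ _ (stC set0 set0)) (\sum_F stX (stC set0 set0) F).
Proof. exact: (sumX_null hP hN0 p0 p1 p2 p3). Qed.

Definition Dt (p : T) : R := stD (s := stC set0 set0) (ev p).

Lemma z0_hom L : ga_hom 1 (z0 L).
Proof.
case: L => [F|j] /=; first by case: eqP => _; [apply: ga_hom0 | apply: X_hom].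
by apply: homN; apply: hom_sum => H _; apply: X_hom.
Qed.
Lemma ev_hom k p : ga_hom k p -> ga_hom k (ev p).
Proof. by apply: evz_hom => i; apply: z0_hom. Qed.

Lemma dims0 : dims (topC set0) (rhoC set0 set0) (seqC set0 set0) = rk setT.
Proof.
rewrite /dims (eq_bigl (pred1 setT)) => [|F]; last by rewrite topC0 eq_sym.
rewrite -big_filter filter_pred1_uniq ?big_seq1 ?rhoC0 //.
  by rewrite sort_uniq enum_uniq.
by rewrite mem_seqC; apply: UcT.
Qed.

Lemma Dt_degfun : degfun (rk setT) Dt.
Proof.
rewrite -dims0; split.
  split=> [p q|c p]; rewrite /Dt.
    by rewrite rmorphD (linD hD0.1).
  by rewrite rmorphM evz_C (linZ hD0.1).
by move=> k p hp; apply: hD0.2; apply: ev_hom.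
Qed.

Lemma null_Dt p : null (@stD _ _ (stC set0 set0)) (ev p) -> null Dt p.
Proof. by move=> np q; rewrite /Dt rmorphM np. Qed.

Lemma chow_mono (P : ga R) (x : Lab m n -> P) (J J' : P -> Prop) : (forall p, J p -> J' p) -> ideal J' ->
  chow pi rk x J -> chow pi rk x J'.
Proof. by move=> JJ hJ' [_ h1 h2]; split=> // *; apply: JJ; [apply: h1 | apply: h2]. Qed.

Lemma I_Dt p : @chow_ideal R m n rk pi p -> null Dt p.
Proof. by move=> /(I_evl hpi hP base_chow); apply: null_Dt. Qed.

Lemma Dt_chow : chow pi rk xl (null Dt).
Proof.
have hI := rels_null_hom Dt_degfun; exact: (chow_mono (P := T) (J' := null Dt) I_Dt hI (chow_xl hpi hP R)).
Qed.

Definition thC S C := th (leC C) (topC C) (rhoC S C) (yC S C) (seqC S C).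

Lemma xf_hom F : ga_hom 1 (xf F).
Proof.
rewrite /xf; case: eqP => _; last exact: xl_hom.
by apply: homN; apply: hom_sum => G _; apply: xl_hom.
Qed.
Lemma hh_hom F : ga_hom 1 (hh F). Proof. by apply: hom_sum => G _; apply: xf_hom. Qed.
Lemma yC_hom S C F : ga_hom 1 (yC S C F).
Proof.
rewrite /(yC _ _); case: ifP => _; last exact: ga_hom0.
by case: ifP => _; [apply: hh_hom | apply: xf_hom].
Qed.

Lemma hhT : hh setT = xf setT.
Proof.
rewrite /hh (big_pred1 setT) // => H /=; apply/idP/eqP => [h|-> //].
by apply/eqP; rewrite -subTset.
Qed.

Lemma ev_xf F : null (@stD _ _ (stC set0 set0)) (ev (xf F) - stX (stC set0 set0) F).
Proof.
have [e|FT] := eqVneq F setT; last first.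
  have := evl_xl hpi hP base_chow (inl F); rewrite /xf (negbTE FT) /=.
  by rewrite (negbTE FT).
rewrite e /xf eqxx rmorphN rmorph_sum -opprD; apply: (nullN hD0).
have := base_sumX; rewrite (bigD1 setT) //= => h.
set u := _ + _ in h; set v := _ + _.
rewrite -(subrK u v); apply: (nullD hD0) h.
have -> : v - u = \sum_(G : {set 'I_m} | G != setT) (ev (xl (inl G)) - stX (stC set0 set0) G).
  by rewrite /u /v sumrB; ring.
apply: (null_sum hD0) => G GT.
by have := evl_xl hpi hP base_chow (inl G); rewrite /= (negbTE GT).
Qed.

Lemma ev_th0 f : null (@stD _ _ (stC set0 set0)) (ev (thC set0 set0 f) - f).
Proof.
rewrite /thC (th_comp (T := T) (phi := ev)); last exact: evz_C.
have {2}-> : f = th (leC set0) (topC set0) (rhoC set0 set0) (@stX _ _ (stC set0 set0)) (seqC set0 set0) f.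
  by rewrite (th_id (orderC set0) _ (ok_seqC pi rk set0 set0)).
apply: (th_cong hN0) => K Ks; rewrite -sumrB; apply: (null_sum hD0) => H _.
have [UH|nU] := boolP (Uc set0 set0 H); last first.
  by rewrite stX_nonU // /(yC _ _) (negbTE nU) rmorph0 subrr; apply: (null0 hD0).
have -> : yC set0 set0 H = xf H; last exact: ev_xf.
rewrite /(yC _ _) UH topC0; case: eqP => [<-|//]; exact: hhT.
Qed.

Section OneCone.
Variables (S : {set 'I_n}) (C : {set {set 'I_m}}).
Hypothesis hc : conep S C.
Definition Dsig (p : T) : R := Dt (xsig S C * p).
Local Notation rho := (rhoC S C).

Lemma xsig_hom : ga_hom (#|C| + #|S|) (xsig S C).
Proof.
have h (I : finType) (V : {set I}) (w : I -> T) : (forall i, ga_hom 1 (w i)) ->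
    ga_hom #|V| (\prod_(i in V) w i).
  move=> hw; rewrite -sum1_card; elim/big_rec2: _ => [|i d u _ hu]; first exact: hom1.
  exact: ga_homM.
by apply: ga_homM; apply: h => u; apply: xl_hom.
Qed.

Lemma Dsig_degfun : degfun (rk setT - (#|C| + #|S|)) Dsig.
Proof.
have hT := Dt_degfun; split.
  by split=> [p q|c p]; rewrite /Dsig ?mulrDr ?(linD hT.1) // mulrCA (linZ hT.1).
move=> k p hp kd; have [e|e] := eqVneq ((#|C| + #|S|) + k)%N (rk setT).
  by rewrite -e addKn eqxx in kd.
by apply: (hT.2 _ _ _ e); apply: ga_homM => //; apply: xsig_hom.
Qed.

Lemma null_Dsig p : Jsig S C xl (null Dt) p <-> null Dsig p.
Proof. by split=> h q; have := h q; rewrite /Dsig mulrA. Qed.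

Lemma I_Dsig p : @chow_ideal R m n rk pi p -> null Dsig p.
Proof. by move=> /I_Dt np; apply/null_Dsig; apply: nullM. Qed.

Let gC := goodC hP hc.
Let okC := ok_seqC pi rk S C.
Lemma yC_nonU F : ~~ Uc S C F -> yC S C F = 0.
Proof. by rewrite /(yC _ _) => /negbTE ->. Qed.

Lemma null_thC f : null (stD (s := stC S C)) f -> null Dsig (thC S C f).
Proof.
move=> nf; apply/null_Dsig.
apply: (null_to_relsP (orderC C) (leqnn _) gC okC) nf.
- exact: ideal_Jsig Dt_chow.
- exact: yC_nonU.
exact: (rels_cone hpi hP hc Dt_chow).
Qed.

(** The image of [m0] ([thC_m0]); its integral decides the normalisation on the star of the cone. *)
Definition mC : T := \prod_(F | (F \in C) || (F == setT)) (- hh F) ^+ (rho F).-1.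

Lemma thC_X F : Uc S C F -> thC S C (stX (stC S C) F) = yC S C F.
Proof.
move=> UF; rewrite /thC (th_X (orderC C) _ F yC_nonU okC) mem_seqC UF //.
Qed.

Lemma thC_h F : Uc S C F ->
  null Dsig (thC S C (hsum (leC C) (topC C) R rho (seqC S C) F) - hh F).
Proof.
move=> UF; apply/null_Dsig; have := yC_sum hP hc Dt_chow UF; congr (Jsig _ _ _ _ (_ - _)).
rewrite /hsum rmorph_sum; apply: eq_bigr => K _.
have [UK|nU] := boolP (Uc S C K); first by rewrite -thC_X.
by rewrite yC_nonU // [stX _ _](stX_nonU nU) rmorph0.
Qed.

Lemma yC_top F : (F \in C) || (F == setT) -> yC S C F = hh F.
Proof.
move=> CF; have UF : Uc S C F by case/orP: CF => [/(UcC hc)//|/eqP ->]; apply: UcT.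
by rewrite /(yC _ _) UF (topC_id hc) CF.
Qed.

Lemma thC_m0 : thC S C (m0 (leC C) (topC C) R rho (seqC S C)) = mC.
Proof.
rewrite m0E; last by rewrite sort_uniq enum_uniq.
rewrite rmorph_prod /mC; apply: eq_big => F.
  rewrite mem_seqC (topC_id hc); apply: andb_idl => /orP [/(UcC hc)//|/eqP ->]; exact: UcT.
move=> /andP [+ tF]; rewrite mem_seqC => UF.
rewrite rmorphXn rmorphN; congr ((- _) ^+ _); rewrite -/(thC S C) thC_X // yC_top //.
by rewrite -(topC_id hc).
Qed.

Hypothesis kappa : Dsig mC = 1.

Lemma kappa_deg : (rk setT - (#|C| + #|S|) = dims (topC C) rho (seqC S C))%N /\
  forall f, Dsig (thC S C f) = stD (s := stC S C) f.
Proof.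
apply: (state_uniq (orderC C) gC okC Dsig_degfun (yC_hom S C) null_thC).
by rewrite thC_m0.
Qed.
End OneCone.
End ConeDegree.

Section ConeDegree.
Variables (m n : nat) (a : 'I_m -> nat) (pi : 'I_n -> 'I_m).
Hypothesis hpi : forall i : 'I_m, #|pi @^-1: [set i]| = a i.
Variables (rk : {set 'I_m} -> nat).
Hypothesis hP : is_polymatroid a rk.
Variable R : comNzRingType.
Implicit Types (A B F G H K : {set 'I_m}) (S : {set 'I_n}) (C : {set {set 'I_m}}).
Local Notation nS := (nS pi).
Local Notation sflat := (sflat pi rk).
Local Notation conep := (conep pi rk).
Local Notation Uc := (Uc pi rk).
Local Notation fS := (fS pi rk).
Local Notation rhoC := (rhoC pi rk).
Local Notation seqC := (seqC pi rk).
Local Notation T := (mpolyGA R (nrays rk pi)).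
Local Notation xl := (xl pi rk R).
Local Notation xf := (xf xl).
Local Notation hh := (hh xl).
Local Notation xsig S C := (xsig S C xl).
Local Notation yC S C := (yC pi rk S C xl).

Local Notation stC := (stC pi rk R).
Local Notation z0 := (zlab pi (@stX _ _ (stC set0 set0))).
Local Notation ev := (evl pi rk z0).
Local Notation Dt := (@Dt m n pi rk R).
Local Notation thC := (thC pi rk R).
Local Notation Dsig := (@Dsig m n pi rk R).
Local Notation mC := (mC pi rk R).
Local Notation I := (@chow_ideal R m n rk pi).

Local Notation bC := (bC pi rk).

Lemma Dsig0 p : Dsig set0 set0 p = Dt p.
Proof. by rewrite /Dsig !xsigE /xC /xS !big_set0 !mul1r. Qed.

Lemma kappa0 : Dsig set0 set0 (mC set0 set0) = 1.
Proof.
rewrite Dsig0 -(thC_m0 R (conep0 pi rk)).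
have hD0 := D_degfun (leC set0) (topC set0) R (rhoC set0 set0) (seqC set0 set0).
rewrite /Dt (null_congr hD0 (ev_th0 hpi hP _)).
exact: (D_m0 (orderC set0) R (goodC hP (conep0 pi rk)) (ok_seqC pi rk set0 set0)).
Qed.

Lemma mC_set0 S : mC S set0 = (- hh setT) ^+ fS S setT.
Proof.
rewrite /mC (big_pred1 setT) => [|F]; last by rewrite inE.
by rewrite rhoCE /bC big_pred0 ?subn0 // => K; rewrite inE.
Qed.

(** Removes one [j] from [S]: against the other factors [x_j] acts as [- hh setT], because the flats
    in the difference are killed by [chow_rel], and the exponent in [mC] changes accordingly by
    one. *)
Lemma kappaS k S : #|S| = k -> conep S set0 -> Dsig S set0 (mC S set0) = 1.
Proof.
elim: k S => [|k IH] S.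
  by move=> /eqP; rewrite cards_eq0 => /eqP -> _; apply: kappa0.
move=> eS hc; have [j jS] : exists j, j \in S by apply/set0Pn; rewrite -card_gt0 eS.
pose S' := S :\ j; have jS' : j \notin S' by rewrite !inE eqxx.
have SS : S = j |: S' by rewrite setD1K.
have nSS A : nS S A = ((pi j \in A) + nS S' A)%N by rewrite SS nS_setU1.
have iS : ind pi rk S by case/conepP: hc.
have hc' : conep S' set0.
  apply/conepP; split=> [|F|F G]; rewrite ?inE //.
  by apply/forallP => A; have := indP A iS; rewrite nSS; lia.
have <- := IH S' _ hc'; last by have := cardsD1 j S; rewrite jS eS => -[].
have eT : fS S' setT = (fS S setT).+1.
  by rewrite !fSE; have := indP setT iS; rewrite nSS inE; lia.
rewrite /Dsig !mC_set0 eT; apply: (null_congr (Dt_degfun pi rk R)).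
rewrite !xsigE SS xS_setU1 // -SS; set kk := fS S setT.
have -> : xC xl set0 * (xl (inr j) * xS xl S') * (- hh setT) ^+ kk - xC xl set0 * xS xl S' * (- hh setT) ^+ kk.+1 =
  xC xl set0 * (xS xl S' * (xl (inr j) + hh setT) * (- hh setT) ^+ kk) by rewrite exprS; ring.
have hch := Dt_chow hpi hP R; have hJ := chow_ideal_J hch.
apply: nullM.
have -> : xl (inr j) + hh setT = (xl (inr j) + hh [set pi j]) -
     \sum_(H : {set 'I_m} | (pi j \in H) && ~~ (setT \subset H)) xf H.
  by rewrite (hh_split _ (G := setT)) ?inE //; ring.
rewrite mulrBr mulrBl; apply: (idealB hJ).
  apply: nullMr; apply: nullM; exact: (chow_xj hch).
rewrite mulr_sumr mulr_suml; apply: ideal_sum => // H /andP [jH TH].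
rewrite exprNn (mulrC (xS xl S')) mulrCA; apply: nullM.
apply: (chow_rel hpi hP hch); first by rewrite properE subsetT.
have := indP H iS; have := indP setT iS; rewrite /kk fSE !nSS jH inE; lia.
Qed.

Section RemoveFlat.
Variables (S : {set 'I_n}) (C : {set {set 'I_m}}) (F : {set 'I_m}).
Hypotheses (hc : conep S C) (FC : F \in C).
Let C' := C :\ F.
Let t := topC C' F.
Let C'C G : G \in C' -> G \in C. Proof. by rewrite !inE => /andP []. Qed.
Lemma conep_D1 : conep S C'.
Proof.
move/conepP: hc => [h1 h2 h3]; apply/conepP; split=> // [G /C'C/h2 //|G H /C'C GC /C'C]; exact: h3.
Qed.
Let hc' := conep_D1.
Let FT : F != setT. Proof. by case/conepP: hc => _ /(_ F FC) []. Qed.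
Let FC' : F \notin C'. Proof. by rewrite !inE eqxx. Qed.
Let sC G : G \in C -> sflat S G. Proof. by case/conepP: hc => _ + _ => h /h []. Qed.
Let UF : Uc S C' F.
Proof.
by apply/UcP; split=> [|K /C'C KC]; [apply: sC | case/conepP: hc => _ _; apply].
Qed.
Let tF : t != F. Proof. by rewrite (topC_id hc') negb_or FC'. Qed.
Let tC' : (t \in C') || (t == setT).
Proof. by rewrite -(topC_id hc') topC_top. Qed.
Let Ft : F \proper t.
Proof. by rewrite properEneq eq_sym tF sub_topC. Qed.
Let topF : topC C F = F. Proof. by apply/eqP; rewrite (topC_id hc) FC. Qed.
Let topt : topC C t = t.
Proof.
apply/eqP; rewrite (topC_id hc); case/orP: tC' => [/C'C -> //|->]; exact: orbT.
Qed.

Let bCF : bC S C F = bC S C' t.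
Proof.
apply: eq_bigl => K; rewrite !inE; apply/andP/andP => [[KC KF]|[/andP [KF KC] Kt]]; split=> //.
- by rewrite KC andbT; apply: contraTneq KF => ->; rewrite properxx.
- exact: proper_trans KF Ft.
by apply: (Uc_below UF) => //; rewrite !inE KF.
Qed.

Let bCt : bC S C t = (fS S F).+1.
Proof.
apply/eqP; rewrite eqn_leq; apply/andP; split; last first.
  by apply: (bigop.bigmax_sup F) => //; rewrite FC.
apply/bigmax_leqP => K /andP [KC Kt]; rewrite ltnS.
have [->//|KF] := eqVneq K F; apply: (fS_le hc (sC KC)); apply: proper_sub.
by apply: (Uc_below UF) => //; rewrite !inE KF.
Qed.

Let bCG G : (G \in C') || (G == setT) -> G != t -> bC S C G = bC S C' G.
Proof.
move=> GC Gt; apply/eqP; rewrite eqn_leq; apply/andP; split; last first.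
  by apply/bigmax_leqP => K /andP [/C'C KC KG]; apply: (bigop.bigmax_sup K); rewrite ?KC.
apply/bigmax_leqP => K /andP [KC KG]; have [eK|KF] := eqVneq K F; last first.
  by apply: (bigop.bigmax_sup K); rewrite // !inE KF KC.
rewrite eK in KG *.
have tG : t \proper G.
  rewrite properEneq eq_sym Gt /=; case/orP: GC => [GC|/eqP ->]; last exact: subsetT.
  by apply: topC_sub => //; apply: proper_sub.
have tC : t \in C'.
  by case/orP: tC' => // /eqP e; move: tG; rewrite e properE subsetT andbF.
apply: (bigop.bigmax_sup t); first by rewrite tC.
by rewrite ltnS; apply: (fS_le hc (sC FC)); apply: proper_sub.
Qed.

Lemma rhoC_D1F : rhoC S C F = rhoC S C' F.
Proof. by rewrite !rhoCE topF bCF. Qed.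
Lemma rhoC_D1t : rhoC S C t = (rhoC S C' t - rhoC S C' F)%N.
Proof.
rewrite !rhoCE topt bCt topC_top // -/t; have := bC_lt hc' UF; rewrite -/t.
by have := fS_mono hc (sC FC) Ft; lia.
Qed.
Lemma rhoC_D1G G : (G \in C') || (G == setT) -> G != t -> rhoC S C G = rhoC S C' G.
Proof.
move=> GC Gt; rewrite !rhoCE.
have -> : topC C G = G.
  by apply/eqP; rewrite (topC_id hc); case/orP: GC => [/C'C -> //|->]; rewrite orbT.
have -> : topC C' G = G by apply/eqP; rewrite (topC_id hc').
by rewrite bCG.
Qed.

Hypothesis kappa' : Dsig S C' (mC S C') = 1.

(** Without [F] the two adjacent intervals of the chain merge and [F] becomes an element of the link
    below its top; times the divisor of [F], [mC S C] corresponds to the monomial of [D_exc_m0]. *)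
Lemma kappa_D1 : Dsig S C (mC S C) = 1.
Proof.
have gC := goodC hP hc'; have okC := ok_seqC pi rk S C'.
have [_ dE] := kappa_deg hpi hP hc' kappa'.
have Fs : F \in seqC S C' by rewrite mem_seqC.
have := D_exc_m0 (orderC C') R gC okC Fs tF; rewrite -/(stC S C') -dE => <-.
have eD p : Dsig S C p = Dsig S C' (xf F * p).
  rewrite /Dsig !xsigE (xC_D1 hc xl FC); congr (Dt _); ring.
rewrite eD; apply: (null_congr (Dsig_degfun pi rk R S C')).
have th (G : {set 'I_m}) : (G \in C') || (G == setT) -> thC S C' (stX (stC S C') G) = hh G.
  move=> CG; have UG : Uc S C' G by case/orP: CG => [/(UcC hc')//|/eqP ->]; apply: UcT.
  by rewrite thC_X // yC_top.
rewrite !rmorphM !rmorphXn !rmorphN /= -/t.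
rewrite [thC S C' (stX _ F)]thC_X // /(yC _ _) UF (negbTE tF) th //.
set Q := (- hh t) ^+ _ * _.
set hF := thC S C' _.
have -> : mC S C = (- hh F) ^+ (rhoC S C' F).-1 * Q.
  rewrite /mC (bigD1 F) ?FC //= rhoC_D1F; congr (_ * _); rewrite (bigD1 t) /=; last first.
    rewrite tF andbT; case/orP: tC' => [/C'C -> //|->]; exact: orbT.
  rewrite /Q rhoC_D1t; congr (_ * _); rewrite rmorph_prod; apply: eq_big => [G|G].
    rewrite mem_seqC (topC_id hc').
    apply/idP/idP => [/andP [/andP [CG GF] Gt]|/andP [/andP [UG CG] Gt]].
      have CG' : (G \in C') || (G == setT) by rewrite !inE GF.
      rewrite CG' Gt !andbT; case/orP: CG' => [/(UcC hc')//|/eqP ->]; exact: UcT.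
    rewrite Gt andbT; case/orP: CG => [|/eqP ->].
      by rewrite !inE => /andP [-> ->].
    by rewrite eqxx orbT eq_sym FT.
  move=> /andP [/andP [CG GF] Gt].
  have CG' : (G \in C') || (G == setT) by rewrite !inE GF.
  by rewrite rhoC_D1G // rmorphXn rmorphN /= th.
have hDs := Dsig_degfun pi rk R S C'.
have ringE (u v w y : T) : u * (v * w) - u * y * w = u * w * (v - y) by ring.
rewrite ringE.
apply: nullM; rewrite subrXX; apply: nullMr; rewrite opprK addrC.
exact: (thC_h hpi hP hc' UF).
Qed.
End RemoveFlat.

Lemma kappa S C : conep S C -> Dsig S C (mC S C) = 1.
Proof.
move: {2}#|C| (erefl #|C|) => k; elim: k C => [|k IH] C.
  by move=> /eqP; rewrite cards_eq0 => /eqP ->; apply: kappaS.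
move=> eC hc; have [F FC] : exists F, F \in C by apply/set0Pn; rewrite -card_gt0 eC.
apply: (kappa_D1 hc FC); apply: IH; last exact: (conep_D1 F hc).
by have := cardsD1 F C; rewrite FC eC => -[].
Qed.
End ConeDegree.

(** * Surjectivity onto the links, and generators *)

Section Onto.
Variables (m n : nat) (a : 'I_m -> nat) (pi : 'I_n -> 'I_m).
Hypothesis hpi : forall i : 'I_m, #|pi @^-1: [set i]| = a i.
Variables (rk : {set 'I_m} -> nat).
Hypothesis hP : is_polymatroid a rk.
Variable R : comNzRingType.
Implicit Types (A B F G H K : {set 'I_m}) (S : {set 'I_n}) (C : {set {set 'I_m}}).
Local Notation nS := (nS pi).
Local Notation sflat := (sflat pi rk).
Local Notation conep := (conep pi rk).
Local Notation Uc := (Uc pi rk).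
Local Notation fS := (fS pi rk).
Local Notation rhoC := (rhoC pi rk).
Local Notation seqC := (seqC pi rk).
Local Notation T := (mpolyGA R (nrays rk pi)).
Local Notation xl := (xl pi rk R).
Local Notation xf := (xf xl).
Local Notation hh := (hh xl).
Local Notation xsig S C := (xsig S C xl).
Local Notation yC S C := (yC pi rk S C xl).

Local Notation stC := (stC pi rk R).
Local Notation z0 := (zlab pi (@stX _ _ (stC set0 set0))).
Local Notation ev := (evl pi rk z0).
Local Notation Dt := (@Dt m n pi rk R).
Local Notation thC := (thC pi rk R).
Local Notation Dsig := (@Dsig m n pi rk R).
Local Notation mC := (mC pi rk R).
Local Notation I := (@chow_ideal R m n rk pi).

Local Notation X_ i := ('X_i : T).

Lemma mpoly_ideal_gen (Q : T -> Prop) k (y : T) : ideal Q -> (forall i, Q ('X_i : {mpoly R[nrays rk pi]})) ->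
  ga_hom k.+1 y -> Q y.
Proof.
move=> hQ QX hy; have [_ _ QM] := hQ; rewrite (mpolyE y) big_seq; apply: (ideal_sum (T := T)) => // u uy.
move/dhomogP: hy => /(_ u uy) /= eu; rewrite -mul_mpolyC; apply: (QM _ _).
have [/existsP [i ui]|] := boolP [exists i, (0 < u i)%N].
  rewrite mpolyXE_id (bigD1 i) //= -(prednK ui) exprS.
  rewrite -mulrA; apply: (idealMr (T := T) _ hQ); exact: QX.
rewrite negb_exists => /forallP h0; suff : mdeg u = 0%N by rewrite eu.
by rewrite mdegE big1 // => i _; apply/eqP; rewrite -leqn0 leqNgt.
Qed.

Section Cone.
Variables (S : {set 'I_n}) (C : {set {set 'I_m}}).
Hypothesis hc : conep S C.
Let hch := Dt_chow hpi hP R.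
Let hDs := Dsig_degfun pi rk R S C.
Let hQ0 := rels_null_hom hDs.
Let nD (p : T) : null Dt p -> null (Dsig S C) p.
Proof. by move=> np; apply/null_Dsig; apply: nullM. Qed.

(** Descending induction: a chain member is its [hh] minus strictly larger flats. *)
Lemma xf_down (Q : T -> Prop) : (forall a b, Q a -> Q b -> Q (a - b)) -> Q 0 ->
  (forall F, (F \in C) || (F == setT) -> Q (hh F)) ->
  (forall F, F \notin C -> F != setT -> Q (xf F)) -> forall F, Q (xf F).
Proof.
move=> QB Q0 Qh Qn F.
have QD u v : Q u -> Q v -> Q (u + v).
  by move=> hu hv; rewrite -[v]opprK -[- v]sub0r; do 2! apply: (QB _ _) => //.
move: {2}#|~: F| (leqnn #|~: F|) => k; elim: k F => [|k IH] F hF.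
  have -> : F = setT by apply: setC_inj; rewrite setCT; apply/eqP; rewrite -cards_eq0 -leqn0.
  by rewrite -hhT; apply: Qh; rewrite eqxx orbT.
have [CF|] := boolP ((F \in C) || (F == setT)); last first.
  by rewrite negb_or => /andP [h1 h2]; apply: Qn.
have -> : xf F = hh F - \sum_(H : {set 'I_m} | (F \subset H) && (H != F)) xf H.
  by rewrite [hh F](bigD1 F) //= addrK.
apply: (QB _ _ (Qh F CF)); elim/big_rec: _ => [|H t /andP [FH HF] ht]; first exact: Q0.
apply: (QD _ _) => //; apply: IH.
have pFH : F \proper H by rewrite properEneq eq_sym HF.
have := proper_card pFH; have := cardsC F; have := cardsC H; lia.
Qed.

Definition in_link (p : T) := exists2 u, ga_hom 1 u & null (Dsig S C) (p - thC S C u).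

(** By [xf_down] it suffices to reach [hh] at the tops and the flats off the chain; these are values
    [yC] or die against [xsig]. Each [x_j] is minus a sum of flats. *)
Lemma link_X i : in_link ('X_i : {mpoly R[nrays rk pi]}).
Proof.
have LB p q : in_link p -> in_link q -> in_link (p - q).
  move=> [u hu nu] [v hv nv]; exists (u - v); first exact: homB.
  have -> : p - q - thC S C (u - v) = (p - thC S C u) - (q - thC S C v) by rewrite rmorphB; ring.
  exact: (nullB hDs).
have L0 p : null (Dsig S C) p -> in_link p.
  by move=> np; exists 0; [apply: ga_hom0 | rewrite rmorph0 subr0].
have l0 : in_link 0 by apply: (L0 _); apply: (null0 hDs).
have Ly F : Uc S C F -> in_link (yC S C F).
  by move=> UF; exists (stX (stC S C) F); [apply: X_hom | rewrite thC_X // subrr; apply: (null0 hDs)].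
have Lx F : in_link (xf F).
  apply: xf_down => // {}F; first by move=> CF; rewrite -(yC_top R hc CF); apply: Ly; case/orP: CF => [/(UcC hc)//|/eqP ->]; apply: UcT.
  move=> FC FT; have [UF|nU] := boolP (Uc S C F); last first.
    by apply: (L0 _); apply/null_Dsig; exact: (Jsig_U hc hch nU).
  have := Ly F UF; rewrite /(yC _ _) UF (topC_id hc) (negbTE FC) (negbTE FT) //.
rewrite -(xl_ray R i); case e : (ray_of i) => [F|j].
  have [eF|FT] := eqVneq F setT; last by have := Lx F; rewrite /xf (negbTE FT).
  rewrite xl_nonray // (raysP hpi hP); apply/negP => /conepP [_ /(_ F) h _].
  by case: h; rewrite ?inE // eF eqxx.
have -> : xl (inr j) = 0 - (0 - (xl (inr j) + hh [set pi j])) - hh [set pi j] by ring.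
apply: (LB _ _); first by apply: (LB _ _) => //; apply: (LB _ _) => //; apply: (L0 _); apply: nD; exact: (chow_xj hch).
have LD p q : in_link p -> in_link q -> in_link (p + q).
  by move=> hp hq; rewrite -[q]opprK -[- q]sub0r; do 2! apply: (LB _ _) => //.
by rewrite /hh; elim/big_rec: _ => [|H t _ ht] //; apply: (LD _ _).
Qed.

Lemma link_onto k (p : T) : ga_hom k p -> exists2 u, ga_hom k u & null (Dsig S C) (p - thC S C u).
Proof.
have /choice [u hu] i : exists u, ga_hom 1 u /\ null (Dsig S C) (('X_i : T) - thC S C u).
  by have [u] := link_X i; exists u.
move=> hp; exists (evz u p); first by apply: evz_hom hp => i; have [] := hu i.
have := rmorph_agree (P := T) (f := GRing.RMorphism.clone T T idfun _)
  (g := GRing.RMorphism.clone T T (thC S C \o evz u) _) hQ0.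
move=> /=; apply=> [c|i].
  by rewrite evz_C th_sc.
by rewrite evz_X; have [] := hu i.
Qed.

(* The rays of a cone can be rewritten modulo the linear relations by the other rays. *)
Lemma link_gen (Q : T -> Prop) : ideal Q -> (forall p, null (Dsig S C) p -> Q p) ->
  (forall F, F \notin C -> Q (xl (inl F))) -> (forall j, j \notin S -> Q (xl (inr j))) ->
  forall L, Q (xl L).
Proof.
move=> hQ Qn QF Qj; have [Q0 QD QM] := hQ.
have QB u v : Q u -> Q v -> Q (u - v) by apply: idealB.
have Qxj j : Q (xl (inr j) + hh [set pi j]) by apply: Qn; apply: nD; exact: (chow_xj hch).
have Qxf F : F \notin C -> F != setT -> Q (xf F) by move=> FC FT; rewrite /xf (negbTE FT); apply: QF.
have iS : ind pi rk S by case/conepP: hc.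
have Qh t : (t \in C) || (t == setT) -> Q (hh t).
  move=> Ct; have Ut : Uc S C t by case/orP: Ct => [/(UcC hc)//|/eqP ->]; apply: UcT.
  have main j : j \notin S -> pi j \in t ->
      (forall H, H \in C -> pi j \in H -> ~~ (t \subset H) -> False) -> Q (hh t).
    move=> jS jt hH; have := hh_split xl jt; set sm := \sum_(_ | _) _ => eh.
    have -> : hh t = (xl (inr j) + hh [set pi j]) - xl (inr j) - sm by rewrite eh; ring.
    apply: (QB _ _); first by apply: (QB _ _) => //; apply: Qj.
    apply: ideal_sum => // H /andP [jH tH]; apply: Qxf; last by apply: contraNneq tH => ->; apply: subsetT.
    by apply/negP => HC; apply: (hH H).
  have tK K : K \in C -> ~~ (t \subset K) -> K \proper t.
    by case/UcP: Ut => _ h /h /orP [->//|Kt] tK; rewrite properE Kt.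
  have [/existsP [K0 h0]|] := boolP [exists K, (K \in C) && (K \proper t)]; last first.
    rewrite negb_exists => /forallP nK.
    have [/existsP [j /andP [jS jt]]|] := boolP [exists j, (j \notin S) && (pi j \in t)].
      by apply: (main j) => // H HC _ /(tK _ HC) Ht; have := nK H; rewrite HC Ht.
    rewrite negb_exists => /forallP hS; apply: Qn; apply/null_Dsig.
    rewrite /Jsig !xsigE -mulrA; apply: nullM; rewrite -[hh t]expr1.
    apply: (chow_rel0 hpi hP hch); rewrite addnC leq_add2l.
    have := rk_pre hpi hP (sub0set t); case: (hP) => -> _ _ _; rewrite add0n setD0 => h.
    apply: (leq_trans h); apply: subset_leq_card; apply/subsetP => j; rewrite !inE => jt.
    by have := hS j; rewrite jt andbT negbK => ->.
  case: (arg_maxnP (P := fun K => (K \in C) && (K \proper t)) (fun K : {set 'I_m} => #|K|) h0) => K /andP [KC Kt] hK.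
  have sK : sflat S K by case/conepP: hc => _ /(_ K KC) [].
  have [j jS /andP [jt jK]] := sflat_pre hpi hP sK Kt.
  apply: (main j) => // H HC jH tH; have Ht := tK H HC tH.
  have /conepP [_ _ /(_ H K HC KC)/orP [HK|KH]] := hc.
    by case/negP: jK; apply: (subsetP HK).
  have := hK H; rewrite HC Ht => /(_ isT) le.
  have /eqP e : K == H by rewrite eqEcard KH.
  by case/negP: jK; rewrite e.
have Qxa F : Q (xf F) by apply: xf_down.
case=> [F|j].
  have [eF|FT] := eqVneq F setT; last by have := Qxa F; rewrite /xf (negbTE FT).
  by apply: QF; apply/negP => FC; case/conepP: hc => _ /(_ F FC) []; rewrite eF eqxx.
have -> : xl (inr j) = (xl (inr j) + hh [set pi j]) - hh [set pi j] by ring.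
by apply: (QB _ _) => //; apply: ideal_sum.
Qed.
End Cone.
End Onto.

(** Inverts summation over the elements below by the recursion [step], which is stable at [F] after
    [w F + 1] rounds; dominance keeps [0 <= t <= ep]. *)
Lemma ordered_moebius (R : realFieldType) (L : finType) (lt : rel L) (w : L -> nat) (U : pred L) (ep : L -> R) :
  (forall F G, lt F G -> (w F < w G)%N) -> (forall F, ~~ U F -> ep F = 0) ->
  (forall F, U F -> \sum_(G | lt G F) ep G < ep F) ->
  exists t : L -> R, [/\ forall F, 0 <= t F, forall F, ~~ U F -> t F = 0 &
    forall F, U F -> ep F = t F + \sum_(G | lt G F) t G].
Proof.
move=> hw h0 h1.
pose step (t : L -> R) F := if U F then ep F - \sum_(G | lt G F) t G else 0.
pose tn k := iter k step (fun=> 0).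
have st k F : (w F < k)%N -> tn k F = tn k.+1 F.
  elim: k F => // k IH F hF; change (step (tn k) F = step (tn k.+1) F); rewrite /step; case: ifP => // _.
  congr (_ - _); apply: eq_bigr => G /hw GF; apply: IH; exact: leq_trans GF hF.
pose M := (\max_F w F).+1.
have tE F : tn M F = step (tn M) F.
  by rewrite st // ltnS; apply: leq_bigmax.
exists (tn M).
have tU F : ~~ U F -> tn M F = 0 by move=> nU; rewrite tE /step (negbTE nU).
have t2 k F : (w F < k)%N -> 0 <= tn M F <= ep F.
  elim: k F => // k IH F hF; have [UF|nU] := boolP (U F); last by rewrite tU // h0 // lexx.
  rewrite tE /step UF.
  have hG G : lt G F -> 0 <= tn M G <= ep G by move=> /hw GF; apply: IH; apply: leq_trans GF hF.
  have s1 : 0 <= \sum_(G | lt G F) tn M G by apply: sumr_ge0 => G /hG /andP [].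
  have s2 : \sum_(G | lt G F) tn M G <= \sum_(G | lt G F) ep G by apply: ler_sum => G /hG /andP [].
  by have := h1 F UF; lra.
split=> // F; first by have /andP [] := t2 _ F (ltnSn _).
by move=> UF; rewrite {1}tE /step UF subrK.
Qed.

(** * The Hodge-Riemann relations for all cones *)

Section Hodge.
Variables (m n : nat) (a : 'I_m -> nat) (pi : 'I_n -> 'I_m).
Hypothesis hpi : forall i : 'I_m, #|pi @^-1: [set i]| = a i.
Variables (rk : {set 'I_m} -> nat).
Hypothesis hP : is_polymatroid a rk.
Variable R : realType.
Implicit Types (A B F G H K : {set 'I_m}) (S : {set 'I_n}) (C : {set {set 'I_m}}).
Local Notation nS := (nS pi).
Local Notation sflat := (sflat pi rk).
Local Notation conep := (conep pi rk).
Local Notation Uc := (Uc pi rk).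
Local Notation fS := (fS pi rk).
Local Notation rhoC := (rhoC pi rk).
Local Notation seqC := (seqC pi rk).
Local Notation T := (mpolyGA R (nrays rk pi)).
Local Notation xl := (xl pi rk R).
Local Notation xf := (xf xl).
Local Notation hh := (hh xl).
Local Notation xsig S C := (xsig S C xl).
Local Notation yC S C := (yC pi rk S C xl).

Local Notation stC := (stC pi rk R).
Local Notation z0 := (zlab pi (@stX _ _ (stC set0 set0))).
Local Notation ev := (evl pi rk z0).
Local Notation Dt := (@Dt m n pi rk R).
Local Notation thC := (thC pi rk R).
Local Notation Dsig := (@Dsig m n pi rk R).
Local Notation mC := (mC pi rk R).
Local Notation I := (@chow_ideal R m n rk pi).

Local Notation sc := (@ga_sc R T).
Implicit Types (V : {set Lab m n}) (L : Lab m n).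

Definition con V := conep (labS V) (labC V).
Definition DV V := Dsig (labS V) (labC V).
Local Notation d V := (rk setT - #|V|)%N.

Let hch := Dt_chow hpi hP R.
Let hI : @ideal R T I := ideal_I pi rk R.

Lemma card_lab V : (#|labC V| + #|labS V|)%N = #|V|.
Proof.
rewrite -!sum1_card big_sumType /=; congr (_ + _)%N; apply: eq_bigl => u; by rewrite inE.
Qed.
Lemma DV_degfun V : degfun (d V) (DV V).
Proof. by rewrite -card_lab; apply: Dsig_degfun. Qed.
Lemma DVE V p : DV V p = Dt ((\prod_(L in V) xl L) * p).
Proof. by rewrite lab_prod. Qed.
Lemma DV_add L V p : L \notin V -> DV (L |: V) p = DV V (xl L * p).
Proof. by move=> LV; rewrite !DVE big_setU1 // mulrCA mulrA. Qed.
Lemma I_DV V p : I p -> null (DV V) p. Proof. exact: (I_Dsig hpi hP). Qed.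

Lemma DV_ncon V L : L \notin V -> ~~ con (L |: V) -> null (DV V) (xl L).
Proof.
move=> LV nc p; rewrite -DV_add // DVE lab_prod; have := chow_SR hch nc; exact.
Qed.

Definition combo (c : Lab m n -> R) : T := \sum_L sc (c L) * xl L.
(** The quantification over all cones lets one class serve on every link without being
    restricted. *)
Definition amp (l : T) := forall V, con V -> exists c, [/\ I (l - combo c), forall L, L \in V -> c L = 0 &
  forall L, L \notin V -> con (L |: V) -> 0 < c L].
Definition nef (l : T) := forall V, con V -> exists c, [/\ I (l - combo c), forall L, L \in V -> c L = 0 &
  forall L, 0 <= c L].

Lemma comboD c c' : combo (fun L => c L + c' L) = combo c + combo c'.
Proof. by rewrite /combo -big_split; apply: eq_bigr => L _ /=; rewrite rmorphD mulrDl. Qed.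
Lemma comboZ r c : combo (fun L => r * c L) = sc r * combo c.
Proof. by rewrite /combo mulr_sumr; apply: eq_bigr => L _ /=; rewrite rmorphM mulrA. Qed.

Lemma nef0 : nef 0.
Proof.
move=> V _; exists (fun=> 0); split=> //; have [I0 _ _] := hI.
by rewrite /combo big1 ?subrr // => L _; rewrite rmorph0 mul0r.
Qed.
Lemma nefD u v r : 0 <= r -> nef u -> nef v -> nef (u + sc r * v).
Proof.
move=> r0 hu hv V hV; have [c [h1 h2 h3]] := hu V hV; have [c' [k1 k2 k3]] := hv V hV.
exists (fun L => c L + r * c' L); split=> [|L LV|L].
- rewrite (comboD c (fun L => r * c' L)) comboZ.
  have -> : u + sc r * v - (combo c + sc r * combo c') = (u - combo c) + sc r * (v - combo c') by ring.
  by have [_ ID IM] := hI; apply: ID => //; apply: IM.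
- by rewrite h2 // k2 // mulr0 addr0.
by rewrite addr_ge0 // mulr_ge0.
Qed.

Lemma amp_path l0 l (t : R) : 0 < t <= 1 -> nef l0 -> amp l -> amp (l0 + sc t * (l - l0)).
Proof.
move=> /andP [t0 t1] h0 hl V hV; have [c [h1 h2 h3]] := h0 V hV; have [c' [k1 k2 k3]] := hl V hV.
exists (fun L => (1 - t) * c L + t * c' L); split=> [|L LV|L LV cL].
- rewrite (comboD (fun L => (1 - t) * c L) (fun L => t * c' L)) !comboZ rmorphB rmorph1.
  have -> : l0 + sc t * (l - l0) - ((1 - sc t) * combo c + sc t * combo c') =
    (1 - sc t) * (l0 - combo c) + sc t * (l - combo c') by ring.
  by have [_ ID IM] := hI; apply: ID; apply: IM.
- by rewrite h2 // k2 // !mulr0 addr0.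
have a1 : 0 <= (1 - t) * c L by apply: mulr_ge0 => //; lra.
have a2 : 0 < t * c' L by apply: mulr_gt0 => //; apply: k3.
lra.
Qed.

(* If [l ^ (d - 2 k) x] vanishes, then [x] is primitive on every divisor [L] of the link; writing
   [l] as a positive combination of these divisors, the Hodge-Riemann forms of the restrictions
   sum to zero, so each restriction vanishes. *)
Lemma HL_links V l : con V -> ga_hom 1 l -> amp l ->
  (forall L, L \notin V -> con (L |: V) -> (0 < d V)%N -> HR (d (L |: V)) (DV (L |: V)) l) ->
  HL (d V) (DV V) l.
Proof.
move=> hV hl ha IH k hk x hx ker; have hD := DV_degfun V.
have [e0|e0] := eqVneq (2 * k)%N (d V).
  apply: (null_hom hD hx) => j y ej hy; have := ker y; rewrite e0 subnn expr0 mul1r; apply.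
  have -> : k = j by lia.
  by [].
have dk : (2 * k < d V)%N by rewrite ltn_neqAle e0.
have [c [h1 h2 h3]] := ha V hV.
have [e ee] : exists e, (d V - 2 * k = e.+1)%N by exists (d V - 2 * k).-1; lia.
have dL L : L \notin V -> d (L |: V) = (d V).-1 by move=> LV; rewrite cardsU1 LV add1n subnS.
have hr L : L \notin V -> con (L |: V) -> 0 <= (-1) ^+ k * DV V (xl L * (l ^+ e * x * x)) /\
    (DV V (xl L * (l ^+ e * x * x)) = 0 -> null (DV V) (xl L * x)).
  move=> LV cL; have := IH L LV cL (leq_ltn_trans (leq0n _) dk).
  move=> /(_ k _ x hx); rewrite dL //.
  have -> : ((d V).-1 - 2 * k = e)%N by lia.
  move=> /(_ _ _) []; [by lia| |].
    move=> j y ej hy; rewrite DV_add //.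
    rewrite mulrCA addn1 -ee.
    by apply: ker; rewrite -ej; apply: (ga_homM (xl_hom _ _ _ _) hy).
  rewrite DV_add // => p1 p2; split=> // /p2 nx y; have := nx y.
  by rewrite DV_add // mulrA.
have sum0 : \sum_L c L * ((-1) ^+ k * DV V (xl L * (l ^+ e * x * x))) = 0.
  have e1 : DV V (l * (l ^+ e * x * x)) = 0.
    have -> : l * (l ^+ e * x * x) = l ^+ (d V - 2 * k) * x * x by rewrite ee exprS !mulrA.
    exact: ker.
  have e2 : DV V (l * (l ^+ e * x * x)) = DV V (combo c * (l ^+ e * x * x)).
    apply: (null_congr hD); rewrite -mulrBl; apply: nullMr; exact: I_DV.
  rewrite e1 /combo mulr_suml (lin_sum hD.1) in e2.
  transitivity ((-1) ^+ k * \sum_L DV V (sc (c L) * xl L * (l ^+ e * x * x))); last by rewrite -e2 mulr0.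
  rewrite mulr_sumr; apply: eq_bigr => L _.
  by rewrite -[sc (c L) * xl L * _]mulrA (linZ hD.1) mulrCA.
have pos L : 0 <= c L * ((-1) ^+ k * DV V (xl L * (l ^+ e * x * x))).
  have [LV|LV] := boolP (L \in V); first by rewrite h2 // mul0r.
  have [cL|nc] := boolP (con (L |: V)); last by rewrite (DV_ncon LV nc) !mulr0.
  by rewrite mulr_ge0 ?(hr _ LV cL).1 // ltW // h3.
have QL L : L \notin V -> null (DV V) (x * xl L).
  move=> LV; rewrite mulrC; have [cL|nc] := boolP (con (L |: V)); last by apply: nullMr; apply: DV_ncon.
  apply: (hr L LV cL).2.
  have /eqP := sum0; rewrite psumr_eq0 => [/allP /(_ L (mem_index_enum _)) /=|L' _]; last exact: pos.
  by rewrite mulf_eq0 (gt_eqF (h3 L LV cL)) mulf_eq0 signr_eq0 => /eqP.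
have hQ : ideal (fun t : T => null (DV V) (x * t)).
  split; first by rewrite mulr0; apply: (null0 hD).
    by move=> u v hu hv; rewrite mulrDr; apply: (nullD hD).
  by move=> u v hv; rewrite mulrCA; apply: nullM.
have Qall : forall L, null (DV V) (x * xl L).
  apply: (link_gen hpi hP hV hQ) => [p np|F FV|j jV]; first exact: nullM.
    by apply: QL; move: FV; rewrite inE.
  by apply: QL; move: jV; rewrite inE.
(* The complementary degree is positive since [2 k < d V], and a class of positive degree lies in
   the ideal of the rays, all of which annihilate [x]. *)
apply: (null_hom hD hx) => j y ej hy; case: j ej hy => [|j] ej hy; first by lia.
apply: null_eq0; apply: (mpoly_ideal_gen hQ _ hy) => i.
by rewrite -(xl_ray R i); apply: Qall.
Qed.

(** An effective expression avoiding the rays of the cone is required. If all chain members contain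
    [G], [e0] is one. Otherwise take the largest member [K] not containing [G] and an element [j]
    over [G] minus [K] outside the cone: the relation of [j] leaves [x_j] and the flats that contain
    [pi j] but not [G], none of them in the chain. *)
Lemma nef_hh G : nef (- hh G).
Proof.
have e0 : - hh G = \sum_(H : {set 'I_m} | ~~ (G \subset H)) xf H.
  have e1 : hh G + \sum_(H : {set 'I_m} | ~~ (G \subset H)) xf H = 0.
    rewrite -[RHS](hh0 xl) [in RHS]/hh [RHS](bigID (fun H : {set 'I_m} => G \subset H)) /=.
    by congr (_ + _); apply: eq_bigl => H; rewrite sub0set.
  by apply/eqP; rewrite -subr_eq0 -opprD oppr_eq0 e1.
move=> V hV; have /conepP [_ sC cC] := hV.
have [I0 ID IM] := hI; have hcI := chow_xl hpi hP R.
have comboE (cF : {set 'I_m} -> bool) (cj : 'I_n -> R) :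
    combo (fun L => match L with inl F => (cF F)%:R | inr j => cj j end) =
    \sum_(F | cF F) xl (inl F) + \sum_j sc (cj j) * xl (inr j).
  rewrite /combo big_sumType /=; congr (_ + _); rewrite [RHS]big_mkcond; apply: eq_bigr => F _.
  by case: (cF F); rewrite ?rmorph1 ?mul1r // rmorph0 mul0r.
have xE (P : pred {set 'I_m}) : (forall H, P H -> ~~ (G \subset H)) ->
    \sum_(H | P H) xf H = \sum_(H | P H) xl (inl H).
  move=> hPs; apply: eq_bigr => H /hPs GH; rewrite /xf ifN //.
  by apply: contraNneq GH => ->; apply: subsetT.
have [/existsP [K0 h0]|] := boolP [exists K, (K \in labC V) && ~~ (G \subset K)]; last first.
  rewrite negb_exists => /forallP nK.
  exists (fun L => match L with inl F => (~~ (G \subset F))%:R | inr j => 0 end); split.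
  - rewrite (comboE (fun F => ~~ (G \subset F)) (fun=> 0)) e0 xE //.
    have -> : \sum_j sc 0 * xl (inr j) = 0 by apply: big1 => j _; rewrite rmorph0 mul0r.
    by rewrite addr0 subrr.
  - move=> [F|j] // FV; have := nK F; rewrite inE FV /= => /negbTE ->; by [].
  - by move=> [F|j] //; apply: ler0n.
case: (arg_maxnP (P := fun K => (K \in labC V) && ~~ (G \subset K)) (fun K : {set 'I_m} => #|K|) h0) => K /andP [KV GK] hK.
have pK : K \proper G :|: K by rewrite properE subsetUr subUset subxx andbT.
have [j jS /andP [jG jK]] := sflat_pre hpi hP (sC K KV).1 pK.
have {}jG : pi j \in G by move: jG; rewrite inE (negbTE jK) orbF.
exists (fun L => match L with inl F => ((pi j \in F) && ~~ (G \subset F))%:R | inr i => (i == j)%:R end); split.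
- rewrite (comboE (fun F => (pi j \in F) && ~~ (G \subset F)) (fun i => (i == j)%:R)).
  rewrite -xE; last by move=> H /andP [].
  have -> : \sum_i sc (i == j)%:R * xl (inr i) = xl (inr j).
    rewrite (bigD1 j) //= eqxx rmorph1 mul1r big1 ?addr0 // => i /negbTE ->; by rewrite rmorph0 mul0r.
  have := chow_xj hcI j; rewrite (hh_split _ jG); set s1 := \sum_(_ | _) _ => hx.
  have -> : - hh G - (s1 + xl (inr j)) = - (xl (inr j) + (hh G + s1)) by ring.
  exact: (idealN (T := T) hI hx).
- move=> [F|i] LV /=; last by case: eqP => // e; case/negP: jS; rewrite inE -e.
  have FC : F \in labC V by rewrite inE.
  case: (boolP (pi j \in F)) => //= jF; case: (boolP (G \subset F)) => //= GF.
  have := hK F; rewrite FC GF => /(_ isT) le.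
  have /orP [FK|KF] := cC F K FC KV; first by rewrite (subsetP FK _ jF) in jK.
  have /eqP e : K == F by rewrite eqEcard KF.
  by rewrite e jF in jK.
by move=> [F|i]; apply: ler0n.
Qed.

(* The classes [- hh G] are nef but, being limits of ample classes, do not satisfy [amp]; a suitable
   combination of them is the ample class of the iterated blow-up. *)
Lemma nef_HR V : con V -> exists l0, [/\ ga_hom 1 l0, nef l0 & HR (d V) (DV V) l0].
Proof.
move=> hV; set S := labS V in hV *; set C := labC V in hV *.
have gC := goodC hP hV; have okC := ok_seqC pi rk S C.
have [ep [hr [ep0 epd]]] := Ev_ex (Ev_and (state_HR (orderC C) R (leqnn _) gC okC) (Ev_dom R okC)).
have [| | |t [t0 tU tE]] := ordered_moebius (lt := olt (leC C)) (w := fun F : {set 'I_m} => #|F|) (U := Uc S C) (ep := ep).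
- by move=> F G /leC_same_proper /proper_card.
- by move=> F nU; apply: ep0; rewrite mem_seqC.
- by move=> F UF; apply: epd; rewrite mem_seqC.
pose l0 : T := \sum_G sc (t G) * - hh G.
have hDs := DV_degfun V.
exists l0; split.
- by apply: hom_sum => G _; apply: homZ; apply: homN; apply: hh_hom.
- rewrite /l0; elim/big_rec: _ => [|G u _ hu]; first exact: nef0.
  by rewrite addrC; apply: nefD => //; apply: nef_hh.
have [ed dE] := kappa_deg hpi hP hV (kappa hpi hP R hV).
rewrite -ed card_lab in hr.
apply: (HR_congr hDs _ (HR_transfer (phi := thC S C) hDs _ dE _ hr)).
- have eL : thC S C (lform (leC C) (topC C) (rhoC S C) (seqC S C) ep) = - \sum_K sc (ep K) * yC S C K.
    rewrite /lform rmorphN rmorph_sum; congr (- _); apply: eq_bigr => K _; rewrite rmorphM th_sc; congr (_ * _).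
    have [UK|nU] := boolP (Uc S C K); first by rewrite -thC_X.
    by rewrite [stX _ _](stX_nonU R nU) rmorph0 yC_nonU.
  have -> : l0 = - \sum_G sc (t G) * hh G by rewrite -sumrN; apply: eq_bigr => G _; rewrite mulrN.
  rewrite eL -opprD; apply: (nullN hDs).
  (* Exchange of summations: the coefficient at [K] is the sum of [t G] over the [G] below or equal
     to [K], that is [ep K]. *)
  have -> : \sum_K sc (ep K) * yC S C K = \sum_G sc (t G) * \sum_(K | leC C G K) yC S C K.
    under [RHS]eq_bigr => G _ do rewrite mulr_sumr.
    rewrite (exchange_big_dep xpredT) //=; apply: eq_bigr => K _; rewrite -mulr_suml -rmorph_sum.
    have [UK|nU] := boolP (Uc S C K); last by rewrite yC_nonU // !mulr0.
    congr (sc _ * _); rewrite (tE K UK) [RHS](bigD1 K) /=; last exact: (ole_refl (orderC C)).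
    by congr (_ + _); apply: eq_bigl => G.
  rewrite -sumrN -big_split; apply: (null_sum hDs) => G _ /=.
  rewrite -mulrBr; have [UG|nU] := boolP (Uc S C G); last first.
    by rewrite tU // rmorph0 mul0r; apply: (null0 hDs).
  apply: nullM; apply/null_Dsig; exact: (yC_sum hP hV hch UG).
- by move=> k x hx; apply: th_hom hx => H; apply: yC_hom.
- by move=> k y hy; apply: (link_onto hpi hP hV hy).
Qed.

Lemma HRall V l : con V -> ga_hom 1 l -> amp l -> HR (d V) (DV V) l.
Proof.
move: {2}(d V) (leqnn (d V)) => k; elim: k V l => [|k IH] V l hk hV hl ha.
all: have [l0 [h1 h2 h3]] := nef_HR hV; apply: (HR_path (DV_degfun V) h1 hl h3) => t ht.
all: have hh : ga_hom 1 (l0 + sc t * (l - l0)) by apply: ga_homD => //; apply: homZ; apply: homB.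
all: apply: HL_links => //; first exact: amp_path.
  by move=> L LV cL d0; lia.
move=> L LV cL d0; apply: IH => //; last exact: amp_path.
by rewrite cardsU1 LV add1n subnS -ltnS prednK.
Qed.
End Hodge.

(** * The annihilator of the degree is the Chow ideal *)

Section Presentation.
Variables (m n : nat) (a : 'I_m -> nat) (pi : 'I_n -> 'I_m).
Hypothesis hpi : forall i : 'I_m, #|pi @^-1: [set i]| = a i.
Variables (rk : {set 'I_m} -> nat).
Hypothesis hP : is_polymatroid a rk.
Variable R : comNzRingType.
Implicit Types (A B F G H K : {set 'I_m}) (S : {set 'I_n}) (C : {set {set 'I_m}}).
Local Notation nS := (nS pi).
Local Notation sflat := (sflat pi rk).
Local Notation conep := (conep pi rk).
Local Notation Uc := (Uc pi rk).
Local Notation fS := (fS pi rk).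
Local Notation rhoC := (rhoC pi rk).
Local Notation seqC := (seqC pi rk).
Local Notation T := (mpolyGA R (nrays rk pi)).
Local Notation xl := (xl pi rk R).
Local Notation xf := (xf xl).
Local Notation hh := (hh xl).
Local Notation xsig S C := (xsig S C xl).
Local Notation yC S C := (yC pi rk S C xl).

Local Notation stC := (stC pi rk R).
Local Notation z0 := (zlab pi (@stX _ _ (stC set0 set0))).
Local Notation ev := (evl pi rk z0).
Local Notation Dt := (@Dt m n pi rk R).
Local Notation thC := (thC pi rk R).
Local Notation Dsig := (@Dsig m n pi rk R).
Local Notation mC := (mC pi rk R).
Local Notation I := (@chow_ideal R m n rk pi).

Local Notation st0 := (stC set0 set0).
Let c0 := conep0 pi rk.
Let hI : @ideal R T I := ideal_I pi rk R.
Let hT := Dt_degfun pi rk R.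
Let hD0 := D_degfun (leC set0) (topC set0) R (rhoC set0 set0) (seqC set0 set0).

Lemma Jsig0 (J : T -> Prop) p : Jsig set0 set0 xl J p <-> J p.
Proof. by rewrite /Jsig !xsigE /xC /xS !big_set0 !mul1r. Qed.

Lemma xl_nonflat F : ~~ sflat set0 F -> xl (inl F) = 0.
Proof.
move=> nF; apply: xl_nonray; rewrite (raysP hpi hP); apply: contra nF => /conepP [_ /(_ F) h _].
have [|sF _] := h; first by rewrite !inE.
suff e : labS [set inl F : Lab m n] = set0 by rewrite e in sF.
by apply/setP => j; rewrite !inE.
Qed.

Lemma yC0_xf F : I (yC set0 set0 F - xf F).
Proof.
have [I0 ID IM] := hI.
have [fF|nF] := boolP (sflat set0 F); last first.
  have FT : F != setT by apply: contraNneq nF => ->; apply: sflatT.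
  by rewrite yC_nonU ?Uc0 // /xf (negbTE FT) xl_nonflat // subrr.
by rewrite /(yC _ _) Uc0 fF topC0; case: eqP => [<-|_]; rewrite ?hhT subrr.
Qed.

Lemma th_ev p : I (thC set0 set0 (ev p) - p).
Proof.
have [I0 ID IM] := hI; have hch := chow_xl hpi hP R.
have := rmorph_agree (P := T) (f := GRing.RMorphism.clone T T (thC set0 set0 \o ev) _)
  (g := GRing.RMorphism.clone T T idfun _) hI.
move=> /=; apply=> [c|i]; first by rewrite evz_C th_sc.
rewrite evz_X -(xl_ray R i); case: (ray_of i) => [F|j].
  have [eF|FT] := eqVneq F setT.
    rewrite /= eF eqxx rmorph0 xl_nonray ?subrr //.
    rewrite (raysP hpi hP); apply/negP => /conepP [_ /(_ setT) h _].
    by case: h; rewrite ?inE // eqxx.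
  rewrite /= (negbTE FT); have [fF|nF] := boolP (sflat set0 F); last first.
    by rewrite stX_nonU ?Uc0 // rmorph0 xl_nonflat // subrr.
  rewrite thC_X ?Uc0 //; have := yC0_xf F; by rewrite /xf (negbTE FT).
rewrite /= rmorphN rmorph_sum.
have -> : - \sum_(H : {set 'I_m} | [set pi j] \subset H) thC set0 set0 (stX st0 H) - xl (inr j) =
   - (\sum_(H : {set 'I_m} | [set pi j] \subset H) (thC set0 set0 (stX st0 H) - xf H)) - (xl (inr j) + hh [set pi j]).
  by rewrite sumrB /hh; ring.
apply: (idealB (T := T) hI); last exact: (chow_xj hch).
apply: (idealN (T := T) hI); apply: (ideal_sum (T := T)) => // H _.
have [UH|nU] := boolP (Uc set0 set0 H); first by rewrite thC_X //; apply: yC0_xf.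
by have := yC0_xf H; rewrite yC_nonU // [stX _ _](stX_nonU R nU) rmorph0.
Qed.

(** A null class has null image in the tower; [null_to_relsP] sends that image back into the Chow
    ideal, and by [th_ev] the round trip is the identity modulo the ideal. *)
Lemma nullI p : null Dt p <-> I p.
Proof.
split=> [np|]; last exact: (I_Dt hpi hP).
have n0 : null (stD (s := st0)) (ev p).
  move=> w; rewrite (null_congr (x := _) (y := ev p * ev (thC set0 set0 w)) hD0).
    by rewrite -rmorphM; apply: np.
  rewrite -mulrBr -opprB mulrN; apply: (nullN hD0); apply: nullM; exact: (ev_th0 hpi hP).
have hch := chow_xl hpi hP R.
have := null_to_relsP (orderC set0) (leqnn _) (goodC hP c0) (ok_seqC pi rk set0 set0)
  (ideal_Jsig set0 set0 hch) (fun H => yC_nonU R (F := H)) (rels_cone hpi hP c0 hch) n0.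
move=> /Jsig0 h; have := idealB (T := T) hI h (th_ev p); congr (I _); rewrite /thC; ring.
Qed.

Local Notation m1 := (mC set0 set0).
Lemma m1E : m1 = (- hh setT) ^+ rk setT. Proof. by rewrite mC_set0 fS0. Qed.
Lemma m1_hom : ga_hom (rk setT) m1.
Proof. by rewrite m1E; apply: homX1; apply: homN; apply: hh_hom. Qed.
Lemma Dt_m1 : Dt m1 = 1. Proof. by have := kappa0 hpi hP R; rewrite Dsig0. Qed.

Lemma mp_hom0 (p : T) : ga_hom 0 p -> exists c, p = ga_sc T c.
Proof.
move=> hp; exists (p@_0%MM); apply/mpolyP => u /=; rewrite mcoeffC.
have [<-|nu] := eqVneq 0%MM u; first by rewrite mulr1.
rewrite mulr0; apply: (dhomog_nemf_coeff hp) => /=; rewrite mdeg_eq0.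
by rewrite eq_sym.
Qed.

Lemma Dt_top p : ga_hom (rk setT) p -> I (p - ga_sc T (Dt p) * m1).
Proof.
move=> hp; apply/nullI; apply: (null_hom hT (k := rk setT)).
  by apply: homB => //; apply: homZ; apply: m1_hom.
move=> j y ej hy; have j0 : j = 0%N by lia.
rewrite j0 in hy; have [c ->] := mp_hom0 hy.
by rewrite mulrC (linZ hT.1) (linB hT.1) (linZ hT.1) Dt_m1 mulr1 subrr mulr0.
Qed.

Lemma Dt_represents : represents (rk setT) Dt.
Proof.
have [_ dE] := kappa_deg hpi hP c0 (kappa0 hpi hP R).
apply: (represents_transfer (f := thC set0 set0) (g := ev) (E := stD (s := st0))).
- exact: th_sc.
- by move=> k x; apply: th_hom => H; apply: yC_hom.
- by move=> k x; apply: ev_hom.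
- by move=> x; rewrite -dE Dsig0.
- by move=> x nx y; have := null_thC hpi hP c0 nx y; rewrite Dsig0.
- exact: hT.
- by move=> x; apply/nullI; apply: th_ev.
have := state_represents (orderC set0) (R := R) (leqnn _) (goodC hP c0) (ok_seqC pi rk set0 set0).
by rewrite dims0.
Qed.
End Presentation.

(** * Change of coefficients *)

Section BaseChange.
Variables (m n : nat) (a : 'I_m -> nat) (pi : 'I_n -> 'I_m).
Hypothesis hpi : forall i : 'I_m, #|pi @^-1: [set i]| = a i.
Variables (rk : {set 'I_m} -> nat).
Hypothesis hP : is_polymatroid a rk.
Variables (R R' : comNzRingType) (phi : {rmorphism R -> R'}).
Local Notation N := (nrays rk pi).
Local Notation mp := (map_mpoly phi).
Local Notation Dt R := (@Dt m n pi rk R).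

Lemma map_mp_X i : mp ('X_i : {mpoly R[N]}) = 'X_i. Proof. exact: map_mpolyX. Qed.
Lemma map_mp_C c : mp (c%:MP : {mpoly R[N]}) = (phi c)%:MP. Proof. exact: map_mpolyC. Qed.

Lemma map_I p : @chow_ideal R m n rk pi p -> @chow_ideal R' m n rk pi (mp p).
Proof.
move=> [s [hs ->]]; exists [seq (mp q.1, mp q.2) | q <- s]; split; last first.
  by rewrite rmorph_sum big_map; apply: eq_bigr => q _; rewrite rmorphM.
move=> q /mapP [u us ->] /=; have [[V [nV ->]]|[v ->]] := hs u us.
  left; exists V; split=> //; rewrite rmorph_prod; apply: eq_bigr => i _; exact: map_mp_X.
right; exists v; rewrite rmorph_sum; apply: eq_bigr => i _.
by rewrite -!mul_mpolyC rmorphM /= map_mp_C rmorph_int map_mp_X.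
Qed.

Lemma map_hom k (p : {mpoly R[N]}) : p \is k.-homog -> mp p \is k.-homog.
Proof.
move=> /dhomogP hp; apply/dhomogP => u; rewrite mcoeff_msupp mcoeff_map_mpoly => hu.
apply: hp; rewrite mcoeff_msupp; apply: contraNneq hu => ->; apply/eqP; exact: rmorph0.
Qed.

Lemma map_xl L : mp (xl pi rk R L : {mpoly R[N]}) = xl pi rk R' L.
Proof. by rewrite /xl rmorph_sum; apply: eq_bigr => i _; apply: map_mp_X. Qed.

Lemma map_m1 : mp (mC pi rk R set0 set0 : {mpoly R[N]}) = mC pi rk R' set0 set0.
Proof.
rewrite !m1E // rmorphXn; congr (_ ^+ _).
rewrite !hhT /xf eqxx !opprK rmorph_sum; by apply: eq_bigr => F _; apply: map_xl.
Qed.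

(** The towers over the two rings are never compared: [Dt_top] is a congruence modulo the Chow
    ideal, which coefficient maps respect, and [mC] at the empty cone has integral 1 on both
    sides. *)
Lemma Dt_map (p : {mpoly R[N]}) : p \is (rk setT).-homog -> Dt R' (mp p) = phi (Dt R p).
Proof.
move=> hp; have := map_I (Dt_top hpi hP (R := R) hp).
rewrite rmorphB rmorphM /= map_m1 map_mp_C => /(I_Dt hpi hP) h.
have hT := Dt_degfun pi rk R'.
have -> := null_congr hT h; rewrite (linZ hT.1).
by have := Dt_m1 hpi hP R'; move=> ->; rewrite mulr1.
Qed.
End BaseChange.

(** * Descent to the integers and the rationals *)

Section Final.
Variables (m n : nat) (a : 'I_m -> nat) (pi : 'I_n -> 'I_m).
Hypothesis hpi : forall i : 'I_m, #|pi @^-1: [set i]| = a i.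
Variables (rk : {set 'I_m} -> nat).
Hypothesis hP : is_polymatroid a rk.
Local Notation N := (nrays rk pi).
Local Notation r := (rk setT).
Local Notation Dt R := (@Dt m n pi rk R).
Local Notation I R := (@chow_ideal R m n rk pi).
Local Notation RR := Rdefinitions.R.

(** An additive map commutes with integer multiples; this turns the functionals of [pairing_iso]
    into those of [represents]. *)
Lemma flin_int k (psi : mpolyGA int N -> int) :
  (forall y z : {mpoly int[N]}, y \is k.-homog -> z \is k.-homog -> psi (y + z) = psi y + psi z) ->
  flin (S := mpolyGA int N) k psi.
Proof.
move=> hadd c x y hx hy.
have p0 : psi 0 = 0.
  have h0 : (0 : {mpoly int[N]}) \is k.-homog by apply: dhomog0.
  have := hadd 0 0 h0 h0; rewrite addr0 => /eqP.
  by rewrite -subr_eq0 opprD addrA subrr sub0r oppr_eq0 => /eqP.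
have pn i : psi (x *+ i) = psi x *+ i.
  elim: i => [|i IH]; first by rewrite !mulr0n.
  rewrite !mulrS hadd ?IH //; exact: (rpredMn i hx).
have pN u : u \is k.-homog -> psi (- u) = - psi u.
  move=> hu; have := hadd u (- u) hu; rewrite rpredN => /(_ hu); rewrite subrr p0 => e.
  by apply/eqP; rewrite -addr_eq0 addrC -e.
have hcx : ga_hom k (ga_sc (mpolyGA int N) c * x) by apply: homZ.
rewrite hadd //; congr (_ + _).
have scn (i : nat) : ga_sc (mpolyGA int N) (Posz i) * x = x *+ i.
  by rewrite -[Posz i]natz rmorph_nat mulr_natl.
case: c hcx => i hcx; first by rewrite scn pn -mulr_natl natz.
rewrite NegzE rmorphN mulNr scn pN ?pn; last exact: (rpredMn i.+1 hx).
by rewrite -mulr_natl natz mulNr.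
Qed.

Lemma pairing k1 k2 : (k1 + k2 = r)%N -> pairing_iso (I int) (Dt int) k1 k2.
Proof.
move=> ek; have hT := Dt_degfun pi rk int; split=> [x hx h|psi hadd hI].
  apply/(nullI hpi hP); apply: (null_hom hT hx) => j y ej hy; apply: h.
  have <- : j = k2 by lia.
  exact: hy.
have [w hw nw|x hx px] := Dt_represents hpi hP (R := int) (flin_int hadd).
  by apply: hI => //; apply/(nullI hpi hP).
exists x; last exact: px.
by apply: hx.1.
Qed.

Variable c : Lab m n -> int.
Hypothesis hc : strictly_convex_PL rk pi c.

Lemma PL_combo (R : comNzRingType) : PL_class R rk pi c = \sum_L (c L)%:~R * xl pi rk R L.
Proof.
rewrite -(sum_xl (fun L => (c L)%:~R)); apply: eq_bigr => i _.
by rewrite -mul_mpolyC rmorph_int.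
Qed.

Lemma PL_hom (R : comNzRingType) : ga_hom (g := mpolyGA R N) 1 (PL_class R rk pi c).
Proof.
apply: hom_sum => i _; rewrite -mul_mpolyC; apply: (homZ (S := mpolyGA R N)).
by rewrite /= /mp_hom dhomogX /= mdeg1.
Qed.

(** Subtracting the linear function [mu] of a cone changes the class by linear relations only and
    leaves the coefficients that [amp] requires. *)
Lemma PL_amp : @amp m n pi rk RR (PL_class RR rk pi c).
Proof.
move=> V hV; have cV : is_cone rk pi V by rewrite (is_coneE hpi hP).
have [mu [h1 h2]] := hc cV.
pose q L : rat := (c L)%:~R - \sum_j mu j * (ray_vec pi L j)%:~R.
have hI : @ideal RR (mpolyGA RR N) (I RR) := ideal_I pi rk RR.
exists (fun L => ratr (q L)); split.
- rewrite PL_combo /combo -sumrB.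
  have -> : \sum_L ((c L)%:~R * xl pi rk RR L - ga_sc (mpolyGA RR N) (ratr (q L)) * xl pi rk RR L) =
      \sum_j ga_sc (mpolyGA RR N) (ratr (mu j)) * \sum_L (ray_vec pi L j)%:~R * xl pi rk RR L.
    under [RHS]eq_bigr => j _ do rewrite mulr_sumr.
    rewrite exchange_big; apply: eq_bigr => L _.
    rewrite /q rmorphB rmorph_int rmorph_sum rmorphB rmorph_int rmorph_sum -mulrBl opprB addrC subrK.
    rewrite mulr_suml; apply: eq_bigr => j _; by rewrite (rmorphM (@ratr RR)) (rmorphM (ga_sc (mpolyGA RR N))) !rmorph_int mulrA.
  apply: (ideal_sum (T := mpolyGA RR N)) => // j _; have [_ _ IM] := hI; apply: (IM _ _).
  rewrite lab_sum; exact: (chow_LIN (chow_xl hpi hP RR) j).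
- by move=> L LV; rewrite /q h1 // subrr rmorph0.
move=> L LV cL; rewrite ltr0q.
have cL' : is_cone rk pi (L |: V) by rewrite (is_coneE hpi hP).
(* Strict convexity is tested on the single ray [L]. *)
have e : \sum_(L' in L |: V) (L' == L)%:R * ((c L')%:~R - \sum_j mu j * (ray_vec pi L' j)%:~R) = q L.
  rewrite (bigD1 L) ?setU11 //= eqxx mul1r -[RHS]addr0; congr (_ + _).
  by apply: big1 => L' /andP [_ /negbTE ->]; rewrite mul0r.
rewrite -e; apply: (h2 _ cL' (subsetUr _ _)) => [L' _|]; first exact: ler0n.
by exists L; rewrite ?eqxx ?ltr01 // !inE eqxx LV.
Qed.

Local Notation ratR := (GRing.RMorphism.clone rat RR (@ratr RR) _).
Local Notation mp := (map_mpoly ratR).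

Lemma HR_real : HR r (Dt RR) (PL_class RR rk pi c).
Proof.
have c0 : con pi rk set0.
  have [e1 e2] := cone_labelsK (set0 : {set 'I_n}) (set0 : {set {set 'I_m}}).
  rewrite /con; have -> : labS (set0 : {set Lab m n}) = set0 by apply/setP => j; rewrite !inE.
  have -> : labC (set0 : {set Lab m n}) = set0 by apply/setP => F; rewrite !inE.
  exact: conep0.
have := HRall hpi hP c0 (PL_hom RR) PL_amp.
rewrite cards0 subn0.
have -> : @DV m n pi rk RR set0 = Dt RR; last by [].
by apply/funext => p; rewrite DVE big_set0 mul1r.
Qed.

Lemma map_PL : mp (PL_class rat rk pi c) = PL_class RR rk pi c.
Proof.
rewrite /PL_class rmorph_sum; apply: eq_bigr => i _.
by rewrite -!mul_mpolyC rmorphM /= map_mp_C rmorph_int map_mp_X.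
Qed.

Lemma null_map k (x : {mpoly rat[N]}) : x \is k.-homog -> null (S := mpolyGA RR N) (Dt RR) (mp x) -> I rat x.
Proof.
move=> hx nx; apply/(nullI hpi hP); apply: (null_hom (Dt_degfun pi rk rat) (k := k) hx) => j y ej hy.
have hxy : x * y \is r.-homog by rewrite -ej addnC; apply: dhomogM.
have := Dt_map hpi hP ratR hxy; rewrite rmorphM nx => /esym/eqP.
by rewrite fmorph_eq0 => /eqP.
Qed.

Local Notation ellQ := (PL_class rat rk pi c).
Local Notation ellR := (PL_class RR rk pi c).

(** A rational class killed by the Lefschetz power is killed over the reals, where hard Lefschetz
    makes it null; [null_map] brings this back to the rational Chow ideal. *)
Lemma HL_rat : HL r (Dt rat) (ellQ : mpolyGA rat N).
Proof.
move=> k hk x hx h; have hQ := Dt_degfun pi rk rat.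
have hl : ga_hom (g := mpolyGA rat N) (r - 2 * k + k) (ellQ ^+ (r - 2 * k) * x).
  by apply: (ga_homM (g := mpolyGA rat N)) => //; apply: homX1; apply: PL_hom.
have Il : I rat (ellQ ^+ (r - 2 * k) * x).
  apply/(nullI hpi hP); apply: (null_hom hQ hl) => j y ej hy; apply: h.
  have <- : j = k by lia.
  exact: hy.
apply/(nullI hpi hP); apply: (null_map hx).
apply: (HR_HL (PL_hom RR) HR_real hk (map_hom ratR hx)) => y hy.
have := I_Dt hpi hP (map_I ratR Il) y.
by rewrite rmorphM rmorphXn /= map_PL.
Qed.
End Final.

Theorem theorem3p17 (m n : nat) (a : 'I_m -> nat) (pi : 'I_n -> 'I_m)
    (hpi : forall i : 'I_m, #|pi @^-1: [set i]| = a i)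
    (rk : {set 'I_m} -> nat) (hP : is_polymatroid a rk)
    (c : Lab m n -> int) (hc : strictly_convex_PL rk pi c) :
  let r := rk [set: 'I_m] in
  let N := nrays rk pi in
  let IZ := @chow_ideal int m n rk pi in
  let IQ := @chow_ideal rat m n rk pi in
  let ellQ := @PL_class rat m n rk pi c in
  exists (deg : {mpoly int[N]} -> int) (degQ : {mpoly rat[N]} -> rat),
  [/\
    (* (1) deg_P : A^r -> Z is an isomorphism *)
    [/\ forall p q : {mpoly int[N]}, p \is r.-homog -> q \is r.-homog ->
          deg (p + q) = deg p + deg q,
        forall p : {mpoly int[N]}, p \is r.-homog -> (IZ p <-> deg p = 0) &
        exists2 p : {mpoly int[N]}, p \is r.-homog & deg p = 1],
    (* (1) Poincare duality: unimodular pairings *)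
    (forall k : nat, (2 * k <= r)%N -> unimodular_pairing IZ deg k (r - k)),
    (* degQ is deg_P (x) Q : A^r (x) Q -> Q *)
    [/\ forall p q : {mpoly rat[N]}, p \is r.-homog -> q \is r.-homog ->
          degQ (p + q) = degQ p + degQ q,
        forall (s : rat) (p : {mpoly rat[N]}), p \is r.-homog ->
          degQ (s *: p) = s * degQ p &
        forall p : {mpoly int[N]}, p \is r.-homog ->
          degQ (map_mpoly (fun z : int => z%:~R : rat) p) = (deg p)%:~R],
    (* (2) Hard Lefschetz *)
    (forall k : nat, (2 * k <= r)%N ->
       (forall x : {mpoly rat[N]}, x \is k.-homog ->
          IQ (ellQ ^+ (r - 2 * k) * x) -> IQ x) /\
       (forall y : {mpoly rat[N]}, y \is (r - k)%N.-homog ->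
          exists2 x : {mpoly rat[N]}, x \is k.-homog &
            IQ (ellQ ^+ (r - 2 * k) * x - y))) &
    (* (3) Hodge--Riemann *)
    (forall k : nat, (2 * k <= r)%N ->
       forall x : {mpoly rat[N]}, x \is k.-homog -> ~ IQ x ->
         IQ (ellQ ^+ (r - 2 * k + 1) * x) ->
         0 < (-1) ^+ k * degQ (ellQ ^+ (r - 2 * k) * x * x))].

Proof.
move=> r N IZ IQ ellQ; exists (@Dt m n pi rk int), (@Dt m n pi rk rat).
have hZ := Dt_degfun pi rk int; have hQ := Dt_degfun pi rk rat.
split.
- split.
  + by move=> p q _ _; apply: (linD hZ.1).
  + move=> p hp; split=> [/(I_Dt hpi hP)/null_eq0 //|e].
    have := Dt_top hpi hP (R := int) hp; rewrite e rmorph0 mul0r subr0; exact.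
  exists (mC pi rk int set0 set0); first exact: m1_hom.
  exact: (Dt_m1 hpi hP).
- by move=> k hk; split; apply: (pairing hpi hP); lia.
- split.
  + by move=> p q _ _; apply: (linD hQ.1).
  + by move=> s p _; rewrite -mul_mpolyC; apply: (linZ hQ.1).
  exact: (Dt_map hpi hP (GRing.RMorphism.clone int rat (intmul 1) _)).
- move=> k hk; have hHL := HL_rat hpi hP hc; split.
    move=> x hx hI; apply/(nullI hpi hP); apply: (hHL k hk x hx) => y _.
    exact: (I_Dt hpi hP hI y).
  (* Surjectivity: [u] represents the functional [deg (y w)] of [w] through the Lefschetz form. *)
  move=> y hy; have [| |u hu h] := HL_surj hQ hHL (k := k) (phi := fun w => Dt (R := rat) (y * w)) hk.
  + by split=> [p q|s p]; rewrite ?mulrDr ?(linD hQ.1) // mulrCA (linZ hQ.1).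
  + by move=> x _ nx; rewrite mulrC; apply: nx.
  exists u => //; apply/(nullI hpi hP).
  have hd : ga_hom (g := mpolyGA rat N) (r - k) (ellQ ^+ (r - 2 * k) * u - y).
    apply: homB => //; have e : (r - 2 * k + k)%N = (r - k)%N by lia.
    apply: (homE e); apply: (ga_homM (g := mpolyGA rat N)) => //.
    by apply: homX1; apply: PL_hom.
  apply: (null_hom hQ hd) => j w ej hw; have jk : j = k by lia.
  by rewrite mulrBl (linB hQ.1) h ?subrr // -jk.
move=> k hk x hx nx hI.
pose ratR := GRing.RMorphism.clone rat Rdefinitions.R (@ratr Rdefinitions.R) _.
have hmx := map_hom ratR hx.
have := HR_real hpi hP hc hk hmx; case.
  move=> j y ej hy; have := I_Dt hpi hP (map_I ratR hI) y.
  by rewrite rmorphM rmorphXn /= map_PL.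
have hh : ellQ ^+ (r - 2 * k) * x * x \is r.-homog.
  have e : (r - 2 * k + k + k)%N = r by lia.
  have h1 : ga_hom (g := mpolyGA rat N) (r - 2 * k) (ellQ ^+ (r - 2 * k)).
    by apply: homX1; apply: PL_hom.
  have h2 : ga_hom (g := mpolyGA rat N) (r - 2 * k + k + k) (ellQ ^+ (r - 2 * k) * x * x).
    by do 2! apply: (ga_homM (g := mpolyGA rat N)) => //.
  by rewrite e in h2.
have := Dt_map hpi hP ratR hh; rewrite !rmorphM rmorphXn /= map_PL => -> p1 p2.
(* A zero value would make the real class null by definiteness, and [null_map] would put [x] in the
   rational Chow ideal. *)
have p3 : Dt (R := rat) (ellQ ^+ (r - 2 * k) * x * x) != 0.
  apply/eqP => e; apply: nx; apply: (null_map hpi hP hx); apply: p2.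
  by rewrite e rmorph0.
rewrite lt_neqAle eq_sym mulf_eq0 signr_eq0 (negbTE p3) /=.
have e1 : (-1) ^+ k * ratR (Dt (R := rat) (ellQ ^+ (r - 2 * k) * x * x)) =
   ratR ((-1) ^+ k * Dt (R := rat) (ellQ ^+ (r - 2 * k) * x * x)).
  by rewrite rmorphM rmorphXn rmorphN1.
by move: p1; rewrite e1 /= ler0q.
Qed.
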